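(* Let $\Omega=(0,1)^3$, let $s\in(0,1)$, let $\sigma\in(0,1)$, and let $f$ be analytic in $\overline{\Omega}$. Let $u\in\widetilde H^s(\Omega)$ be the weak solution of the Dirichlet integral fractional Laplace problem, i.e. $a(u,v)=\langle f,v\rangle_{L^2(\Omega)}$ for all $v\in\widetilde H^s(\Omega)$. For $L\in\mathbb{N}$ and a polynomial degree $q\in\mathbb{N}$ with $q\sim L$ (i.e. $c_1L\le q\le c_2 L$ for fixed constants $0<c_1\le c_2$), let $V_N:=W^L_q=\mathcal{S}^q_0(\Omega,\mathcal{T}^L_{\mathrm{geo},\sigma})$, $N:=\dim W^L_q$ (so that $L\sim q\sim N^{1/6}$), and let $u_N\in V_N$ be the Galerkin approximation, $a(u_N,v)=\langle f,v\rangle_{L^2(\Omega)}$ for all $v\in V_N$. Then there exist constants $b,C>0$ (depending on $\Omega$, $f$, $s$, and the fixed parameters $\sigma,c_1,c_2$, but not on $L$ or $N$) such that $$\|u-u_N\|_{\widetilde H^s(\Omega)}\le C\exp(-b\sqrt[6]{N}).$$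
   Context: For $t\in(0,1)$ and open $\omega\subset\mathbb{R}^3$: $|v|_{H^t(\omega)}^2=\int_\omega\int_\omega \frac{|v(x)-v(z)|^2}{|x-z|^{3+2t}}\,dz\,dx$, $\|v\|_{H^t(\omega)}^2=\|v\|_{L^2(\omega)}^2+|v|_{H^t(\omega)}^2$. $\widetilde H^t(\Omega)=\{u\in H^t(\mathbb{R}^3): u\equiv 0 \text{ on }\mathbb{R}^3\setminus\overline\Omega\}$ with norm $\|v\|_{\widetilde H^t(\Omega)}^2=\|v\|_{H^t(\Omega)}^2+\|v/r_{\partial\Omega}^t\|_{L^2(\Omega)}^2$, where $r_{\partial\Omega}(x)=\operatorname{dist}(x,\partial\Omega)$. The bilinear form is $a(u,v)=\frac{C(s)}{2}\int_{\mathbb{R}^3}\int_{\mathbb{R}^3}\frac{(u(x)-u(z))(v(x)-v(z))}{|x-z|^{3+2s}}\,dz\,dx$ with $C(s)=-2^{2s}\frac{\Gamma(s+3/2)}{\pi^{3/2}\Gamma(-s)}$; it is continuous and coercive on $\widetilde H^s(\Omega)$. Geometric mesh: for $L\ge1$ define nodes in $[0,1]$: $x_0=0$, $x_i=\sigma^{L-i}/2$ for $i=1,\dots,L$, $x_i=1-\sigma^{i-L}/2$ for $i=L+1,\dots,2L$, $x_{2L+1}=1$; $\mathcal{T}^L_{\mathrm{geo},\sigma}$ is the tensor-product mesh of $(0,1)^3$ into axis-parallel boxes $K=(x_i,x_{i+1})\times(x_j,x_{j+1})\times(x_k,x_{k+1})$, each the image of the reference cube $\widehat K=(0,1)^3$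 under an affine map $F_K$ with diagonal Jacobian. $\mathcal{S}^q_0(\Omega,\mathcal{T}^L_{\mathrm{geo},\sigma})=\{v\in C(\overline\Omega): v|_K\circ F_K\in\mathbb{Q}_q(\widehat K)\ \forall K,\ v|_{\partial\Omega}=0\}$, where $\mathbb{Q}_q=\mathbb{P}_q^{\otimes 3}$ is the space of polynomials of degree $\le q$ in each variable; $\dim W^L_q=O(q^3L^3)$. *)

(* Defs.v *)
From HB Require Import structures.
From mathcomp Require Import all_boot all_order all_algebra.
From mathcomp Require Import all_classical all_reals all_analysis.
Set Implicit Arguments. Unset Strict Implicit. Unset Printing Implicit Defensive.
Import Order.TTheory GRing.Theory Num.Theory.
Import numFieldNormedType.Exports.
Local Open Scope classical_set_scope.
Local Open Scope ring_scope.

Section Defs.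
Variable R : realType.

Definition pt := ((R * R) * R)%type.
Definition c1 (x : pt) : R := x.1.1.
Definition c2 (x : pt) : R := x.1.2.
Definition c3 (x : pt) : R := x.2.

(** Lebesgue measure on R^3 (product measure). Double integrals over
    R^3 x R^3 are written as iterated integrals (Tonelli/Fubini). *)
Notation leb3 :=
  ((@lebesgue_measure R \x @lebesgue_measure R) \x @lebesgue_measure R)%E.

Definition edist (x z : pt) : R :=
  Num.sqrt ((c1 x - c1 z) ^+ 2 + (c2 x - c2 z) ^+ 2 + (c3 x - c3 z) ^+ 2).

Definition Omega : set pt :=
  [set x | [/\ 0 < c1 x < 1, 0 < c2 x < 1 & 0 < c3 x < 1]].
Definition Omega_bar : set pt :=
  [set x | [/\ 0 <= c1 x <= 1, 0 <= c2 x <= 1 & 0 <= c3 x <= 1]].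

(** r_{dOmega}(x) = dist(x, boundary of Omega), written out for x in Omega. *)
Definition rbd (x : pt) : R :=
  Num.min (Num.min (Num.min (c1 x) (1 - c1 x)) (Num.min (c2 x) (1 - c2 x)))
          (Num.min (c3 x) (1 - c3 x)).

Definition L2sq (D : set pt) (v : pt -> R) : \bar R :=
  (\int[leb3]_(x in D) ((v x) ^+ 2)%:E)%E.

Definition Hsemi_sq (t : R) (D : set pt) (v : pt -> R) : \bar R :=
  (\int[leb3]_(x in D) \int[leb3]_(z in D)
     (((v x - v z) ^+ 2) / (edist x z `^ (3 + 2 * t)))%:E)%E.

Definition in_H (t : R) (v : pt -> R) : Prop :=
  [/\ measurable_fun setT v, (L2sq setT v < +oo)%E & (Hsemi_sq t setT v < +oo)%E].

Definition in_Ht (t : R) (v : pt -> R) : Prop :=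
  in_H t v /\ (forall x, ~ Omega_bar x -> v x = 0).

Definition Ht_norm_sq (t : R) (v : pt -> R) : \bar R :=
  (L2sq Omega v + Hsemi_sq t Omega v
   + \int[leb3]_(x in Omega) ((v x / rbd x `^ t) ^+ 2)%:E)%E.

(** Gamma function: Euler integral for x > 0, extended to (-1,0] by the
    functional equation Gamma(x) = Gamma(x+1)/x (only used at -s, s in (0,1)). *)
Definition Gamma_pos (x : R) : R :=
  Rintegral (@lebesgue_measure R) `]0, +oo[ (fun t => t `^ (x - 1) * expR (- t)).
Definition Gamma (x : R) : R :=
  if 0 < x then Gamma_pos x else Gamma_pos (x + 1) / x.

Definition Cs (s : R) : R :=
  - (2 `^ (2 * s)) * Gamma (s + 3 / 2) / (pi `^ (3 / 2) * Gamma (- s)).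

Definition aform (s : R) (u v : pt -> R) : R :=
  Cs s / 2 * Rintegral leb3 setT (fun x => Rintegral leb3 setT
    (fun z => (u x - u z) * (v x - v z) / (edist x z `^ (3 + 2 * s)))).

Definition L2ip (f v : pt -> R) : R := Rintegral leb3 Omega (fun x => f x * v x).

Definition analytic_on_closure (f : pt -> R) : Prop :=
  forall x0, Omega_bar x0 ->
  exists r : R, 0 < r /\
  exists cf : nat -> nat -> nat -> R,
  forall x, edist x x0 < r ->
    let term i j k := cf i j k * (c1 x - c1 x0) ^+ i * (c2 x - c2 x0) ^+ j
                                 * (c3 x - c3 x0) ^+ k in
    (exists M : R, forall n,
       \sum_(i < n) \sum_(j < n) \sum_(k < n) `|term i j k| <= M) /\
    ((fun n => \sum_(i < n) \sum_(j < n) \sum_(k < n) term i j k) @ \oo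
       --> f x).

(** Nodes of the geometric mesh on [0,1] (indices 0 .. 2L+1). *)
Definition node (sigma : R) (L i : nat) : R :=
  if i == 0%N then 0
  else if (i <= L)%N then sigma ^+ (L - i) / 2
  else if (i <= 2 * L)%N then 1 - sigma ^+ (i - L) / 2
  else 1.

Definition box (sigma : R) (L i j k : nat) : set pt :=
  [set x | [/\ node sigma L i < c1 x < node sigma L i.+1,
               node sigma L j < c2 x < node sigma L j.+1 &
               node sigma L k < c3 x < node sigma L k.+1]].

(** Q_q polynomials (degree <= q in each variable), evaluated in physical
    coordinates (the element maps F_K are diagonal affine, so pulling back
    to the reference cube preserves Q_q). *)
Definition is_Qq (q : nat) (p : pt -> R) : Prop :=
  exists c : 'I_q.+1 -> 'I_q.+1 -> 'I_q.+1 -> R,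
    forall x, p x = \sum_(a < q.+1) \sum_(b < q.+1) \sum_(e < q.+1)
                      c a b e * c1 x ^+ a * c2 x ^+ b * c3 x ^+ e.

(** W^L_q = S^q_0(Omega, T^L_geo,sigma), its elements extended by zero
    outside Omega: continuous on R^3 (equivalently continuous on the closed
    cube with zero trace), zero off Omega, and Q_q on every mesh box. *)
Definition W (sigma : R) (L q : nat) (v : pt -> R) : Prop :=
  [/\ continuous v,
      (forall x, ~ Omega x -> v x = 0) &
      (forall i j k : nat, (i <= 2 * L)%N -> (j <= 2 * L)%N -> (k <= 2 * L)%N ->
         exists p, is_Qq q p /\ forall x, box sigma L i j k x -> v x = p x)].

Definition has_dim (V : (pt -> R) -> Prop) (n : nat) : Prop :=
  exists bs : 'I_n -> pt -> R,
  [/\ forall i, V (bs i),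
      (forall c : 'I_n -> R,
         (forall x, \sum_(i < n) c i * bs i x = 0) -> forall i, c i = 0) &
      (forall v, V v -> exists c : 'I_n -> R,
         forall x, v x = \sum_(i < n) c i * bs i x)].

End Defs.

(* Main.v *)
(** By Céa's lemma it suffices to approximate [u] in energy by one function [w] of the
    spline space at an exponential rate.

    Analytic regularity comes from deforming the cube: [Phi i e] moves the coordinate [x_i]
    to [x_i + e * chi x_i], where [chi] is the distance to [{0, 1}]. The pulled-back
    solutions [u o Phi i e] solve variational problems whose kernels are power series in
    [e], so the [k]-th divided differences of [e |-> u o Phi i e] are bounded by [D * G ^ k]
    in energy. As [Phi i e] translates by a fraction of the distance to the boundary, these
    are the weighted analytic bounds, and Lagrange interpolation in [e] approximates [u] by
    polynomials on boxes of size comparable to that distance; by the Hardy inequality the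
    energy controls the weighted [L^2] norm in which the error is measured.

    On each mesh cell the local polynomials are glued by Bernstein polynomials of degree
    [n ~ q]: these sum to one away from the boundary layer, and their Chernoff tails
    [exp (- c n)] beat the growth [B ^ m] of interpolants of degree [m = iota * L] far from
    their base points. In the layer of width [sigma ^ L] the weighted mass of [u] is
    [O(sigma ^ L)], by comparing [u] with its dilations. Finally, for [e = u - w] the weak
    form gives [A e e = (f, e) - A w e] up to a factor; far from the diagonal this is
    controlled by the weighted [L^2] norm of [e], and near the diagonal by the Lipschitz
    constant of [w]. *)

Require Import Defs.
From HB Require Import structures.
From mathcomp Require Import all_boot all_order all_algebra.
From mathcomp Require Import all_classical all_reals all_analysis.
From mathcomp Require Import measurable_realfun.
From mathcomp.real_closed Require polyrcf.
From mathcomp Require Import ring lra zify.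
Set Implicit Arguments. Unset Strict Implicit. Unset Printing Implicit Defensive.
Import Order.TTheory GRing.Theory Num.Theory.
Import numFieldNormedType.Exports.
Local Open Scope classical_set_scope.
Local Open Scope ring_scope.

(** * Iterated integrals and coordinate changes *)

(** Divided differences in the deformation parameter replace derivatives: they are finite
    combinations of elements of the energy space, so the form itself supplies the bounds, through a
    discrete Leibniz rule, and no differentiability of [e |-> u o Phi i e] is ever discussed. The
    deformation may be merely Lipschitz ([chi] has a kink at 1/2), because only analyticity in [e]
    of the transported kernel is used, and that kernel is a power of a quadratic polynomial in [e].

    The obstacle is that regularity yields approximation in a weighted [L^2] norm only, which does
    not control the energy near the diagonal. The Lipschitz bound that takes over there is
    exponentially large, of order [8 ^ pm] for each factor of the approximant. The near-diagonal
    zone is therefore made exponentially thin, and the weighted error must be smaller still, since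
    the far part costs an inverse power of that width. This dictates the order in which the
    constants are fixed: first the thinness ratio [muc], then the parameter radius [e0], which
    determines the growth [Bw] of the interpolants over a cell, and last the ratio [r] between [L]
    and the interpolation degree. *)

Notation mu1 := (@lebesgue_measure _).
Notation edist := Defs.edist.

Section ProductSigmaFinite.
Local Open Scope ereal_scope.
Context d1 d2 (T1 : measurableType d1) (T2 : measurableType d2) (R : realType).
Variable m1 : {sigma_finite_measure set T1 -> \bar R}.
Variable m2 : {sigma_finite_measure set T2 -> \bar R}.

(** A copy of the product measure on which sigma-finiteness is declared, so that products can be
    iterated up to [L6]. It is convertible to the original, hence to the measure used in the
    statement. *)
Definition prodm (A : set (T1 * T2)) : \bar R := (m1 \x m2) A.
HB.instance Definition _ := Measure.copy prodm (m1 \x m2).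

Lemma prodm_sigma_finite : sigma_finite setT prodm.
Proof.
have /sigma_finiteP[F [TF ndF Foo]] := sigma_finiteT m1.
have /sigma_finiteP[G [TG ndG Goo]] := sigma_finiteT m2.
apply/sigma_finiteP; exists (fun n => F n `*` G n); split.
- rewrite -setXTT TF TG; apply/seteqP; split => -[x y] /=.
    move=> [[n _ Fx] [k _ Gy]]; exists (maxn n k) => //; split => /=.
      by move: x Fx; exact/subsetPset/ndF/leq_maxl.
    by move: y Gy; exact/subsetPset/ndG/leq_maxr.
  by move=> [n _ [Fx Gy]]; split; exists n.
- move=> m n mn; apply/subsetPset => -[x y] [/= Fx Gy]; split => /=.
    by move: x Fx; exact/subsetPset/ndF.
  by move: y Gy; exact/subsetPset/ndG.
- move=> n; have [mF Fy] := Foo n; have [mG Gy] := Goo n.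
  split; first exact: measurableX.
  change ((m1 \x m2) (F n `*` G n) < +oo); rewrite product_measure1E//.
  by rewrite lte_mul_pinfty// ge0_fin_numE.
Qed.
HB.instance Definition _ := Measure_isSigmaFinite.Build _ _ _ prodm prodm_sigma_finite.

Lemma tonelli1 (f : T1 * T2 -> \bar R) : measurable_fun setT f ->
  (forall x, 0 <= f x) -> \int[prodm]_z f z = \int[m1]_x \int[m2]_y f (x, y).
Proof. exact: fubini_tonelli1. Qed.

Lemma tonelli2 (f : T1 * T2 -> \bar R) : measurable_fun setT f ->
  (forall x, 0 <= f x) -> \int[prodm]_z f z = \int[m2]_y \int[m1]_x f (x, y).
Proof. exact: fubini_tonelli2. Qed.

Lemma measurable_tonelli1 (f : T1 * T2 -> \bar R) : measurable_fun setT f ->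
  (forall x, 0 <= f x) -> measurable_fun setT (fun x => \int[m2]_y f (x, y)).
Proof. exact: measurable_fun_fubini_tonelli_F. Qed.

Lemma measurable_tonelli2 (f : T1 * T2 -> \bar R) : measurable_fun setT f ->
  (forall x, 0 <= f x) -> measurable_fun setT (fun y => \int[m1]_x f (x, y)).
Proof. exact: measurable_fun_fubini_tonelli_G. Qed.

Lemma fubini_prodm (f : T1 * T2 -> \bar R) : prodm.-integrable setT f ->
  \int[prodm]_z f z = \int[m1]_x \int[m2]_y f (x, y).
Proof. by move=> h; rewrite -(integral12_prod_meas1 h). Qed.

End ProductSigmaFinite.

Notation L2 := (prodm mu1 mu1).
Notation L3 := (prodm L2 mu1).
Notation L6 := (prodm L3 L3).

Section Tonelli3.
Local Open Scope ereal_scope.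
Context d1 d2 d3 (T1 : measurableType d1) (T2 : measurableType d2)
  (T3 : measurableType d3) (R : realType).
Variables (m1 : {sigma_finite_measure set T1 -> \bar R})
 (m2 : {sigma_finite_measure set T2 -> \bar R})
 (m3 : {sigma_finite_measure set T3 -> \bar R}).
Variable F : T1 * T2 * T3 -> \bar R.
Hypothesis mF : measurable_fun setT F.
Hypothesis F0 : forall x, 0 <= F x.

Lemma tonelli3_1 : \int[prodm (prodm m1 m2) m3]_x F x =
  \int[m3]_z \int[m2]_y \int[m1]_x F (x, y, z).
Proof.
rewrite tonelli2//; apply: eq_integral => z _.
by rewrite (@tonelli2 _ _ _ _ _ m1 m2 (fun p => F (p, z)))//; exact: measurableT_comp.
Qed.

Lemma tonelli3_2 : \int[prodm (prodm m1 m2) m3]_x F x =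
  \int[m3]_z \int[m1]_x \int[m2]_y F (x, y, z).
Proof.
rewrite tonelli2//; apply: eq_integral => z _.
by rewrite (@tonelli1 _ _ _ _ _ m1 m2 (fun p => F (p, z)))//; exact: measurableT_comp.
Qed.

Lemma tonelli3_3 : \int[prodm (prodm m1 m2) m3]_x F x =
  \int[m1]_x \int[m2]_y \int[m3]_z F (x, y, z).
Proof.
rewrite tonelli1// tonelli1//; first exact: measurable_tonelli1.
by move=> x; exact: integral_ge0.
Qed.

End Tonelli3.

Section IntegralTools.
Local Open Scope ereal_scope.
Context d (T : measurableType d) (R : realType) (m : {measure set T -> \bar R}).
Implicit Types f g : T -> \bar R.

Lemma ge0_intD f g : measurable_fun setT f -> measurable_fun setT g ->
  (forall x, 0 <= f x) -> (forall x, 0 <= g x) ->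
  \int[m]_x (f x + g x) = \int[m]_x f x + \int[m]_x g x.
Proof. by move=> mf mg f0 g0; apply: ge0_integralD. Qed.

Lemma ge0_intZ (k : R) f : (0 <= k)%R -> measurable_fun setT f ->
  (forall x, 0 <= f x) -> \int[m]_x (k%:E * f x) = k%:E * \int[m]_x f x.
Proof. by move=> k0 mf f0; rewrite ge0_integralZl_EFin. Qed.

Lemma ge0_intZr (k : R) f : (0 <= k)%R -> measurable_fun setT f ->
  (forall x, 0 <= f x) -> \int[m]_x (f x * k%:E) = \int[m]_x f x * k%:E.
Proof. by move=> k0 mf f0; rewrite ge0_integralZr. Qed.

Lemma ge0_le_int f g : measurable_fun setT f -> measurable_fun setT g ->
  (forall x, 0 <= f x) -> (forall x, f x <= g x) ->
  \int[m]_x f x <= \int[m]_x g x.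
Proof. by move=> mf mg f0 fg; apply: ge0_le_integral => // x _; rewrite (le_trans (f0 x)). Qed.

Lemma measurable_EF (f : T -> R) : measurable_fun setT f ->
  measurable_fun setT (fun x => (f x)%:E).
Proof. by move=> h; exact/measurable_EFinP. Qed.

End IntegralTools.

(** * Change of variables in one coordinate of [R^3] *)

Inductive axis := A1 | A2 | A3.

Section Jacobian.
Variable R : realType.
Notation X3 := (R * R * R)%type.

Definition co (i : axis) (x : X3) : R :=
  match i with A1 => x.1.1 | A2 => x.1.2 | A3 => x.2 end.

Definition upd (i : axis) (t : R) (x : X3) : X3 :=
  match i with
  | A1 => (t, x.1.2, x.2) | A2 => (x.1.1, t, x.2) | A3 => (x.1.1, x.1.2, t)
  end.

Lemma measurable_co i : measurable_fun setT (co i).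
Proof. by case: i; do ?apply: measurableT_comp => //; apply: measurable_fst. Qed.

Lemma measurable_tuple3 d (T : measurableType d) (a b c : T -> R) :
  measurable_fun setT a -> measurable_fun setT b -> measurable_fun setT c ->
  measurable_fun setT (fun x => (a x, b x, c x)).
Proof. by move=> ma mb mc; do 2 apply: measurable_fun_pair => //. Qed.

Lemma measurable_upd d (T : measurableType d) i (f : T -> R) (g : T -> X3) :
  measurable_fun setT f -> measurable_fun setT g ->
  measurable_fun setT (fun x => upd i (f x) (g x)).
Proof.
move=> mf mg; have mc j : measurable_fun setT (fun x => co j (g x)).
  by apply: measurableT_comp => //; exact: measurable_co.
by case: i; apply: measurable_tuple3 => //;
  [exact: (mc A2)|exact: (mc A3)|exact: (mc A1)|exact: (mc A3)|exact: (mc A1)|exact: (mc A2)].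
Qed.

Lemma measurable_affine (a b : R) : measurable_fun setT (fun x : R => a * x + b).
Proof. by apply: measurable_funD => //; exact: mulrl_measurable. Qed.

(** The image of Lebesgue measure under the affine map, scaled by [a], agrees with Lebesgue measure
    on half-open intervals, and these determine it. *)
Lemma ge0_integral_affine (a b : R) (g : R -> \bar R) : 0 < a ->
  measurable_fun setT g -> (forall x, 0 <= g x)%E ->
  (\int[mu1]_x g x = a%:E * \int[mu1]_x g (a * x + b)%R)%E.
Proof.
move=> a0 mg g0.
pose phi : R -> measurableTypeR R := fun x => a * x + b.
have mphi : measurable_fun setT phi by exact: measurable_affine.
have a0' : 0 <= a by exact: ltW.
pose m := mscale (NngNum a0') (pushforward (@lebesgue_measure R) phi).
have e A : measurable A -> lebesgue_measure A = m mphi A.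
  move=> mA; apply: (lebesgue_measure_unique (mu := m mphi)) => // _ [[u v] _ <-].
  transitivity (a%:E * lebesgue_measure (phi @^-1` `]u, v]%classic))%E; last by [].
  have -> : phi @^-1` `]u, v]%classic = `](u - b) / a, (v - b) / a]%classic.
    apply/seteqP; split => x /=; rewrite !in_itv /= /phi => /andP[h1 h2]; apply/andP; split.
    - by rewrite ltr_pdivrMr// mulrC ltrBlDr.
    - by rewrite ler_pdivlMr// mulrC lerBrDr.
    - by move: h1; rewrite ltr_pdivrMr// mulrC ltrBlDr.
    - by move: h2; rewrite ler_pdivlMr// mulrC lerBrDr.
  rewrite !lebesgue_measure_itv/= !lte_fin ltr_pM2r ?invr_gt0// ltrD2r.
  case: ifP => _; last by rewrite mule0.
  by rewrite -!EFinB -EFinM; congr (_%:E); field; lra.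
rewrite (@eq_measure_integral _ _ _ setT (m mphi)) => [|A mA _]; last exact: e.
rewrite ge0_integral_mscale //; congr (_ * _)%E.
by rewrite ge0_integral_pushforward.
Qed.

(** A substitution is recorded by its effect on nonnegative integrals, with [J] in the part of the
    derivative. Piecewise affine maps fit this form without any discussion of their kinks. *)
Definition jac (phi J : R -> R) := [/\ measurable_fun setT phi,
  measurable_fun setT J, forall t, 0 <= J t &
  forall g : R -> \bar R, measurable_fun setT g -> (forall x, 0 <= g x)%E ->
  (\int[mu1]_t (g (phi t) * (J t)%:E) = \int[mu1]_t g t)%E].

Lemma jac_affine a b : 0 < a -> jac (fun x => a * x + b) (fun=> a).
Proof.
move=> a0; split => //; [exact: measurable_affine|by move=> _; exact: ltW|].
move=> g mg g0; rewrite (ge0_integral_affine b a0 mg g0).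
rewrite ge0_integralZr ?lee_fin ?(ltW a0)//; first by rewrite muleC.
by apply: measurableT_comp => //; exact: measurable_affine.
Qed.

(** Tonelli with the [i]-th variable innermost reduces this to the one-dimensional identity. *)
Lemma integral_upd i phi J (F : X3 -> \bar R) : jac phi J ->
  measurable_fun setT F -> (forall x, 0 <= F x)%E ->
  (\int[L3]_x (F (upd i (phi (co i x)) x) * (J (co i x))%:E) = \int[L3]_x F x)%E.
Proof.
move=> [mphi mJ J0 H] mF F0.
have mFJ : measurable_fun setT
    (fun x => F (upd i (phi (co i x)) x) * (J (co i x))%:E)%E.
  have mc := @measurable_co i.
  apply: emeasurable_funM.
    apply: (measurableT_comp mF); apply: measurable_upd => //.
    exact: measurableT_comp.
  by apply/measurable_EFinP; exact: measurableT_comp.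
have FJ0 x : (0 <= F (upd i (phi (co i x)) x) * (J (co i x))%:E)%E.
  by rewrite mule_ge0// lee_fin.
have mA (T U V : R -> R) : measurable_fun setT T -> measurable_fun setT U ->
    measurable_fun setT V -> measurable_fun setT (fun t => F (T t, U t, V t)).
  by move=> mT mU mV; apply: (measurableT_comp mF); exact: measurable_tuple3.
case: i mFJ FJ0 => /= mFJ FJ0.
- rewrite (tonelli3_1 mu1 mu1 mu1 mFJ FJ0) (tonelli3_1 mu1 mu1 mu1 mF F0).
  apply: eq_integral => z _; apply: eq_integral => y _ /=.
  by rewrite (H (fun t => F (t, y, z))) //; exact: mA.
- rewrite (tonelli3_2 mu1 mu1 mu1 mFJ FJ0) (tonelli3_2 mu1 mu1 mu1 mF F0).
  apply: eq_integral => z _; apply: eq_integral => y _ /=.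
  by rewrite (H (fun t => F (y, t, z))) //; exact: mA.
- rewrite (tonelli3_3 mu1 mu1 mu1 mFJ FJ0) (tonelli3_3 mu1 mu1 mu1 mF F0).
  apply: eq_integral => z _; apply: eq_integral => y _ /=.
  by rewrite (H (fun t => F (z, y, t))) //; exact: mA.
Qed.

Lemma integral_affine3 (a b : X3) (F : X3 -> \bar R) :
  (forall i, 0 < co i a) -> measurable_fun setT F -> (forall x, 0 <= F x)%E ->
  (\int[L3]_x F x = (co A1 a * co A2 a * co A3 a)%:E *
   \int[L3]_x F (co A1 a * co A1 x + co A1 b, co A2 a * co A2 x + co A2 b,
                 co A3 a * co A3 x + co A3 b)%R)%E.
Proof.
move=> a0 mF F0.
have mC i := @measurable_co i.
have mcf (i : axis) (c e : R) : measurable_fun setT (fun x : X3 => c * co i x + e).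
  exact: (measurableT_comp (measurable_affine c e) (mC i)).
pose F1 (x : X3) := F (co A1 a * co A1 x + co A1 b, co A2 x, co A3 x).
pose F2 (x : X3) := F (co A1 a * co A1 x + co A1 b, co A2 a * co A2 x + co A2 b, co A3 x).
pose F3 (x : X3) := F (co A1 a * co A1 x + co A1 b, co A2 a * co A2 x + co A2 b,
                 co A3 a * co A3 x + co A3 b).
have m1 : measurable_fun setT F1.
  by apply: (measurableT_comp mF); exact: measurable_tuple3 (mcf A1 _ _) (mC A2) (mC A3).
have m2 : measurable_fun setT F2.
  by apply: (measurableT_comp mF); exact: measurable_tuple3 (mcf A1 _ _) (mcf A2 _ _) (mC A3).
have m3 : measurable_fun setT F3.
  by apply: (measurableT_comp mF); exact: measurable_tuple3 (mcf A1 _ _) (mcf A2 _ _) (mcf A3 _ _).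
have step i (G H : X3 -> \bar R) : measurable_fun setT G -> measurable_fun setT H ->
    (forall x, 0 <= G x)%E -> (forall x, 0 <= H x)%E ->
    (forall x, H x = G (upd i (co i a * co i x + co i b) x)) ->
    (\int[L3]_x G x = (co i a)%:E * \int[L3]_x H x)%E.
  move=> mG mH G0 H0 HG.
  rewrite -(integral_upd i (jac_affine (co i b) (a0 i)) mG G0).
  under eq_integral do rewrite -HG.
  by rewrite ge0_integralZr ?lee_fin ?(ltW (a0 _))// muleC.
have e1 := step A1 F F1 mF m1 F0 (fun=> F0 _) (fun=> erefl).
have e2 := step A2 F1 F2 m1 m2 (fun=> F0 _) (fun=> F0 _) (fun=> erefl).
have e3 := step A3 F2 F3 m2 m3 (fun=> F0 _) (fun=> F0 _) (fun=> erefl).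
by rewrite e1 e2 e3 !EFinM !muleA.
Qed.

End Jacobian.

(** * Deformations of the cube *)

Section Deformation.
Variable R : realType.
Notation X3 := (R * R * R)%type.
Implicit Types (e t u : R) (x z : X3) (i : axis).

(** Cut off at zero outside the unit interval, so that [phi e] is the identity there. *)
Definition chi t : R := Num.max 0 (Num.min t (1 - t)).
Definition phi e t := t + e * chi t.
(** Inverse of [phi e]. The break point [(1 + e) / 2] is the image of the kink of [chi] at 1/2. *)
Definition phiV e t :=
  if t <= 0 then t else if t <= (1 + e) / 2 then t / (1 + e)
  else if t <= 1 then (t - e) / (1 - e) else t.
Definition jphi e t : R :=
  if t <= 0 then 1 else if t <= 1 / 2 then 1 + e else if t <= 1 then 1 - e else 1.

Lemma chiE t : chi t = if t <= 0 then 0 else if t <= 1 / 2 then t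
  else if t <= 1 then 1 - t else 0.
Proof.
rewrite /chi; case: (leP t (1 - t)) => h1; case: (leP 0 _) => h2;
  do ![case: ifPn => ?]; lra.
Qed.

Lemma chi_ge0 t : 0 <= chi t. Proof. by rewrite /chi le_max lexx. Qed.

Lemma chi_half t : chi t <= 1 / 2.
Proof. by rewrite chiE; do ![case: ifPn => ?]; lra. Qed.

Lemma chi_gt0 t : (0 < chi t) = (0 < t < 1).
Proof. by rewrite chiE; do ![case: ifPn => ?]; lra. Qed.

Lemma chi_lip t u : `|chi t - chi u| <= `|t - u|.
Proof.
by case: (ger0P (t - u)) => tu; rewrite ler_norml !chiE;
  do ![case: ifPn => ?]; lra.
Qed.

Lemma chi_lip2 t u : `|chi t - chi u| <= `|t - u| /\ `|chi u - chi t| <= `|t - u|.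
Proof. by rewrite chi_lip distrC chi_lip. Qed.

Lemma measurable_chi : measurable_fun setT chi.
Proof.
apply: measurable_maxr => //; apply: measurable_minr => //.
by apply: measurable_funB.
Qed.

Lemma measurable_phi e : measurable_fun setT (phi e).
Proof. by apply: measurable_funD => //; apply: measurable_funM => //; exact: measurable_chi. Qed.

Lemma measurable_ifle (a : R) (f g : R -> R) : measurable_fun setT f ->
  measurable_fun setT g -> measurable_fun setT (fun t => if t <= a then f t else g t).
Proof. by move=> mf mg; apply: measurable_fun_ifT => //; exact: measurable_fun_ler. Qed.

Lemma measurable_eifle (a : R) (f g : R -> \bar R) : measurable_fun setT f ->
  measurable_fun setT g -> measurable_fun setT (fun t => if t <= a then f t else g t).
Proof. by move=> mf mg; apply: measurable_fun_ifT => //; exact: measurable_fun_ler. Qed.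

Lemma measurable_phiV e : measurable_fun setT (phiV e).
Proof.
do 3?[apply: measurable_ifle => //].
  by apply: mulrr_measurable.
by apply: measurable_funM => //; exact: measurable_funB.
Qed.

Lemma measurable_jphi e : measurable_fun setT (jphi e).
Proof. by do 3?[apply: measurable_ifle => //]. Qed.

Lemma phiK e t : `|e| < 1 -> phiV e (phi e t) = t.
Proof.
rewrite ltr_norml => he.
have h1 : 1 + e != 0 by lra. have h2 : 1 - e != 0 by lra.
rewrite /phi chiE /phiV.
have [?|?] := lerP t 0; first by rewrite mulr0 addr0 ifT.
have [?|?] := lerP t (1 / 2); first by do ![case: ifPn => ?]; by [field|exfalso; nra].
have [?|?] := lerP t 1; last by rewrite mulr0 addr0; do ![case: ifPn => ?]; by [|exfalso; nra].
by do ![case: ifPn => ?]; by [field|exfalso; nra].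
Qed.

Lemma phiVK e t : `|e| < 1 -> phi e (phiV e t) = t.
Proof.
rewrite ltr_norml => he.
have h1 : 0 < 1 + e by lra. have h2 : 0 < 1 - e by lra.
rewrite /phi chiE /phiV.
have [?|?] := lerP t 0; first by rewrite ifT// mulr0 addr0.
have [?|?] := lerP t ((1 + e) / 2).
  have k1 : 0 < t / (1 + e) by rewrite divr_gt0.
  have k2 : t / (1 + e) <= 1 / 2 by rewrite ler_pdivrMr//; lra.
  by do ![case: ifPn => ?]; by [field; lra|exfalso; lra].
have [?|?] := lerP t 1; last by do ![case: ifPn => ?]; by [rewrite mulr0 addr0|exfalso; lra].
have k1 : 1 / 2 < (t - e) / (1 - e) by rewrite ltr_pdivlMr//; lra.
have k2 : (t - e) / (1 - e) <= 1 by rewrite ler_pdivrMr//; lra.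
by do ![case: ifPn => ?]; by [field; lra|exfalso; lra].
Qed.

Lemma jphi_bounds e t : `|e| <= 1 / 4 -> 3 / 4 <= jphi e t <= 5 / 4.
Proof. by rewrite ler_norml /jphi => ?; do ![case: ifPn => ?]; lra. Qed.

Lemma phi_pieces e t : -1 < e < 1 -> [/\ ((1 + e) * t + 0 <= 0) = (t <= 0),
  ((1 + e) * t + 0 <= (1 + e) / 2) = (t <= 1 / 2), ((1 - e) * t + e <= (1 + e) / 2) = (t <= 1 / 2) &
  ((1 - e) * t + e <= 1) = (t <= 1)].
Proof.
move=> he; have q1 : 0 < 1 + e by lra. have q2 : 0 < 1 - e by lra.
split.
- by rewrite addr0 pmulr_rle0.
- by rewrite addr0 ler_pM2l// mul1r.
- have -> : (1 + e) / 2 = (1 - e) * (1 / 2) + e by field.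
  by rewrite lerD2r ler_pM2l.
- by rewrite -lerBrDr -[leRHS]mulr1 ler_pM2l.
Qed.

Lemma jac_phi e : `|e| < 1 -> jac (phi e) (jphi e).
Proof.
move=> he; have := he; rewrite ltr_norml => he'.
split; [exact: measurable_phi|exact: measurable_jphi|
  by move=> t; rewrite /jphi; do ![case: ifPn => ?]; lra|].
move=> g mg g0.
(* The integrand is cut at the images 0, [c], 1 of the break points of [phi e]; on each piece the
   substitution is affine, and outside the unit interval it is the identity. *)
pose c := (1 + e) / 2.
pose G1 (t : R) : \bar R := if t <= 0 then 0%E else if t <= c then g t else 0%E.
pose G2 (t : R) : \bar R := if t <= c then 0%E else if t <= 1 then g t else 0%E.
pose G3 (t : R) : \bar R := if t <= 0 then g t else if t <= 1 then 0%E else g t.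
have m1 : measurable_fun setT G1 by do 2?[apply: measurable_eifle => //].
have m2 : measurable_fun setT G2 by do 2?[apply: measurable_eifle => //].
have m3 : measurable_fun setT G3 by do 2?[apply: measurable_eifle => //].
have p1 t : (0 <= G1 t)%E by rewrite /G1; do ![case: ifPn => ?].
have p2 t : (0 <= G2 t)%E by rewrite /G2; do ![case: ifPn => ?].
have p3 t : (0 <= G3 t)%E by rewrite /G3; do ![case: ifPn => ?].
have gE t : g t = (G1 t + (G2 t + G3 t))%E.
  by rewrite /G1 /G2 /G3 /c; do ![case: ifPn => ?]; rewrite ?adde0 ?add0e//; exfalso; lra.
have mp : measurable_fun setT (g \o phi e) by apply: measurableT_comp => //; exact: measurable_phi.
have gpE t : (g (phi e t) * (jphi e t)%:E = (1 + e)%:E * G1 ((1 + e) * t + 0)%R +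
   ((1 - e)%:E * G2 ((1 - e) * t + e)%R + G3 t))%E.
  have [b1 b2 b3 b4] := phi_pieces t he'.
  rewrite /phi /jphi chiE /G1 /G2 /G3 /c b1 b2 b3 b4.
  have [t0|t0] := lerP t 0; have [t1|t1] := lerP t (1 / 2); have [t2|t2] := lerP t 1 => /=;
    try by [exfalso; lra|rewrite !mule0 !add0e mulr0 addr0 mule1].
  - by rewrite (_ : t + e * t = (1 + e) * t + 0) ?mule0 ?adde0 1?muleC//; ring.
  - by rewrite (_ : t + e * (1 - t) = (1 - e) * t + e) ?mule0 ?adde0 ?add0e 1?muleC//; ring.
have q1 : 0 < 1 + e by lra. have q2 : 0 < 1 - e by lra.
have mG1 : measurable_fun setT (fun t => G1 ((1 + e) * t + 0)).
  by apply: measurableT_comp => //; exact: measurable_affine.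
have mG2 : measurable_fun setT (fun t => G2 ((1 - e) * t + e)).
  by apply: measurableT_comp => //; exact: measurable_affine.
have mq1 : measurable_fun setT (fun t => (1 + e)%:E * G1 ((1 + e) * t + 0)%R)%E by exact: measurable_funeM.
have mq2 : measurable_fun setT (fun t => (1 - e)%:E * G2 ((1 - e) * t + e)%R)%E by exact: measurable_funeM.
have pq1 t : (0 <= (1 + e)%:E * G1 ((1 + e) * t + 0)%R)%E by rewrite mule_ge0// lee_fin ltW.
have pq2 t : (0 <= (1 - e)%:E * G2 ((1 - e) * t + e)%R)%E by rewrite mule_ge0// lee_fin ltW.
under eq_integral do rewrite gpE.
under [RHS]eq_integral do rewrite gE.
have mq3 := emeasurable_funD mq2 m3.
have /= -> := ge0_intD mu1 mq1 mq3 pq1 (fun t => adde_ge0 (pq2 t) (p3 t)).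
have /= -> := ge0_intD mu1 mq2 m3 pq2 p3.
have /= -> := ge0_intZ mu1 (ltW q1) mG1 (fun t => p1 _).
have /= -> := ge0_intZ mu1 (ltW q2) mG2 (fun t => p2 _).
rewrite -(ge0_integral_affine 0 q1 m1 p1) -(ge0_integral_affine e q2 m2 p2).
have m23 := emeasurable_funD m2 m3.
have /= -> := ge0_intD mu1 m1 m23 p1 (fun t => adde_ge0 (p2 t) (p3 t)).
by have /= -> := ge0_intD mu1 m2 m3 p2 p3.
Qed.

Definition Phi i e x := upd i (phi e (co i x)) x.
Definition PhiV i e x := upd i (phiV e (co i x)) x.
Definition JPhi i e x := jphi e (co i x).

Lemma measurable_Phi i e : measurable_fun setT (Phi i e).
Proof.
apply: measurable_upd => //; apply: measurableT_comp; first exact: measurable_phi.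
exact: measurable_co.
Qed.

Lemma measurable_PhiV i e : measurable_fun setT (PhiV i e).
Proof.
apply: measurable_upd => //; apply: measurableT_comp; first exact: measurable_phiV.
exact: measurable_co.
Qed.

Lemma measurable_JPhi i e : measurable_fun setT (JPhi i e).
Proof.
apply: measurableT_comp; first exact: measurable_jphi.
exact: measurable_co.
Qed.

Lemma PhiK i e : `|e| < 1 -> cancel (Phi i e) (PhiV i e).
Proof.
by move=> he [[a b] c]; case: i; rewrite /Phi /PhiV /= phiK.
Qed.

Lemma PhiVK i e : `|e| < 1 -> cancel (PhiV i e) (Phi i e).
Proof.
by move=> he [[a b] c]; case: i; rewrite /Phi /PhiV /= phiVK.
Qed.

Lemma JPhi_bounds i e x : `|e| <= 1 / 4 -> 3 / 4 <= JPhi i e x <= 5 / 4.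
Proof. exact: jphi_bounds. Qed.

Lemma integral_Phi i e (F : X3 -> \bar R) : `|e| < 1 ->
  measurable_fun setT F -> (forall x, 0 <= F x)%E ->
  (\int[L3]_x (F (Phi i e x) * (JPhi i e x)%:E) = \int[L3]_x F x)%E.
Proof. by move=> he mF F0; exact: (integral_upd i (jac_phi he)). Qed.

Lemma phi_in e t : `|e| < 1 -> (0 < phi e t < 1) = (0 < t < 1).
Proof.
rewrite ltr_norml /phi chiE => ?; do ![case: ifPn => ?]; apply/idP/idP => ?; nra.
Qed.

Lemma phi_inc e t : `|e| < 1 -> (0 <= phi e t <= 1) = (0 <= t <= 1).
Proof.
rewrite ltr_norml /phi chiE => ?; do ![case: ifPn => ?]; apply/idP/idP => ?; nra.
Qed.

Lemma Omega_Phi i e x : `|e| < 1 -> Omega (Phi i e x) <-> Omega x.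
Proof.
move=> he; rewrite /Omega /c1 /c2 /c3 /Phi; case: x => [[a b] c] /=.
by case: i => /=; rewrite phi_in.
Qed.

Lemma Omega_bar_Phi i e x : `|e| < 1 -> Omega_bar (Phi i e x) <-> Omega_bar x.
Proof.
move=> he; rewrite /Omega_bar /c1 /c2 /c3 /Phi; case: x => [[a b] c] /=.
by case: i => /=; rewrite phi_inc.
Qed.

Lemma chi_phi e t : `|e| <= 1 / 4 -> 1 / 2 * chi t <= chi (phi e t) <= 2 * chi t.
Proof.
move=> he; have h : phi e t - t = e * chi t by rewrite /phi; ring.
have [h1 h2] := chi_lip2 (phi e t) t; have c0 := chi_ge0 t.
have h3 : `|phi e t - t| <= 1 / 4 * chi t.
  by rewrite h normrM (ger0_norm c0) ler_wpM2r.
have := le_trans h1 h3; have := le_trans h2 h3; rewrite !ler_norml; lra.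
Qed.

(** Boundary distance inside the cube, extended by zero. Thus [rr x > 0] characterises the cube, and
    negative powers of [rr] vanish outside it by the convention for powers of zero. *)
Definition rr x : R := Num.min (Num.min (chi (co A1 x)) (chi (co A2 x))) (chi (co A3 x)).

Lemma rr_le i x : rr x <= chi (co i x).
Proof. by rewrite /rr; case: i; rewrite !ge_min lexx ?orbT. Qed.

Lemma le_rr (c : R) x : (forall i, c <= chi (co i x)) -> c <= rr x.
Proof. by move=> h; rewrite /rr !le_min !h. Qed.

Lemma lt_rr (c : R) x : (forall i, c < chi (co i x)) -> c < rr x.
Proof. by move=> h; rewrite /rr !lt_min !h. Qed.

Lemma rr_ex x : exists i, rr x = chi (co i x).
Proof.
rewrite /rr; case: (leP _ (chi (co A3 x))) => _; last by exists A3.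
by case: (leP (chi (co A1 x)) _) => _; [exists A1|exists A2].
Qed.

Lemma rr_ge0 x : 0 <= rr x. Proof. by apply: le_rr => i; exact: chi_ge0. Qed.

Lemma rr_half x : rr x <= 1 / 2.
Proof. by rewrite (le_trans (rr_le A1 x))// chi_half. Qed.

Lemma rr_gt0 x : Omega x <-> 0 < rr x.
Proof.
split=> [[h1 h2 h3]|h]; first by apply: lt_rr => -[] /=; rewrite chi_gt0.
by split; rewrite -chi_gt0 (lt_le_trans h)//; [exact: (rr_le A1)|exact: (rr_le A2)|exact: (rr_le A3)].
Qed.

Lemma rr_eq0 x : ~ Omega x -> rr x = 0.
Proof. by move=> /rr_gt0/negP; rewrite -leNgt => h; apply/le_anti; rewrite h rr_ge0. Qed.

Lemma rbdE x : Omega x -> rbd x = rr x.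
Proof.
case: x => [[a b] c] [/= h1 h2 h3]; rewrite /rbd /rr /chi /c1 /c2 /c3 /= in h1 h2 h3 *.
have h t : 0 < t < 1 -> Num.max 0 (Num.min t (1 - t)) = Num.min t (1 - t).
  by move=> ?; apply/max_idPr; rewrite le_min; lra.
by rewrite !h.
Qed.

Lemma measurable_rr : measurable_fun setT rr.
Proof.
have m i : measurable_fun setT (fun x => chi (co i x)).
  by apply: measurableT_comp; [exact: measurable_chi|exact: measurable_co].
by apply: measurable_minr => //; apply: measurable_minr.
Qed.

Lemma rr_Phi i e x : `|e| <= 1 / 4 -> 1 / 2 * rr x <= rr (Phi i e x) <= 2 * rr x.
Proof.
move=> he; have [j] := rr_ex x; have [k] := rr_ex (Phi i e x) => hk hj.
have H l : 1 / 2 * chi (co l x) <= chi (co l (Phi i e x)) <= 2 * chi (co l x).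
  have := chi_ge0 (co l x); have := chi_phi (co l x) he.
  by case: x {hj hk} => [[a b] c]; case: i; case: l => /=; lra.
have := rr_le k x; have := rr_le j (Phi i e x); have := H j; have := H k.
by rewrite -hj -hk; lra.
Qed.

Lemma co_edist i x z : `|co i x - co i z| <= edist x z.
Proof.
rewrite /edist /c1 /c2 /c3; case: x z => [[a b] c] [[a' b'] c'] /=.
rewrite -sqrtr_sqr ler_wsqrtr//.
have h1 := sqr_ge0 (a - a'); have h2 := sqr_ge0 (b - b'); have h3 := sqr_ge0 (c - c').
by case: i => /=; lra.
Qed.

Lemma rr_lip x z : `|rr x - rr z| <= edist x z.
Proof.
have [j hj] := rr_ex x; have [k hk] := rr_ex z.
have := rr_le k x; have := rr_le j z.
have := le_trans (chi_lip _ _) (co_edist j x z); have := le_trans (chi_lip _ _) (co_edist k x z).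
by rewrite -hj -hk !ler_norml; lra.
Qed.

Lemma edist_ge0 x z : 0 <= edist x z. Proof. exact: sqrtr_ge0. Qed.

Lemma edistC x z : edist x z = edist z x.
Proof. by congr Num.sqrt; ring. Qed.

Lemma edist_sqr x z : edist x z ^+ 2 =
  (co A1 x - co A1 z) ^+ 2 + (co A2 x - co A2 z) ^+ 2 + (co A3 x - co A3 z) ^+ 2.
Proof. by rewrite sqr_sqrtr// !addr_ge0// sqr_ge0. Qed.

(** The factor 2 rounds up the square root of 3. *)
Lemma edist_le_max (r : R) x z : 0 <= r -> (forall i, `|co i x - co i z| <= r) ->
  edist x z <= 2 * r.
Proof.
move=> r0 h; rewrite -(@ler_pXn2r _ 2) ?nnegrE ?edist_ge0 ?mulr_ge0// edist_sqr.
have H i : (co i x - co i z) ^+ 2 <= r ^+ 2.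
  by rewrite -real_normK ?num_real// ler_pXn2r ?nnegrE.
by have := H A1; have := H A2; have := H A3; have := sqr_ge0 r; rewrite exprMn; lra.
Qed.

Lemma edist_eq0 x z : edist x z = 0 -> x = z.
Proof.
move=> h; have H i : co i x = co i z.
  by apply/eqP; rewrite -subr_eq0 -normr_le0 -h co_edist.
by case: x z H {h} => [[a b] c] [[a' b'] c'] H; rewrite (H A1 : a = a') (H A2 : b = b') (H A3 : c = c').
Qed.

(** Since [chi] is 1-Lipschitz, the difference of the moved coordinates changes by at most a quarter
    of itself, and the two other coordinates stay fixed. *)
Lemma edist_Phi i e x z : `|e| <= 1 / 4 ->
  3 / 4 * edist x z <= edist (Phi i e x) (Phi i e z) <= 5 / 4 * edist x z.
Proof.
move=> he.
have key (t u : R) : 9 / 16 * (t - u) ^+ 2 <= (phi e t - phi e u) ^+ 2 <= 25 / 16 * (t - u) ^+ 2.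
  have := chi_lip t u; rewrite /phi; have := he; rewrite ler_norml.
  set a := t - u; set b := chi t - chi u => he' hb.
  have -> : t + e * chi t - (u + e * chi u) = a + e * b by rewrite /a /b; ring.
  have : `|e * b| <= 1 / 4 * `|a| by rewrite normrM ler_pM.
  have [a0|a0] := leP 0 a; rewrite ?(ger0_norm a0) ?(ltr0_norm a0) ler_norml; set c := e * b; nra.
have r0 := edist_ge0 x z; have r1 := edist_ge0 (Phi i e x) (Phi i e z).
have : 9 / 16 * edist x z ^+ 2 <= edist (Phi i e x) (Phi i e z) ^+ 2 <= 25 / 16 * edist x z ^+ 2.
  rewrite !edist_sqr; have := key (co i x) (co i z).
  have := sqr_ge0 (co A1 x - co A1 z); have := sqr_ge0 (co A2 x - co A2 z).
  have := sqr_ge0 (co A3 x - co A3 z).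
  by rewrite /Phi; case: i {r0 r1} => /=; lra.
by move=> /andP[h1 h2]; apply/andP; split; nra.
Qed.

End Deformation.

(** * The energy space *)

Section FubiniR.
Context d1 d2 (T1 : measurableType d1) (T2 : measurableType d2) (R : realType).
Variable m1 : {sigma_finite_measure set T1 -> \bar R}.
Variable m2 : {sigma_finite_measure set T2 -> \bar R}.

(** The inner real integrals are finite parts of extended ones. Integrability makes the latter
    finite for almost every [x], which suffices for the outer integral. *)
Lemma Rfubini (f : T1 * T2 -> R) :
  (prodm m1 m2).-integrable setT (EFin \o f) ->
  Rintegral m1 setT (fun x => Rintegral m2 setT (fun y => f (x, y))) =
  Rintegral (prodm m1 m2) setT f.
Proof.
move=> fi; rewrite /Rintegral; congr fine.
have fi' : (m1 \x m2)%E.-integrable setT (EFin \o f) by [].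
have Fi := integrable_fubini_F fi'.
rewrite (fubini_prodm fi); apply: ae_eq_integral => //.
- apply: measurable_EF; apply: (measurableT_comp (f := fine)); first exact: fine_measurable.
  exact: measurable_int Fi.
- exact: measurable_int Fi.
- have := integrable_ae measurableT Fi; apply: filterS => x /(_ I) h _.
  by rewrite /= fineK.
Qed.

End FubiniR.

(** * Square-integrable functions and their inner product *)

Section SquareIntegrable.
Context d (T : measurableType d) (R : realType) (m : {measure set T -> \bar R}).
Implicit Types f g h : T -> R.

Definition sqi f := measurable_fun setT f /\ (\int[m]_x (f x ^+ 2)%:E < +oo)%E.
Definition ip f g : R := Rintegral m setT (fun x => f x * g x).

Lemma sqi_fin f : sqi f -> (\int[m]_x (f x ^+ 2)%:E = (ip f f)%:E)%E.
Proof.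
move=> [mf fy]; rewrite /ip /Rintegral fineK; first by apply: eq_integral => x _; rewrite expr2.
rewrite ge0_fin_numE; last by apply: integral_ge0 => x _; rewrite lee_fin -expr2 sqr_ge0.
by under eq_integral do rewrite -expr2.
Qed.

Lemma ip_ge0 f : 0 <= ip f f.
Proof. by apply: Rintegral_ge0 => x _; rewrite -expr2 sqr_ge0. Qed.

Lemma sqi_le f g (c : R) : measurable_fun setT f -> sqi g ->
  0 <= c -> (forall x, f x ^+ 2 <= c * g x ^+ 2) -> sqi f /\ ip f f <= c * ip g g.
Proof.
move=> mf sg c0 h; have [mg gy] := sg.
have mf2 := measurable_EF (measurable_funX 2 mf).
have mg2 := measurable_EF (measurable_funX 2 mg).
have le : (\int[m]_x (f x ^+ 2)%:E <= c%:E * \int[m]_x (g x ^+ 2)%:E)%E.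
  rewrite -(ge0_intZ m c0 mg2) => [|x]; last by rewrite lee_fin sqr_ge0.
  apply: ge0_le_int => [||x|x]; [exact: mf2|exact: measurable_funeM|
    by rewrite lee_fin sqr_ge0|by rewrite -EFinM lee_fin].
have sf : sqi f.
  split=> //; apply: le_lt_trans le _.
  by rewrite (sqi_fin sg) -EFinM ltry.
by split=> //; move: le; rewrite (sqi_fin sf) (sqi_fin sg) -EFinM lee_fin.
Qed.

Lemma sqiZ (k : R) f : sqi f -> sqi (fun x => k * f x).
Proof.
move=> sf; have [mf _] := sf.
apply: (proj1 (sqi_le (c := k ^+ 2) _ sf _ _)).
- by apply: measurable_funM.
- exact: sqr_ge0.
- by move=> x; rewrite exprMn.
Qed.

Lemma sqiD f g : sqi f -> sqi g -> sqi (fun x => f x + g x).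
Proof.
move=> [mf fy] [mg gy]; split; first exact: measurable_funD.
have mf2 := measurable_EF (measurable_funX 2 mf).
have mg2 := measurable_EF (measurable_funX 2 mg).
have pf x : (0 <= (f x ^+ 2)%:E)%E by rewrite lee_fin sqr_ge0.
have pg x : (0 <= (g x ^+ 2)%:E)%E by rewrite lee_fin sqr_ge0.
apply: (@le_lt_trans _ _ (2%:E * (\int[m]_x (f x ^+ 2)%:E + \int[m]_x (g x ^+ 2)%:E))%E).
  rewrite -(ge0_intD m mf2 mg2 pf pg).
  have mfg := emeasurable_funD mf2 mg2.
  rewrite -(ge0_intZ m (ler0n _ 2) mfg) => [|x]; last by rewrite adde_ge0.
  apply: ge0_le_int => [||x|x].
  - by apply: measurable_EF; apply: measurable_funX; exact: measurable_funD.
  - exact: measurable_funeM.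
  - by rewrite lee_fin sqr_ge0.
  - by rewrite -EFinD -EFinM lee_fin; have := sqr_ge0 (f x - g x); rewrite sqrrB sqrrD; lra.
by rewrite (sqi_fin (conj mf fy)) (sqi_fin (conj mg gy)) -EFinD -EFinM ltry.
Qed.

Lemma sqi0 : sqi (fun=> 0).
Proof.
split=> //; under eq_integral do rewrite expr0n /=.
by rewrite integral0.
Qed.

Lemma sqiB f g : sqi f -> sqi g -> sqi (fun x => f x - g x).
Proof.
move=> sf /(sqiZ (-1)) sg; have := sqiD sf sg.
by congr sqi; apply/funext => x; rewrite mulN1r.
Qed.

Lemma sqi_sum (I : Type) (s : seq I) (F : I -> T -> R) :
  (forall i, sqi (F i)) -> sqi (fun x => \sum_(i <- s) F i x).
Proof.
move=> h; elim: s => [|i s IH].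
  by have := sqi0; congr sqi; apply/funext => x; rewrite big_nil.
have := sqiD (h i) IH; congr sqi; apply/funext => x; by rewrite big_cons.
Qed.

Lemma sqi_int f g : sqi f -> sqi g -> m.-integrable setT (EFin \o (fun x => f x * g x)).
Proof.
move=> sf sg; have [mf fy] := sf; have [mg gy] := sg.
have mf2 := measurable_EF (measurable_funX 2 mf).
have mg2 := measurable_EF (measurable_funX 2 mg).
have pf x : (0 <= (f x ^+ 2)%:E)%E by rewrite lee_fin sqr_ge0.
have pg x : (0 <= (g x ^+ 2)%:E)%E by rewrite lee_fin sqr_ge0.
have mfg : measurable_fun setT (fun x => f x * g x) by exact: measurable_funM.
have ma : measurable_fun setT (abse \o (fun x => (f x * g x)%:E)).
  by apply: measurableT_comp; [exact: abse_measurable|exact: measurable_EF].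
apply/integrableP; split; first exact: measurable_EF.
apply: (@le_lt_trans _ _ (\int[m]_x (f x ^+ 2)%:E + \int[m]_x (g x ^+ 2)%:E)%E).
  rewrite -(ge0_intD m mf2 mg2 pf pg).
  apply: ge0_le_int => [||x|x] /=.
  - exact: ma.
  - exact: emeasurable_funD.
  - by rewrite lee_fin.
  - rewrite -EFinD lee_fin normrM -(real_normK (num_real (f x))) -(real_normK (num_real (g x))).
    by have := sqr_ge0 (`|f x| - `|g x|); rewrite sqrrB; have := sqr_ge0 `|f x|; have := sqr_ge0 `|g x|; lra.
by rewrite (sqi_fin sf) (sqi_fin sg) -EFinD ltry.
Qed.

Lemma ipC f g : ip f g = ip g f.
Proof. by rewrite /ip; apply: eq_Rintegral => x _; rewrite mulrC. Qed.

Lemma ipZl (k : R) f g : sqi f -> sqi g -> ip (fun x => k * f x) g = k * ip f g.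
Proof.
move=> sf sg; rewrite /ip -RintegralZl//; last exact: sqi_int.
by apply: eq_Rintegral => x _; rewrite mulrA.
Qed.

Lemma ipDl f g h : sqi f -> sqi g -> sqi h ->
  ip (fun x => f x + g x) h = ip f h + ip g h.
Proof.
move=> sf sg sh; rewrite /ip -RintegralD//; [|exact: sqi_int..].
by apply: eq_Rintegral => x _; rewrite mulrDl.
Qed.

Lemma ipBl f g h : sqi f -> sqi g -> sqi h ->
  ip (fun x => f x - g x) h = ip f h - ip g h.
Proof.
move=> sf sg sh; rewrite /ip -RintegralB//; [|exact: sqi_int..].
by apply: eq_Rintegral => x _; rewrite mulrBl.
Qed.

Lemma ipDr f g h : sqi f -> sqi g -> sqi h ->
  ip h (fun x => f x + g x) = ip h f + ip h g.
Proof. by move=> sf sg sh; rewrite ipC ipDl// (ipC f) (ipC g). Qed.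

Lemma ipBr f g h : sqi f -> sqi g -> sqi h ->
  ip h (fun x => f x - g x) = ip h f - ip h g.
Proof. by move=> sf sg sh; rewrite ipC ipBl// (ipC f) (ipC g). Qed.

Lemma ipZr (k : R) f g : sqi f -> sqi g -> ip f (fun x => k * g x) = k * ip f g.
Proof. by move=> sf sg; rewrite ipC ipZl// ipC. Qed.

Lemma cauchy f g : sqi f -> sqi g -> `|ip f g| <= Num.sqrt (ip f f) * Num.sqrt (ip g g).
Proof.
move=> sf sg.
have key (t : R) : 0 <= ip f f + 2 * t * ip f g + t ^+ 2 * ip g g.
  have := ip_ge0 (fun x => f x + t * g x).
  have st := sqiZ t sg.
  have /= -> := ipDl sf st (sqiD sf st).
  have /= -> := ipDr sf st sf; have /= -> := ipDr sf st st.
  have /= -> := ipZl t sg sf; have /= -> := ipZr t sf sg.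
  have /= -> := ipZl t sg st; have /= -> := ipZr t sg sg.
  by rewrite (ipC g f); lra.
rewrite -sqrtrM ?ip_ge0// -sqrtr_sqr ler_wsqrtr//.
have [g0|g0] := eqVneq (ip g g) 0.
  rewrite g0 mulr0; have [->|fg0] := eqVneq (ip f g) 0; first by rewrite expr0n.
  have := key (- (ip f f + 1) / (2 * ip f g)); rewrite g0 mulr0 addr0.
  rewrite (_ : 2 * _ * _ = - (ip f f + 1)); last by field.
  by lra.
have gp : 0 < ip g g by rewrite lt_neqAle eq_sym g0 ip_ge0.
have := key (- ip f g / ip g g).
rewrite (_ : _ + _ + _ = ip f f - ip f g ^+ 2 / ip g g); last by field.
by rewrite subr_ge0 ler_pdivrMr.
Qed.

Lemma cauchy_bound f g (c : T -> R) (M : R) : sqi f -> sqi g -> measurable_fun setT c -> 0 <= M ->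
  (forall x, `|c x| <= M) ->
  sqi (fun x => c x * g x) /\
  `|ip f (fun x => c x * g x)| <= M * Num.sqrt (ip f f) * Num.sqrt (ip g g).
Proof.
move=> sf sg mc M0 cM; have [mg _] := sg.
have [scg le] : sqi (fun x => c x * g x) /\
    ip (fun x => c x * g x) (fun x => c x * g x) <= M ^+ 2 * ip g g.
  apply: sqi_le => //; [exact: measurable_funM|exact: sqr_ge0|].
  move=> x; rewrite exprMn ler_wpM2r ?sqr_ge0//.
  by rewrite -real_normK ?num_real// ler_pXn2r ?nnegrE.
split=> //; apply: le_trans (cauchy sf scg) _.
rewrite (mulrC M) -mulrA ler_wpM2l ?sqrtr_ge0//.
rewrite -[M in leRHS](ger0_norm M0) -sqrtr_sqr -sqrtrM ?sqr_ge0// ler_wsqrtr//.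
Qed.

Lemma ip_sqrtD f g : sqi f -> sqi g ->
  Num.sqrt (ip (fun x => f x + g x) (fun x => f x + g x)) <=
  Num.sqrt (ip f f) + Num.sqrt (ip g g).
Proof.
move=> sf sg; have sD := sqiD sf sg.
rewrite -(@ler_pXn2r _ 2) ?nnegrE ?addr_ge0 ?sqrtr_ge0//.
rewrite sqr_sqrtr ?ip_ge0// sqrrD !sqr_sqrtr ?ip_ge0//.
have /= -> := ipDl sf sg sD; have /= -> := ipDr sf sg sf.
have /= -> := ipDr sf sg sg; rewrite (ipC g f).
have := cauchy sf sg; rewrite ler_norml => /andP[_]; lra.
Qed.

End SquareIntegrable.

Section JacobianMeasure.
Context d (T : measurableType d) (R : realType) (m : {measure set T -> \bar R}).

(** Counterpart of [jac] on an arbitrary measure space. It is stable under products ([jacm_prod]),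
    which lets a deformation of [R^3] act on pairs of points. *)
Definition jacm (Psi : T -> T) (w : T -> R) := [/\ measurable_fun setT Psi,
  measurable_fun setT w, forall x, 0 <= w x &
  forall F : T -> \bar R, measurable_fun setT F -> (forall x, 0 <= F x)%E ->
  (\int[m]_x (F (Psi x) * (w x)%:E) = \int[m]_x F x)%E].

Lemma jacm_R Psi w (h : T -> R) : jacm Psi w -> measurable_fun setT h ->
  Rintegral m setT (fun x => h (Psi x) * w x) = Rintegral m setT h.
Proof.
move=> [mP mw w0 H] mh; rewrite /Rintegral; congr fine.
have mE := measurable_EF mh.
rewrite [LHS]integralE [RHS]integralE.
rewrite -(H _ (measurable_funepos mE))// -(H _ (measurable_funeneg mE))//.
congr (_ - _)%E; apply: eq_integral => x _ /=.
  by rewrite !funeposE -!EFin_max -EFinM maxr_pMl// mul0r.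
by rewrite !funenegE -!EFinN -!EFin_max -EFinM maxr_pMl// mul0r mulNr.
Qed.

Lemma jacm_sqi Psi w (f : T -> R) (c : R) : jacm Psi w -> 0 < c ->
  (forall x, c <= w x) -> sqi m f ->
  sqi m (fun x => f (Psi x)) /\
  ip m (fun x => f (Psi x)) (fun x => f (Psi x)) <= c^-1 * ip m f f.
Proof.
move=> [mP mw w0 H] c0 cw sf; have [mf fy] := sf.
have mf2 := measurable_EF (measurable_funX 2 mf).
have mfP : measurable_fun setT (fun x => f (Psi x)) by exact: measurableT_comp.
have mfP2 := measurable_EF (measurable_funX 2 mfP).
have le : (\int[m]_x (f (Psi x) ^+ 2)%:E <= c^-1%:E * \int[m]_x (f x ^+ 2)%:E)%E.
  rewrite -(H _ mf2) => [|x]; last by rewrite lee_fin sqr_ge0.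
  rewrite -(ge0_intZ m); first apply: ge0_le_int => [||x|x].
  - exact: mfP2.
  - by apply: measurable_funeM; apply: emeasurable_funM => //; exact: measurable_EF.
  - by rewrite lee_fin sqr_ge0.
  - rewrite -!EFinM lee_fin mulrA mulrC mulrA ler_peMl ?sqr_ge0//.
    by rewrite -(mulfV (lt0r_neq0 c0)) ler_wpM2r// invr_ge0 ltW.
  - by rewrite invr_ge0 ltW.
  - by apply: emeasurable_funM => //; exact: measurable_EF.
  - by move=> x; rewrite mule_ge0// lee_fin ?sqr_ge0.
have sfP : sqi m (fun x => f (Psi x)).
  by split=> //; apply: le_lt_trans le _; rewrite (sqi_fin sf) -EFinM ltry.
by split=> //; move: le; rewrite (sqi_fin sfP) (sqi_fin sf) -EFinM lee_fin.
Qed.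

End JacobianMeasure.

Lemma jacm_prod d1 d2 (T1 : measurableType d1) (T2 : measurableType d2) (R : realType)
  (m1 : {sigma_finite_measure set T1 -> \bar R})
  (m2 : {sigma_finite_measure set T2 -> \bar R}) Psi1 w1 Psi2 w2 :
  jacm m1 Psi1 w1 -> jacm m2 Psi2 w2 ->
  jacm (prodm m1 m2) (fun p => (Psi1 p.1, Psi2 p.2)) (fun p => w1 p.1 * w2 p.2).
Proof.
move=> [mP1 mw1 w10 H1] [mP2 mw2 w20 H2].
have mP : measurable_fun setT (fun p : T1 * T2 => (Psi1 p.1, Psi2 p.2)).
  by apply: measurable_fun_pair; apply: measurableT_comp.
have mw : measurable_fun setT (fun p : T1 * T2 => w1 p.1 * w2 p.2).
  by apply: measurable_funM; apply: measurableT_comp.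
split=> // [x|F mF F0]; first exact: mulr_ge0.
rewrite tonelli1; first last.
- by move=> x; rewrite mule_ge0// lee_fin mulr_ge0.
- by apply: emeasurable_funM; [exact: measurableT_comp|exact: measurable_EF].
have -> : (\int[prodm m1 m2]_x F x = \int[m1]_x \int[m2]_y F (x, y))%E by exact: tonelli1.
have m1F := measurable_tonelli1 m2 mF F0.
have mFx x : measurable_fun setT (fun y => F (x, y)).
  by apply: (measurableT_comp mF); exact: measurable_fun_pair.
rewrite -(H1 _ m1F) => [|x]; last exact: integral_ge0.
apply: eq_integral => x _ /=.
have e2 := H2 _ (mFx (Psi1 x)) (fun=> F0 _); rewrite -e2.
have mG : measurable_fun setT (fun y => F (Psi1 x, Psi2 y) * (w2 y)%:E)%E.
  by apply: emeasurable_funM; [exact: (measurableT_comp (mFx (Psi1 x)))|exact: measurable_EF].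
have G0 y : (0 <= F (Psi1 x, Psi2 y) * (w2 y)%:E)%E by rewrite mule_ge0// lee_fin.
have /= <- := ge0_intZr m2 (w10 x) mG G0.
by apply: eq_integral => y _; rewrite EFinM -muleA (muleC (w1 x)%:E).
Qed.

(** * The energy form and its behaviour under deformations *)

Section Energy.
Variable R : realType.
Variable s : R.
Hypothesis s01 : 0 < s < 1.
Notation X3 := (R * R * R)%type.
Notation X6 := (X3 * X3)%type.
Implicit Types (u v w : X3 -> R) (p : X6) (x z : X3).

Lemma measurable_edist : measurable_fun setT (fun p : X6 => edist p.1 p.2).
Proof.
rewrite /edist /c1 /c2 /c3; apply: measurableT_comp.
  by apply: continuous_measurable_fun => x; exact: sqrt_continuous.
have mc i : measurable_fun setT (fun p : X6 => (co i p.1 - co i p.2) ^+ 2).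
  have mco := @measurable_co R i.
  by apply: measurable_funX; apply: measurable_funB; apply: measurableT_comp.
by apply: measurable_funD (mc A3); exact: measurable_funD (mc A1) (mc A2).
Qed.

Definition kern p : R := (edist p.1 p.2 `^ (3 + 2 * s))^-1.
(* The square root of the kernel turns the energy form into an [L^2] inner product on [R^3 x R^3]. *)
Definition kh p : R := edist p.1 p.2 `^ (- ((3 + 2 * s) / 2)).

Lemma khE p : kh p ^+ 2 = kern p.
Proof.
rewrite /kh /kern -powRN -powR_mulrn ?powR_ge0// -powRrM; congr (_ `^ _).
by rewrite mulNr divfK.
Qed.

Lemma kern_ge0 p : 0 <= kern p. Proof. by rewrite invr_ge0 powR_ge0. Qed.

Lemma measurable_kh : measurable_fun setT kh.
Proof. by apply: (measurableT_comp (measurable_powR _)); exact: measurable_edist. Qed.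

Lemma measurable_kern : measurable_fun setT kern.
Proof.
by rewrite (_ : kern = fun p => kh p ^+ 2); [apply: measurable_funX; exact: measurable_kh|apply/funext => p; rewrite khE].
Qed.

Definition dv v p := (v p.1 - v p.2) * kh p.

Lemma dvM u v p : dv u p * dv v p = (u p.1 - u p.2) * (v p.1 - v p.2) * kern p.
Proof. by rewrite /dv -khE; ring. Qed.

Lemma dv2 u p : dv u p ^+ 2 = (u p.1 - u p.2) ^+ 2 * kern p.
Proof. by rewrite /dv exprMn khE. Qed.

Lemma measurable_diff v : measurable_fun setT v ->
  measurable_fun setT (fun p : X6 => v p.1 - v p.2).
Proof. by move=> mv; apply: measurable_funB; apply: measurableT_comp. Qed.

Lemma measurable_dv v : measurable_fun setT v -> measurable_fun setT (dv v).
Proof. by move=> mv; apply: measurable_funM; [exact: measurable_diff|exact: measurable_kh]. Qed.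

Definition Hs v := [/\ sqi L3 v, sqi L6 (dv v) & forall x, ~ Omega_bar x -> v x = 0].

Lemma Hsemi_sqE v : measurable_fun setT v ->
  Hsemi_sq s setT v = (\int[L6]_p (dv v p ^+ 2)%:E)%E.
Proof.
move=> mv; rewrite tonelli1.
- by apply: eq_integral => x _; apply: eq_integral => z _; rewrite dv2.
- by apply: measurable_EF; apply: measurable_funX; exact: measurable_dv.
- by move=> p; rewrite lee_fin sqr_ge0.
Qed.

Lemma HsP v : in_Ht s v <-> Hs v.
Proof.
split=> [[[mv h1 h2] h3]|[[mv h1] [_ h2] h3]]; split => //.
  by split; [exact: measurable_dv|rewrite -Hsemi_sqE].
by split => //; rewrite Hsemi_sqE.
Qed.

(** The form of the statement without its factor [Cs s / 2], which [weak_form] moves to the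
    right-hand side. *)
Definition A u v : R := ip L6 (dv u) (dv v).

Lemma aformE u v : sqi L6 (dv u) -> sqi L6 (dv v) ->
  aform s u v = Cs s / 2 * A u v.
Proof.
move=> su sv; rewrite /aform /A /ip; congr (_ * _).
have h := Rfubini (sqi_int su sv); rewrite -[RHS]h.
by apply: eq_Rintegral => x _; apply: eq_Rintegral => z _; rewrite dvM.
Qed.

Lemma dvD u v : dv (fun x => u x + v x) = fun p => dv u p + dv v p.
Proof. by apply/funext => p; rewrite /dv; ring. Qed.

Lemma dvB u v : dv (fun x => u x - v x) = fun p => dv u p - dv v p.
Proof. by apply/funext => p; rewrite /dv; ring. Qed.

Lemma dvZ (k : R) v : dv (fun x => k * v x) = fun p => k * dv v p.
Proof. by apply/funext => p; rewrite /dv; ring. Qed.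

Lemma HsD u v : Hs u -> Hs v -> Hs (fun x => u x + v x).
Proof.
move=> [su eu hu] [sv ev hv]; split; [exact: sqiD|by rewrite dvD; exact: sqiD|].
by move=> x hx; rewrite hu// hv// addr0.
Qed.

Lemma HsZ (k : R) v : Hs v -> Hs (fun x => k * v x).
Proof.
move=> [sv ev hv]; split; [exact: sqiZ|by rewrite dvZ; exact: sqiZ|].
by move=> x hx; rewrite hv// mulr0.
Qed.

Lemma HsB u v : Hs u -> Hs v -> Hs (fun x => u x - v x).
Proof.
move=> hu hv; have := HsD hu (HsZ (-1) hv); congr Hs.
by apply/funext => x; rewrite mulN1r.
Qed.

Lemma ABl u v w : Hs u -> Hs v -> Hs w -> A (fun x => u x - v x) w = A u w - A v w.
Proof. by move=> [_ hu _] [_ hv _] [_ hw _]; rewrite /A dvB ipBl. Qed.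

Lemma ABr u v w : Hs u -> Hs v -> Hs w -> A w (fun x => u x - v x) = A w u - A w v.
Proof. by move=> [_ hu _] [_ hv _] [_ hw _]; rewrite /A dvB ipBr. Qed.

Lemma AC u v : A u v = A v u. Proof. exact: ipC. Qed.

Lemma A_ge0 u : 0 <= A u u. Proof. exact: ip_ge0. Qed.

Lemma jacm_Phi i e : `|e| < 1 -> jacm L3 (@Phi R i e) (JPhi i e).
Proof.
move=> he; split.
- exact: measurable_Phi.
- exact: measurable_JPhi.
- by move=> x; have [_ _ h _] := jac_phi he; exact: h.
- by move=> F mF F0; exact: integral_Phi.
Qed.

Definition Phi2 i e p : X6 := (Phi i e p.1, Phi i e p.2).
Definition JPhi2 i e p : R := JPhi i e p.1 * JPhi i e p.2.

Lemma jacm_Phi2 i e : `|e| < 1 -> jacm L6 (Phi2 i e) (JPhi2 i e).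
Proof. by move=> he; apply: jacm_prod; exact: jacm_Phi. Qed.

Lemma powR5 (c : R) : 0 < c <= 1 -> c ^+ 5 <= c `^ (3 + 2 * s).
Proof.
move=> hc; rewrite -powR_mulrn ?(ltW (andP hc).1)//.
by apply: (ger_powR hc); have := s01; lra.
Qed.

(** The power 5 comes from [3 + 2 * s < 5]. The last premise reflects that the kernel takes the
    value zero on the diagonal, the inverse of zero being zero. *)
Lemma kern_le (c : R) p q : 0 < c <= 1 -> c * edist q.1 q.2 <= edist p.1 p.2 ->
  (edist q.1 q.2 = 0 -> edist p.1 p.2 = 0) -> kern p <= c ^- 5 * kern q.
Proof.
move=> hc h hpq; rewrite /kern.
have c0 : 0 < c by case/andP: hc.
have [p0|p0] := eqVneq (edist p.1 p.2) 0.
  rewrite p0 powR0 ?invr0 ?mulr_ge0 ?invr_ge0 ?powR_ge0 ?exprn_ge0 ?(ltW c0)//.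
  by have := s01; lra.
have q0 : edist q.1 q.2 != 0 by apply: contra_neq p0.
have pp : 0 < edist p.1 p.2 by rewrite lt_neqAle eq_sym p0 edist_ge0.
have qp : 0 < edist q.1 q.2 by rewrite lt_neqAle eq_sym q0 edist_ge0.
rewrite -invfM lef_pV2 ?posrE ?mulr_gt0 ?exprn_gt0 ?powR_gt0//.
apply: (@le_trans _ _ ((c * edist q.1 q.2) `^ (3 + 2 * s))).
  by rewrite powRM ?edist_ge0 ?(ltW c0)// ler_wpM2r ?powR_ge0// powR5.
by apply: ge0_ler_powR; rewrite ?nnegrE ?mulr_ge0 ?edist_ge0 ?(ltW c0)//; have := s01; lra.
Qed.

Lemma edist_Phi0 i e x z : `|e| <= 1 / 4 ->
  (edist (Phi i e x) (Phi i e z) = 0) <-> (edist x z = 0).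
Proof.
move=> he; have := edist_Phi i x z he; have := edist_ge0 x z.
by have := edist_ge0 (Phi i e x) (Phi i e z); split => ?; lra.
Qed.

(** Both [(4 / 3) ^ 5] and [(5 / 4) ^ 5] are at most 5. *)
Lemma kern_Phi i e p : `|e| <= 1 / 4 ->
  kern (Phi2 i e p) <= 5 * kern p /\ kern p <= 5 * kern (Phi2 i e p).
Proof.
move=> he; have := edist_Phi i p.1 p.2 he => /andP[h1 h2].
have h0 := edist_Phi0 i p.1 p.2 he.
split.
  apply: (le_trans (kern_le (c := 3 / 4) (q := p) _ _ _)) => //=; [lra|by rewrite h0|].
  by rewrite ler_wpM2r ?kern_ge0//; lra.
apply: (le_trans (kern_le (c := 4 / 5) (q := Phi2 i e p) _ _ _)) => //=; [lra|lra|by rewrite h0|].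
by rewrite ler_wpM2r ?kern_ge0//; lra.
Qed.

(** The constant 9 rounds up 5, from the kernel, times [16 / 9], from the two Jacobians. *)
Lemma Hs_Phi i e v : `|e| <= 1 / 4 -> Hs v ->
  Hs (fun x => v (Phi i e x)) /\
  A (fun x => v (Phi i e x)) (fun x => v (Phi i e x)) <= 9 * A v v.
Proof.
move=> he [sv ev hv].
have he1 : `|e| < 1 by apply: le_lt_trans he _; lra.
have [mv _] := sv.
have mvP : measurable_fun setT (fun x => v (Phi i e x)).
  by apply: (measurableT_comp mv); exact: measurable_Phi.
have [h1 _] := jacm_sqi (c := 3 / 4) (jacm_Phi i he1) ltac:(lra)
  (fun x => (andP (JPhi_bounds i x he)).1) sv.
have J2 p : 9 / 16 <= JPhi2 i e p.
  have := JPhi_bounds i p.1 he; have := JPhi_bounds i p.2 he; rewrite /JPhi2; nra.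
have [h2 h3] := jacm_sqi (c := 9 / 16) (jacm_Phi2 i he1) ltac:(lra) J2 ev.
have [h4 h5] : sqi L6 (dv (fun x => v (Phi i e x))) /\
   A (fun x => v (Phi i e x)) (fun x => v (Phi i e x)) <=
   5 * ip L6 (fun p => dv v (Phi2 i e p)) (fun p => dv v (Phi2 i e p)).
  apply: sqi_le => //; first exact: measurable_dv.
  move=> p; rewrite !dv2 /= mulrCA ler_wpM2l ?sqr_ge0//.
  by have [] := kern_Phi i p he.
have aux (a b c : R) : a <= 5 * b -> b <= (9 / 16)^-1 * c -> 0 <= c -> a <= 9 * c by clear; lra.
split; last exact: aux h5 h3 (A_ge0 v).
split => // x hx; apply: hv; apply: contra_not hx.
by move/Omega_bar_Phi; exact.
Qed.

Lemma jacm_PhiV i e F : `|e| < 1 -> measurable_fun setT F ->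
  (forall x, 0 <= F x)%E ->
  (\int[L3]_x F (PhiV i e x) = \int[L3]_x (F x * (JPhi i e x)%:E))%E.
Proof.
move=> he mF F0; have [_ _ _ H] := jacm_Phi i he.
rewrite -(H (fun x => F (PhiV i e x))) //.
  by apply: eq_integral => x _; rewrite PhiK.
by apply: (measurableT_comp mF); exact: measurable_PhiV.
Qed.

Lemma Hs_PhiV i e v : `|e| <= 1 / 4 -> Hs v -> Hs (fun x => v (PhiV i e x)).
Proof.
move=> he [sv ev hv].
have he1 : `|e| < 1 by apply: le_lt_trans he _; lra.
have aux (q k k' J : R) : k' <= 5 * k -> 0 <= J -> 0 <= q -> 0 <= k -> 0 <= k' ->
    J <= 25 / 16 -> q * k' * J <= 8 * (q * k).
  clear => h J0 q0 k0 k'0 J1; rewrite -mulrA [leRHS]mulrCA ler_wpM2l//.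
  apply: (@le_trans _ _ (5 * k * (25 / 16))); last by lra.
  by apply: ler_pM.
have auxJ (a b : R) : 3 / 4 <= a <= 5 / 4 -> 3 / 4 <= b <= 5 / 4 -> a * b <= 25 / 16.
  by clear; nra.
have [mv vy] := sv; have [mdv evy] := ev.
have mvP : measurable_fun setT (fun x => v (PhiV i e x)).
  by apply: (measurableT_comp mv); exact: measurable_PhiV.
have mv2 := measurable_EF (measurable_funX 2 mv).
have mdv2 := measurable_EF (measurable_funX 2 mdv).
split.
- split => //; rewrite (jacm_PhiV i he1 mv2) => [|x]; last by rewrite lee_fin sqr_ge0.
  apply: (@le_lt_trans _ _ ((5 / 4)%:E * \int[L3]_x (v x ^+ 2)%:E)%E); last first.
    by rewrite (sqi_fin sv) -EFinM ltry.
  rewrite -(ge0_intZ L3) => [|||x]; [|by rewrite divr_ge0|exact: mv2|by rewrite lee_fin sqr_ge0].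
  apply: ge0_le_int => [||x|x].
  + by apply: emeasurable_funM => //; apply: measurable_EF; exact: measurable_JPhi.
  + exact: measurable_funeM.
  + rewrite mule_ge0// lee_fin ?sqr_ge0//.
    by apply: le_trans (andP (JPhi_bounds i x he)).1; rewrite divr_ge0.
  + rewrite -!EFinM lee_fin mulrC ler_wpM2r ?sqr_ge0//.
    by case/andP: (JPhi_bounds i x he).
- have [mP mw w0 H] := jacm_Phi2 i he1.
  have mdP := measurable_dv mvP.
  have mdP2 := measurable_EF (measurable_funX 2 mdP).
  split => //; rewrite -(H _ mdP2) => [|p]; last by rewrite lee_fin sqr_ge0.
  apply: (@le_lt_trans _ _ (8%:E * \int[L6]_p (dv v p ^+ 2)%:E)%E); last first.
    by rewrite (sqi_fin ev) -EFinM ltry.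
  rewrite -(ge0_intZ L6) => [|||p]; [|by []|exact: mdv2|by rewrite lee_fin sqr_ge0].
  apply: ge0_le_int => [||p|p].
  + by apply: emeasurable_funM; [exact: (measurableT_comp mdP2)|exact: measurable_EF].
  + exact: measurable_funeM.
  + by rewrite mule_ge0// lee_fin ?sqr_ge0.
  + rewrite -!EFinM lee_fin !dv2 /= !PhiK//.
    have [h1 _] := kern_Phi i p he.
    by apply: (aux _ _ _ _ h1 (w0 p) (sqr_ge0 _) (kern_ge0 _) (kern_ge0 _));
      exact: auxJ (JPhi_bounds i p.1 he) (JPhi_bounds i p.2 he).
- move=> x hx; apply: hv; apply: contra_not hx => /(Omega_bar_Phi i _ he1).
  by rewrite PhiVK.
Qed.

End Energy.

(** * Kernel integrals and the Hardy inequality *)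

Section Dyadic.
Context d (T : measurableType d) (R : realType) (m : {measure set T -> \bar R}).

(** A substitute for polar coordinates: with a dyadic cover and a bound for [g] on each piece,
    singular integrals reduce to geometric series. *)
Lemma integral_cover_le (g : T -> R) (B : nat -> set T) (G V : nat -> R) (S : R) :
  measurable_fun setT g -> (forall x, 0 <= g x) ->
  (forall j, measurable (B j)) -> (forall j, (m (B j) <= (V j)%:E)%E) ->
  (forall j, 0 <= G j) ->
  (forall x, g x = 0 \/ exists2 j, B j x & g x <= G j) ->
  (forall N, \sum_(j < N) G j * V j <= S) ->
  (\int[m]_x (g x)%:E <= S%:E)%E.
Proof.
move=> mg g0 mB mV G0 hg hS.
pose F j x : \bar R := (G j * \1_(B j) x)%:E.
have mF j : measurable_fun setT (F j).
  by apply: measurable_EF; apply: measurable_funM => //; exact: measurable_indic.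
have F0 j x : (0 <= F j x)%E by rewrite lee_fin mulr_ge0.
apply: (@le_trans _ _ (\int[m]_x (\sum_(j <oo) F j x))%E).
  apply: ge0_le_int => [||x|x].
  - exact: measurable_EF.
  - by apply: ge0_emeasurable_sum.
  - by rewrite lee_fin.
  - case: (hg x) => [->|[j Bj gj]]; first by apply: nneseries_ge0 => *; exact: F0.
    apply: le_trans (nneseries_lim_ge j.+1 (fun k _ _ => F0 k x)).
    rewrite big_mkord big_ord_recr /=.
    apply: (@le_trans _ _ (F j x)).
      by rewrite /F indicE mem_set// mulr1 lee_fin.
    by rewrite leeDr// sume_ge0.
rewrite integral_nneseries//.
apply: lime_le; first by apply: is_cvg_nneseries => j _ _; exact: integral_ge0.
apply: nearW => N; rewrite big_mkord.
apply: (@le_trans _ _ (\sum_(j < N) (G j * V j)%:E)%E); last by rewrite sumEFin lee_fin.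
apply: lee_sum => j _; rewrite /F.
have mi : measurable_fun setT (fun x => (\1_(B j) x)%:E : \bar R).
  by apply: measurable_EF; exact: measurable_indic.
under eq_integral do rewrite EFinM.
rewrite (ge0_intZ m (G0 j) mi) => [|x]; last by rewrite lee_fin.
by rewrite integral_indic// setIT EFinM lee_wpmul2l// lee_fin.
Qed.

End Dyadic.

Section PowerSums.
Variable R : realType.
Implicit Types (r b al t : R).

Lemma geo_sum_le (q : R) N : 0 <= q < 1 -> \sum_(j < N) q ^+ j <= (1 - q)^-1.
Proof.
move=> /andP[q0 q1]; have h : 0 < 1 - q by rewrite subr_gt0.
have e : (1 - q) * \sum_(j < N) q ^+ j = 1 - q ^+ N.
  by rewrite -[in RHS]opprB subrX1 -mulNr opprB.
by rewrite -[leRHS]mul1r ler_pdivlMr// mulrC e gerBl exprn_ge0.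
Qed.

Lemma powRX b al j : 0 <= b -> (b ^+ j) `^ al = (b `^ al) ^+ j.
Proof. by move=> b0; rewrite -(powR_mulrn j b0) -(powR_mulrn j (powR_ge0 b al)) powRAC. Qed.

Lemma dyadic_up r t : 0 < r -> r <= t -> exists j, r * 2 ^+ j <= t < r * 2 ^+ j.+1.
Proof.
move=> r0 rt.
have ex : exists n : nat, t < r * 2 ^+ n.
  exists (Num.truncn (t / r)).+1; rewrite mulrC -ltr_pdivrMr//.
  apply: lt_le_trans (truncnS_gt _) _.
  by rewrite -natrX ler_nat ltnW// ltn_expl.
case: (ex_minnP ex) => -[|n] h1 h2; first by move: h1; rewrite expr0 mulr1 ltNge rt.
exists n; rewrite h1 andbT leNgt; apply/negP => /h2; by rewrite ltnn.
Qed.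

Lemma dyadic_down r t : 0 < t -> t < r ->
  exists j, r * (1 / 2) ^+ j.+1 <= t < r * (1 / 2) ^+ j.
Proof.
move=> t0 tr; have r0 : 0 < r by exact: lt_trans tr.
have ex : exists n : nat, r * (1 / 2) ^+ n <= t.
  exists (Num.truncn (r / t)).+1; rewrite mul1r exprVn ler_pdivrMr ?exprn_gt0//.
  rewrite mulrC -ler_pdivrMr//; apply: le_trans (ltW (truncnS_gt _)) _.
  by rewrite -natrX ler_nat ltnW// ltn_expl.
case: (ex_minnP ex) => -[|n] h1 h2; first by move: h1; rewrite expr0 mulr1 leNgt tr.
exists n; rewrite h1 /= ltNge; apply/negP => /h2; by rewrite ltnn.
Qed.

End PowerSums.

Section KernelIntegrals.
Variable R : realType.
Variable s : R.
Hypothesis s01 : 0 < s < 1.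
Notation X3 := (R * R * R)%type.
Notation X6 := (X3 * X3)%type.
Implicit Types (u v w : X3 -> R) (p : X6) (x z : X3) (r : R).

Definition box3 (a b : X3) : set X3 :=
  (`]co A1 a, co A1 b[%classic `*` `]co A2 a, co A2 b[%classic) `*` `]co A3 a, co A3 b[%classic.

Lemma box3P a b x : box3 a b x <-> forall i, co i a < co i x < co i b.
Proof.
rewrite /box3; split => [[[/= h1 h2] h3] i|h].
  by case: i; move: h1 h2 h3; rewrite /= !in_itv.
by split; [split|]; rewrite /= in_itv; [exact: (h A1)|exact: (h A2)|exact: (h A3)].
Qed.

Lemma measurable_box3 a b : measurable (box3 a b).
Proof. by do 2?[apply: measurableX] => //. Qed.

Lemma L3_box3 a b : (forall i, co i a <= co i b) ->
  L3 (box3 a b) = ((co A1 b - co A1 a) * (co A2 b - co A2 a) * (co A3 b - co A3 a))%:E.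
Proof.
move=> h.
have e i : lebesgue_measure (`]co i a, co i b[%classic : set R) = (co i b - co i a)%:E.
  rewrite lebesgue_measure_itv /= lte_fin -EFinB; case: ltP => // hi.
  have -> : co i b = co i a by apply/le_anti; rewrite hi h.
  by rewrite subrr.
have -> : L3 (box3 a b) = (L2 (`]co A1 a, co A1 b[%classic `*` `]co A2 a, co A2 b[%classic)
   * mu1 (`]co A3 a, co A3 b[%classic : set R))%E.
  by apply: product_measure1E => //; exact: measurableX.
have -> : L2 (`]co A1 a, co A1 b[%classic `*` `]co A2 a, co A2 b[%classic)
   = (mu1 (`]co A1 a, co A1 b[%classic : set R) * mu1 (`]co A2 a, co A2 b[%classic : set R))%E.
  exact: product_measure1E.
by rewrite !EFinM -!(e A1) -!(e A2) -!(e A3).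
Qed.

Definition cube3 x r := box3 (x.1.1 - r, x.1.2 - r, x.2 - r) (x.1.1 + r, x.1.2 + r, x.2 + r).

Lemma cube3P x r z : cube3 x r z <-> forall i, `|co i x - co i z| < r.
Proof.
rewrite /cube3 box3P; split => h i; have := h i; case: i => /=; rewrite distrC ltr_distl; lra.
Qed.

Lemma edist_cube x r z : edist x z < r -> cube3 x r z.
Proof. by move=> h; apply/cube3P => i; exact: le_lt_trans (co_edist i x z) h. Qed.

Lemma L3_cube3 x r : 0 <= r -> L3 (cube3 x r) = ((2 * r) ^+ 3)%:E.
Proof.
move=> r0; rewrite /cube3 L3_box3 => [|i]; last by case: i => /=; lra.
by congr (_%:E) => /=; ring.
Qed.

Lemma measurable_edist1 x : measurable_fun setT (fun z : X3 => edist x z).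
Proof.
have h : measurable_fun setT (fun z : X3 => (x, z)) by exact: measurable_fun_pair.
exact: (measurableT_comp (@measurable_edist R) h).
Qed.

Lemma integral_edist_le (g : R -> R) (G T : nat -> R) (S : R) x :
  measurable_fun setT g -> (forall t, 0 <= g t) -> g 0 = 0 ->
  (forall j, 0 <= G j) -> (forall j, 0 <= T j) ->
  (forall t, 0 < t -> g t = 0 \/ exists2 j, t < T j & g t <= G j) ->
  (forall N, \sum_(j < N) G j * (2 * T j) ^+ 3 <= S) ->
  (\int[L3]_z (g (edist x z))%:E <= S%:E)%E.
Proof.
move=> mg g0 g00 G0 T0 hg hS.
apply: (@integral_cover_le _ _ R L3 (fun z => g (edist x z)) (fun j => cube3 x (T j)) G
  (fun j => (2 * T j) ^+ 3)) => //.
- by apply: measurableT_comp mg _; exact: measurable_edist1.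
- by move=> j; exact: measurable_box3.
- move=> j; have h : (L3 (cube3 x (T j)) <= ((2 * T j) ^+ 3)%:E)%E by rewrite L3_cube3.
  exact: h.
- move=> z; have := edist_ge0 x z; rewrite le_eqVlt => /orP[/eqP <-|e0]; first by left.
  by case: (hg _ e0) => [|[j h1 h2]]; [left|right; exists j => //; exact: edist_cube].
Qed.

Definition hp (al : R) : R := (1 / 2) `^ al.

Lemma hp_lt1 al : 0 < al -> 0 <= hp al < 1.
Proof.
have e1 : (1 : R) `^ al = 1 by rewrite powR1.
move=> h; rewrite powR_ge0 /= /hp -[X in _ < X]e1.
by apply: gt0_ltr_powR => //; rewrite ?nnegrE; lra.
Qed.

Lemma powR_split (y : R) n (al : R) : 0 < y -> y ^+ n * y `^ al = y `^ (n%:R + al).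
Proof. by move=> y0; rewrite powRD ?(gt_eqF y0) ?implybT// powR_mulrn// ltW. Qed.

Lemma powR_hp (r : R) al j : 0 < r -> (r * (1 / 2) ^+ j) `^ al = r `^ al * hp al ^+ j.
Proof.
by move=> r0; rewrite powRM ?exprn_ge0 ?(ltW r0) ?divr_ge0// powRX// divr_ge0.
Qed.

Lemma powRV (y al : R) : 0 < y -> y `^ (- al) = y^-1 `^ al.
Proof.
move=> y0; rewrite -powR_inv1 ?(ltW y0)// -powRrM mulN1r; congr (_ `^ _).
Qed.

Lemma powRN_le (y t al : R) : 0 < y -> y <= t -> 0 <= al -> t `^ (- al) <= y `^ (- al).
Proof.
move=> y0 yt al0; have t0 := lt_le_trans y0 yt.
rewrite !powRN lef_pV2 ?posrE ?powR_gt0//.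
by apply: ge0_ler_powR; rewrite ?nnegrE ?(ltW y0) ?(ltW t0).
Qed.

(** 64 is [4 ^ 3]: the shell between [r * 2 ^ j] and [r * 2 ^ j.+1] lies in a cube of side
    [4 * r * 2 ^ j]. The denominator sums the geometric series over the shells. *)
Definition Cfar : R := 64 / (1 - hp (2 * s)).

Lemma Cfar_gt0 : 0 < Cfar.
Proof.
have /andP[_ h] : 0 <= hp (2 * s) < 1 by apply: hp_lt1; have := s01; lra.
by rewrite divr_gt0// subr_gt0.
Qed.

Lemma kern_far x r : 0 < r ->
  (\int[L3]_z (if r <= edist x z then kern s (x, z) else 0)%:E <=
   (Cfar * r `^ (- (2 * s)))%:E)%E.
Proof.
move=> r0; have /andP[h0 h1] : 0 <= hp (2 * s) < 1 by apply: hp_lt1; have := s01; lra.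
pose g (t : R) := if r <= t then t `^ (- (3 + 2 * s)) else 0.
have -> : (\int[L3]_z (if r <= edist x z then kern s (x, z) else 0)%:E =
   \int[L3]_z (g (edist x z))%:E)%E.
  by apply: eq_integral => z _; rewrite /g /kern /= powRN.
apply: (integral_edist_le (G := fun j => (r * 2 ^+ j) `^ (- (3 + 2 * s)))
  (T := fun j => r * 2 ^+ j.+1)) => [|t||j|j|t t0|N].
- by apply: measurable_fun_ifT => //; exact: measurable_fun_ler.
- by rewrite /g; case: ifP => // _; exact: powR_ge0.
- by rewrite /g leNgt r0.
- exact: powR_ge0.
- by rewrite mulr_ge0 ?exprn_ge0// ltW.
- rewrite /g; case: ifPn => [rt|]; last by left.
  right; have [j /andP[h2 h3]] := dyadic_up r0 rt; exists j => //.
  apply: powRN_le => //; [by rewrite mulr_gt0// exprn_gt0|by have := s01; lra].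
- apply: (@le_trans _ _ (\sum_(j < N) 64 * r `^ (- (2 * s)) * hp (2 * s) ^+ j)).
    apply: ler_sum => j _; have y0 : 0 < r * 2 ^+ j by rewrite mulr_gt0// exprn_gt0.
    rewrite [leLHS](_ : _ = 64 * ((r * 2 ^+ j) ^+ 3 * (r * 2 ^+ j) `^ (- (3 + 2 * s)))); last by rewrite (exprS 2 j); ring.
    rewrite powR_split// (_ : 3%:R + _ = - (2 * s)); last by ring.
    rewrite -mulrA ler_wpM2l// powRV// invfM -exprVn -[2^-1]mul1r powR_hp ?invr_gt0//.
    by rewrite -powRV.
  rewrite -mulr_sumr /Cfar [leRHS](_ : _ = (64 * r `^ (- (2 * s))) * (1 - hp (2 * s))^-1); last by ring.
  apply: ler_wpM2l; first by apply: mulr_ge0; [exact: ler0n|exact: powR_ge0].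
  by apply: geo_sum_le; rewrite h0.
Qed.

(** 256 is [4 * 4 ^ 3]: in a shell whose outer radius is twice the inner radius [y], the squared
    distance is at most [4 * y ^ 2] and the enclosing cube has side [4 * y]. *)
Definition Cnear : R := 256 / (1 - hp (2 - 2 * s)).

Lemma kern_near x r : 0 < r ->
  (\int[L3]_z (if edist x z < r then edist x z ^+ 2 * kern s (x, z) else 0)%:E <=
   (Cnear * r `^ (2 - 2 * s))%:E)%E.
Proof.
move=> r0; have /andP[h0 h1] : 0 <= hp (2 - 2 * s) < 1 by apply: hp_lt1; have := s01; lra.
pose g (t : R) := if t < r then t ^+ 2 * t `^ (- (3 + 2 * s)) else 0.
have -> : (\int[L3]_z (if edist x z < r then edist x z ^+ 2 * kern s (x, z) else 0)%:E =
   \int[L3]_z (g (edist x z))%:E)%E.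
  by apply: eq_integral => z _; rewrite /g /kern /= powRN.
pose y j := r * (1 / 2) ^+ j.
have y0 j : 0 < y j by rewrite mulr_gt0// exprn_gt0//; lra.
have yS j : y j = 2 * y j.+1 by rewrite /y exprS; field.
apply: (integral_edist_le (G := fun j => 4 * y j.+1 ^+ 2 * y j.+1 `^ (- (3 + 2 * s)))
  (T := y)) => [|t||j|j|t t0|N].
- apply: measurable_fun_ifT => //; first exact: measurable_fun_ltr.
  by apply: measurable_funM; [exact: measurable_funX|exact: measurable_powR].
- by rewrite /g; case: ifP => // _; rewrite mulr_ge0 ?powR_ge0 ?sqr_ge0.
- by rewrite /g r0 expr0n /= mul0r.
- by rewrite mulr_ge0 ?powR_ge0// mulr_ge0// sqr_ge0.
- exact: ltW.
- rewrite /g; case: ifPn => [rt|]; last by left.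
  right; have [j /andP[h2 h3]] := dyadic_down t0 rt; exists j => //.
  apply: ler_pM; rewrite ?sqr_ge0 ?powR_ge0//.
    rewrite (_ : 4 = 2 ^+ 2 :> R); last by ring.
    by rewrite -exprMn -yS lerXn2r ?nnegrE ?(ltW t0) ?(ltW (y0 _)) ?(ltW h3).
  by apply: powRN_le => //; have := s01; lra.
- apply: (@le_trans _ _ (\sum_(j < N) 256 * r `^ (2 - 2 * s) * hp (2 - 2 * s) ^+ j)).
    apply: ler_sum => j _; rewrite (yS j).
    rewrite [leLHS](_ : _ = 256 * (y j.+1 ^+ 5 * y j.+1 `^ (- (3 + 2 * s)))); last by ring.
    rewrite powR_split// (_ : 5%:R + _ = 2 - 2 * s); last by ring.
    rewrite -mulrA; apply: ler_wpM2l; first exact: ler0n.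
    rewrite /y powR_hp//; apply: ler_wpM2l; [exact: powR_ge0|rewrite exprS].
    by rewrite ler_piMl ?exprn_ge0// ltW.
  rewrite -mulr_sumr /Cnear [leRHS](_ : _ = (256 * r `^ (2 - 2 * s)) * (1 - hp (2 - 2 * s))^-1); last by ring.
  apply: ler_wpM2l; first by apply: mulr_ge0; [exact: ler0n|exact: powR_ge0].
  by apply: geo_sum_le; rewrite h0.
Qed.

End KernelIntegrals.

Notation OM := (@Omega _).

(** * The Hardy inequality and representatives vanishing off the open cube *)

Section Hardy.
Variable R : realType.
Variable s : R.
Hypothesis s01 : 0 < s < 1.
Notation X3 := (R * R * R)%type.
Notation X6 := (X3 * X3)%type.
Implicit Types (u v w : X3 -> R) (p : X6) (x z : X3) (i : axis).

(** Inside the cube this is the weight of the norm in the statement; off the cube the base is zero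
    and so is the power. *)
Definition wh x : R := rr x `^ (- s).

Lemma wh_ge0 x : 0 <= wh x. Proof. exact: powR_ge0. Qed.

Lemma wh_out x : ~ Omega x -> wh x = 0.
Proof. by move=> h; rewrite /wh rr_eq0// powR0// oppr_eq0; have := s01; lra. Qed.

Lemma wh2 x : wh x ^+ 2 = rr x `^ (- (2 * s)).
Proof. by rewrite /wh -powR_mulrn ?powR_ge0// -powRrM; congr (_ `^ _); ring. Qed.

Lemma measurable_wh : measurable_fun setT wh.
Proof.
rewrite /wh; apply: (measurableT_comp (f := fun t : R => t `^ (- s))).
  exact: measurable_powR.
exact: measurable_rr.
Qed.

Lemma wh_ge1 x : Omega x -> 1 <= wh x.
Proof.
move=> /rr_gt0 h; have h2 := rr_half x; rewrite /wh powRN.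
rewrite -[leLHS]invr1 lef_pV2 ?posrE ?powR_gt0//.
have e1 : (1 : R) `^ s = 1 by rewrite powR1.
rewrite -[leRHS]e1; apply: ge0_ler_powR; rewrite ?nnegrE//; have := s01; lra.
Qed.

(** Lower end, in direction [i], of a box of side [rr x] lying just outside the face nearest to [x].
    In the two other directions the box starts at [x] itself. *)
Let lo i x : R := if co i x <= 1 / 2 then - rr x else 1.
Let bot i x : X3 := upd i (lo i x) x.
Let top i x : X3 := upd i (lo i x + rr x)
  (x.1.1 + rr x, x.1.2 + rr x, x.2 + rr x).

Let co_upd i j t x : co j (upd i t x) =
  match i, j with A1, A1 | A2, A2 | A3, A3 => t | _, _ => co j x end.
Proof. by case: i; case: j. Qed.

Let boxo i x z : rr x = chi (co i x) -> 0 < rr x -> box3 (bot i x) (top i x) z ->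
  ~ Omega_bar z /\ edist x z <= 4 * rr x.
Proof.
move=> hi r0 /box3P h; split.
  have hz : ~ (0 <= co i z <= 1).
    have := h i; rewrite /bot /top /lo !co_upd; case: i hi h => /= hi h;
    case: ifP => _; lra.
  by case: i hi h hz => /= hi h hz [? ? ?]; apply: hz.
have -> : 4 * rr x = 2 * (2 * rr x) by ring.
apply: edist_le_max; first by lra.
move=> j; have := h j; have := r0; have := hi; rewrite chiE /bot /top /lo !co_upd.
move: (rr x) => r; case: i h hi => h hi; case: j => /=; rewrite ler_norml;
  do ![case: ifPn => ?]; lra.
Qed.

(** On the outer box [v] vanishes and the distance to [x] is at most [4 * rr x]. Kernel times volume
    [rr x ^ 3] is then at least [4 ^ (-5)] times the squared weight, so part of the energy density
    at [x] already dominates the left side. *)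
Let hardy_pt v x : (forall x, ~ Omega_bar x -> v x = 0) -> measurable_fun setT v ->
  (((wh x * v x) ^+ 2)%:E <= \int[L3]_z ((4 ^+ 5 * dv s v (x, z) ^+ 2)%:E))%E.
Proof.
move=> v0 mv.
have [/rr_gt0 r0|ho] := pselect (Omega x); last first.
  by rewrite wh_out// mul0r expr0n /=; apply: integral_ge0 => z _;
     rewrite lee_fin mulr_ge0 ?sqr_ge0// exprn_ge0.
have [i hi] := rr_ex x; set r := rr x in r0 hi *.
pose B := box3 (bot i x) (top i x).
have mB : measurable B by exact: measurable_box3.
pose c := v x ^+ 2 * r `^ (- (3 + 2 * s)).
have c0 : 0 <= c by rewrite mulr_ge0 ?sqr_ge0 ?powR_ge0.
apply: (@le_trans _ _ (\int[L3]_z (c * \1_B z)%:E)%E).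
  have mi : measurable_fun setT (fun z => (\1_B z)%:E : \bar R).
    by apply: measurable_EF; exact: measurable_indic.
  have i0 z : (0 <= (\1_B z)%:E :> \bar R)%E by rewrite lee_fin.
  under eq_integral do rewrite EFinM.
  rewrite (ge0_intZ L3 c0 mi i0) integral_indic// setIT.
  have hB : L3 B = (r ^+ 3)%:E.
    rewrite /B L3_box3.
      rewrite /bot /top /lo; congr (_%:E); rewrite -/r; case: (i) => /=; ring.
    by move=> j; rewrite /bot /top !co_upd -/r; case: (i); case: (j) => /=; lra.
  rewrite [X in (_ <= _ * X)%E]hB.
  rewrite -EFinM lee_fin exprMn wh2 -/r /c mulrAC -mulrA (mulrC (_ ^+ 3)).
  rewrite [X in _ <= _ * X]mulrC (powR_split 3 _ r0).
  by rewrite (_ : 3%:R + - (3 + 2 * s) = - (2 * s)) 1?mulrC//; ring.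
apply: ge0_le_int => [||z|z].
- by apply: measurable_EF; apply: measurable_funM => //; exact: measurable_indic.
- apply: measurable_EF; apply: measurable_funM => //; apply: measurable_funX.
  have h : measurable_fun setT (fun z : X3 => (x, z)) by exact: measurable_fun_pair.
  exact: (measurableT_comp (measurable_dv s mv) h).
- by rewrite lee_fin mulr_ge0.
- rewrite lee_fin indicE; case: (boolP (z \in B)) => [/set_mem hz|_]; last first.
    by rewrite mulr0 mulr_ge0 ?sqr_ge0// exprn_ge0.
  have [zo ez] := boxo hi r0 hz; rewrite mulr1 dv2 /= (v0 _ zo) subr0 /c mulrCA.
  apply: ler_wpM2l; first exact: sqr_ge0.
  have d0 : 0 < edist x z.
    rewrite lt_neqAle edist_ge0 andbT eq_sym; apply/eqP => /edist_eq0 xz; apply: zo.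
    by rewrite -xz; move/rr_gt0 : r0 => [? ? ?]; split; lra.
  rewrite /kern /= powRN -ler_pdivrMl ?exprn_gt0// -invfM lef_pV2 ?posrE ?powR_gt0//;
    last by rewrite mulr_gt0 ?powR_gt0// exprn_gt0.
  apply: (@le_trans _ _ ((4 * r) `^ (3 + 2 * s))).
    by apply: ge0_ler_powR; rewrite ?nnegrE ?(ltW d0)//; have := s01; lra.
  rewrite powRM ?(ltW r0)//.
  rewrite ler_wpM2r ?powR_ge0// -powR_mulrn//.
  by apply: ler_powR; [lra|have := s01; lra].
Qed.

Lemma hardy v : Hs s v -> sqi L3 (fun x => wh x * v x) /\
  ip L3 (fun x => wh x * v x) (fun x => wh x * v x) <= 4 ^+ 5 * A s v v.
Proof.
move=> [[mv _] ev v0]; have [mdv _] := ev.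
have mwv : measurable_fun setT (fun x => wh x * v x).
  by apply: measurable_funM => //; exact: measurable_wh.
have m2 : measurable_fun setT (fun p => (4 ^+ 5 * dv s v p ^+ 2)%:E : \bar R).
  by apply: measurable_EF; apply: measurable_funM => //; exact: measurable_funX.
have m20 p : (0 <= (4 ^+ 5 * dv s v p ^+ 2)%:E :> \bar R)%E.
  by rewrite lee_fin mulr_ge0 ?sqr_ge0// exprn_ge0.
have H : (\int[L3]_x ((wh x * v x) ^+ 2)%:E <= (4 ^+ 5 * A s v v)%:E)%E.
  apply: (@le_trans _ _ (\int[L3]_x \int[L3]_z (4 ^+ 5 * dv s v (x, z) ^+ 2)%:E)%E).
    apply: ge0_le_int => [||x|x].
    - by apply: measurable_EF; exact: measurable_funX.
    - exact: (measurable_tonelli1 L3 m2 m20).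
    - by rewrite lee_fin sqr_ge0.
    - exact: hardy_pt.
  rewrite -(tonelli1 L3 L3 m2 m20).
  under eq_integral do rewrite EFinM.
  have m2' : measurable_fun setT (fun p => (dv s v p ^+ 2)%:E : \bar R).
    by apply: measurable_EF; exact: measurable_funX.
  have m20' p : (0 <= (dv s v p ^+ 2)%:E :> \bar R)%E by rewrite lee_fin sqr_ge0.
  have c0 : (0 : R) <= 4 ^+ 5 by exact: exprn_ge0.
  by rewrite (ge0_intZ L6 c0 m2' m20') (sqi_fin ev).
have sw : sqi L3 (fun x => wh x * v x) by split => //; exact: le_lt_trans H (ltry _).
by split => //; rewrite -lee_fin -(sqi_fin sw).
Qed.

(** Values on the faces are required to vanish as well, so that pointwise comparison with the
    weighted function holds there, [wh] being zero on the faces. *)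
Definition Ho v := Hs s v /\ forall x, ~ Omega x -> v x = 0.

Lemma HoZ (k : R) v : Ho v -> Ho (fun x => k * v x).
Proof. by move=> [hv v0]; split; [exact: HsZ|move=> x hx; rewrite v0// mulr0]. Qed.

Lemma HoB u v : Ho u -> Ho v -> Ho (fun x => u x - v x).
Proof. by move=> [hu u0] [hv v0]; split; [exact: HsB|move=> x hx; rewrite u0// v0// subr0]. Qed.

Lemma wh_dominates v x : (forall x, ~ Omega x -> v x = 0) -> v x ^+ 2 <= 1 * (wh x * v x) ^+ 2.
Proof.
move=> v0; have [hx|hx] := pselect (Omega x); last by rewrite v0// mulr0 expr0n /= mulr0.
rewrite mul1r exprMn ler_peMl ?sqr_ge0//.
by rewrite -[leLHS](expr1n R 2) lerXn2r ?nnegrE ?wh_ge0 ?wh_ge1.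
Qed.

Lemma L2_le v : Ho v -> ip L3 v v <= 4 ^+ 5 * A s v v.
Proof.
move=> [hv v0]; have [h1 h2] := hardy hv; have [[mv _] _ _] := hv.
apply: le_trans h2; rewrite -[leRHS]mul1r.
by apply: (sqi_le mv h1 ler01 _).2 => x; exact: wh_dominates.
Qed.

Lemma measurable_Omega : measurable (OM : set X3).
Proof.
rewrite (_ : OM = [set x : X3 | 0 < rr x]); last by apply/seteqP; split=> x /=; rewrite rr_gt0.
rewrite -[X in measurable X]setTI.
have h : measurable_fun setT (@rr R) := @measurable_rr R.
move: (h measurableT `]0, +oo[%classic).
move=> /(_ (measurable_itv _)); congr (measurable (_ `&` _)).
by apply/seteqP; split=> x /=; rewrite in_itv /= andbT.
Qed.

(** The Hardy inequality bounds the [L^2] part and the weighted part, and the seminorm over the cube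
    is a portion of the energy. *)
Lemma Ht_norm_le v : Ho v -> (Ht_norm_sq s v <= ((2 * 4 ^+ 5 + 1) * A s v v)%:E)%E.
Proof.
move=> hov; have [hv v0] := hov; have [sv ev _] := hv; have [mv _] := sv.
have [sw hw] := hardy hv.
have mO := measurable_Omega.
have mdv2 : measurable_fun setT (fun p => (dv s v p ^+ 2)%:E : \bar R).
  by apply: measurable_EF; apply: measurable_funX; exact: measurable_dv.
have h1 : (L2sq OM v <= (4 ^+ 5 * A s v v)%:E)%E.
  apply: (@le_trans _ _ (\int[L3]_x ((v x) ^+ 2)%:E)%E).
    apply: ge0_subset_integral => //; first by apply: measurable_EF; exact: measurable_funX.
    by move=> x _; rewrite lee_fin sqr_ge0.
  by rewrite (sqi_fin sv) lee_fin; exact: L2_le.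
have h3 : (\int[L3]_(x in OM) ((v x / rbd x `^ s) ^+ 2)%:E <= (4 ^+ 5 * A s v v)%:E)%E.
  apply: (@le_trans _ _ (\int[L3]_x ((wh x * v x) ^+ 2)%:E)%E); last first.
    by rewrite (sqi_fin sw) lee_fin.
  rewrite [leLHS](_ : _ = (\int[L3]_(x in OM) ((wh x * v x) ^+ 2)%:E)%E); last first.
    by apply: eq_integral => x /set_mem ox; rewrite rbdE// /wh powRN mulrC.
  apply: ge0_subset_integral => //; last by move=> x _; rewrite lee_fin sqr_ge0.
  by apply: measurable_EF; apply: measurable_funX; case: sw.
have h2 : (Hsemi_sq s OM v <= (A s v v)%:E)%E.
  have -> : ((A s v v)%:E = \int[L3]_x \int[L3]_z (dv s v (x, z) ^+ 2)%:E)%E.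
    rewrite -(sqi_fin ev) (tonelli1 L3 L3 mdv2)// => p.
    by rewrite lee_fin sqr_ge0.
  pose G p := \1_OM p.1 * (\1_OM p.2 * dv s v p ^+ 2).
  have mG : measurable_fun setT (fun p => (G p)%:E : \bar R).
    apply: measurable_EF; apply: measurable_funM; last apply: measurable_funM.
    - by apply: measurableT_comp => //; exact: measurable_indic.
    - by apply: measurableT_comp => //; exact: measurable_indic.
    - by apply: measurable_funX; exact: measurable_dv.
  have G0 p : (0 <= (G p)%:E :> \bar R)%E by rewrite lee_fin; apply: mulr_ge0 => //; apply: mulr_ge0 => //; exact: sqr_ge0.
  have -> : (Hsemi_sq s OM v = \int[L3]_x \int[L3]_z (G (x, z))%:E)%E.
    rewrite /Hsemi_sq integral_mkcond; apply: eq_integral => x _.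
    rewrite /patch; case: ifPn => hx; last first.
      rewrite -[LHS](integral0 L3 setT); apply: eq_integral => z _.
      by rewrite /G /= indicE (negbTE hx) mul0r.
    rewrite integral_mkcond; apply: eq_integral => z _.
    rewrite /patch /G /= !indicE hx mul1r; case: ifPn => hz; last by rewrite mul0r.
    by rewrite mul1r dv2.
  apply: ge0_le_int => [||x|x].
  - exact: (measurable_tonelli1 L3 mG G0).
  - have h p : (0 <= (dv s v p ^+ 2)%:E :> \bar R)%E by rewrite lee_fin sqr_ge0.
    exact: (measurable_tonelli1 L3 mdv2 h).
  - by apply: integral_ge0.
  - apply: ge0_le_int => [||z|z].
    + have h : measurable_fun setT (fun z : X3 => (x, z)) by exact: measurable_fun_pair.
      exact: (measurableT_comp mG h).
    + have h : measurable_fun setT (fun z : X3 => (x, z)) by exact: measurable_fun_pair.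
      exact: (measurableT_comp mdv2 h).
    + exact: G0.
    + rewrite lee_fin /G /= !indicE; case: (_ \in _); case: (_ \in _);
      rewrite ?mul1r ?mul0r ?mulr0 ?sqr_ge0//.
rewrite /Ht_norm_sq (_ : (2 * 4 ^+ 5 + 1) * A s v v = 4 ^+ 5 * A s v v + A s v v + 4 ^+ 5 * A s v v); last by ring.
by rewrite !EFinD; apply: leeD => //; exact: leeD.
Qed.

Let slice i (c : R) : set X3 := [set x | co i x = c].

Let slice_null i c : measurable (slice i c) /\ L3 (slice i c) = 0%E.
Proof.
have m1c : measurable ([set c] : set R) by exact: measurable_set1.
have e1 : lebesgue_measure ([set c] : set R) = 0%E by rewrite lebesgue_measure_set1.
have mT : measurable ([set: R]) by [].
have e2 (B1 B2 : set R) : measurable B1 -> measurable B2 ->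
    L2 (B1 `*` B2) = (lebesgue_measure B1 * lebesgue_measure B2)%E.
  by move=> ? ?; exact: product_measure1E.
have e3 (B1 : set (R * R)) (B2 : set R) : measurable B1 -> measurable B2 ->
    L3 (B1 `*` B2) = (L2 B1 * lebesgue_measure B2)%E.
  by move=> ? ?; exact: product_measure1E.
case: i.
- have -> : slice A1 c = ([set c] `*` setT) `*` setT.
    by apply/seteqP; split=> -[[a b] d] //= [[]].
  split; first by do 2?[apply: measurableX] => //.
  by rewrite e3 ?e2 ?e1 ?mul0e//; exact: measurableX.
- have -> : slice A2 c = (setT `*` [set c]) `*` setT.
    by apply/seteqP; split=> -[[a b] d] //= [[]].
  split; first by do 2?[apply: measurableX] => //.
  by rewrite e3 ?e2 ?e1 ?mule0 ?mul0e//; exact: measurableX.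
- have -> : slice A3 c = setT `*` [set c].
    by apply/seteqP; split=> -[[a b] d] //= [].
  split; first by do 2?[apply: measurableX] => //.
  by rewrite e3 ?e1 ?mule0.
Qed.

(* Membership in the energy space leaves [u] free on the null set where some coordinate
   is 0 or 1; [cut u] is the representative vanishing off the open cube. *)
Definition cut u x := \1_OM x * u x.

Let bd : set X3 := \bigcup_(i in [set: axis]) (slice i 0 `|` slice i 1).

Let bd_null : L3.-negligible bd.
Proof.
have h i : L3.-negligible (slice i 0 `|` slice i 1).
  apply: negligibleU; [exists (slice i 0)|exists (slice i 1)];
    by have [? ?] := slice_null i 0; have [? ?] := slice_null i 1; split.
have -> : bd = (slice A1 0 `|` slice A1 1) `|` (slice A2 0 `|` slice A2 1)
   `|` (slice A3 0 `|` slice A3 1).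
  apply/seteqP; split=> [x [[] _ ?]|x [[?|?]|?]]; rewrite /=; try tauto.
  - by exists A1. - by exists A2. - by exists A3.
by apply: negligibleU; [apply: negligibleU|]; exact: h.
Qed.

Let negl2 (N : set X3) : L3.-negligible N -> L6.-negligible [set p | N p.1 \/ N p.2].
Proof.
move=> [B [mB B0 NB]].
have e (C1 C2 : set X3) : measurable C1 -> measurable C2 ->
    L6 (C1 `*` C2) = (L3 C1 * L3 C2)%E.
  by move=> ? ?; exact: product_measure1E.
have h1 : L6.-negligible (B `*` setT).
  exists (B `*` setT); split => //; first exact: measurableX.
  by rewrite e ?B0 ?mul0e.
have h2 : L6.-negligible (setT `*` B).
  exists (setT `*` B); split => //; first exact: measurableX.
  by rewrite e ?B0 ?mule0.
apply: (negligibleS _ (negligibleU h1 h2)) => p [/NB|/NB] ?; [left|right] => //.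
Qed.

Let cut_eq u x : (forall x, ~ Omega_bar x -> u x = 0) -> ~ bd x -> cut u x = u x.
Proof.
move=> u0 hb; rewrite /cut indicE; case: (boolP (x \in OM)) => [_|/negP hx]; first by rewrite mul1r.
rewrite mul0r u0// => -[h1 h2 h3]; apply: hx; rewrite inE.
have n1 i : co i x != 0 by apply/eqP => e; apply: hb; exists i => //; left.
have n2 i : co i x != 1 by apply/eqP => e; apply: hb; exists i => //; right.
by split; [have := n1 A1; have := n2 A1|have := n1 A2; have := n2 A2|have := n1 A3; have := n2 A3];
  rewrite /co /c1 /c2 /c3 in h1 h2 h3 * => a b; move/andP: h1 h2 h3 => ? ? ?; rewrite !lt_neqAle; lra.
Qed.

Lemma cutP u : Hs s u -> Ho (cut u) /\ forall v, Hs s v -> A s (cut u) v = A s u v.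
Proof.
move=> [[mu uy] [mdu duy] u0].
have mc : measurable_fun setT (cut u).
  by apply: measurable_funM => //; apply: measurable_indic; exact: measurable_Omega.
have out x : ~ Omega x -> cut u x = 0.
  by move=> hx; rewrite /cut indicE memNset// mul0r.
have deq p : ~ (bd p.1 \/ bd p.2) -> dv s (cut u) p = dv s u p.
  by move=> h; rewrite /dv !cut_eq// => ?; apply: h; tauto.
have sc : sqi L3 (cut u).
  have su : sqi L3 u by split; [exact: mu|exact: uy].
  have hle x : cut u x ^+ 2 <= 1 * u x ^+ 2.
    by rewrite mul1r /cut indicE; case: (_ \in _); rewrite ?mul1r ?mul0r ?expr0n ?sqr_ge0//.
  have [h _] := @sqi_le _ _ R L3 (cut u) u 1 mc su ler01 hle.
  exact: h.
have mdc := measurable_dv s mc.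
have hc : Hs s (cut u).
  split => //.
  - split => //.
    rewrite (_ : (\int[L6]_p (dv s (cut u) p ^+ 2)%:E = \int[L6]_p (dv s u p ^+ 2)%:E)%E)//.
    apply: ae_eq_integral => //; [by apply: measurable_EF; exact: measurable_funX..|].
    apply: (negligibleS _ (negl2 bd_null)) => p /= hp; apply: contrapT => h.
    by apply: hp => _; rewrite deq.
  - by move=> x hx; apply: out => -[h1 h2 h3]; apply: hx; split; apply/andP; split; apply: ltW; [case/andP: h1|case/andP: h1|case/andP: h2|case/andP: h2|case/andP: h3|case/andP: h3].
split; first by split.
move=> v [_ [mdv _] _]; rewrite /A /ip /Rintegral; congr fine.
apply: ae_eq_integral => //; [by apply: measurable_EF; exact: measurable_funM..|].
apply: (negligibleS _ (negl2 bd_null)) => p /= hp; apply: contrapT => h.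
by apply: hp => _; rewrite deq.
Qed.

(** Pythagoras for the energy form. With the Galerkin error as [u] and a spline as [v] it gives
    Céa's lemma with constant one. *)
Lemma A_sub_le u v : Ho u -> Ho v -> A s u v = 0 ->
  A s u u <= A s (fun x => u x - v x) (fun x => u x - v x).
Proof.
move=> [hu _] [hv _] h; rewrite ABl//; last exact: HsB.
by rewrite !ABr// (AC _ v u) h subr0 sub0r opprK lerDl A_ge0.
Qed.

End Hardy.

(** * Lipschitz functions and splines *)

Section LipschitzGluing.
Variable R : realType.
Implicit Types (g : R -> R) (M a b c t u : R).

Definition ctsat g b := forall e, 0 < e -> exists2 d, 0 < d & forall y, `|y - b| < d -> `|g y - g b| < e.
Definition lip_on g M a b := forall t u, a < t -> t <= u -> u < b -> `|g u - g t| <= M * (u - t).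

Lemma lip_close_right g M t b : 0 <= M -> ctsat g b -> t < b ->
  (forall y, t < y -> y < b -> `|g y - g t| <= M * (y - t)) -> `|g b - g t| <= M * (b - t).
Proof.
move=> M0 cg tb h; rewrite leNgt; apply/negP => lt.
have [d d0 hd] := cg (`|g b - g t| - M * (b - t)) ltac:(by rewrite subr_gt0).
pose y := b - Num.min d (b - t) / 2.
have m1 : 0 < Num.min d (b - t) by rewrite lt_min d0 subr_gt0.
have m2 : Num.min d (b - t) <= d by rewrite ge_min lexx.
have m3 : Num.min d (b - t) <= b - t by rewrite ge_min lexx orbT.
have y1 : t < y by rewrite /y; lra.
have y2 : y < b by rewrite /y; lra.
have /hd : `|y - b| < d by rewrite distrC gtr0_norm /y; lra.
have := h y y1 y2; have : M * (y - t) <= M * (b - t) by rewrite ler_wpM2l//; lra.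
have := ler_distD (g y) (g b) (g t); rewrite (distrC (g b) (g y)); lra.
Qed.

Lemma lip_close_left g M b u : 0 <= M -> ctsat g b -> b < u ->
  (forall y, b < y -> y < u -> `|g u - g y| <= M * (u - y)) -> `|g u - g b| <= M * (u - b).
Proof.
move=> M0 cg tb h; rewrite leNgt; apply/negP => lt.
have [d d0 hd] := cg (`|g u - g b| - M * (u - b)) ltac:(by rewrite subr_gt0).
pose y := b + Num.min d (u - b) / 2.
have m1 : 0 < Num.min d (u - b) by rewrite lt_min d0 subr_gt0.
have m2 : Num.min d (u - b) <= d by rewrite ge_min lexx.
have m3 : Num.min d (u - b) <= u - b by rewrite ge_min lexx orbT.
have y1 : b < y by rewrite /y; lra.
have y2 : y < u by rewrite /y; lra.
have /hd : `|y - b| < d by rewrite gtr0_norm /y; lra.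
have := h y y1 y2; have : M * (u - y) <= M * (u - b) by rewrite ler_wpM2l//; lra.
have := ler_distD (g y) (g u) (g b); lra.
Qed.

Lemma lip_glue g M a b c : 0 <= M -> ctsat g b -> lip_on g M a b -> lip_on g M b c ->
  lip_on g M a c.
Proof.
move=> M0 cg h1 h2 t u at_ tu uc.
have [ub|bu] := ltP u b; first exact: h1.
have [bt|tb] := ltP b t; first exact: h2.
have A1 : `|g b - g t| <= M * (b - t).
  move: tb; rewrite le_eqVlt => /orP[/eqP->|tb]; first by rewrite !subrr normr0 mulr0.
  by apply: lip_close_right => // y ty yb; apply: h1 => //; exact: ltW.
have A2 : `|g u - g b| <= M * (u - b).
  move: bu; rewrite le_eqVlt => /orP[/eqP->|bu]; first by rewrite !subrr normr0 mulr0.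
  by apply: lip_close_left => // y ty yb; apply: h2 => //; exact: ltW.
by have := ler_distD (g b) (g u) (g t); lra.
Qed.

(** Lipschitz bounds on consecutive open intervals are joined at the nodes by continuity; the zero
    extension counts as two further intervals of slope zero. *)
Lemma lip_chain g M (nd : nat -> R) n : 0 <= M -> (forall b, ctsat g b) ->
  (forall t, t < nd 0%N -> g t = 0) -> (forall t, nd n < t -> g t = 0) ->
  (forall i, (i < n)%N -> lip_on g M (nd i) (nd i.+1)) ->
  forall t u, `|g t - g u| <= M * `|t - u|.
Proof.
move=> M0 cg g0 g1 h.
have z (a b : R) : (forall t, a < t -> t < b -> g t = 0) -> lip_on g M a b.
  move=> hz t u at_ tu ub; rewrite !hz ?subrr ?normr0 ?mulr_ge0 ?subr_ge0//.
  - exact: le_lt_trans tu ub.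
  - exact: lt_le_trans at_ tu.
have H a : lip_on g M a (nd n).
  elim: n h {g1} => [|n IH] h; first by apply: z => t _; exact: g0.
  apply: (lip_glue M0 (cg (nd n))); last exact: h.
  by apply: IH => i hi; apply: h; exact: ltnW.
have H2 a b : lip_on g M a b.
  by apply: (lip_glue M0 (cg (nd n)) (H a)); apply: z => t ht _; exact: g1.
have H3 t u : t <= u -> `|g t - g u| <= M * `|t - u|.
  move=> tu; rewrite distrC (distrC t) (ger0_norm (_ : 0 <= u - t)) ?subr_ge0//.
  by apply: (H2 (t - 1) (u + 1)) => //; [rewrite ltrBlDr ltrDl|rewrite ltrDl].
move=> t u; have [tu|/ltW tu] := leP t u; first exact: H3.
by rewrite distrC (distrC t); exact: H3.
Qed.

Lemma avoid_finite (bad : seq R) (d : R) : 0 < d ->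
  exists2 e, 0 < e < d & forall b, b \in bad -> e != b.
Proof.
elim: bad d => [|b l IH] d d0.
  by exists (d / 2) => //; rewrite divr_gt0//= ltr_pdivrMr// ltr_pMr// ltr1n.
have [b0|b0] := ltP 0 b.
  have [|e /andP[e0 e1] he] := IH (Num.min d b); first by rewrite lt_min d0.
  move: e1; rewrite lt_min => /andP[e1 e2]; exists e; first by rewrite e0.
  by move=> x; rewrite inE => /orP[/eqP->|/he//]; rewrite lt_eqF.
have [e /andP[e0 e1] he] := IH d d0; exists e; first by rewrite e0.
by move=> x; rewrite inE => /orP[/eqP->|/he//]; rewrite gt_eqF// (le_lt_trans b0).
Qed.

Lemma uniform_bound (P : nat -> R -> Prop) n :
  (forall i M M', P i M -> M <= M' -> P i M') ->
  (forall i, (i <= n)%N -> exists2 M, 0 <= M & P i M) ->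
  exists2 M, 0 <= M & forall i, (i <= n)%N -> P i M.
Proof.
move=> mono; elim: n => [|n IH] h.
  by have [M M0 hM] := h 0%N isT; exists M => // i; rewrite leqn0 => /eqP ->.
have [|M M0 hM] := IH; first by move=> i hi; apply: h; exact: leqW.
have [M' M'0 hM'] := h n.+1 (leqnn _).
exists (M + M'); first exact: addr_ge0.
move=> i; rewrite leq_eqVlt => /orP[/eqP ->|hi].
  by apply: mono hM' _; rewrite lerDr.
by apply: (mono _ M); [exact: hM|rewrite lerDl].
Qed.

Lemma pow_lip n t u : 0 <= t <= 1 -> 0 <= u <= 1 -> `|t ^+ n - u ^+ n| <= n%:R * `|t - u|.
Proof.
move=> ht hu; elim: n => [|n IH]; first by rewrite !expr0 subrr normr0 mul0r.
rewrite !exprS (_ : _ - _ = t * (t ^+ n - u ^+ n) + (t - u) * u ^+ n); last by ring.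
apply: (le_trans (ler_normD _ _)); rewrite !normrM -natr1 mulrDl mul1r lerD//.
  have t1 : `|t| <= 1 by rewrite ger0_norm; lra.
  by apply: le_trans IH; rewrite ler_piMl.
rewrite ler_piMr// ger0_norm ?exprn_ge0 ?exprn_ile1; lra.
Qed.

End LipschitzGluing.

(** * Splines are globally Lipschitz *)

Section SplineLipschitz.
Variable R : realType.
Notation X3 := (R * R * R)%type.
Implicit Types (v w : X3 -> R) (x z : X3) (i : axis).

Definition esum3 x z := `|co A1 x - co A1 z| + `|co A2 x - co A2 z| + `|co A3 x - co A3 z|.

Lemma esum3_le x z : esum3 x z <= 3 * edist x z.
Proof. have := co_edist A1 x z; have := co_edist A2 x z; have := co_edist A3 x z; rewrite /esum3; lra. Qed.

Lemma continuous_edist v x e : continuous (v : pt R -> R) -> 0 < e ->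
  exists2 d, 0 < d & forall z, edist x z < d -> `|v x - v z| < e.
Proof.
move=> cv e0; have /cvgrPdist_lt /(_ e e0) := cv x.
move=> /nbhs_ballP[d /= d0 H]; exists d => // z hz; apply: H.
have h i := le_lt_trans (co_edist i x z) hz.
by split; [split; [exact: (h A1)|exact: (h A2)]|exact: (h A3)].
Qed.

Lemma edist_upd i t u x : edist (upd i t x) (upd i u x) = `|t - u|.
Proof.
have := sqrtr_sqr (t - u); rewrite /edist /c1 /c2 /c3.
by case: x => [[a b] c]; case: i => /= <-; rewrite !subrr expr0n /= ?addr0 ?add0r.
Qed.

Lemma upd_co i x : upd i (co i x) x = x.
Proof. by case: x => [[a b] c]; case: i. Qed.

Lemma ctsat_upd v i x : continuous (v : pt R -> R) -> forall b, ctsat (fun t => v (upd i t x)) b.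
Proof.
move=> cv b e e0; have [d d0 hd] := continuous_edist (upd i b x) cv e0.
exists d => // y yb; rewrite distrC; apply: hd; by rewrite edist_upd distrC.
Qed.

Lemma Qq_lip q (p : X3 -> R) : is_Qq q (p : pt R -> R) -> exists2 M, 0 <= M &
  forall x z, (forall i, 0 <= co i x <= 1) -> (forall i, 0 <= co i z <= 1) ->
  `|p x - p z| <= M * esum3 x z.
Proof.
move=> [c hc].
exists (\sum_(a < q.+1) \sum_(b < q.+1) \sum_(e < q.+1) `|c a b e| * q%:R).
  by do 3!(apply: sumr_ge0 => ? _); exact: mulr_ge0.
move=> x z hx hz; rewrite !hc -sumrB mulr_suml.
apply: le_trans (ler_norm_sum _ _ _) _; apply: ler_sum => a _.
rewrite -sumrB mulr_suml.
apply: le_trans (ler_norm_sum _ _ _) _; apply: ler_sum => b _.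
rewrite -sumrB mulr_suml.
apply: le_trans (ler_norm_sum _ _ _) _; apply: ler_sum => e _.
rewrite /c1 /c2 /c3.
have q0 (k : 'I_q.+1) : (k : nat)%:R <= q%:R :> R by rewrite ler_nat -ltnS.
have h1 := pow_lip a (hx A1) (hz A1); have h2 := pow_lip b (hx A2) (hz A2).
have h3 := pow_lip e (hx A3) (hz A3).
have b1 (y : X3) i k : (forall i, 0 <= co i y <= 1) -> `|co i y ^+ k| <= 1.
  by move=> hy; have /andP[? ?] := hy i; rewrite ger0_norm ?exprn_ge0// exprn_ile1.
rewrite [X in `|X|](_ : _ = c a b e * ((co A1 x ^+ a - co A1 z ^+ a) * (co A2 x ^+ b * co A3 x ^+ e)
  + co A1 z ^+ a * ((co A2 x ^+ b - co A2 z ^+ b) * co A3 x ^+ e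
  + co A2 z ^+ b * (co A3 x ^+ e - co A3 z ^+ e)))); last by rewrite /co; ring.
rewrite normrM -mulrA ler_wpM2l// /esum3.
have step (k : 'I_q.+1) (d : R) : k%:R * `|d| <= q%:R * `|d| by rewrite ler_wpM2r.
have m1 (r1 r2 r3 : R) : `|r2| <= 1 -> `|r3| <= 1 -> `|r1 * (r2 * r3)| <= `|r1|.
  by move=> ? ?; rewrite !normrM ler_piMr// -(mulr1 1) ler_pM.
have m2 (r1 r3 : R) : `|r3| <= 1 -> `|r1 * r3| <= `|r1|.
  by move=> ?; rewrite normrM ler_piMr.
apply: le_trans (ler_normD _ _) _; rewrite !(mulrDr q%:R) -addrA lerD//.
  by apply: le_trans (m1 _ _ _ (b1 x A2 b hx) (b1 x A3 e hx)) _; apply: le_trans h1 (step _ _).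
rewrite mulrC; apply: le_trans (m2 _ _ (b1 z A1 a hz)) _.
apply: le_trans (ler_normD _ _) _; rewrite lerD//.
  by apply: le_trans (m2 _ _ (b1 x A3 e hx)) _; apply: le_trans h2 (step _ _).
rewrite mulrC; apply: le_trans (m2 _ _ (b1 z A2 b hz)) _; exact: le_trans h3 (step _ _).
Qed.

Variables (sigma : R) (L q : nat).
Hypothesis sigma01 : 0 < sigma < 1.
Hypothesis L1 : (1 <= L)%N.
Notation nd := (node sigma L).

Lemma nd0 : nd 0 = 0. Proof. by []. Qed.

Lemma nd_last : nd (2 * L).+1 = 1.
Proof. by rewrite /node /= ltnNge leq_pmull// ltnn. Qed.

Lemma nd_bounds (i : nat) : 0 <= nd i <= 1.
Proof.
have /andP[/ltW s0 /ltW s1] := sigma01.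
have h k : 0 <= sigma ^+ k <= 1 by rewrite exprn_ge0 ?exprn_ile1.
rewrite /node; case: eqP => _; first by rewrite lexx ler01.
case: ifP => _; first by have := h (L - i)%N; lra.
case: ifP => _; first by have := h (i - L)%N; lra.
by rewrite lexx ler01.
Qed.

(** Membership in [W] prescribes a function on open boxes only. An axis-parallel line through a
    generic point of the cube meets mesh faces only at the nodes of its own direction and runs
    through open boxes in between. *)
Definition generic x := forall i j, (j <= (2 * L).+1)%N -> co i x != nd j.

Lemma generic_cell (t : R) : 0 < t < 1 -> (forall j, (j <= (2 * L).+1)%N -> t != nd j) ->
  exists2 j, (j <= 2 * L)%N & nd j < t < nd j.+1.
Proof.
move=> ht hg.
have ex : exists j, t < nd j by exists (2 * L).+1; rewrite nd_last; lra.
case: (ex_minnP ex) => -[|j] h1 h2; first by move: h1; rewrite nd0; lra.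
have jL : (j <= 2 * L)%N by rewrite -ltnS; apply: h2; rewrite nd_last; lra.
exists j => //; rewrite h1 andbT lt_neqAle eq_sym hg ?leqW//= leNgt.
by apply/negP => /h2; rewrite ltnn.
Qed.

Lemma generic_near x (d : R) : 0 < d ->
  exists e, [/\ 0 < e < d & generic (x.1.1 + e, x.1.2 + e, x.2 + e)].
Proof.
move=> d0; pose js := iota 0 (2 * L).+2.
have [e he hb] := avoid_finite ([seq nd j - x.1.1 | j <- js] ++
  [seq nd j - x.1.2 | j <- js] ++ [seq nd j - x.2 | j <- js]) d0.
exists e; split => // i j hj; apply/eqP => h.
have mj (y : R) : nd j - y \in [seq nd j - y | j <- js].
  by apply/mapP; exists j => //; rewrite mem_iota.
have /eqP := hb (nd j - match i with A1 => x.1.1 | A2 => x.1.2 | A3 => x.2 end) ltac:(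
  by rewrite !mem_cat; case: (i); rewrite mj ?orbT).
by apply; rewrite -h; case: (i) => /=; ring.
Qed.

Lemma generic_near2 x z (d : R) : 0 < d ->
  exists e, [/\ 0 < e < d, generic (x.1.1 + e, x.1.2 + e, x.2 + e) &
    generic (z.1.1 + e, z.1.2 + e, z.2 + e)].
Proof.
move=> d0; pose js := iota 0 (2 * L).+2.
have [e he hb] := avoid_finite (([seq nd j - x.1.1 | j <- js] ++
  [seq nd j - x.1.2 | j <- js] ++ [seq nd j - x.2 | j <- js]) ++
  ([seq nd j - z.1.1 | j <- js] ++
  [seq nd j - z.1.2 | j <- js] ++ [seq nd j - z.2 | j <- js])) d0.
have mj (y : R) j : (j <= (2 * L).+1)%N -> nd j - y \in [seq nd j - y | j <- js].
  by move=> hj; apply/mapP; exists j => //; rewrite mem_iota.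
exists e; split => // i j hj; apply/eqP => h.
- have /eqP := hb (nd j - match i with A1 => x.1.1 | A2 => x.1.2 | A3 => x.2 end) ltac:(
    by rewrite !mem_cat; case: (i); rewrite mj ?orbT).
  by apply; rewrite -h; case: (i) => /=; ring.
- have /eqP := hb (nd j - match i with A1 => z.1.1 | A2 => z.1.2 | A3 => z.2 end) ltac:(
    by rewrite !mem_cat; case: (i); rewrite mj ?orbT).
  by apply; rewrite -h; case: (i) => /=; ring.
Qed.

Lemma edist_shift x z (e : R) :
  edist (x.1.1 + e, x.1.2 + e, x.2 + e) (z.1.1 + e, z.1.2 + e, z.2 + e) = edist x z.
Proof. by rewrite /edist /c1 /c2 /c3 /=; congr (Num.sqrt (_ ^+ 2 + _ ^+ 2 + _ ^+ 2)); ring. Qed.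

Lemma edist_shift1 x (e : R) : 0 <= e -> edist x (x.1.1 + e, x.1.2 + e, x.2 + e) <= 2 * e.
Proof.
by move=> e0; apply: edist_le_max => // i; case: i => /=; rewrite distrC addrC addKr ger0_norm.
Qed.

(** On axis-parallel lines through generic points the one-dimensional gluing applies; two generic
    points are joined by three such moves; continuity covers the rest, since one small diagonal
    shift makes any two points generic simultaneously. *)
Lemma W_lip v : W sigma L q v -> exists2 K, 0 <= K & forall x z, `|v x - v z| <= K * edist x z.
Proof.
move=> [cv v0 hv].
have [M M0 hM] : exists2 M, 0 <= M & forall i : nat, (i <= 2 * L)%N -> forall j, (j <= 2 * L)%N ->
    forall k, (k <= 2 * L)%N -> forall x z, box sigma L i j k x -> box sigma L i j k z ->
    `|v x - v z| <= M * esum3 x z.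
  have e0 x z : 0 <= esum3 x z by rewrite !addr_ge0.
  apply: uniform_bound => [i M M' h MM j hj k hk x z hx hz|i hi].
    by apply: le_trans (h j hj k hk x z hx hz) _; rewrite ler_wpM2r.
  apply: uniform_bound => [j M M' h MM k hk x z hx hz|j hj].
    by apply: le_trans (h k hk x z hx hz) _; rewrite ler_wpM2r.
  apply: uniform_bound => [k M M' h MM x z hx hz|k hk].
    by apply: le_trans (h x z hx hz) _; rewrite ler_wpM2r.
  have [p [hp vp]] := hv i j k hi hj hk.
  have [M M0 hM] := Qq_lip hp; exists M => // x z hx hz.
  rewrite (vp x hx) (vp z hz); apply: hM => l; [case: hx|case: hz];
    rewrite /c1 /c2 /c3; have := nd_bounds i; have := nd_bounds j; have := nd_bounds k;
    have := nd_bounds i.+1; have := nd_bounds j.+1; have := nd_bounds k.+1;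
    case: l => /=; lra.
have cells (t : R) l x : generic x -> (forall i, i <> l -> 0 < co i x < 1) ->
    forall k, (k <= 2 * L)%N -> exists (i j e : nat), [/\ (i <= 2 * L)%N, (j <= 2 * L)%N, (e <= 2 * L)%N &
      forall t, nd k < t < nd k.+1 -> box sigma L i j e (upd l t x)].
  move=> gx hx k hk.
  case: l hx => hx.
  - have [j ? ?] := generic_cell (hx A2 ltac:(by [])) (gx A2).
    have [e ? ?] := generic_cell (hx A3 ltac:(by [])) (gx A3).
    by exists k, j, e; split.
  - have [j ? ?] := generic_cell (hx A1 ltac:(by [])) (gx A1).
    have [e ? ?] := generic_cell (hx A3 ltac:(by [])) (gx A3).
    by exists j, k, e; split.
  - have [j ? ?] := generic_cell (hx A1 ltac:(by [])) (gx A1).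
    have [e ? ?] := generic_cell (hx A2 ltac:(by [])) (gx A2).
    by exists j, e, k; split.
have coord x l (t u : R) : generic x -> `|v (upd l t x) - v (upd l u x)| <= M * `|t - u|.
  move=> gx.
  (* If some other coordinate lies outside the open unit interval, [v] is zero along the whole
     line. *)
  have [hx|hx] := pselect (forall i, i <> l -> 0 < co i x < 1); last first.
    move/existsNP: hx => [i /not_implyP[il hi]].
    have out t0 : v (upd l t0 x) = 0.
      apply: v0 => -[h1 h2 h3]; apply: hi; move: il h1 h2 h3; rewrite /c1 /c2 /c3.
      by destruct l, i.
    by rewrite !out subrr normr0 mulr_ge0.
  apply: (@lip_chain _ (fun t => v (upd l t x)) M nd (2 * L).+1 M0).
  - exact: ctsat_upd.
  - move=> s; rewrite nd0 => s0; apply: v0 => -[]; rewrite /c1 /c2 /c3.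
    by case: (l) => /=; lra.
  - move=> s; rewrite nd_last => s0; apply: v0 => -[]; rewrite /c1 /c2 /c3.
    by case: (l) => /=; lra.
  - move=> k hk a b ha ab hb.
    have [i [j [e [hi hj he H]]]] := cells 0 l x gx hx k hk.
    have := hM i hi j hj e he _ _ (H b ltac:(lra)) (H a ltac:(lra)).
    rewrite (_ : esum3 _ _ = b - a)//.
    rewrite /esum3; case: (l) => /=; rewrite !subrr !normr0 ?addr0 ?add0r ger0_norm ?subr_ge0//.
have gen x z : generic x -> generic z -> `|v x - v z| <= M * esum3 x z.
  move=> gx gz.
  pose y1 : X3 := (z.1.1, x.1.2, x.2); pose y2 : X3 := (z.1.1, z.1.2, x.2).
  have g1 : generic y1 by case=> j hj; [exact: (gz A1)|exact: (gx A2)|exact: (gx A3)].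
  have g2 : generic y2 by case=> j hj; [exact: (gz A1)|exact: (gz A2)|exact: (gx A3)].
  have h1 := coord x A1 (co A1 x) (co A1 z) gx.
  have h2 := coord y1 A2 (co A2 x) (co A2 z) g1.
  have h3 := coord y2 A3 (co A3 x) (co A3 z) g2.
  have e1 : upd A1 (co A1 x) x = x by rewrite upd_co.
  have e2 : upd A2 (co A2 x) y1 = upd A1 (co A1 z) x by rewrite /y1; move: (x) => [[? ?] ?].
  have e3 : upd A3 (co A3 x) y2 = upd A2 (co A2 z) y1 by rewrite /y1 /y2; move: (x) => [[? ?] ?].
  have e4 : upd A3 (co A3 z) y2 = z by rewrite /y2; move: (z) => [[? ?] ?].
  rewrite e1 in h1; rewrite e2 in h2; rewrite e3 e4 in h3.
  have := ler_distD (v (upd A1 (co A1 z) x)) (v x) (v z).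
  have := ler_distD (v (upd A2 (co A2 z) y1)) (v (upd A1 (co A1 z) x)) (v z).
  rewrite /esum3 !mulrDr.
  move: h1 h2 h3; move: (M * _) (M * _) (M * _) => m1 m2 m3; lra.
exists (3 * M); first exact: mulr_ge0.
move=> x z; rewrite leNgt; apply/negP => lt.
(* Half of the supposed excess. A small common shift keeps the distance of the two points and
   changes each value by less than [e], which contradicts the bound for generic points. *)
pose e := (`|v x - v z| - 3 * M * edist x z) / 2.
have e0 : 0 < e by rewrite divr_gt0// subr_gt0.
have [d1 d10 h1] := continuous_edist x cv e0.
have [d2 d20 h2] := continuous_edist z cv e0.
have [|r [/andP[r0 rd] gx gz]] := generic_near2 x z (d := Num.min d1 d2 / 2).
  by rewrite divr_gt0// lt_min d10.
have m1 : Num.min d1 d2 <= d1 by rewrite ge_min lexx.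
have m2 : Num.min d1 d2 <= d2 by rewrite ge_min lexx orbT.
have rd1 : 2 * r < d1 by lra.
have rd2 : 2 * r < d2 by lra.
have H1 := h1 _ (le_lt_trans (edist_shift1 x (ltW r0)) rd1).
have H2 := h2 _ (le_lt_trans (edist_shift1 z (ltW r0)) rd2).
have H3 := gen _ _ gx gz.
have H4 := esum3_le (x.1.1 + r, x.1.2 + r, x.2 + r) (z.1.1 + r, z.1.2 + r, z.2 + r).
rewrite edist_shift in H4.
have H5 := ler_wpM2l M0 H4.
move: H1 H2 H3 H5; set x' := (x.1.1 + r, _, _); set z' := (z.1.1 + r, _, _) => H1 H2 H3 H5.
have := ler_distD (v x') (v x) (v z); have := ler_distD (v z') (v x') (v z).
rewrite (distrC (v z') (v z)); rewrite /e in H1 H2.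
have aux (a b c d f g h : R) : a < (b - c) / 2 -> d < (b - c) / 2 -> f <= g -> g <= c ->
  h <= f + d -> b <= a + h -> False by lra.
move=> K1 K2; rewrite mulrCA mulrA in H5.
exact: (aux _ _ _ _ _ _ _ H1 H2 H3 H5 K1 K2).
Qed.

Lemma W_sub v w : W sigma L q v -> W sigma L q w -> W sigma L q (fun x => v x - w x).
Proof.
move=> [cv v0 hv] [cw w0 hw]; split.
- by move=> x; apply: cvgB; [exact: cv|exact: cw].
- by move=> x hx; rewrite v0// w0// subr0.
- move=> i j k hi hj hk; have [p [[c hc] vp]] := hv i j k hi hj hk.
  have [p' [[c' hc'] wp]] := hw i j k hi hj hk.
  exists (fun x => p x - p' x); split; last by move=> x hx; rewrite vp// wp.
  exists (fun a b e => c a b e - c' a b e) => x; rewrite hc hc' -sumrB.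
  apply: eq_bigr => a _; rewrite -sumrB; apply: eq_bigr => b _; rewrite -sumrB.
  by apply: eq_bigr => e _; ring.
Qed.

End SplineLipschitz.

(** * Lipschitz functions vanishing off the cube have finite energy *)

Section LipschitzEnergy.
Variable R : realType.
Variable s : R.
Hypothesis s01 : 0 < s < 1.
Notation X3 := (R * R * R)%type.
Notation X6 := (X3 * X3)%type.
Implicit Types (v : X3 -> R) (x z : X3).

Lemma near_rat (t d : R) : 0 < d -> exists q : rat, `|t - ratr q| < d.
Proof.
move=> d0; have td : t - d < t by lra.
have [q] := rat_in_itvoo td; rewrite in_itv /= => hq; exists q; rewrite ger0_norm; lra.
Qed.

(** A superlevel set is the countable union of those cubes with rational centre on which the
    Lipschitz bound already forces [v > a]; each of them is a product of intervals. *)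
Lemma measurable_lip v K : 0 <= K -> (forall x z, `|v x - v z| <= K * edist x z) ->
  measurable_fun setT v.
Proof.
move=> K0 lip.
apply: (@measurability _ _ _ _ _ _ _ (RGenOInfty.measurableE R)) => //.
move=> _ [_ [a ->] <-]; rewrite setTI.
pose qv (q : rat * rat * rat) : X3 := (ratr q.1.1, ratr q.1.2, ratr q.2).
pose F (qn : rat * rat * rat * nat) : set X3 :=
  if a + 2 * K / qn.2.+1%:R < v (qv qn.1) then cube3 (qv qn.1) (qn.2.+1%:R^-1) else set0.
rewrite (_ : _ @^-1` _ = \bigcup_qn F qn); last first.
  apply/seteqP; split => [x|x [qn _]] /=.
    rewrite in_itv /= andbT => ax.
    (* One half of [4 * K] pays for the passage from [x] to a rational centre, the other half is the
       margin required in [F]. *)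
    have [n hn] : exists n : nat, 4 * K / n.+1%:R < v x - a.
      exists (Num.truncn ((v x - a)^-1 * (4 * K))).
      rewrite ltr_pdivrMr// -ltr_pdivrMl ?subr_gt0//.
      exact: truncnS_gt.
    have n0 : 0 < n.+1%:R^-1 :> R by rewrite invr_gt0.
    have rq (t : R) := near_rat t n0.
    have [q1 h1] := rq (co A1 x); have [q2 h2] := rq (co A2 x); have [q3 h3] := rq (co A3 x).
    exists ((q1, q2, q3), n) => //; rewrite /F /=.
    have hq i : `|co i x - co i (qv (q1, q2, q3))| < n.+1%:R^-1 by case: i.
    rewrite ifT; last first.
      have := lip x (qv (q1, q2, q3)).
      have := edist_le_max (ltW n0) (fun i => ltW (hq i)).
      move=> /(ler_wpM2l K0); rewrite ler_norml.
      rewrite (_ : 2 * K / n.+1%:R = 2 * (K * n.+1%:R^-1)); last by ring.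
      move: hn; rewrite (_ : 4 * K / n.+1%:R = 4 * (K * n.+1%:R^-1)); last by ring.
      rewrite (mulrCA K 2); move: (K * n.+1%:R^-1) (K * edist _ _) => ? ?; lra.
    by apply/cube3P => i; rewrite distrC.
  rewrite /F; case: ifP => // h1 /cube3P h2; rewrite in_itv /= andbT.
  have n0 : 0 <= qn.2.+1%:R^-1 :> R by rewrite invr_ge0.
  have := lip (qv qn.1) x; have := edist_le_max n0 (fun i => ltW (h2 i)).
  move=> /(ler_wpM2l K0); rewrite ler_norml.
  move: h1; rewrite (_ : 2 * K / qn.2.+1%:R = 2 * (K * qn.2.+1%:R^-1)); last by ring.
  rewrite (mulrCA K 2); move: (K * qn.2.+1%:R^-1) (K * edist _ _) => ? ?; lra.
apply: countable_bigcupT_measurable; first exact: countableP.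
by move=> qn; rewrite /F; case: ifP => // _; exact: measurable_box3.
Qed.

Lemma lip_bounded v K x : 0 <= K -> (forall x, ~ Omega x -> v x = 0) ->
  (forall x z, `|v x - v z| <= K * edist x z) -> `|v x| <= K.
Proof.
move=> K0 v0 lip; have [[h _ _]|hx] := pselect (Omega x); last by rewrite v0// normr0.
have := lip (upd A1 (co A1 x) x) (upd A1 0 x).
rewrite edist_upd subr0 upd_co (v0 (upd A1 0 x)); last by case; rewrite /c1 /= ltxx.
rewrite subr0 => /le_trans; apply; rewrite ler_piMr//.
by move: h; rewrite /c1 /= => /andP[? ?]; rewrite ger0_norm// ltW.
Qed.

Lemma L3_Omega : (L3 (OM : set X3) = 1)%E.
Proof.
have -> : (OM : set X3) = box3 (0, 0, 0) (1, 1, 1).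
  apply/seteqP; split => x.
    by move=> [? ? ?]; apply/box3P; case.
  by move=> /box3P h; split; [exact: (h A1)|exact: (h A2)|exact: (h A3)].
rewrite L3_box3 => [|[] //=]; by congr (_%:E); rewrite /=; ring.
Qed.

(** Below distance one the Lipschitz bound tames the kernel, beyond it the bound [2 * K] for
    differences does. Pairs with both points off the cube contribute nothing, so one of the two
    variables ranges over a set of measure one. *)
Lemma lip_Ho v K : 0 <= K -> (forall x, ~ Omega x -> v x = 0) ->
  (forall x z, `|v x - v z| <= K * edist x z) -> Ho s v.
Proof.
move=> K0 v0 lip; have mv := measurable_lip K0 lip.
have bv x := lip_bounded x K0 v0 lip.
have mO : measurable (OM : set X3) by exact: measurable_Omega.
have mI : measurable_fun setT (fun x : X3 => (\1_OM x)%:E : \bar R).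
  by apply: measurable_EF; exact: measurable_indic.
have I0 (x : X3) : (0 <= (\1_OM x)%:E :> \bar R)%E by rewrite lee_fin.
have iI : (\int[L3]_x (\1_(OM : set X3) x)%:E = 1)%E.
  rewrite integral_indic// setIT; exact: L3_Omega.
pose h1 (p : X6) := if edist p.1 p.2 < 1 then edist p.1 p.2 ^+ 2 * kern s p else 0.
pose h2 (p : X6) := if 1 <= edist p.1 p.2 then kern s p else 0.
pose h p := K ^+ 2 * h1 p + 4 * K ^+ 2 * h2 p.
have med := @measurable_edist R.
have mh1 : measurable_fun setT h1.
  apply: measurable_fun_ifT => //; first exact: measurable_fun_ltr.
  by apply: measurable_funM; [exact: measurable_funX|exact: measurable_kern].
have mh2 : measurable_fun setT h2.
  apply: measurable_fun_ifT => //; first exact: measurable_fun_ler.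
  exact: measurable_kern.
have mh : measurable_fun setT h by apply: measurable_funD; exact: measurable_funM.
have k0 p : 0 <= kern s p by rewrite invr_ge0 powR_ge0.
have h10 p : 0 <= h1 p by rewrite /h1; case: ifP => // _; rewrite mulr_ge0 ?sqr_ge0.
have h20 p : 0 <= h2 p by rewrite /h2; case: ifP.
have h0 p : 0 <= h p by rewrite addr_ge0 ?mulr_ge0 ?sqr_ge0.
pose C := K ^+ 2 * Cnear s + 4 * K ^+ 2 * Cfar s.
have int_h x : (\int[L3]_z (h (x, z))%:E <= C%:E)%E.
  have mp : measurable_fun setT (fun z : X3 => (x, z)) by exact: measurable_fun_pair.
  have a1 : measurable_fun setT (fun z => (K ^+ 2 * h1 (x, z))%:E : \bar R).
    by apply: measurable_EF; apply: measurable_funM; [exact: measurable_cst|exact: (measurableT_comp mh1 mp)].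
  have a2 : measurable_fun setT (fun z => (4 * K ^+ 2 * h2 (x, z))%:E : \bar R).
    by apply: measurable_EF; apply: measurable_funM; [exact: measurable_cst|exact: (measurableT_comp mh2 mp)].
  have p1 z : (0 <= (K ^+ 2 * h1 (x, z))%:E :> \bar R)%E by rewrite lee_fin mulr_ge0 ?sqr_ge0.
  have p2 z : (0 <= (4 * K ^+ 2 * h2 (x, z))%:E :> \bar R)%E.
    by rewrite lee_fin mulr_ge0// mulr_ge0// sqr_ge0.
  under eq_integral do rewrite /h EFinD.
  have /= -> := ge0_intD L3 a1 a2 p1 p2.
  rewrite /C EFinD; apply: leeD.
    under eq_integral do rewrite EFinM.
    have m1 : measurable_fun setT (fun z => (h1 (x, z))%:E : \bar R).
      by apply: measurable_EF; exact: (measurableT_comp mh1 mp).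
    have q1 z : (0 <= (h1 (x, z))%:E :> \bar R)%E by rewrite lee_fin.
    have /= -> := ge0_intZ L3 (sqr_ge0 K) m1 q1.
    rewrite [leRHS]EFinM lee_wpmul2l ?lee_fin ?sqr_ge0//.
    have := kern_near s01 x ltr01; by rewrite powR1 mulr1.
  under eq_integral do rewrite EFinM.
  have m2 : measurable_fun setT (fun z => (h2 (x, z))%:E : \bar R).
    by apply: measurable_EF; exact: (measurableT_comp mh2 mp).
  have q2 z : (0 <= (h2 (x, z))%:E :> \bar R)%E by rewrite lee_fin.
  have c0 : 0 <= 4 * K ^+ 2 by rewrite mulr_ge0 ?sqr_ge0.
  have /= -> := ge0_intZ L3 c0 m2 q2.
  rewrite [leRHS]EFinM lee_wpmul2l ?lee_fin//.
  have := kern_far s01 x ltr01; by rewrite powR1 mulr1.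
have mdv2 : measurable_fun setT (fun p => (dv s v p ^+ 2)%:E : \bar R).
  by apply: measurable_EF; apply: measurable_funX; exact: measurable_dv.
have mG1 : measurable_fun setT (fun p : X6 => (\1_OM p.1 * h p)%:E : \bar R).
  apply: measurable_EF; apply: measurable_funM => //.
  by apply: measurableT_comp => //; exact: measurable_indic.
have mG2 : measurable_fun setT (fun p : X6 => (\1_OM p.2 * h p)%:E : \bar R).
  apply: measurable_EF; apply: measurable_funM => //.
  by apply: measurableT_comp => //; exact: measurable_indic.
have G10 (p : X6) : (0 <= (\1_OM p.1 * h p)%:E :> \bar R)%E by rewrite lee_fin mulr_ge0.
have G20 (p : X6) : (0 <= (\1_OM p.2 * h p)%:E :> \bar R)%E by rewrite lee_fin mulr_ge0.
have C0 : 0 <= C.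
  rewrite -lee_fin; apply: le_trans (int_h (0, 0, 0)).
  by apply: integral_ge0 => z _; rewrite lee_fin.
have inner x : (\int[L3]_z (\1_OM x * h (x, z))%:E <= (\1_OM x)%:E * C%:E)%E.
  have mp : measurable_fun setT (fun z : X3 => (x, z)) by exact: measurable_fun_pair.
  have m1 : measurable_fun setT (fun z => (h (x, z))%:E : \bar R).
    by apply: measurable_EF; exact: (measurableT_comp mh mp).
  have q1 z : (0 <= (h (x, z))%:E :> \bar R)%E by rewrite lee_fin.
  have i0 : (0 : R) <= \1_OM x by [].
  under eq_integral do rewrite EFinM.
  have /= -> := ge0_intZ L3 i0 m1 q1.
  by apply: lee_wpmul2l => //; rewrite lee_fin.
have outer : (\int[L3]_x ((\1_OM x)%:E * C%:E) = C%:E)%E.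
  by have /= -> := ge0_intZr L3 C0 mI I0; rewrite iI mul1e.
have hC x z : h (x, z) = h (z, x) by rewrite /h /h1 /h2 /kern /= edistC.
have mIC : measurable_fun setT (fun x : X3 => ((\1_OM x)%:E * C%:E)%E : \bar R).
  by under eq_fun do rewrite -EFinM; apply: measurable_EF; apply: measurable_funM => //;
     exact: measurable_indic.
have I1 : (\int[L6]_p (\1_OM p.1 * h p)%:E <= C%:E)%E.
  rewrite (tonelli1 L3 L3 mG1 G10); rewrite -outer; apply: ge0_le_int => [||x|x].
  - exact: (measurable_tonelli1 L3 mG1 G10).
  - exact: mIC.
  - by apply: integral_ge0 => z _.
  - exact: inner.
have I2 : (\int[L6]_p (\1_OM p.2 * h p)%:E <= C%:E)%E.
  rewrite (tonelli2 L3 L3 mG2 G20); rewrite -outer; apply: ge0_le_int => [||x|x].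
  - exact: (measurable_tonelli2 L3 mG2 G20).
  - exact: mIC.
  - by apply: integral_ge0 => z _.
  - by apply: le_trans (inner x); under eq_integral do rewrite /= hC.
have pt p : dv s v p ^+ 2 <= \1_OM p.1 * h p + \1_OM p.2 * h p.
  have main : dv s v p ^+ 2 <= h p.
    rewrite dv2 /h /h1 /h2; case: (ltP (edist p.1 p.2) 1) => _; rewrite mulr0 ?addr0 ?add0r.
      rewrite mulrA ler_wpM2r// -exprMn -[leLHS]real_normK ?num_real//.
      by rewrite lerXn2r ?nnegrE ?mulr_ge0 ?edist_ge0.
    rewrite ler_wpM2r// -[leLHS]real_normK ?num_real// (_ : 4 * K ^+ 2 = (2 * K) ^+ 2); last by ring.
    rewrite lerXn2r ?nnegrE ?mulr_ge0//; apply: le_trans (ler_normB _ _) _.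
    by rewrite mulr_natl mulr2n; exact: lerD (bv p.1) (bv p.2).
  rewrite !indicE; case: (boolP (p.1 \in OM)) => [_|n1]; first by rewrite mul1r ler_wpDr// mulr_ge0.
  case: (boolP (p.2 \in OM)) => [_|n2]; first by rewrite mul0r add0r mul1r.
  rewrite !mul0r addr0 dv2 !v0 ?subrr ?expr0n ?mul0r//.
    by move=> ?; move/negP: n2; apply; rewrite inE.
  by move=> ?; move/negP: n1; apply; rewrite inE.
have fin : (\int[L6]_p (dv s v p ^+ 2)%:E < +oo)%E.
  apply: (@le_lt_trans _ _ (C + C)%:E); last exact: ltry.
  apply: (@le_trans _ _ (\int[L6]_p ((\1_OM p.1 * h p)%:E + (\1_OM p.2 * h p)%:E))%E).
    apply: ge0_le_int => [||p|p] //.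
    - exact: emeasurable_funD.
    - by rewrite lee_fin sqr_ge0.
    - by rewrite -EFinD lee_fin pt.
  by have /= -> := ge0_intD L6 mG1 mG2 G10 G20; rewrite EFinD leeD.
split => //; split.
- split => //; apply: (@le_lt_trans _ _ (\int[L3]_x ((\1_OM x)%:E * (K ^+ 2)%:E))%E).
    apply: ge0_le_int => [||x|x].
    - by apply: measurable_EF; exact: measurable_funX.
    - by under eq_fun do rewrite -EFinM; apply: measurable_EF; apply: measurable_funM => //;
        exact: measurable_indic.
    - by rewrite lee_fin sqr_ge0.
    - rewrite -EFinM lee_fin indicE; case: (boolP (x \in OM)) => [_|n1].
        rewrite mul1r -[leLHS]real_normK ?num_real//.
        by rewrite lerXn2r ?nnegrE.
      by rewrite mul0r v0 ?expr0n// => ?; move/negP: n1; apply; rewrite inE.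
  by have /= -> := ge0_intZr L3 (sqr_ge0 K) mI I0; rewrite iI mul1e ltry.
- by split => //; exact: measurable_dv.
- move=> x hx; apply: v0 => -[/andP[? ?] /andP[? ?] /andP[? ?]]; apply: hx.
  by split; apply/andP; split; exact: ltW.
Qed.

End LipschitzEnergy.

(** * Divided differences *)

Section DividedDifferences.
Variable R : realType.
Implicit Types (f g h : R -> R) (a : nat -> R) (e t b c : R) (i j k n m : nat).

(** Newton's recursion for the divided difference of [g] at the first [k] nodes of [a] and at [e].
    The last point stays a free argument because the recursion evaluates it at two places. *)
Fixpoint dd g a k e : R :=
  if k is k'.+1 then (dd g a k' e - dd g a k' (a k')) / (e - a k') else g e.

Definition shn i a j := a (i + j)%N.
Definition off a k e := forall j, (j < k)%N -> e != a j.

Lemma off_nodes a k : injective a -> off a k (a k).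
Proof. by move=> ia j jk; apply/eqP => /ia jE; rewrite jE ltnn in jk. Qed.

Lemma offS a k e : off a k.+1 e -> off a k e /\ e != a k.
Proof. by move=> h; split=> [j jk|]; apply: h => //; exact: ltnW. Qed.

Lemma dd_ext f g a k e : f e = g e -> (forall j, (j < k)%N -> f (a j) = g (a j)) ->
  dd f a k e = dd g a k e.
Proof.
elim: k e => [//|k IH] e he hj /=.
rewrite (IH e) => [||j jk]; [|exact: he|by apply: hj; exact: ltnW].
by rewrite (IH (a k)) => [||j jk]; [|exact: hj|by apply: hj; exact: ltnW].
Qed.

Lemma ddD f g a k e : dd (fun t => f t + g t) a k e = dd f a k e + dd g a k e.
Proof. by elim: k e => [//|k IH] e /=; rewrite !IH; ring. Qed.

Lemma ddZ c g a k e : dd (fun t => c * g t) a k e = c * dd g a k e.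
Proof. by elim: k e => [//|k IH] e /=; rewrite !IH; ring. Qed.

Lemma ddB f g a k e : dd (fun t => f t - g t) a k e = dd f a k e - dd g a k e.
Proof. by elim: k e => [//|k IH] e /=; rewrite !IH; ring. Qed.

Lemma dd_sum (I : Type) (r : seq I) (F : I -> R -> R) a k e :
  dd (fun t => \sum_(i <- r) F i t) a k e = \sum_(i <- r) dd (F i) a k e.
Proof.
elim: r => [|i r IH].
  rewrite big_nil; transitivity (dd (fun=> 0) a k e); first by apply: dd_ext => [|*]; rewrite big_nil.
  by elim: k e => [//|k IH] e /=; rewrite !IH subrr mul0r.
rewrite big_cons -IH -ddD; apply: dd_ext => [|*]; by rewrite big_cons.
Qed.

Lemma dd_shift1 f a k i e : (i <= k)%N ->
  dd f (shn i a) (k - i).+1 e =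
  (dd f (shn i a) (k - i) e - dd f (shn i a) (k - i) (a k)) / (e - a k).
Proof. by move=> ik /=; rewrite /shn subnKC. Qed.

Lemma dd_leibniz f g a k e : injective a -> off a k e ->
  dd (fun t => f t * g t) a k e = f e * dd g a k e +
    \sum_(i < k) dd f (shn i a) (k - i) e * dd g a i (a i).
Proof.
move=> ia; elim: k e => [|k IH] e; first by rewrite big_ord0 addr0.
move=> /offS [ek eak] /=.
have eak' : e - a k != 0 by rewrite subr_eq0.
rewrite (IH e)// (IH (a k)); last exact: off_nodes.
rewrite big_ord_recr /= subSnn /= /shn addn0.
under [in RHS]eq_bigr => i _ do rewrite subSn ?(ltnW (ltn_ord i))// dd_shift1 ?(ltnW (ltn_ord i))//.
have -> : \sum_(i < k) (dd f (shn i a) (k - i) e - dd f (shn i a) (k - i) (a k)) / (e - a k) * dd g a i (a i)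
  = (\sum_(i < k) dd f (shn i a) (k - i) e * dd g a i (a i) -
     \sum_(i < k) dd f (shn i a) (k - i) (a k) * dd g a i (a i)) / (e - a k).
  by rewrite -sumrB mulr_suml; apply: eq_bigr => i _; ring.
by field.
Qed.

Lemma ddM_affine b c h a k e : injective a -> off a k.+1 e ->
  dd (fun t => (b + c * t) * h t) a k.+1 e =
  (b + c * e) * dd h a k.+1 e + c * dd h a k (a k).
Proof.
move=> ia; elim: k e => [|k IH] e.
  move=> /offS [_ ea] /=; have : e - a 0 != 0 by rewrite subr_eq0.
  by move=> ?; field.
move=> /offS [ek eak]; rewrite [LHS]/= -!/(dd _ a k.+1 _).
rewrite (IH e)// (IH (a k.+1)); last exact: off_nodes.
rewrite [dd h a k.+2 e]/= -!/(dd h a k.+1 _).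
have : e - a k.+1 != 0 by rewrite subr_eq0.
move: (dd h a k.+1 e) (dd h a k.+1 (a k.+1)) (dd h a k (a k)) => x y z ?.
by field.
Qed.

(** The divided difference is [c ^ k] times the complete homogeneous polynomial of degree [n - k] in
    the [k + 1] values of [b + c * t], which has ['C(n, k)] monomials. Pascal's rule matches the
    product rule for an affine factor. *)
Lemma dd_pow_bound b c (B : R) n a k e : injective a -> off a k e ->
  `|b + c * e| <= B -> (forall j, (j < k)%N -> `|b + c * a j| <= B) ->
  `|dd (fun t => (b + c * t) ^+ n) a k e| <= 'C(n, k)%:R * B ^+ (n - k) * `|c| ^+ k.
Proof.
move=> ia; elim: n k e => [|n IH] k e ek eB aB.
  case: k ek aB => [|k] ek aB; first by rewrite /= bin0 !expr0 !mulr1 normr1.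
  rewrite bin0n mul0r mul0r.
  have cst k' t : off a k'.+1 t -> dd (fun t => (b + c * t) ^+ 0) a k'.+1 t = 0.
    elim: k' t => [|k' IH'] t ht /=; first by rewrite !expr0 subrr mul0r.
    have [h1 h2] := offS ht.
    by rewrite -/(dd _ a k'.+1 t) -/(dd _ a k'.+1 _) !IH' ?subrr ?mul0r//; exact: off_nodes.
  by rewrite cst// normr0.
have B0 : 0 <= B by exact: le_trans eB.
case: k ek aB => [|k] ek aB; first by rewrite /= bin0 subn0 expr0 mulr1 mul1r normrX lerXn2r ?nnegrE.
have -> : dd (fun t => (b + c * t) ^+ n.+1) a k.+1 e =
  dd (fun t => (b + c * t) * (b + c * t) ^+ n) a k.+1 e.
  by apply: dd_ext => [|*]; rewrite exprS.
rewrite ddM_affine//; have [ek' _] := offS ek.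
have h1 := IH k.+1 e ek eB aB.
have h2 : `|dd (fun t => (b + c * t) ^+ n) a k (a k)| <= 'C(n, k)%:R * B ^+ (n - k) * `|c| ^+ k.
  by apply: IH; [exact: off_nodes|exact: aB|move=> j jk; apply: aB; exact: ltnW].
apply: (le_trans (ler_normD _ _)); rewrite (normrM (b + c * e)) (normrM c) subSS binS natrD !mulrDl lerD//; last first.
  rewrite exprS (mulrCA _ `|c|) ler_wpM2l//.
apply: (@le_trans _ _ (B * ('C(n, k.+1)%:R * B ^+ (n - k.+1) * `|c| ^+ k.+1))).
  by apply: ler_pM.
rewrite !mulrA ler_wpM2r ?exprn_ge0//.
have [nk|kn] := leqP n k; first by rewrite bin_small// !mulr0 !mul0r.
by rewrite (mulrC B) -mulrA -exprS subnSK.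
Qed.

Lemma dd_cvg (F : nat -> R -> R) g a k e :
  (F N e @[N --> \oo] --> g e) ->
  (forall j, (j < k)%N -> F N (a j) @[N --> \oo] --> g (a j)) ->
  dd (F N) a k e @[N --> \oo] --> dd g a k e.
Proof.
elim: k e => [//|k IH] e he hj /=.
apply: cvgMl; apply: cvgB; apply: IH => //.
- by move=> j jk; apply: hj; exact: ltnW.
- exact: hj.
- by move=> j jk; apply: hj; exact: ltnW.
Qed.

Lemma half_geo_sum k N : \sum_(n < N) (if (k <= n)%N then (1 / 2 : R) ^+ (n - k) else 0) <= 2.
Proof.
have -> : \sum_(n < N) (if (k <= n)%N then (1 / 2 : R) ^+ (n - k) else 0) =
    if (k <= N)%N then 2 - 2 * (1 / 2) ^+ (N - k) else 0.
  elim: N => [|N IH].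
    by rewrite big_ord0; case: ifP => //; rewrite leqn0 => /eqP ->; rewrite subnn expr0; lra.
  rewrite big_ord_recr /= {}IH; case: (leqP k N) => kN.
    by rewrite (leq_trans kN)// subSn// exprS; lra.
  rewrite addr0; case: ifP => // kN'.
  by rewrite (_ : k = N.+1) ?subnn ?expr0; [lra|apply/eqP; rewrite eqn_leq kN kN'].
case: ifP => // _; rewrite gerBl mulr_ge0// exprn_ge0// divr_ge0//.
Qed.

(** The coefficients may depend on the truncation [N], as happens when a triple series is regrouped
    by powers of one variable. With ['C(n, k) <= 2 ^ n] and [K * B <= 1 / 4] the terms decay like
    [(1 / 2) ^ (n - k)]. *)
Lemma dd_powlim (C : nat -> nat -> R) b c (B M K : R) g a k e : injective a ->
  off a k e -> 0 <= M -> 0 <= K -> 0 <= B -> K * B <= 1 / 4 ->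
  `|b + c * e| <= B -> (forall j, (j < k)%N -> `|b + c * a j| <= B) ->
  (forall N n, `|C N n| <= M * K ^+ n) ->
  (\sum_(n < N) C N n * (b + c * e) ^+ n @[N --> \oo] --> g e) ->
  (forall j, (j < k)%N -> \sum_(n < N) C N n * (b + c * a j) ^+ n @[N --> \oo] --> g (a j)) ->
  `|dd g a k e| <= 2 * M * (2 * K * `|c|) ^+ k.
Proof.
move=> ia ek M0 K0 B0 KB eB aB CM ce ca.
have P0 : 0 <= 2 * K * `|c| by rewrite mulr_ge0// mulr_ge0.
have cd := dd_cvg (F := fun N t => \sum_(n < N) C N n * (b + c * t) ^+ n) ce ca.
have cn : `|dd (fun t => \sum_(n < N) C N n * (b + c * t) ^+ n) a k e| @[N --> \oo] -->
    `|dd g a k e| by exact: cvg_norm.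
rewrite -(cvg_lim (@Rhausdorff R) cn); apply: limr_le; first by apply/cvg_ex; exists `|dd g a k e|.
near=> N; rewrite dd_sum; apply: (le_trans (ler_norm_sum _ _ _)).
apply: (@le_trans _ _ (\sum_(n < N) M * (2 * K * `|c|) ^+ k * (if (k <= n)%N then (1 / 2) ^+ (n - k) else 0))); last first.
  rewrite -mulr_sumr [leRHS](_ : _ = M * (2 * K * `|c|) ^+ k * 2); last by ring.
  by apply: ler_wpM2l; [exact: mulr_ge0 M0 (exprn_ge0 _ P0)|exact: half_geo_sum].
apply: ler_sum => n _; rewrite ddZ normrM.
apply: (@le_trans _ _ (M * K ^+ n * ('C(n, k)%:R * B ^+ (n - k) * `|c| ^+ k))).
  by apply: ler_pM => //; exact: dd_pow_bound.
case: leqP => [kn|nk]; last by rewrite bin_small// mulr0n !mul0r !mulr0.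
have hb : ('C(n, k)%:R : R) <= 2 ^+ n.
  rewrite -natrX ler_nat -[2%N]/(1 + 1)%N expnDn (bigD1 (inord k))//= inordK// !exp1n !muln1.
  exact: leq_addr.
apply: (@le_trans _ _ (M * K ^+ n * (2 ^+ n * B ^+ (n - k) * `|c| ^+ k))).
  by rewrite ler_wpM2l ?mulr_ge0 ?exprn_ge0// !ler_wpM2r ?exprn_ge0.
rewrite -{1 2}(subnKC kn) !exprD [leLHS](_ : _ =
  M * (2 * K * `|c|) ^+ k * ((2 * (K * B)) ^+ (n - k))); last by rewrite !exprMn; ring.
apply: ler_wpM2l; first exact: mulr_ge0 M0 (exprn_ge0 _ P0).
by apply: lerXn2r; rewrite ?nnegrE; [exact: mulr_ge0 (ler0n _ 2) (mulr_ge0 K0 B0)|exact: divr_ge0|clear -KB; lra].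
Unshelve. all: by end_near.
Qed.

Definition lag a m j t := \prod_(i <- [seq i <- iota 0 m | i != j]) ((t - a i) / (a j - a i)).

Lemma lag_node a m i j : injective a -> (i < m)%N -> lag a m j (a i) = (i == j)%:R.
Proof.
move=> ia im; rewrite /lag; have [->|ij] := eqVneq i j.
  rewrite big_seq big1// => l; rewrite mem_filter => /andP[lj _].
  by rewrite divff// subr_eq0 (inj_eq ia) eq_sym.
rewrite (big_rem i)/=; first by rewrite subrr mul0r mul0r.
by rewrite mem_filter ij mem_iota add0n.
Qed.

Lemma dd_prod0 (s : seq nat) (B C : nat -> R) a k e : injective a -> off a k e ->
  (size s < k)%N -> dd (fun t => \prod_(i <- s) (B i + C i * t)) a k e = 0.
Proof.
move=> ia; elim: s k e => [|i s IH] k e ek sk.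
  elim: k e ek sk => [//|k IHk] e ek _ /=.
  case: k IHk ek => [|k] IHk ek; first by rewrite /= !big_nil subrr mul0r.
  have [ek' _] := offS ek.
  by rewrite (IHk e)// (IHk (a k.+1)) ?subrr ?mul0r//; exact: off_nodes.
case: k ek sk => [//|k] ek /= sk.
rewrite -/(dd _ a k.+1 e).
have -> : dd (fun t => \prod_(l <- i :: s) (B l + C l * t)) a k.+1 e =
  dd (fun t => (B i + C i * t) * \prod_(l <- s) (B l + C l * t)) a k.+1 e.
  by apply: dd_ext => [|*]; rewrite big_cons.
rewrite ddM_affine// IH//; last exact: ltnW.
by rewrite mulr0 add0r IH ?mulr0//; exact: off_nodes.
Qed.

Lemma dd_vanish h a k e : injective a -> off a k e ->
  (forall j, (j < k)%N -> h (a j) = 0) ->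
  dd h a k e = h e / \prod_(j < k) (e - a j).
Proof.
move=> ia; elim: k e => [|k IH] e; first by rewrite big_ord0 divr1.
move=> /offS[ek eak] hj /=; rewrite IH//; last by move=> j jk; apply: hj; exact: ltnW.
rewrite (IH (a k)); [|exact: off_nodes|by move=> j jk; apply: hj; exact: ltnW].
by rewrite hj// mul0r subr0 big_ord_recr /= invfM mulrA.
Qed.

(** Subtracting the interpolant does not change the difference of order [m], because a polynomial of
    degree below [m] has none; what remains vanishes at the nodes, where [dd_vanish] applies. *)
Lemma dd_remainder g a m e : injective a -> off a m e ->
  g e - \sum_(j < m) lag a m j e * g (a j) = \prod_(j < m) (e - a j) * dd g a m e.
Proof.
move=> ia em.
pose L t := \sum_(j < m) g (a j) * lag a m j t.
have dL : dd L a m e = 0.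
  rewrite dd_sum big1// => j _; rewrite ddZ.
  have -> : dd (lag a m j) a m e = dd (fun t => \prod_(i <- [seq i <- iota 0 m | i != (j : nat)])
     (- a i / (a j - a i) + (a j - a i)^-1 * t)) a m e.
    by apply: dd_ext => [|*]; apply: eq_bigr => i _; ring.
  rewrite dd_prod0 ?mulr0//.
  rewrite -[ltnRHS](size_iota 0 m) size_filter.
  rewrite -(count_predC (fun i => i != j :> nat)) -addn1 leq_add2l -has_count.
  by apply/hasP; exists (j : nat); rewrite ?mem_iota//= negbK.
have hL i : (i < m)%N -> g (a i) - L (a i) = 0.
  move=> im; rewrite /L (bigD1 (Ordinal im))//= lag_node// eqxx mulr1 big1 ?addr0 ?subrr//.
  move=> j jm; rewrite lag_node// (_ : (i == j) = false) ?mulr0//.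
  by apply: contraNF jm => /eqP ij; apply/eqP/val_inj.
have := dd_vanish (h := fun t => g t - L t) ia em hL; rewrite ddB dL subr0 => ->.
rewrite mulrC divfK; last first.
  by apply/prodf_neq0 => j _; rewrite subr_eq0; exact: em.
by congr (_ - _); apply: eq_bigr => j _; rewrite mulrC.
Qed.

End DividedDifferences.

(** * Bernstein blocks on the geometric mesh *)

Section Bernstein.
Variable R : realType.
Implicit Types (c t eta M : R) (n k : nat) (p : {poly R}).

Definition bern n k c : R := 'C(n, k)%:R * (c ^+ k * (1 - c) ^+ (n - k)).

Lemma bern_ge0 n k c : 0 <= c <= 1 -> 0 <= bern n k c.
Proof. by move=> hc; rewrite !mulr_ge0 ?exprn_ge0//; lra. Qed.

Lemma bern_sum n c : \sum_(k < n.+1) bern n k c = 1.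
Proof.
rewrite -[RHS](expr1n R n) -[in RHS](subrK c 1) exprDn; apply: eq_bigr => k _.
by rewrite /bern -mulr_natl; ring.
Qed.

Lemma bern_le1 n k c : 0 <= c <= 1 -> bern n k c <= 1.
Proof.
move=> hc; have [kn|kn] := leqP k n; last by rewrite /bern bin_small// mul0r.
rewrite -(bern_sum n c) (bigD1 (Ordinal (kn : (k < n.+1)%N)))//= lerDl sumr_ge0// => i _.
exact: bern_ge0.
Qed.

Lemma bern_at0 n k : bern n k 0 = (k == 0%N)%:R.
Proof.
by rewrite /bern subr0 expr1n mulr1 expr0n; case: eqP => [->|_]; rewrite ?bin0 ?mulr1 ?mulr0.
Qed.

Lemma bern_at1 n k : (k <= n)%N -> bern n k 1 = (k == n)%:R.
Proof.
move=> kn; rewrite /bern subrr expr1n mul1r expr0n subn_eq0.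
case: eqP => [->|/eqP nk]; first by rewrite leqnn binn mulr1.
by rewrite leqNgt ltn_neqAle nk kn mulr0.
Qed.

Lemma bernn n c : bern n n c = c ^+ n.
Proof. by rewrite /bern binn subnn expr0 mulr1 mul1r. Qed.

Lemma bern0 n c : bern n 0 c = (1 - c) ^+ n.
Proof. by rewrite /bern bin0 subn0 expr0 !mul1r. Qed.

Lemma bern_sum_inner m c :
  \sum_(k < m) bern m.+1 k.+1 c = 1 - (1 - c) ^+ m.+1 - c ^+ m.+1.
Proof.
have := bern_sum m.+1 c; rewrite big_ord_recl big_ord_recr /= bern0 /bump /= add1n bernn.
under eq_bigr do rewrite add1n.
by move=> h; lra.
Qed.

(** Chernoff's argument: after multiplication by [expR (t * k)] the left side is one term of the
    binomial expansion of [(1 - c + c * expR t) ^ n]. *)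
Lemma bern_exp n k c t : 0 <= c <= 1 ->
  bern n k c <= expR (n%:R * (c * (expR t - 1)) - t * k%:R).
Proof.
move=> hc; have [kn|kn] := leqP k n; last by rewrite /bern bin_small// mul0r expR_ge0.
rewrite expRD expRN -ler_pdivrMr ?invr_gt0 ?expR_gt0// invrK.
have -> : bern n k c * expR (t * k%:R) = 'C(n, k)%:R * ((c * expR t) ^+ k * (1 - c) ^+ (n - k)).
  by rewrite mulrC [t * _]mulrC expRM_natl /bern exprMn; ring.
have h0 j : 0 <= 'C(n, j)%:R * ((c * expR t) ^+ j * (1 - c) ^+ (n - j)).
  by rewrite !mulr_ge0 ?exprn_ge0 ?mulr_ge0 ?expR_ge0//; lra.
apply: (@le_trans _ _ ((1 - c + c * expR t) ^+ n)).
  rewrite [leRHS]exprDn (bigD1 (Ordinal (kn : (k < n.+1)%N)))//= -[leLHS]addr0 lerD//.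
    by rewrite le_eqVlt; apply/orP; left; apply/eqP; rewrite -mulr_natl; ring.
  by apply: sumr_ge0 => j _; move: (h0 j); congr (0 <= _); rewrite -[RHS]mulr_natl; ring.
rewrite expRM_natl; apply: lerXn2r; rewrite ?nnegrE ?expR_ge0//.
  by rewrite addr_ge0 ?mulr_ge0 ?expR_ge0//; lra.
apply: le_trans (expR_ge1Dx _); lra.
Qed.

Lemma expR_quad t : `|t| <= 1 / 2 -> expR t - 1 <= t + 2 * t ^+ 2.
Proof.
rewrite ler_norml => ht.
have h : expR t <= (1 - t)^-1.
  rewrite -[t in expR t]opprK expRN lef_pV2 ?posrE ?expR_gt0//; last by lra.
  by apply: le_trans (expR_ge1Dx _); lra.
have h2 : (1 - t)^-1 <= 1 + t + 2 * t ^+ 2.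
  by rewrite -[leLHS]mul1r ler_pdivrMr; [nra|lra].
lra.
Qed.

Lemma expR1_le4 : expR 1 <= 4 :> R.
Proof.
have h : expR (1 / 2) <= 2 :> R.
  rewrite -[X in expR X]opprK expRN -[leRHS]invrK lef_pV2 ?posrE ?expR_gt0 ?invr_gt0//.
  by apply: le_trans (expR_ge1Dx _); lra.
have e : expR (1 : R) = expR (1 / 2) ^+ 2 by rewrite -expRM_natl; congr expR; field.
have := expR_ge0 (1 / 2 : R); rewrite e expr2; move: (expR (1 / 2)) h => y h y0; nra.
Qed.

Definition btail n eta := expR (- (n%:R * eta ^+ 2 / 8)).

(* The tilt [t = ± eta / 4] of the Chernoff bound also absorbs shifts of [n] and [k] by one. *)
Lemma bern_tail_gen n n' k k' c eta : 0 <= c <= 1 -> 0 <= eta <= 1 -> (0 < n)%N ->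
  (n' <= n)%N -> (n <= n'.+1)%N -> (k' <= k)%N -> (k <= k'.+1)%N ->
  eta <= `|c - k%:R / n%:R| -> bern n' k' c <= 4 * btail n eta.
Proof.
move=> hc he n0 n1 n2 k1 k2 hk.
have N0 : 0 < n%:R :> R by rewrite ltr0n.
pose t := if c <= k%:R / n%:R then eta / 4 else - (eta / 4).
have ht : t = eta / 4 \/ t = - (eta / 4) by rewrite /t; case: ifP; [left|right].
have t1 : `|t| <= 1 / 4 by case: ht => ->; rewrite ler_norml; lra.
have t2 : t ^+ 2 = eta ^+ 2 / 16 by case: ht => ->; field.
have tc : t * (c - k%:R / n%:R) <= - (eta ^+ 2 / 4).
  move: hk; rewrite /t; case: ifPn => [h|]; last rewrite -ltNge => h.
    by rewrite ler0_norm ?subr_le0//; move: (k%:R / n%:R) h => y h hk; nra.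
  by rewrite gtr0_norm ?subr_gt0//; move: (k%:R / n%:R) h => y h hk; nra.
apply: le_trans (bern_exp n' k' t hc) _.
have e1 : expR t - 1 <= t + 2 * t ^+ 2 by apply: expR_quad; lra.
have e0 : - (1 / 4) <= expR t - 1.
  by have := expR_ge1Dx t; move: t1; rewrite ler_norml; lra.
have four := expR1_le4.
apply: (@le_trans _ _ (expR (1 - n%:R * eta ^+ 2 / 8))); last first.
  by rewrite expRD ler_wpM2r ?expR_ge0.
rewrite ler_expR.
have m1 : n%:R * (c * (expR t - 1)) - t * k%:R <= - (n%:R * eta ^+ 2 / 8).
  have -> : n%:R * (c * (expR t - 1)) - t * k%:R = n%:R * (c * (expR t - 1) - t * (k%:R / n%:R)).
    by field; rewrite gt_eqF.
  rewrite [leRHS](_ : _ = n%:R * - (eta ^+ 2 / 8)); last by ring.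
  apply: ler_wpM2l; first exact: ltW.
  move: tc; move: (k%:R / n%:R) => y; move: e1; move: (expR t - 1) => E e1 tc.
  have : c * E <= c * (t + 2 * t ^+ 2) by rewrite ler_wpM2l//; lra.
  rewrite t2; nra.
have d1 : n%:R = n'%:R + (n - n')%:R :> R by rewrite -natrD subnKC.
have d2 : k%:R = k'%:R + (k - k')%:R :> R by rewrite -natrD subnKC.
have b1 : 0 <= (n - n')%:R :> R /\ (n - n')%:R <= 1 :> R.
  by rewrite ler0n (ler_nat _ _ 1) leq_subLR addn1.
have b2 : 0 <= (k - k')%:R :> R /\ (k - k')%:R <= 1 :> R.
  by rewrite ler0n (ler_nat _ _ 1) leq_subLR addn1.
move: m1; rewrite {1}d1 d2; move: b1 b2; move: ((n - n')%:R : R) ((k - k')%:R : R) => a b [a0 a1] [b0 b1].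
have h1 : - (1 / 4) <= a * (c * (expR t - 1)).
  have : - (1 / 4) <= c * (expR t - 1) by nra.
  by nra.
have h2 : - (1 / 4) <= - (t * b) by move: t1; rewrite ler_norml; nra.
move: h1 h2; move: (c * (expR t - 1)) => E h1 h2; lra.
Qed.

Lemma bern_tail n k c eta : 0 <= c <= 1 -> 0 <= eta <= 1 -> (0 < n)%N ->
  eta <= `|c - k%:R / n%:R| -> bern n k c <= 4 * btail n eta.
Proof. by move=> hc he n0; apply: bern_tail_gen. Qed.

Definition bernp n k : {poly R} := 'C(n, k)%:R *: ('X ^+ k * (1 - 'X) ^+ (n - k)).

Lemma horner_bernp n k c : (bernp n k).[c] = bern n k c.
Proof.
by rewrite /bernp hornerZ hornerM hornerXn horner_exp hornerD hornerN hornerC hornerX.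
Qed.

Lemma size_bernp n k : (k <= n)%N -> (size (bernp n k) <= n.+1)%N.
Proof.
move=> kn; apply: leq_trans (size_scale_leq _ _) _.
apply: leq_trans (size_polyMleq _ _) _; rewrite size_polyXn /=.
have h : (size ((1 - 'X : {poly R}) ^+ (n - k)) <= (n - k).+1)%N.
  apply: leq_trans (size_poly_exp_leq _ _) _; rewrite ltnS.
  have -> : (size (1 - 'X : {poly R})) = 2%N.
    by rewrite -opprB size_polyN size_XsubC.
  by rewrite mul1n.
by apply: (leq_trans (leq_add (leqnn k) h)); rewrite addnS subnKC.
Qed.

(** Differentiation yields two Bernstein polynomials with degree, and possibly index, lowered by
    one; this is why [bern_tail_gen] tolerates such shifts. *)
Lemma deriv_bernp n k c : (k <= n.+1)%N ->
  (bernp n.+1 k)^`().[c] =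
  n.+1%:R * ((if k is k'.+1 then bern n k' c else 0) - bern n k c).
Proof.
move=> kn; rewrite /bernp derivZ derivM derivXn.
have dX : (1 - 'X : {poly R})^`() = - 1 by rewrite derivB derivC derivX sub0r.
have hX : (1 - 'X : {poly R}).[c] = 1 - c by rewrite hornerD hornerN hornerC hornerX.
have de j : ((1 - 'X : {poly R}) ^+ j)^`().[c] = - (j%:R * (1 - c) ^+ j.-1).
  rewrite deriv_exp dX hornerMn hornerM hornerN hornerC horner_exp hX -mulr_natl.
  by ring.
rewrite hornerZ hornerD !hornerM de hornerMn hornerXn horner_exp hX hornerXn /bern.
case: k kn => [|k] kn.
  rewrite mulr0n mul0r add0r !bin0 subn0 expr0 /= subn0 -natr1; ring.
rewrite /= subSS -mulr_natl.
have hb : (k.+1%:R : R) * 'C(n.+1, k.+1)%:R = n.+1%:R * 'C(n, k)%:R.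
  by rewrite -!natrM mul_bin_diag.
have [kn'|kn'] := leqP n k.
  have -> : k = n by apply/eqP; rewrite eqn_leq kn' -ltnS kn.
  rewrite subnn (bin_small (ltnSn n)) !binn /= expr0 !mul0r; ring.
have hb2 : ((n - k)%:R : R) * 'C(n.+1, k.+1)%:R = n.+1%:R * 'C(n, k.+1)%:R.
  rewrite -!natrM; congr (_%:R).
  by have := mul_bin_down n.+1 k.+1; rewrite subSS => ->.
rewrite -subnS; set a := (1 - c) ^+ (n - k); set b := (1 - c) ^+ (n - k.+1).
rewrite [RHS](_ : _ = n.+1%:R * 'C(n, k)%:R * (c ^+ k * a) -
   n.+1%:R * 'C(n, k.+1)%:R * (c ^+ k.+1 * b)); last by ring.
by rewrite -hb -hb2; ring.
Qed.

Lemma deriv_bernp_le n k c : 0 <= c <= 1 -> (k <= n)%N -> `|(bernp n k)^`().[c]| <= 2 * n%:R.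
Proof.
case: n => [|n] hc kn.
  have -> : k = 0%N by apply/eqP; rewrite -leqn0.
  by rewrite /bernp subn0 !expr0 mulr1 bin0 scale1r derivC horner0 normr0 mulr0.
rewrite deriv_bernp// normrM ger0_norm// mulrC ler_wpM2r//.
have h0 j := bern_ge0 n j hc; have h1 j := bern_le1 n j hc.
by case: k kn => [|k] kn; rewrite ler_norml;
  [have := h0 0%N; have := h1 0%N|have := h0 k; have := h1 k; have := h0 k.+1; have := h1 k.+1]; lra.
Qed.

Lemma deriv_bernp_tail n k c eta : 0 <= c <= 1 -> 0 <= eta <= 1 -> (0 < n)%N -> (k <= n)%N ->
  eta <= `|c - k%:R / n%:R| -> `|(bernp n k)^`().[c]| <= 8 * n%:R * btail n eta.
Proof.
case: n => [//|n] hc he n0 kn hk.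
rewrite deriv_bernp// normrM ger0_norm// -mulrA mulrCA ler_wpM2l//.
have h0 j := bern_ge0 n j hc.
have B1 : bern n k c <= 4 * btail n.+1 eta by apply: (bern_tail_gen (k := k)) => //.
have e0 : 0 <= btail n.+1 eta by exact: expR_ge0.
case: k kn hk B1 => [|k] kn hk B1.
  by rewrite ler_norml; have := h0 0%N; lra.
have B2 : bern n k c <= 4 * btail n.+1 eta by apply: (bern_tail_gen (k := k.+1)) => //.
by rewrite ler_norml; have := h0 k; have := h0 k.+1; lra.
Qed.

Lemma poly_lip p M (a b : R) : (forall c, 0 <= c <= 1 -> `|p^`().[c]| <= M) ->
  0 <= a <= 1 -> 0 <= b <= 1 -> `|p.[a] - p.[b]| <= M * `|a - b|.
Proof.
move=> h.
have H (x y : R) : 0 <= x -> x < y -> y <= 1 -> `|p.[y] - p.[x]| <= M * `|y - x|.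
  move=> x0 xy y1; have [c] := polyrcf.poly_mvt p xy; rewrite in_itv /= => /andP[c1 c2] ->.
  by rewrite normrM ler_wpM2r//; apply: h; lra.
move=> ha hb; have [ab|ba|->] := ltgtP a b; last by rewrite !subrr normr0 mulr0.
- by rewrite distrC (distrC a); apply: H; lra.
- by apply: H; lra.
Qed.

End Bernstein.

Lemma clamp_unit_lip (R : realType) (t u : R) :
  `|Num.max 0 (Num.min 1 t) - Num.max 0 (Num.min 1 u)| <= `|t - u|.
Proof.
have cE (x : R) : Num.max 0 (Num.min 1 x) = if x <= 0 then 0 else if x <= 1 then x else 1.
  case: leP => x0; first by rewrite max_l// ge_min x0 orbT.
  by case: (leP x 1) => x1; rewrite max_r// ltW.
have := ler_norm (t - u); have := ler_norm (u - t); have := normr_ge0 (t - u).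
rewrite (distrC u) ler_norml !cE; move: (`|t - u|) => y y0 h1 h2.
by case: (leP t 0) => a1; case: (leP u 0) => b1 //; try (case: (leP t 1) => a2);
  try (case: (leP u 1) => b2); apply/andP; split; lra.
Qed.

(** * A Bernstein partition of unity on the geometric mesh *)

Section Blocks.
Variable R : realType.
Variables (sigma : R) (L n : nat).
Hypothesis s01 : 0 < sigma < 1.
Hypothesis L2 : (2 <= L)%N.
Hypothesis n0 : (0 < n)%N.
Notation nd := (node sigma L).
Implicit Types (t u : R) (i k : nat) (p : {poly R}).

Definition cln i : R := nd i.+1 - nd i.
(** Local coordinate of cell [i], frozen at 0 and 1 outside it. Polynomials in it are thereby
    defined on the whole line and remain Lipschitz. *)
Definition cl i t : R := Num.max 0 (Num.min 1 ((t - nd i) / cln i)).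
Definition tp i k : R := nd i + cln i * (k%:R / n%:R).
(* The last Bernstein polynomial of cell [i] is multiplied by the first one of the
   next cell, which makes the family continuous across the node and telescoping. *)
Definition psi i k t : R := bern n k (cl i t) * (if k == n then (1 - cl i.+1 t) ^+ n else 1).

Lemma nodeE i : (1 <= i <= 2 * L)%N -> nd i =
  if (i <= L)%N then sigma ^+ (L - i) / 2 else 1 - sigma ^+ (i - L) / 2.
Proof. by move=> /andP[i1 i2]; rewrite /node gtn_eqF// i2. Qed.

(** The geometric grading: on every cell not touching the boundary, length and boundary distance are
    comparable. *)
Lemma cell_chi i t : (1 <= i < 2 * L)%N -> nd i <= t <= nd i.+1 ->
  [/\ 0 < cln i, sigma * cln i <= chi t & (1 - sigma) * chi t <= cln i].
Proof.
move=> /andP[i1 i2]; have /andP[s0 s1] := s01.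
rewrite /cln !nodeE ?i1 ?(ltnW i2)//.
(* Cells of the left half have the form [[y * sigma / 2, y / 2]] with [y] a power of [sigma]; [key2]
   is the mirror image. *)
have key (y : R) : 0 < y <= 1 -> y * sigma / 2 <= t <= y / 2 ->
   [/\ 0 < y / 2 - y * sigma / 2, sigma * (y / 2 - y * sigma / 2) <= chi t
   & (1 - sigma) * chi t <= y / 2 - y * sigma / 2].
  move=> hy ht; have -> : chi t = t.
    have t0 : 0 < t by apply: lt_le_trans (proj1 (andP ht)); rewrite divr_gt0// mulr_gt0//; lra.
    by rewrite chiE; do ![case: ifPn => ?]; lra.
  by split; nra.
have key2 (y : R) : 0 < y <= 1 -> 1 - y / 2 <= t <= 1 - y * sigma / 2 ->
   [/\ 0 < y / 2 - y * sigma / 2, sigma * (y / 2 - y * sigma / 2) <= chi t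
   & (1 - sigma) * chi t <= y / 2 - y * sigma / 2].
  move=> hy ht; have -> : chi t = 1 - t.
    have t0 : 0 < 1 - t.
      have : 0 < y * sigma / 2 by rewrite divr_gt0// mulr_gt0//; lra.
      lra.
    by rewrite chiE; do ![case: ifPn => ?]; lra.
  by split; nra.
have pw k : 0 < sigma ^+ k <= 1 by rewrite exprn_gt0 ?exprn_ile1 ?(ltW s0) ?(ltW s1).
case: (ltngtP i L) => iL.
- have e : sigma ^+ (L - i) = sigma ^+ (L - i.+1) * sigma by rewrite -(subnSK iL) exprSr.
  by rewrite e; exact: key.
- rewrite (subSn (ltnW iL)) exprSr => ht.
  have := key2 _ (pw (i - L)%N) ht.
  by rewrite (_ : 1 - _ - _ = sigma ^+ (i - L) / 2 - sigma ^+ (i - L) * sigma / 2)//; ring.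
- rewrite iL subnn subSnn expr0 expr1 => ht.
  have y1 : 0 < (1 : R) <= 1 by rewrite ltr01 lexx.
  have ht' : 1 - 1 / 2 <= t <= 1 - 1 * sigma / 2 by lra.
  have := key2 1 y1 ht'.
  by rewrite (_ : 1 - sigma / 2 - 1 / 2 = 1 / 2 - 1 * sigma / 2)//; field.
Qed.

Lemma cln_gt0 i : (1 <= i < 2 * L)%N -> 0 < cln i.
Proof.
move=> hi; have [h|h] := leP (nd i) (nd i.+1).
  by have [] := @cell_chi i (nd i) hi; rewrite ?lexx.
move: h; have /andP[s0 s1] := s01; case/andP: hi => i1 i2.
have pw k : 0 < sigma ^+ k by rewrite exprn_gt0.
rewrite !nodeE ?i1 ?(ltnW i2)//; case: (ltngtP i L) => iL.
- rewrite -(subnSK iL) exprSr; have := pw (L - i.+1)%N; nra.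
- rewrite (subSn (ltnW iL)) exprSr; have := pw (i - L)%N; nra.
- rewrite iL subnn subSnn expr0 expr1; lra.
Qed.

Lemma cl_in i t : 0 <= cl i t <= 1.
Proof.
rewrite /cl le_max lexx /= ge_max ler01 /=.
by rewrite ge_min lexx.
Qed.

Lemma cl_cell i t : (1 <= i < 2 * L)%N -> nd i <= t <= nd i.+1 ->
  t = nd i + cln i * cl i t /\ cl i t = (t - nd i) / cln i.
Proof.
move=> hi ht; have l0 := cln_gt0 hi.
have e : cl i t = (t - nd i) / cln i.
  have h0 : 0 <= (t - nd i) / cln i by rewrite divr_ge0 ?(ltW l0)// subr_ge0; lra.
  have h1 : (t - nd i) / cln i <= 1 by rewrite ler_pdivrMr// mul1r /cln; lra.
  by rewrite /cl (min_idPr h1) (max_idPr h0).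
by split => //; rewrite e; field; rewrite gt_eqF.
Qed.

Lemma cl_left i t : (1 <= i < 2 * L)%N -> t <= nd i -> cl i t = 0.
Proof.
move=> hi ht; have l0 := cln_gt0 hi; apply/max_idPl.
by rewrite ge_min; apply/orP; right; rewrite pmulr_lle0 ?invr_gt0// subr_le0.
Qed.

Lemma cl_right i t : (1 <= i < 2 * L)%N -> nd i.+1 <= t -> cl i t = 1.
Proof.
move=> hi ht; have l0 := cln_gt0 hi.
have h : 1 <= (t - nd i) / cln i by rewrite ler_pdivlMr// mul1r /cln; lra.
by rewrite /cl (min_idPl h); apply/max_idPr.
Qed.

Lemma cl_lip i t u : (1 <= i < 2 * L)%N -> `|cl i t - cl i u| <= (cln i)^-1 * `|t - u|.
Proof.
move=> hi; have l0 := cln_gt0 hi; rewrite /cl.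
have e : (t - nd i) / cln i - (u - nd i) / cln i = (cln i)^-1 * (t - u) by field; rewrite gt_eqF.
have -> : (cln i)^-1 * `|t - u| = `|(t - nd i) / cln i - (u - nd i) / cln i|.
  by rewrite e normrM gtr0_norm ?invr_gt0.
move: ((t - nd i) / cln i) ((u - nd i) / cln i) => a b.
exact: clamp_unit_lip.
Qed.

Lemma nd_mono i j : (1 <= i)%N -> (i <= j)%N -> (j <= 2 * L)%N -> nd i <= nd j.
Proof.
move=> i1; elim: j => [|j IH]; first by rewrite leqn0 => /eqP h; move: i1; rewrite h.
rewrite leq_eqVlt => /orP[/eqP ->//|ij] jL.
apply: le_trans (IH ij (ltnW jL)) _; rewrite -subr_ge0; apply: ltW; apply: cln_gt0.
by rewrite (leq_trans i1 ij).
Qed.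

Lemma psi_ge0 i k t : 0 <= psi i k t.
Proof.
have h1 := cl_in i t; have h2 := cl_in i.+1 t.
rewrite /psi mulr_ge0 ?bern_ge0//; case: ifP => // _.
by rewrite exprn_ge0// subr_ge0; case/andP: h2.
Qed.

Lemma psi_le1 i k t : psi i k t <= 1.
Proof.
have h1 := cl_in i t; have h2 := cl_in i.+1 t.
rewrite /psi -[leRHS](mulr1 1) ler_pM ?bern_ge0 ?bern_le1//.
  by case: ifP => // _; rewrite exprn_ge0//; lra.
case: ifP => // _; rewrite exprn_ile1//; lra.
Qed.

(** Each row sums to a difference of [(1 - cl) ^ n] for consecutive cells, and the rows telescope.
    The index [k = 0] is left out of a row because that polynomial already serves as the trailing
    factor of the preceding row. *)
Lemma psi_sum t : \sum_(1 <= i < (2 * L).-1) \sum_(1 <= k < n.+1) psi i k t =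
  (1 - cl (2 * L).-1 t) ^+ n - (1 - cl 1 t) ^+ n.
Proof.
have row i : (1 <= i < (2 * L).-1)%N -> \sum_(1 <= k < n.+1) psi i k t =
    (1 - cl i.+1 t) ^+ n - (1 - cl i t) ^+ n.
  move=> /andP[i1 i2].
  have hi : (1 <= i < 2 * L)%N by rewrite i1 (leq_trans i2) ?leq_pred.
  have hi1 : (1 <= i.+1 < 2 * L)%N by rewrite /= -ltn_predRL.
  have S := bern_sum n (cl i t); rewrite big_ord_recl /= bern0 in S.
  have e : (cl i t) ^+ n * (1 - cl i.+1 t) ^+ n = (cl i t) ^+ n + (1 - cl i.+1 t) ^+ n - 1.
    have [h|/ltW h] := leP t (nd i.+1); first by rewrite (cl_left hi1 h) subr0 expr1n; ring.
    by rewrite (cl_right hi h) expr1n; ring.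
  have [m nm] : exists m, n = m.+1 by exists n.-1; rewrite prednK.
  rewrite big_add1 /= [in X in \sum_(_ <= _ < X) _]nm big_nat_recr //= big_mkord.
  rewrite [X in X + _](_ : _ = 1 - (1 - cl i t) ^+ n - (cl i t) ^+ n); last first.
    rewrite nm -bern_sum_inner; apply: eq_bigr => k _.
    by rewrite /psi ltn_eqF ?mulr1 nm// ltnS; exact: ltn_ord.
  by rewrite -nm /psi eqxx bernn e; ring.
rewrite -(telescope_sumr (fun i => (1 - cl i t) ^+ n)); last by case: L L2 => [|[|l]].
by apply: eq_big_nat => i hi; apply: row.
Qed.

Lemma psi_sum_in t : 0 <= \sum_(1 <= i < (2 * L).-1) \sum_(1 <= k < n.+1) psi i k t <= 1.
Proof.
apply/andP; split; first by apply: sumr_ge0 => i _; apply: sumr_ge0 => k _; exact: psi_ge0.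
have h1 := cl_in (2 * L).-1 t; have h2 := cl_in 1 t.
rewrite psi_sum lerBlDr -[leLHS]addr0 lerD ?exprn_ge0 ?exprn_ile1//; lra.
Qed.

Lemma psi_sum1 t : nd 2 <= t <= nd (2 * L).-1 ->
  \sum_(1 <= i < (2 * L).-1) \sum_(1 <= k < n.+1) psi i k t = 1.
Proof.
move=> /andP[h1 h2]; have L4 : (4 <= 2 * L)%N by rewrite (leq_mul2l 2 2).
rewrite psi_sum cl_left ?cl_right//.
- by rewrite subrr subr0 expr1n expr0n gtn_eqF// subr0.
- by rewrite (leq_trans _ L4).
- by case: (2 * L)%N L4 => // -[|l] //= _; rewrite ltnS leqnn.
Qed.

(** A block with [k = n] extends over two cells, but its sample point [tp i n] is their common node,
    so [t] and the sample point always share a cell. *)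
Lemma psi_supp i k t : (1 <= i < (2 * L).-1)%N -> (1 <= k <= n)%N -> psi i k t != 0 ->
  exists j, [/\ (1 <= j < 2 * L)%N, nd j <= t <= nd j.+1, nd j <= tp i k <= nd j.+1 &
    (j = i) \/ (k = n /\ j = i.+1)].
Proof.
move=> /andP[i1 i2] /andP[k1 k2].
have hi : (1 <= i < 2 * L)%N by rewrite i1 (leq_trans i2) ?leq_pred.
have hi1 : (1 <= i.+1 < 2 * L)%N by rewrite /= -ltn_predRL.
have l0 := cln_gt0 hi; have l1 := cln_gt0 hi1.
have hk : 0 <= (k%:R / n%:R : R) <= 1.
  by rewrite divr_ge0//= ler_pdivrMr ?ltr0n// mul1r ler_nat.
have htp : nd i <= tp i k <= nd i.+1.
  rewrite /tp; move: hk l0; rewrite /cln; move: (k%:R / n%:R) => y hy; nra.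
rewrite /psi => hp.
have [tl|tl] := leP t (nd i).
  by move: hp; rewrite (cl_left hi tl) bern_at0 gtn_eqF// mul0r eqxx.
have [tr|tr] := leP t (nd i.+1).
  by exists i; split => //; [lra|left].
have kn : k = n.
  apply/eqP; apply: contraNT hp => kn.
  by rewrite (cl_right hi (ltW tr)) bern_at1// (negbTE kn) mul0r.
exists i.+1; split => //; last by right.
  rewrite (ltW tr) /= leNgt; apply/negP => tr2; move: hp.
  by rewrite kn eqxx (cl_right hi1 (ltW tr2)) subrr expr0n gtn_eqF// mulr0 eqxx.
rewrite /tp kn divff ?pnatr_eq0 ?gtn_eqF// mulr1 /cln subrKC lexx /=.
by move: l1; rewrite /cln subr_gt0 => /ltW.
Qed.

Section BlockProduct.
Variables (i k : nat) (pl : {poly R}) (h B0 B1 N0 N1 : R).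
Hypothesis hi : (1 <= i < (2 * L).-1)%N.
Hypothesis hk : (1 <= k <= n)%N.
Hypothesis h01 : 0 <= h <= 1.
Notation rho := (chi (tp i k)).
Hypothesis hB0 : forall j t, (1 <= j < 2 * L)%N -> (j = i \/ j = i.+1) ->
  nd j <= tp i k <= nd j.+1 -> nd j <= t <= nd j.+1 ->
  `|pl.[t]| <= B0 /\ rho * `|pl^`().[t]| <= B1.
Hypothesis hN0 : forall t, `|t - tp i k| <= h * rho -> `|pl.[t]| <= N0 /\ rho * `|pl^`().[t]| <= N1.
Hypothesis B00 : 0 <= B0.
Hypothesis B10 : 0 <= B1.
Hypothesis N00 : 0 <= N0.
Hypothesis N10 : 0 <= N1.

Notation E := (btail n (h * sigma)).
(** Derivative bound, in the local coordinate, for a Bernstein polynomial times [pl]. Within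
    [h * rho] of the sample point the moderate bounds [N0] and [N1] are used; elsewhere the large
    bounds [B0] and [B1] are damped by the Bernstein tail [E]. *)
Definition blockM := 2 * n%:R * N0 + N1 / sigma + E * (8 * n%:R * B0 + 4 * (B1 / sigma)).
Definition theta t := psi i k t * pl.[t].

Let hi0 : (1 <= i < 2 * L)%N.
Proof. by case/andP: hi => i1 i2; rewrite i1 (leq_trans i2) ?leq_pred. Qed.

Let hi1 : (1 <= i.+1 < 2 * L)%N.
Proof. by case/andP: hi => i1 i2; rewrite /= -ltn_predRL. Qed.

Let k01 : 0 <= (k%:R / n%:R : R) <= 1.
Proof.
case/andP: hk => k1 k2.
by rewrite divr_ge0//= ler_pdivrMr ?ltr0n// mul1r ler_nat.
Qed.

Let tp_in : nd i <= tp i k <= nd i.+1.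
Proof. by have := cln_gt0 hi0; rewrite /tp; move: k01; rewrite /cln; move: (k%:R / n%:R) => y; nra. Qed.

Let tp_n : k = n -> tp i k = nd i.+1.
Proof. by move=> ->; rewrite /tp divff ?pnatr_eq0 ?gtn_eqF// mulr1 /cln subrKC. Qed.

Let tp_in1 : k = n -> nd i.+1 <= tp i k <= nd i.+2.
Proof. by move=> /tp_n ->; have := cln_gt0 hi1; rewrite /cln => h1; lra. Qed.

Let eta01 : 0 <= h * sigma <= 1.
Proof. by have := s01; have := h01; nra. Qed.

Let pc j l : {poly R} := bernp R n l * (pl \Po (cln j *: 'X + (nd j)%:P)).

Let pcE j l c : (pc j l).[c] = bern n l c * pl.[nd j + cln j * c].
Proof.
rewrite /pc hornerM horner_bernp horner_comp hornerD hornerZ hornerX hornerC.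
by rewrite (addrC (nd j)).
Qed.

Let pc_deriv j l c : (1 <= j < 2 * L)%N -> (j = i \/ j = i.+1) -> (l <= n)%N ->
  nd j <= tp i k <= nd j.+1 -> tp i k = nd j + cln j * (l%:R / n%:R) -> 0 <= c <= 1 ->
  `|(pc j l)^`().[c]| <= blockM.
Proof.
move=> hj hji ln htp etp hc; have l0 := cln_gt0 hj; have /andP[s0 s1] := s01.
set t := nd j + cln j * c.
have ht : nd j <= t <= nd j.+1 by rewrite /t; move: l0; rewrite /cln; nra.
have [_ c1 c2] := cell_chi hj htp.
have -> : (pc j l)^`().[c] = (bernp R n l)^`().[c] * pl.[t] + bern n l c * (pl^`().[t] * cln j).
  have dq : (cln j *: 'X + (nd j)%:P : {poly R})^`() = (cln j)%:P.
    by rewrite derivD derivZ derivX derivC addr0 alg_polyC.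
  have hq : (cln j *: 'X + (nd j)%:P : {poly R}).[c] = t.
    by rewrite hornerD hornerZ hornerX hornerC addrC.
  by rewrite /pc derivM hornerD !hornerM deriv_comp hornerM !horner_comp horner_bernp dq hq hornerC.
apply: le_trans (ler_normD _ _) _.
rewrite (normrM (bernp R n l)^`().[c]) (normrM (bern n l c)) (normrM pl^`().[t]).
rewrite (ger0_norm (bern_ge0 n l hc)) (gtr0_norm l0).
have r0 : 0 < rho by apply: lt_le_trans c1; rewrite mulr_gt0.
have lr : cln j <= rho / sigma by rewrite ler_pdivlMr// mulrC.
have d0 : 0 <= `|pl^`().[t]| by [].
have e0 : 0 <= E by exact: expR_ge0.
have n0' : 0 <= n%:R :> R by [].
have b0 := bern_ge0 n l hc; have b1 := bern_le1 n l hc.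
have dl X : rho * `|pl^`().[t]| <= X -> `|pl^`().[t]| * cln j <= X / sigma.
  move=> hX; apply: (@le_trans _ _ (`|pl^`().[t]| * (rho / sigma))); first by rewrite ler_wpM2l.
  by rewrite mulrA ler_wpM2r ?invr_ge0 ?(ltW s0)// mulrC.
have P1 : 0 <= 2 * n%:R * N0 + N1 / sigma.
  by rewrite addr_ge0 ?mulr_ge0 ?invr_ge0 ?(ltW s0).
have P2 : 0 <= E * (8 * n%:R * B0 + 4 * (B1 / sigma)).
  by rewrite mulr_ge0// addr_ge0 ?mulr_ge0 ?invr_ge0 ?(ltW s0).
have [near|far] := leP `|t - tp i k| (h * rho).
  have [h1 h2] := hN0 near.
  apply: (@le_trans _ _ (2 * n%:R * N0 + N1 / sigma)); last by rewrite /blockM lerDl.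
  apply: lerD; first by apply: ler_pM => //; exact: deriv_bernp_le.
  by apply: le_trans (dl _ h2); rewrite ler_piMl// mulr_ge0// ltW.
have [h1 h2] := hB0 hj hji htp ht.
have hf : h * sigma <= `|c - l%:R / n%:R|.
  rewrite -(ler_pM2l l0) -[X in _ <= X * _](gtr0_norm l0) -normrM.
  rewrite (_ : cln j * (c - _) = t - tp i k); last by rewrite etp /t; ring.
  apply: le_trans (ltW far); rewrite mulrCA ler_wpM2l//; first by case/andP: h01.
  by rewrite mulrC.
apply: (@le_trans _ _ (E * (8 * n%:R * B0 + 4 * (B1 / sigma)))); last by rewrite /blockM lerDr.
rewrite [leRHS]mulrDr; apply: lerD.
  rewrite mulrA (mulrC E); apply: ler_pM => //; exact: deriv_bernp_tail.
rewrite [leRHS](_ : _ = 4 * E * (B1 / sigma)); last by ring.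
apply: ler_pM => //; [by rewrite mulr_ge0// ltW|exact: bern_tail|exact: dl].
Qed.

(** Clamping turns the product into a sum: for [k = n] one of the two local coordinates is always
    frozen at the common node, where both polynomials take the value [pl.[nd i.+1]]. Lipschitz
    bounds can then be taken term by term. *)
Lemma theta_split t : theta t = (pc i k).[cl i t] +
  (if k == n then (pc i.+1 0).[cl i.+1 t] - pl.[nd i.+1] else 0).
Proof.
case/andP: hk => k1 k2; have l0 := cln_gt0 hi0; have l1 := cln_gt0 hi1.
have e1 : nd i + cln i = nd i.+1 by rewrite /cln subrKC.
rewrite /theta /psi !pcE.
have [tl|tl] := leP t (nd i).
  rewrite (cl_left hi0 tl) (cl_left hi1 (_ : t <= nd i.+1)); last by move: l0; rewrite /cln; lra.
  rewrite !bern_at0 (gtn_eqF k1) eqxx !mul0r add0r mulr0 addr0 mul1r subrr.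
  by case: ifP.
have [tm|tm] := leP t (nd i.+1).
  have ht : nd i <= t <= nd i.+1 by rewrite tm ltW.
  have [e _] := cl_cell hi0 ht.
  rewrite (cl_left hi1 tm) subr0 expr1n mulr0 addr0 bern_at0 eqxx mul1r subrr -e if_same mulr1.
  by rewrite if_same addr0.
rewrite (cl_right hi0 (ltW tm)) bern_at1// mulr1 e1.
case: eqP => [_|_]; last by rewrite !mul0r addr0.
rewrite !mul1r bern0 addrCA subrr addr0.
have [tr|tr] := leP t (nd i.+2).
  have ht : nd i.+1 <= t <= nd i.+2 by rewrite tr ltW.
  by have [<- _] := cl_cell hi1 ht.
by rewrite (cl_right hi1 (ltW tr)) subrr expr0n gtn_eqF// !mul0r.
Qed.

Lemma blockM_ge0 : 0 <= blockM.
Proof.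
have /andP[s0 s1] := s01; have e0 : 0 <= E by exact: expR_ge0.
by rewrite addr_ge0 ?addr_ge0 ?mulr_ge0 ?addr_ge0 ?mulr_ge0 ?invr_ge0 ?(ltW s0).
Qed.

Lemma rho_gt0 : 0 < rho.
Proof.
have [l0 c1 _] := cell_chi hi0 tp_in; apply: lt_le_trans c1.
by rewrite mulr_gt0//; case/andP: s01.
Qed.

Lemma theta_lip t u : `|theta t - theta u| <= 2 * blockM / ((1 - sigma) * rho) * `|t - u|.
Proof.
have M0 := blockM_ge0; have r0 := rho_gt0; have /andP[s0 s1] := s01.
have q0 : 0 < (1 - sigma) * rho by rewrite mulr_gt0// subr_gt0.
have k2 : (k <= n)%N by case/andP: hk.
have piece j l : (1 <= j < 2 * L)%N -> (j = i \/ j = i.+1) -> (l <= n)%N ->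
    nd j <= tp i k <= nd j.+1 -> tp i k = nd j + cln j * (l%:R / n%:R) ->
    `|(pc j l).[cl j t] - (pc j l).[cl j u]| <= blockM / ((1 - sigma) * rho) * `|t - u|.
  move=> hj hji ln htp etp.
  apply: le_trans (poly_lip (M := blockM) _ (cl_in j t) (cl_in j u)) _.
    by move=> c hc; apply: pc_deriv.
  rewrite -mulrA ler_wpM2l//; apply: le_trans (cl_lip t u hj) _.
  rewrite ler_wpM2r// lef_pV2 ?posrE ?(cln_gt0 hj)//.
  by have [] := cell_chi hj htp.
have p1 := piece i k hi0 (or_introl erefl) k2 tp_in erefl.
have c0 : 0 <= blockM / ((1 - sigma) * rho) * `|t - u|.
  by rewrite mulr_ge0// mulr_ge0// invr_ge0 ltW.
rewrite (_ : 2 * _ / _ * _ = blockM / ((1 - sigma) * rho) * `|t - u| + blockM / ((1 - sigma) * rho) * `|t - u|);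
  last by ring.
rewrite !theta_split; case: eqP => [kn|_]; last first.
  by rewrite !addr0; apply: le_trans p1 _; rewrite lerDl.
have etp : tp i k = nd i.+1 + cln i.+1 * (0%:R / n%:R).
  by rewrite tp_n// mul0r mulr0 addr0.
have p2 := piece i.+1 0%N hi1 (or_intror erefl) (leq0n _) (tp_in1 kn) etp.
rewrite (_ : _ - _ = ((pc i k).[cl i t] - (pc i k).[cl i u]) +
  ((pc i.+1 0).[cl i.+1 t] - (pc i.+1 0).[cl i.+1 u])); last by ring.
by apply: le_trans (ler_normD _ _) _; exact: lerD.
Qed.

Lemma psi_far t : h * rho < `|t - tp i k| -> psi i k t <= 4 * E.
Proof.
move=> far; have e0 : 0 <= E by exact: expR_ge0.
have [->|hp] := eqVneq (psi i k t) 0; first exact: mulr_ge0.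
have [j [hj ht htp hji]] := psi_supp hi hk hp.
have l0 := cln_gt0 hj; have [_ c1 c2] := cell_chi hj htp.
have [et ec] := cl_cell hj ht.
have tail l : tp i k = nd j + cln j * (l%:R / n%:R) -> bern n l (cl j t) <= 4 * E.
  move=> etp; apply: bern_tail => //; first exact: cl_in.
  rewrite -(ler_pM2l l0) -[X in _ <= X * _](gtr0_norm l0) -normrM.
  rewrite (_ : cln j * (cl j t - _) = t - tp i k); last by rewrite etp {2}et; ring.
  apply: le_trans (ltW far); rewrite mulrCA ler_wpM2l//; first by case/andP: h01.
  by rewrite mulrC.
have h1 := cl_in i t; have h2 := cl_in i.+1 t.
case: hji => [ji|[kn ji]].
  rewrite ji in tail et ec *; apply: le_trans (tail k erefl).
  rewrite /psi ler_piMr ?bern_ge0//; case: ifP => // _; rewrite exprn_ile1//; lra.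
rewrite ji in tail; apply: (@le_trans _ _ (bern n 0 (cl i.+1 t))).
  by rewrite /psi kn eqxx bern0 ler_piMl ?bern_le1// exprn_ge0//; lra.
by apply: tail; rewrite tp_n// mul0r mulr0 addr0.
Qed.

Lemma theta_bound t : `|theta t| <= N0 + 4 * E * B0.
Proof.
have e0 : 0 <= E by exact: expR_ge0.
have b0 : 0 <= 4 * E * B0 by rewrite !mulr_ge0.
have p0 := psi_ge0 i k t; have p1 := psi_le1 i k t.
have [hp|hp] := eqVneq (psi i k t) 0; first by rewrite /theta hp mul0r normr0 addr_ge0.
have [j [hj ht htp hji]] := psi_supp hi hk hp.
rewrite /theta normrM (ger0_norm p0).
have [near|far] := leP `|t - tp i k| (h * rho).
  have [h1 _] := hN0 near; apply: (@le_trans _ _ N0); last by rewrite lerDl.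
  by apply: le_trans h1; rewrite ler_piMl.
have hji' : j = i \/ j = i.+1 by case: hji => [|[_]]; [left|right].
have [h1 _] := hB0 hj hji' htp ht.
apply: (@le_trans _ _ (4 * E * B0)); last by rewrite lerDr.
by apply: ler_pM => //; exact: psi_far.
Qed.

Lemma psi_out t : t <= nd i \/ nd i.+2 <= t -> psi i k t = 0.
Proof.
have k1 : (0 < k)%N by case/andP: hk.
have k2 : (k <= n)%N by case/andP: hk.
have l1 := cln_gt0 hi1.
case=> ht; rewrite /psi; first by rewrite (cl_left hi0 ht) bern_at0 gtn_eqF// mul0r.
rewrite (cl_right hi1 ht) (cl_right hi0 (_ : nd i.+1 <= t)); last by move: l1; rewrite /cln; lra.
rewrite bern_at1//; case: eqP => _; last by rewrite mul0r.
by rewrite subrr expr0n gtn_eqF// mulr0.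
Qed.

Lemma theta_out t : ~~ (0 < t < 1) -> theta t = 0.
Proof.
move=> ht; rewrite /theta psi_out ?mul0r//.
have := nd_bounds L s01 i; have := nd_bounds L s01 i.+2; lra.
Qed.

Lemma theta_cell j : (j <= 2 * L)%N -> exists p : {poly R},
  (size p <= n + size pl)%N /\ forall t, nd j < t < nd j.+1 -> theta t = p.[t].
Proof.
move=> jL; have i1 : (1 <= i)%N by case/andP: hi.
have comp (l e : nat) : (1 <= e < 2 * L)%N -> (l <= n)%N -> exists p : {poly R},
    (size p <= n + size pl)%N /\ forall t, nd e <= t <= nd e.+1 -> bern n l (cl e t) * pl.[t] = p.[t].
  move=> he ln; have l0 := cln_gt0 he.
  pose q : {poly R} := (cln e)^-1 *: ('X - (nd e)%:P).
  have sq : size q = 2%N by rewrite size_scale ?size_XsubC// invr_eq0 gt_eqF.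
  exists ((bernp R n l \Po q) * pl); split.
    apply: leq_trans (size_polyMleq _ _) _; rewrite size_comp_poly2//.
    have := size_bernp R ln; case: (size (bernp R n l)) => [|z] hz /=.
      by rewrite add0n (leq_trans (leq_pred _))// leq_addl.
    by rewrite leq_add2r.
  move=> t ht; have [_ ec] := cl_cell he ht.
  rewrite hornerM horner_comp horner_bernp ec /q hornerZ hornerXsubC.
  by rewrite (mulrC (cln e)^-1).
have zero : (forall t, nd j < t < nd j.+1 -> theta t = 0) -> exists p : {poly R},
    (size p <= n + size pl)%N /\ forall t, nd j < t < nd j.+1 -> theta t = p.[t].
  by move=> h0; exists 0; rewrite size_poly0; split => // t ht; rewrite h0// horner0.
have k2 : (k <= n)%N by case/andP: hk.
have i2L : (i.+2 <= 2 * L)%N by case/andP: hi1.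
have [ji|ij] := ltnP j i.
  apply: zero => t ht; rewrite /theta psi_out ?mul0r//; left.
  by have := @nd_mono j.+1 i isT ji (ltnW (ltnW i2L)); lra.
have [ij2|ji2] := ltnP i.+1 j.
  apply: zero => t ht; rewrite /theta psi_out ?mul0r//; right.
  by have := @nd_mono i.+2 j isT ij2 jL; lra.
have [ij'|ij'] := eqVneq j i.
  have [p [sp hp]] := comp k i hi0 k2; exists p; split => // t; rewrite ij' => ht.
  have ht' : nd i <= t <= nd i.+1 by lra.
  rewrite -hp// /theta /psi (cl_left hi1); last by lra.
  by rewrite subr0 expr1n if_same mulr1.
have {ij' ij ji2} -> : j = i.+1 by apply/eqP; rewrite eqn_leq ji2 ltn_neqAle eq_sym ij'.
have [p [sp hp]] := comp 0%N i.+1 hi1 (leq0n _).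
have [kn|kn] := eqVneq k n.
  exists p; split => // t ht.
  have ht' : nd i.+1 <= t <= nd i.+2 by lra.
  rewrite -hp// /theta /psi (cl_right hi0); last by lra.
  by rewrite kn eqxx bern_at1// eqxx mul1r bern0.
exists 0; rewrite size_poly0; split => // t ht.
rewrite horner0 /theta /psi (cl_right hi0); last by lra.
by rewrite bern_at1// (negbTE kn) !mul0r.
Qed.

End BlockProduct.

End Blocks.

(** * Power series of the deformed kernel *)

(* The Taylor coefficients of [(q0 + q1 t + q2 t^2) ^ (- p)] at [t = 0] obey the
   three-term recursion given by the differential equation [Q S' = - p Q' S]. *)
Section QuadraticPower.
Variable R : realType.
Variables (q0 q1 q2 p : R).
Hypotheses (q00 : 0 < q0) (hq1 : `|q1| <= 2 * q0) (hq2 : `|q2| <= q0) (hp : 0 <= p <= 5 / 2).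

Fixpoint qcoef2 (n : nat) : R * R :=
  if n is n'.+1 then let: (c, d) := qcoef2 n' in
    (d, - (((p + n'.+1%:R) * q1 * d + (2 * p + n'%:R) * q2 * c) / (n'.+2%:R * q0)))
  else (q0 `^ (- p), - (p * q1 * q0 `^ (- p) / q0)).
Definition qcoef n := (qcoef2 n).1.

Lemma qcoefS n : (qcoef2 n).2 = qcoef n.+1.
Proof. by rewrite /qcoef /=; case: (qcoef2 n). Qed.

Lemma qcoef0 : qcoef 0 = q0 `^ (- p). Proof. by []. Qed.

Lemma qcoef1 : q0 * qcoef 1 = - (p * q1 * qcoef 0).
Proof. by rewrite /qcoef /=; field; rewrite gt_eqF. Qed.

Lemma qcoefSS n : n.+2%:R * q0 * qcoef n.+2 =
  - ((p + n.+1%:R) * q1 * qcoef n.+1 + (2 * p + n%:R) * q2 * qcoef n).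
Proof.
have h : qcoef n.+2 = - (((p + n.+1%:R) * q1 * qcoef n.+1 + (2 * p + n%:R) * q2 * qcoef n) / (n.+2%:R * q0)).
  by rewrite -[in LHS]qcoefS /= -!qcoefS /qcoef; case: (qcoef2 n).
rewrite h; have : (n.+2%:R : R) != 0 by rewrite pnatr_eq0.
move: (n.+2%:R : R) => N N0; field.
by rewrite N0 gt_eqF.
Qed.

(** Induction on two consecutive coefficients. The growth 6 suffices because [12 * (p + n + 1) + (2
    * p + n) <= 36 * (n + 2)] for [p <= 5 / 2]. *)
Lemma qcoef_bound n : `|qcoef n| <= q0 `^ (- p) * 6 ^+ n.
Proof.
have c0 : 0 <= q0 `^ (- p) by exact: powR_ge0.
suff H : `|qcoef n| <= q0 `^ (- p) * 6 ^+ n /\ `|qcoef n.+1| <= q0 `^ (- p) * 6 ^+ n.+1.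
  by have [] := H.
set C := q0 `^ (- p) in c0 *.
elim: n => [|n [IH1 IH2]].
  have h0 : `|qcoef 0| = C by rewrite qcoef0 ger0_norm.
  split; first by rewrite h0 expr0 mulr1.
  have := congr1 Num.norm qcoef1; rewrite normrN !normrM (gtr0_norm q00) h0.
  rewrite (@ger0_norm _ p); last by case/andP: hp.
  move=> h; rewrite expr1 -(ler_pM2l q00) h.
  have : p * `|q1| <= 5 / 2 * (2 * q0) by apply: ler_pM => //; case/andP: hp.
  move=> h1; apply: (le_trans (ler_wpM2r c0 h1)).
  have := mulr_ge0 (ltW q00) c0; set x := q0 * C => x0.
  rewrite (_ : 5 / 2 * (2 * q0) * C = 5 * x); last by rewrite /x; field.
  by rewrite (_ : q0 * (C * 6) = 6 * x); [lra|rewrite /x; ring].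
split=> //.
have := congr1 Num.norm (qcoefSS n); rewrite normrN => h.
have p0 : 0 <= p by case/andP: hp.
have n20 : 0 < (n.+2%:R : R) by rewrite ltr0n.
have h2 : n.+2%:R * q0 * `|qcoef n.+2| <=
    (5 / 2 + n.+1%:R) * (2 * q0) * (C * 6 ^+ n.+1) + (5 + n%:R) * q0 * (C * 6 ^+ n).
  have -> : n.+2%:R * q0 * `|qcoef n.+2| = `|n.+2%:R * q0 * qcoef n.+2|.
    by rewrite !normrM (gtr0_norm q00) (gtr0_norm n20).
  rewrite h; apply: (le_trans (ler_normD _ _)); rewrite !normrM.
  have pn k : 0 <= p + k%:R by rewrite addr_ge0.
  rewrite (ger0_norm (pn _)) (@ger0_norm _ (2 * p + n%:R)); last by rewrite addr_ge0// mulr_ge0.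
  apply: lerD; do 2?[apply: ler_pM => //]; rewrite ?mulr_ge0 ?addr_ge0//; rewrite ?lerD2r; move: hp; lra.
rewrite -(ler_pM2l (mulr_gt0 n20 q00)); apply: (le_trans h2).
have y0 : 0 <= q0 * (C * 6 ^+ n) by rewrite mulr_ge0 ?(ltW q00)// mulr_ge0// exprn_ge0.
rewrite !exprS; move: y0; set y := 6 ^+ n.
rewrite (_ : n.+2%:R = n%:R + 2 :> R); last by rewrite -addn2 natrD.
rewrite (_ : n.+1%:R = n%:R + 1 :> R); last by rewrite -addn1 natrD.
have := ler0n R n; move: (n%:R : R) => N N0 y0.
rewrite -subr_ge0 (_ : _ - _ = (23 * N + 25) * (q0 * (C * y))); last by field.
by rewrite mulr_ge0//; lra.
Qed.

Let Q t : R := q0 + q1 * t + q2 * t ^+ 2.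

Lemma Q_gt0 t : `|t| < 1 / 4 -> q0 / 4 <= Q t.
Proof.
move=> ht; have h1 : `|q1 * t| <= 2 * q0 * (1 / 4).
  by rewrite normrM; apply: ler_pM => //; exact: ltW.
have h2 : `|q2 * t ^+ 2| <= q0 * (1 / 4 * (1 / 4)).
  by rewrite normrM normrX ler_pM ?exprn_ge0// expr2 ler_pM// ltW.
by move: h1 h2; rewrite !ler_norml /Q; move: q00; lra.
Qed.

Section Partial.
Variable t : R.
Hypothesis ht : `|t| <= 1 / 12.
Let a n := qcoef n * t ^+ n.
Let SN N : {poly R} := \sum_(n < N) a n *: 'X^n.
Let QP : {poly R} := q0%:P + (q1 * t) *: 'X + (q2 * t ^+ 2) *: 'X^2.

Let QPE x : QP.[x] = Q (t * x).
Proof. by rewrite /QP !(hornerD, hornerZ, hornerC, hornerX, hornerXn) /Q; ring. Qed.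

Let QP'E x : QP^`().[x] = q1 * t + 2 * (q2 * t ^+ 2) * x.
Proof. by rewrite /QP !(derivD, derivZ, derivC, derivX, derivXn) !(hornerD, hornerZ, hornerC, hornerMn, hornerXn) /= -mulr_natl; ring. Qed.

(** A partial sum satisfies the differential equation up to two top-order terms, those whose
    partners in the recursion were cut off. *)
Let DN N x : QP.[x] * (SN N.+1)^`().[x] + p * QP^`().[x] * (SN N.+1).[x] =
  - (N.+1%:R * q0 * a N.+1 * x ^+ N) + (N%:R + 2 * p) * (q2 * t ^+ 2) * a N * x ^+ N.+1.
Proof.
rewrite QPE QP'E; elim: N => [|N IH].
  rewrite /SN big_ord1 /= expr0 alg_polyC derivC !hornerC /a expr0 !expr1.
  have := qcoef1; move: (qcoef 0) (qcoef 1) => c0 c1 h.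
  rewrite (_ : 1 * q0 * (c1 * t) * 1 = q0 * c1 * t); last by ring.
  by rewrite h; ring.
have -> : SN N.+2 = SN N.+1 + a N.+1 *: 'X^(N.+1) by rewrite /SN big_ord_recr.
rewrite derivD derivZ derivXn !hornerD !hornerZ hornerXn hornerMn hornerXn /=.
rewrite [LHS](_ : _ = (Q (t * x) * (SN N.+1)^`().[x] + p * (q1 * t + 2 * (q2 * t ^+ 2) * x) * (SN N.+1).[x]) +
  a N.+1 * (N.+1%:R * x ^+ N * Q (t * x) + p * (q1 * t + 2 * (q2 * t ^+ 2) * x) * x ^+ N.+1)); last first.
  by rewrite -mulr_natl; ring.
rewrite IH /a /Q !exprS.
have h : N.+2%:R * q0 * (qcoef N.+2 * (t * (t * t ^+ N))) =
    - ((p + N.+1%:R) * q1 * qcoef N.+1 + (2 * p + N%:R) * q2 * qcoef N) * (t * (t * t ^+ N)).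
  by rewrite -qcoefSS; ring.
rewrite h (_ : N.+1%:R = N%:R + 1 :> R); last by rewrite -addn1 natrD.
by ring.
Qed.

(** A partial sum times [Q ^ p] equals 1 at the origin, and its derivative is [Q ^ (p - 1)] times
    the defect in [DN]. By the mean value theorem on the segment from 0 to [t], parametrised by
    [[0, 1]], the product at [t] tends to 1. *)
Lemma qsum_cvg : \sum_(n < N) qcoef n * t ^+ n @[N --> \oo] --> Q t `^ (- p).
Proof.
have p0 : 0 <= p by case/andP: hp.
have Qpos (x : R) : x \in `[0, 1]%R -> q0 / 4 <= QP.[x] <= 4 * q0.
  rewrite in_itv /= => /andP[x0 x1]; have tx : `|t * x| <= 1 / 12.
    by rewrite normrM (ger0_norm x0) -[leRHS]mulr1 ler_pM.
  rewrite QPE Q_gt0 /=; last by apply: le_lt_trans tx _; lra.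
  have h1 : `|q1 * (t * x)| <= 2 * q0 * (1 / 12) by rewrite normrM ler_pM.
  have h2 : `|q2 * (t * x) ^+ 2| <= q0 * (1 / 12 * (1 / 12)).
    by rewrite normrM normrX expr2 ler_pM// ?mulr_ge0// ler_pM.
  by move: h1 h2; rewrite !ler_norml /Q; move: q00; lra.
have Qp (x : R) : x \in `[0, 1]%R -> 0 < QP.[x].
  by move=> /Qpos /andP[h _]; apply: lt_le_trans h; rewrite divr_gt0.
pose C1 := (4 * q0) `^ p * (4 / q0).
have C10 : 0 <= C1 by rewrite mulr_ge0 ?powR_ge0// divr_ge0// ltW.
have main N : `|(SN N.+1).[1] * QP.[1] `^ p - 1| <= C1 * (q0 `^ (- p) * q0 * 16 * (5 / 8) ^+ N).
  pose ph x := (SN N.+1).[x] * QP.[x] `^ p.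
  pose dph x := QP.[x] `^ (p - 1) * (QP.[x] * (SN N.+1)^`().[x] + p * QP^`().[x] * (SN N.+1).[x]).
  have dphE (x : R) : x \in `[0, 1]%R -> is_derive x 1 ph (dph x).
    move=> hx; have q := Qp _ hx.
    have d1 : is_derive x 1 (fun x => QP.[x] `^ p) (p * QP.[x] `^ (p - 1) * QP^`().[x]).
      exact: (@is_derive1_comp R (fun y => y `^ p) (horner QP) x _ _ (is_derive1_powR p q) (is_derive_poly QP x)).
    have d2 := is_deriveM (is_derive_poly (SN N.+1) x) d1.
    apply: is_derive_eq d2 _; rewrite /dph /GRing.scale /=.
    have -> : QP.[x] `^ p = QP.[x] `^ (p - 1) * QP.[x].
      by rewrite -{3}(powRr1 (ltW q)) -powRD ?subrK// (gt_eqF q) implybT.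
    by ring.
  have H1 (x : R) : x \in `]0, 1[ -> is_derive x 1 ph (dph x).
    by rewrite in_itv /= => /andP[x0 x1]; apply: dphE; rewrite in_itv /= (ltW x0) (ltW x1).
  have H2 : {within `[0, 1], continuous ph}.
    by apply: derivable_within_continuous => x hx; exact: (@ex_derive _ _ _ _ _ _ _ (dphE _ hx)).
  have [x hx] := MVT_segment ler01 H1 H2.
  - rewrite subr0 mulr1.
    have -> : ph 0 = 1.
      rewrite /ph QPE mulr0 /Q mulr0 expr0n /= mulr0 !addr0 /SN big_ord_recl hornerD horner_sum big1.
        rewrite addr0 /= hornerZ hornerXn expr0 mulr1 /a expr0 mulr1 qcoef0.
        by rewrite powRN mulVf// gt_eqF// powR_gt0.
      by move=> i _; rewrite hornerZ hornerXn expr0n /= mulr0.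
    move=> ->; rewrite /dph DN normrM; apply: ler_pM => //.
      have /andP[l u] := Qpos _ hx; have q := Qp _ hx.
      rewrite ger0_norm ?powR_ge0// powRB ?(gt_eqF q) ?implybT// powRr1 ?(ltW q)//.
      apply: ler_pM; rewrite ?powR_ge0 ?invr_ge0 ?(ltW q)//.
        by apply: ge0_ler_powR; rewrite ?nnegrE ?(ltW q)// mulr_ge0// ltW.
      by rewrite -[leRHS]invf_div lef_pV2 ?posrE// divr_gt0.
    have /andP[x0 x1] : 0 <= x <= 1 by move: hx; rewrite in_itv.
    have xk k : `|x ^+ k| <= 1 by rewrite normrX exprn_ile1// (ger0_norm x0).
    set c0 := q0 `^ (- p); have c00 : 0 <= c0 by exact: powR_ge0.
    have ak k : `|a k| <= c0 * (1 / 2) ^+ k.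
      have e : `|t| ^+ k <= (1 / 12) ^+ k by apply: lerXn2r; rewrite ?nnegrE ?divr_ge0.
      rewrite /a normrM normrX.
      apply: (le_trans (ler_pM (normr_ge0 _) (exprn_ge0 _ (normr_ge0 _)) (qcoef_bound k) e)).
      by rewrite -/c0 -mulrA -exprMn ler_wpM2l// (_ : 6 * (1 / 12) = 1 / 2)//; field.
    apply: (le_trans (ler_normD _ _)); rewrite normrN.
    have t2 : `|q2| * `|t ^+ 2| <= q0.
      rewrite -[leRHS]mulr1 ler_pM// normrX exprn_ile1//; apply: le_trans ht _; lra.
    have e1 : `|N.+1%:R * q0 * a N.+1 * x ^+ N| <= (N%:R + 1) * q0 * (c0 * (1 / 2) ^+ N) * 1.
      rewrite (normrM _ (x ^+ N)) (normrM _ (a N.+1)) (normrM _ q0) normr_nat (gtr0_norm q00) -natr1; apply: ler_pM; rewrite ?mulr_ge0 ?addr_ge0 ?(ltW q00)//.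
      rewrite ler_wpM2l ?mulr_ge0 ?addr_ge0 ?(ltW q00)//; apply: le_trans (ak _) _.
      rewrite ler_wpM2l// exprS ler_piMl ?exprn_ge0 ?divr_ge0//; lra.
    have e2 : `|(N%:R + 2 * p) * (q2 * t ^+ 2) * a N * x ^+ N.+1| <=
       (N%:R + 5) * q0 * (c0 * (1 / 2) ^+ N) * 1.
      rewrite (normrM _ (x ^+ N.+1)) (normrM _ (a N)) (normrM _ (q2 * _)) (normrM q2).
      apply: ler_pM; rewrite ?mulr_ge0//; apply: ler_pM; rewrite ?mulr_ge0//; apply: ler_pM; rewrite ?mulr_ge0//.
      by rewrite ger0_norm ?addr_ge0 ?mulr_ge0// lerD2l; move: hp; lra.
    apply: (le_trans (lerD e1 e2)); rewrite !mulr1 -!mulrDl.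
    (* The factor linear in [N] in the defect is absorbed by [(5 / 4) ^ N]; together with the decay
       [(1 / 2) ^ N] of the terms this leaves the rate [5 / 8]. *)
    have bern : N%:R + 4 <= 4 * (5 / 4 : R) ^+ N.
      elim: (N) => [|k IH]; first by rewrite expr0; lra.
      by rewrite exprS -natr1; have := ler0n R k; move: IH; lra.
    have -> : (5 / 8 : R) ^+ N = (5 / 4) ^+ N * (1 / 2) ^+ N.
      by rewrite -exprMn; congr (_ ^+ _); field.
    rewrite [leRHS](_ : _ = q0 * (c0 * (1 / 2) ^+ N) * (16 * (5 / 4) ^+ N)); last by ring.
    rewrite [leLHS](_ : _ = q0 * (c0 * (1 / 2) ^+ N) * (N%:R + 1 + (N%:R + 5))); last by ring.
    apply: ler_wpM2l; first by rewrite mulr_ge0 ?(ltW q00)// mulr_ge0// exprn_ge0// divr_ge0.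
    by have := ler0n R N; move: bern; lra.
have lim0 : C1 * (q0 `^ (- p) * q0 * 16 * (5 / 8) ^+ N) @[N --> \oo] --> (0 : R).
  rewrite -[X in _ --> X](mulr0 C1); apply: cvgMr; rewrite -[X in _ --> X](mulr0 (q0 `^ (- p) * q0 * 16)); apply: cvgMr.
  by apply: cvg_expr; rewrite ger0_norm ?divr_ge0//; lra.
have one : (1 : R) \in `[0, 1]%R by rewrite in_itv /= ler01 lexx.
have lim1 : (SN N.+1).[1] * QP.[1] `^ p @[N --> \oo] --> (1 : R).
  apply/cvgrPdist_lt => e e0; near=> N; rewrite distrC.
  apply: le_lt_trans (main N) _; near: N.
  by apply: (cvgr_lt (0 : R)).
have Q1 : Q t = QP.[1] by rewrite QPE mulr1.
have lim2 : (SN N.+1).[1] @[N --> \oo] --> Q t `^ (- p).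
  rewrite Q1 powRN -[X in _ --> X]mul1r.
  rewrite (_ : (fun N => (SN N.+1).[1]) = (fun N => (SN N.+1).[1] * QP.[1] `^ p * (QP.[1] `^ p)^-1)).
    by apply: cvgMl.
  by apply/funext => N; rewrite mulfK// gt_eqF// powR_gt0// Qp.
rewrite -cvg_shiftS; move: lim2; apply: cvg_trans; apply: near_eq_cvg.
near=> N; rewrite /SN horner_sum; apply: eq_bigr => i _.
by rewrite hornerZ hornerXn expr1n mulr1.
Unshelve. all: by end_near.
Qed.

End Partial.

End QuadraticPower.

(** * Dimension of the spline space *)

Section Dimension.
Variable R : realType.
Notation X3 := (R * R * R)%type.

Lemma dependent_rows (N : nat) (I : finType) (c : 'I_N -> I -> R) : (#|I| < N)%N ->
  exists2 a : 'I_N -> R, (exists i, a i != 0) & forall j, \sum_(i < N) a i * c i j = 0.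
Proof.
move=> hN; pose M := \matrix_(i < N, j < #|I|) c i (enum_val j).
have : kermx M != 0.
  rewrite kermx_eq0 /row_free neq_ltn; apply/orP; left.
  by apply: leq_ltn_trans hN; exact: rank_leq_col.
move=> /rowV0Pn[v /sub_kermxP vM v0].
exists (fun i => v 0 i).
  apply: contrapT => h; move/eqP: v0; apply; apply/rowP => i; rewrite mxE.
  by apply: contrapT => /eqP vi; apply: h; exists i.
move=> j; have := congr1 (fun A : 'rV_#|I| => A 0 (enum_rank j)) vM.
rewrite !mxE => h; rewrite -[RHS]h; apply: eq_bigr => i _.
by rewrite mxE enum_rankK.
Qed.

(** With more basis functions than polynomial coefficients over all boxes, some nontrivial
    combination has all its coefficients zero. It vanishes at generic points, hence everywhere by
    the Lipschitz bound, against independence. This is the link between a rate in [L] and a rate in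
    [N]. *)
Lemma W_dim (sigma : R) (L q N : nat) : 0 < sigma < 1 -> (1 <= L)%N ->
  has_dim (W sigma L q) N -> (N <= (2 * L).+1 ^ 3 * q.+1 ^ 3)%N.
Proof.
move=> s01 L1 [bs [hb ind _]]; rewrite leqNgt; apply/negP => hN.
pose n := (2 * L).+1.
pose J := ('I_n * 'I_n * 'I_n * ('I_q.+1 * 'I_q.+1 * 'I_q.+1))%type.
have cJ : #|{: J}| = (n ^ 3 * q.+1 ^ 3)%N.
  by rewrite !card_prod !card_ord /n; ring.
have hc (t : 'I_N * ('I_n * 'I_n * 'I_n)) : exists c : 'I_q.+1 -> 'I_q.+1 -> 'I_q.+1 -> R,
    forall x, box sigma L t.2.1.1 t.2.1.2 t.2.2 x -> bs t.1 x =
    \sum_(a < q.+1) \sum_(b < q.+1) \sum_(e < q.+1) c a b e * c1 x ^+ a * c2 x ^+ b * c3 x ^+ e.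
  have [_ _ H] := hb t.1.
  have lt (i : 'I_n) : (i <= 2 * L)%N by rewrite -ltnS; exact: ltn_ord.
  have [p [[c hc] hp]] := H _ _ _ (lt t.2.1.1) (lt t.2.1.2) (lt t.2.2).
  by exists c => x hx; rewrite hp.
have [C hC] := choice hc.
have [|a [i0 ai0] ha] := @dependent_rows N J (fun i j =>
    C (i, j.1) j.2.1.1 j.2.1.2 j.2.2); first by rewrite cJ.
move/eqP: ai0; apply; apply: ind => x.
pose v x := \sum_(i < N) a i * bs i x.
have vbox i j k y : (i <= 2 * L)%N -> (j <= 2 * L)%N -> (k <= 2 * L)%N ->
    box sigma L i j k y -> v y = 0.
  move=> hi hj hk hy.
  pose t : 'I_n * 'I_n * 'I_n := (Ordinal (hi : (i < n)%N), Ordinal (hj : (j < n)%N), Ordinal (hk : (k < n)%N)).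
  transitivity (\sum_(l < N) \sum_(a1 < q.+1) \sum_(b < q.+1) \sum_(e < q.+1)
      (a l * C (l, t) a1 b e) * (c1 y ^+ a1 * c2 y ^+ b * c3 y ^+ e)).
    apply: eq_bigr => l _; rewrite (hC (l, t) y hy) mulr_sumr; apply: eq_bigr => a1 _.
    rewrite mulr_sumr; apply: eq_bigr => b _; rewrite mulr_sumr; apply: eq_bigr => e _.
    by ring.
  rewrite exchange_big big1// => a1 _; rewrite exchange_big big1// => b _.
  rewrite exchange_big big1// => e _; rewrite -mulr_suml.
  by have /= -> := ha (t, (a1, b, e)); rewrite mul0r.
have vgen y : Omega y -> generic sigma L y -> v y = 0.
  move=> [h1 h2 h3] gy.
  have [i ? ?] := generic_cell h1 (gy A1).
  have [j ? ?] := generic_cell h2 (gy A2).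
  have [k ? ?] := generic_cell h3 (gy A3).
  by apply: (vbox i j k).
have vout y : ~ Omega y -> v y = 0.
  by move=> hy; apply: big1 => i _; have [_ -> //] := hb i; rewrite mulr0.
have vcont : exists2 K, 0 <= K & forall y z, `|v y - v z| <= K * edist y z.
  have /choice[K hK] : forall i, exists K, 0 <= K /\ forall y z, `|bs i y - bs i z| <= K * edist y z.
    by move=> i; have [K K0 h] := W_lip s01 (hb i); exists K.
  exists (\sum_(i < N) `|a i| * K i).
    by apply: sumr_ge0 => i _; rewrite mulr_ge0//; have [] := hK i.
  move=> y z; rewrite /v -sumrB mulr_suml; apply: le_trans (ler_norm_sum _ _ _) _.
  apply: ler_sum => i _; rewrite -mulrBr normrM -mulrA ler_wpM2l//.
  by have [] := hK i.
have [K K0 lip] := vcont.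
apply/eqP; rewrite -normr_le0; apply/ler_addgt0Pr => e e0; rewrite add0r -/(v x).
have d0 : 0 < e / (2 * (K + 1)) by rewrite divr_gt0// mulr_gt0// ltr_wpDl.
have [r [/andP[r0 re] gr]] := generic_near sigma L x d0.
have := lip x (x.1.1 + r, x.1.2 + r, x.2 + r).
have -> : v (x.1.1 + r, x.1.2 + r, x.2 + r) = 0.
  have [h|h] := pselect (Omega (x.1.1 + r, x.1.2 + r, x.2 + r)); first exact: vgen.
  exact: vout.
rewrite subr0 => /le_trans; apply.
apply: (@le_trans _ _ (K * (2 * r))); first by rewrite ler_wpM2l// edist_shift1// ltW.
move: re; rewrite ltr_pdivlMr ?mulr_gt0 ?ltr_wpDl// => re; nra.
Qed.

End Dimension.

(** * Positivity of the normalizing constant *)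

Section GammaPositive.
Variable R : realType.
Implicit Types (x t : R).

Let g x t : R := if 0 < t then t `^ (x - 1) * expR (- t) else 0.

Lemma exp_tail t : 0 < t -> expR (- t) <= 24 / t ^+ 4.
Proof.
move=> t0; rewrite expRN -[leRHS]invf_div lef_pV2 ?posrE ?expR_gt0 ?divr_gt0 ?exprn_gt0//.
have := expR_ge1Dxn 3 (ltW t0); rewrite (_ : (4`!)%:R = 24 :> R); last by rewrite !factS fact0.
by move=> h; apply: le_trans h; rewrite lerDr.
Qed.

Let mg x : measurable_fun setT (g x).
Proof.
apply: measurable_fun_ifT => //; first exact: measurable_fun_ltr.
apply: measurable_funM; first exact: measurable_powR.
by apply: measurableT_comp; [exact: measurable_expR|exact: oppr_measurable].
Qed.

Let g_ge0 x t : 0 <= g x t.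
Proof. by rewrite /g; case: ifP => // _; rewrite mulr_ge0 ?powR_ge0 ?expR_ge0. Qed.

Let hpx x : 0 < x -> 0 <= (1 / 2 : R) `^ x < 1.
Proof. exact: hp_lt1. Qed.

(** An infinite integral would be read as the real number zero, so positivity of [Gamma_pos]
    requires finiteness first. The range of [x] covers [1 - s] and [s + 3 / 2]. *)
Lemma Gamma_fin x : 0 < x <= 5 / 2 -> (\int[@lebesgue_measure R]_t (g x t)%:E < +oo)%E.
Proof.
move=> /andP[x0 x1]; have /andP[h0 h1] := hpx x0.
pose lo t := if t < 1 then g x t else 0.
pose hi t := if t < 1 then 0 else g x t.
have mlo : measurable_fun setT lo.
  by apply: measurable_fun_ifT => //; exact: measurable_fun_ltr.
have mhi : measurable_fun setT hi.
  by apply: measurable_fun_ifT => //; exact: measurable_fun_ltr.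
have lo0 t : 0 <= lo t by rewrite /lo; case: ifP.
have hi0 t : 0 <= hi t by rewrite /hi; case: ifP.
have -> : (\int[@lebesgue_measure R]_t (g x t)%:E =
   \int[@lebesgue_measure R]_t ((lo t)%:E + (hi t)%:E))%E.
  by apply: eq_integral => t _; rewrite -EFinD /lo /hi; case: ifP => _; rewrite ?addr0 ?add0r.
have plo t : (0 <= (lo t)%:E)%E by rewrite lee_fin.
have phi t : (0 <= (hi t)%:E)%E by rewrite lee_fin.
have /= -> := ge0_intD mu1 (measurable_EF mlo) (measurable_EF mhi) plo phi.
have B (T : R) : 0 <= T -> (lebesgue_measure (`]0%R, T[%classic : set R) <= T%:E)%E.
  by move=> T0; rewrite lebesgue_measure_itv /= lte_fin; case: ifP => _; rewrite ?sube0 ?lee_fin.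
apply: lte_add_pinfty.
- apply: (@le_lt_trans _ _ (4 / (1 - (1 / 2) `^ x))%:E); last exact: ltry.
  pose y (j : nat) : R := (1 / 2) ^+ j.
  have y0 j : 0 < y j by rewrite exprn_gt0//; lra.
  apply: (@integral_cover_le _ _ R mu1 lo (fun j => (`]0%R, y j[%classic : set R))
    (fun j => 4 * y j `^ (x - 1)) y) => //.
  + by move=> j; apply: B; exact: ltW.
  + by move=> j; rewrite mulr_ge0// powR_ge0.
  + move=> t; rewrite /lo /g; case: ifP => [t1|]; last by left.
    case: ifP => [t0|]; last by left.
    right; have [j /andP[]] := dyadic_down t0 t1.
    rewrite [X in X <= _](mul1r (y j.+1)) [X in _ < X](mul1r (y j)) => h2 h3.
    exists j; first by rewrite /= in_itv /= t0.
    apply: (@le_trans _ _ (t `^ (x - 1))).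
      by rewrite ler_piMr ?powR_ge0// -expR0 ler_expR oppr_le0 ltW.
    have yS : y j.+1 = y j / 2 by rewrite /y exprS; field.
    have [x2|x2] := leP 1 x.
      apply: (@le_trans _ _ (y j `^ (x - 1))); last by rewrite ler_peMl ?powR_ge0//; lra.
      by apply: ge0_ler_powR; rewrite ?nnegrE ?subr_ge0 ?(ltW t0) ?(ltW (y0 j)) ?(ltW h3).
    apply: (@le_trans _ _ (y j.+1 `^ (x - 1))).
      by rewrite -(opprB 1 x); apply: powRN_le => //; lra.
    rewrite yS powRM ?(ltW (y0 j))// mulrC ler_wpM2r ?powR_ge0//.
    rewrite -(opprB 1 x) powRV// invrK.
    apply: (@le_trans _ _ (2 `^ 1)); last by rewrite powRr1//; lra.
    by apply: ler_powR; lra.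
  + move=> N; apply: (@le_trans _ _ (\sum_(j < N) 4 * ((1 / 2) `^ x) ^+ j)).
      apply: ler_sum => j _; rewrite -mulrA ler_wpM2l//.
      rewrite -{2}(powRr1 (ltW (y0 j))) -powRD ?(gt_eqF (y0 j)) ?implybT// subrK.
      by rewrite /y powRX// divr_ge0.
    by rewrite -mulr_sumr ler_wpM2l// geo_sum_le// h0.
(* At infinity the power of [t] is at most [t ^+ 2], since [x <= 5 / 2], and [exp_tail] supplies
   [24 / t ^+ 4]. *)
- apply: (@le_lt_trans _ _ (48 / (1 - 1 / 2))%:E); last exact: ltry.
  apply: (@integral_cover_le _ _ R mu1 hi (fun j => (`]0%R, 2%R ^+ j.+1[%classic : set R))
    (fun j => 24 * ((1 / 2) ^+ j) ^+ 2) (fun j => 2 ^+ j.+1)) => //.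
  + by move=> j; apply: B; exact: exprn_ge0.
  + move=> t; rewrite /hi /g; case: ltP => [|t1]; first by left.
    have t0 : 0 < t by exact: lt_le_trans t1.
    rewrite t0; right; have [j] := dyadic_up ltr01 t1; rewrite !mul1r => /andP[h2 h3].
    exists j; first by rewrite /= in_itv /= t0.
    apply: (@le_trans _ _ (t ^+ 2 * (24 / t ^+ 4))).
      apply: ler_pM; rewrite ?powR_ge0 ?expR_ge0 ?exp_tail//.
      by rewrite -(powR_mulrn 2 (ltW t0)) ler_powR//; lra.
    rewrite [leLHS](_ : _ = 24 * (t^-1) ^+ 2); last by field; lra.
    rewrite ler_wpM2l// lerXn2r ?nnegrE ?invr_ge0 ?(ltW t0) ?exprn_ge0 ?divr_ge0//.
    by rewrite exprVn lef_pV2 ?posrE ?exprn_gt0.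
  + move=> N; apply: (@le_trans _ _ (\sum_(j < N) 48 * (1 / 2) ^+ j)).
      apply: ler_sum => j _; rewrite (exprS 2 j) [leRHS](_ : _ = 48 * (1 / 2) ^+ j * 1); last by ring.
      rewrite [leLHS](_ : _ = 48 * (1 / 2) ^+ j * ((1 / 2) ^+ j * 2 ^+ j)); last by ring.
      by rewrite -exprMn mul1r mulVf// expr1n.
    by rewrite -mulr_sumr ler_wpM2l// geo_sum_le//; lra.
Qed.

Lemma Gamma_pos_gt0 x : 0 < x <= 5 / 2 -> 0 < Gamma_pos x.
Proof.
move=> hx; have x0 : 0 < x by case/andP: hx.
have e : (\int[@lebesgue_measure R]_(t in `]0%R, +oo[) (t `^ (x - 1) * expR (- t))%:E =
   \int[@lebesgue_measure R]_t (g x t)%:E)%E.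
  rewrite integral_mkcond; apply: eq_integral => t _.
  by rewrite /patch /g mem_setE in_itv /= andbT; case: ifP.
rewrite /Gamma_pos /Rintegral e.
have fy := Gamma_fin hx.
have ig0 : (0 <= \int[@lebesgue_measure R]_t (g x t)%:E)%E.
  by apply: integral_ge0 => t _; rewrite lee_fin.
rewrite -lte_fin fineK; last by rewrite ge0_fin_numE.
(* A lower bound for the integrand on [[1, 2]], whatever the sign of [x - 1]. *)
pose c := Num.min 1 (2 `^ (x - 1)) * expR (- 2).
have c0 : 0 < c by rewrite mulr_gt0 ?expR_gt0// lt_min ltr01 powR_gt0.
apply: (@lt_le_trans _ _ (\int[@lebesgue_measure R]_t (c * \1_(`[1, 2]%classic : set R) t)%:E)%E).
  under eq_integral do rewrite EFinM.
  have mi : measurable_fun setT (fun t => (\1_(`[1, 2]%classic : set R) t)%:E : \bar R).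
    by apply: measurable_EF; exact: measurable_indic.
  have i0 t : (0 <= (\1_(`[1, 2]%classic : set R) t)%:E :> \bar R)%E by rewrite lee_fin.
  rewrite (ge0_intZ mu1 (ltW c0) mi i0).
  have -> : (\int[mu1]_t (\1_(`[1%R, 2%R]%classic : set R) t)%:E = 1%:E)%E.
    rewrite integral_indic// setIT.
    have h : lebesgue_measure (`[1%R, 2%R]%classic : set R) = 1%:E.
      by rewrite lebesgue_measure_itv /= lte_fin ltr1n -EFinB; congr (_%:E); ring.
    exact: h.
  by rewrite -EFinM lte_fin mulr1.
apply: ge0_le_int => [||t|t].
- by apply: measurable_EF; apply: measurable_funM => //; exact: measurable_indic.
- exact: (measurable_EF (mg x)).
- by rewrite lee_fin mulr_ge0 ?(ltW c0).
- rewrite lee_fin indicE; case: (boolP (t \in _)) => [|_]; last by rewrite mulr0.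
  rewrite mem_setE in_itv /= => /andP[t1 t2]; rewrite mulr1 /g (lt_le_trans ltr01 t1).
  apply: ler_pM; rewrite ?expR_ge0 ?ler_expR ?lerN2 ?le_min ?ler01 ?powR_ge0//.
  rewrite ge_min; have [x1|x1] := leP 1 x.
    by rewrite -[X in X <= _](powRr0 t) ler_powR// subr_ge0.
  apply/orP; right; rewrite -(opprB 1 x); apply: powRN_le => //; [exact: lt_le_trans t1|lra].
Qed.

(** [Gamma (- s)] is [Gamma_pos (1 - s)] divided by [- s], a negative number, which cancels the
    leading minus sign. *)
Lemma Cs_gt0 (s : R) : 0 < s < 1 -> 0 < Cs s.
Proof.
move=> /andP[s0 s1]; rewrite /Cs /Gamma.
have e1 : 0 < s + 3 / 2 by lra.
have e2 : (0 < - s) = false by apply/negbTE; rewrite -leNgt; lra.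
rewrite e1 e2.
have g1 : 0 < Gamma_pos (s + 3 / 2) by apply: Gamma_pos_gt0; lra.
have g2 : 0 < Gamma_pos (- s + 1) by apply: Gamma_pos_gt0; lra.
have pi1 : 0 < (pi : R) `^ (3 / 2) by rewrite powR_gt0// pi_gt0.
have p2 : 0 < (2 : R) `^ (2 * s) by rewrite powR_gt0.
have aux (a b p h t : R) : p != 0 -> h != 0 -> t != 0 ->
  - a * b / (p * (h / - t)) = a * b * t / (p * h) by move=> p0 h0 t0; field; rewrite ?oppr_eq0 p0 h0 t0.
rewrite aux ?gt_eqF//; exact: divr_gt0 (mulr_gt0 (mulr_gt0 p2 g1) s0) (mulr_gt0 pi1 g2).
Qed.

End GammaPositive.

(** * Lagrange polynomials *)

Section LagrangeBounds.
Variable R : realType.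
Implicit Types (a : nat -> R) (m j l : nat) (t xi g w : R).

Lemma prod_poly_bound (s : seq nat) (f : nat -> {poly R}) (D : nat -> R) (W V t : R) :
  0 <= W -> 0 <= V -> (forall l, 0 <= D l) ->
  (forall l, l \in s -> `|(f l).[t]| <= D l * W /\ `|(f l)^`().[t]| <= D l * V) ->
  `|(\prod_(l <- s) f l).[t]| <= \prod_(l <- s) D l * W ^+ size s /\
  W * `|(\prod_(l <- s) f l)^`().[t]| <= (size s)%:R * V * (\prod_(l <- s) D l * W ^+ size s).
Proof.
move=> W0 V0 D0; elim: s => [|l s IH] h.
  by rewrite !big_nil /= hornerC normr1 derivC horner0 normr0 mulr0 !mul0r mul1r.
have [|h1 h2] := IH; first by move=> e he; apply: h; rewrite inE he orbT.
have [h3 h4] := h l (mem_head _ _).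
rewrite !big_cons /= derivM hornerD !hornerM exprS.
set P := \prod_(l <- s) D l in h1 h2 *; have P0 : 0 <= P by exact: prodr_ge0.
set S := W ^+ size s in h1 h2 *; have S0 : 0 <= S by exact: exprn_ge0.
split.
  rewrite normrM [leRHS](_ : _ = (D l * W) * (P * S)); last by ring.
  exact: ler_pM.
apply: (@le_trans _ _ (W * (`|(f l)^`().[t]| * `|(\prod_(l <- s) f l).[t]| +
    `|(f l).[t]| * `|(\prod_(l <- s) f l)^`().[t]|))).
  by rewrite ler_wpM2l// -!normrM ler_normD.
rewrite mulrDr [leRHS](_ : _ = W * ((D l * V) * (P * S)) + (D l * W) * ((size s)%:R * V * (P * S)));
  last by rewrite -natr1; ring.
apply: lerD; first by rewrite ler_wpM2l// ler_pM.
by rewrite mulrCA; apply: ler_pM => //; rewrite mulr_ge0.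
Qed.

(** The quotient of [m ^ m] by the factorial is one term of the exponential series at [m], and
    [expR 1 <= 4]. *)
Lemma powm_le_fact m : (m%:R : R) ^+ m <= 4 ^+ m * m`!%:R.
Proof.
case: m => [|m]; first by rewrite !expr0 fact0 mul1r.
have h := @expR_ge1Dxn R m.+1%:R m (ler0n _ _).
have h4 : expR m.+1%:R <= 4 ^+ m.+1 :> R.
  rewrite -(mulr1 m.+1%:R) expRM_natl lerXn2r ?nnegrE ?expR_ge0//.
  exact: expR1_le4.
have f0 : 0 < (m.+1)`!%:R :> R by rewrite ltr0n fact_gt0.
rewrite -ler_pdivrMr//; apply: le_trans h4; apply: le_trans h.
by rewrite lerDr.
Qed.

Lemma prod_dist_fact m j : (j < m)%N ->
  \prod_(l <- [seq l <- iota 0 m | l != j]) `|j%:R - l%:R : R| = (j`! * (m.-1 - j)`!)%:R.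
Proof.
move=> jm; have e : iota 0 m = index_iota 0 m by rewrite /index_iota subn0.
rewrite big_filter e (big_cat_nat _ (n := j)) //=; last exact: ltnW.
rewrite big_nat_cond [X in X * _](_ : _ = \prod_(0 <= l < j) (j - l)%:R); last first.
  rewrite -big_nat_cond big_mkcond /=; apply: eq_big_nat => l /andP[_ lj].
  by rewrite ltn_eqF// -natrB ?ger0_norm// ltnW.
rewrite [X in _ * X]big_ltn_cond//= eqxx /=.
rewrite [X in _ * X](_ : _ = \prod_(j.+1 <= l < m) (l - j)%:R); last first.
  rewrite big_mkcond /=; apply: eq_big_nat => l /andP[jl _].
  by rewrite gtn_eqF// distrC -natrB ?ger0_norm// ltnW.
rewrite natrM; congr (_ * _).
  elim: j {jm} => [|j IH]; first by rewrite big_nil fact0.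
  rewrite big_nat_recl//= subn0 factS natrM -IH; congr (_ * _).
rewrite -{1}(add0n j.+1) big_addn (_ : m - j.+1 = m.-1 - j)%N; last by rewrite -subn1 -subnDA add1n.
elim: (m.-1 - j)%N => [|z IH]; first by rewrite big_nil fact0.
rewrite big_nat_recr//= IH factS natrM mulrC; congr (_%:R * _).
by rewrite -addSnnS addnK.
Qed.

Variables (e0 : R) (m : nat).
Hypothesis e00 : 0 < e0.
Hypothesis m0 : (0 < m)%N.

Definition enode (l : nat) : R := e0 * (2 * l%:R / m%:R - 1).

Lemma enode_inj : injective enode.
Proof.
move=> i j /(mulfI (lt0r_neq0 e00)) /(addIr (-1)) h; apply/eqP; rewrite -(eqr_nat R).
have mm : m%:R != 0 :> R by rewrite pnatr_eq0 gtn_eqF.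
by move/(congr1 (fun y => y * m%:R / 2)): h => h; apply/eqP; move: h; rewrite !divfK// !(mulrC 2) !mulfK ?pnatr_eq0.
Qed.

Lemma enode_bound l : (l < m)%N -> `|enode l| <= e0.
Proof.
move=> lm; rewrite /enode normrM gtr0_norm// ler_piMr ?(ltW e00)//.
have h : 0 <= (l%:R / m%:R : R) <= 1.
  by rewrite divr_ge0//= ler_pdivrMr ?ltr0n// mul1r ler_nat ltnW.
by rewrite -mulrA ler_norml; lra.
Qed.

(** The Lagrange basis in the rescaled variable [(t - xi) / g]. For [g = chi xi] this variable is
    the deformation parameter that carries [xi] to [t]. *)
Definition lagp j xi g : {poly R} := \prod_(l <- [seq l <- iota 0 m | l != j])
  ((enode j - enode l)^-1 *: (g^-1 *: ('X - xi%:P) - (enode l)%:P)).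

Lemma horner_lagp j xi g t : (lagp j xi g).[t] = lag enode m j ((t - xi) / g).
Proof.
rewrite /lagp horner_prod; apply: eq_bigr => l _.
by rewrite hornerZ hornerD hornerN hornerC hornerZ hornerXsubC mulrC (mulrC g^-1).
Qed.

Let sz j : (j < m)%N -> size [seq l <- iota 0 m | l != j] = m.-1.
Proof.
move=> jm; rewrite size_filter.
have := count_predC (pred1 j) (iota 0 m); rewrite size_iota count_uniq_mem ?iota_uniq// mem_iota jm.
by rewrite /= => h; rewrite -[in RHS]h add1n.
Qed.

Lemma size_lagp j xi g : (j < m)%N -> (size (lagp j xi g) <= m)%N.
Proof.
move=> jm; have {1}-> : m = m.-1.+1 by rewrite prednK.
rewrite -(sz jm) /lagp; elim: [seq _ <- _ | _] => [|l s IH].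
  by rewrite big_nil size_poly1.
rewrite big_cons; apply: leq_trans (size_polyMleq _ _) _ => /=.
have h : (size ((enode j - enode l)^-1 *: (g^-1 *: ('X - xi%:P) - (enode l)%:P)) <= 2)%N.
  apply: leq_trans (size_scale_leq _ _) _; apply: leq_trans (size_polyD _ _) _.
  rewrite geq_max size_polyN (leq_trans (size_polyC_leq1 _))// andbT.
  by apply: leq_trans (size_scale_leq _ _) _; rewrite size_XsubC.
by have := leq_add h IH; rewrite addSn add1n; case: (_ + _)%N.
Qed.

(** The number [w] measures the distance from [xi] in units of the interpolation radius [e0 * g].
    For equispaced nodes the denominators are products of two factorials; a binomial coefficient
    below [2 ^ m.-1] and [powm_le_fact] turn them into the factor [4 ^ m]. *)
Lemma lagp_bound j xi g w t : (j < m)%N -> 0 < g -> 1 <= w -> `|t - xi| <= w * e0 * g ->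
  `|(lagp j xi g).[t]| <= (4 * (1 + w)) ^+ m /\
  g * `|(lagp j xi g)^`().[t]| <= m%:R / e0 * (4 * (1 + w)) ^+ m.
Proof.
move=> jm g0 w1 ht; have mR : 0 < m%:R :> R by rewrite ltr0n.
pose W := (1 + w) * e0; pose D l := `|enode j - enode l|^-1.
have W0 : 0 < W by rewrite mulr_gt0//; lra.
have D0 l : 0 <= D l by rewrite invr_ge0.
have gV0 : 0 < g^-1 by rewrite invr_gt0.
have tau : `|(t - xi) / g| <= w * e0 by rewrite normrM normfV (gtr0_norm g0) ler_pdivrMr.
have [l|h1 h2] := @prod_poly_bound [seq l <- iota 0 m | l != j] (fun l =>
  ((enode j - enode l)^-1 *: (g^-1 *: ('X - xi%:P) - (enode l)%:P))) D W g^-1 t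
  (ltW W0) (ltW gV0) D0.
  rewrite mem_filter mem_iota /= => /andP[_ lm]; split.
    rewrite hornerZ hornerD hornerN hornerC hornerZ hornerXsubC normrM normfV ler_wpM2l//.
    apply: (@le_trans _ _ (`|(t - xi) / g| + `|enode l|)); first by rewrite (mulrC g^-1) ler_normB.
    rewrite /W (mulrDl 1 w) mul1r addrC lerD//.
    exact: enode_bound.
  rewrite derivZ derivB derivC subr0 derivZ derivXsubC hornerZ hornerZ hornerC mulr1.
  by rewrite normrM normfV (normfV g) (gtr0_norm g0).
have main : \prod_(l <- [seq l <- iota 0 m | l != j]) D l * W ^+ m.-1 <= (4 * (1 + w)) ^+ m.
  have eD l : D l = (2 * e0 / m%:R)^-1 * `|j%:R - l%:R|^-1.
    rewrite -invfM /D; congr (_^-1).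
    have c0 : 0 <= 2 * e0 / m%:R by rewrite divr_ge0 ?mulr_ge0 ?(ltW e00).
    rewrite -[X in _ = X * _](ger0_norm c0) -normrM; congr (`|_|).
    by rewrite /enode; field; rewrite gt_eqF.
  have -> : \prod_(l <- [seq l <- iota 0 m | l != j]) D l =
      (2 * e0 / m%:R) ^- m.-1 * ((j`! * (m.-1 - j)`!)%:R)^-1.
    under eq_bigr do rewrite eD.
    rewrite big_split /= -(prod_dist_fact jm) -exprVn -(sz jm).
    congr (_ * _); last by rewrite prodfV.
    by rewrite big_const_seq count_predT; elim: (size _) => [|z IH]; rewrite ?expr0 //= IH exprS.
  have jf : 0 < (j`! * (m.-1 - j)`!)%:R :> R by rewrite ltr0n muln_gt0 !fact_gt0.
  have bf : (m.-1)`!%:R <= 2 ^+ m.-1 * (j`! * (m.-1 - j)`!)%:R :> R.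
    have jm1 : (j <= m.-1)%N by rewrite -ltnS prednK.
    rewrite -natrX -natrM ler_nat -(bin_fact jm1) leq_mul2r; apply/orP; right.
    have h := @expnDn 1 1 m.-1; rewrite addn1 in h; rewrite h.
    by rewrite (bigD1 (Ordinal (jm1 : (j < m.-1.+1)%N)))//= !exp1n !muln1 leq_addr.
  have mf := powm_le_fact m.
  have fm : m`!%:R = m%:R * (m.-1)`!%:R :> R by rewrite -natrM -{1}(prednK m0) factS prednK.
  have em : (m%:R : R) ^+ m = m%:R * m%:R ^+ m.-1 by rewrite -exprS prednK.
  have mf' : (m%:R : R) ^+ m.-1 <= 4 ^+ m * (m.-1)`!%:R.
    by rewrite -(ler_pM2l mR) -em; apply: le_trans mf _; rewrite fm mulrCA.
  have -> : (2 * e0 / m%:R) ^- m.-1 * ((j`! * (m.-1 - j)`!)%:R)^-1 * W ^+ m.-1 =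
      ((1 + w) / 2) ^+ m.-1 * (m%:R ^+ m.-1 / (j`! * (m.-1 - j)`!)%:R).
    rewrite -exprVn [LHS](_ : _ = ((2 * e0 / m%:R)^-1 * W) ^+ m.-1 * (j`! * (m.-1 - j)`!)%:R^-1);
      last by rewrite [in RHS]exprMn; ring.
    rewrite [RHS](_ : _ = ((1 + w) / 2 * m%:R) ^+ m.-1 * (j`! * (m.-1 - j)`!)%:R^-1);
      last by rewrite [in RHS]exprMn; ring.
    congr (_ ^+ _ * _); rewrite /W.
    by field; rewrite !gt_eqF.
  apply: (@le_trans _ _ (((1 + w) / 2) ^+ m.-1 * (4 ^+ m * 2 ^+ m.-1))).
    apply: ler_wpM2l; first by rewrite exprn_ge0// divr_ge0//; lra.
    rewrite ler_pdivrMr//; apply: le_trans mf' _.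
    by rewrite -mulrA ler_wpM2l// exprn_ge0.
  rewrite mulrCA -exprMn divfK// exprMn ler_wpM2l ?exprn_ge0//.
  by rewrite -[X in _ <= _ ^+ X](prednK m0) exprS ler_peMl ?exprn_ge0//; lra.
rewrite (sz jm) in h1 h2; split; first exact: le_trans main.
have X0 : 0 <= (4 * (1 + w)) ^+ m by rewrite exprn_ge0//; lra.
have p0 : 0 <= \prod_(l <- [seq l <- iota 0 m | l != j]) D l * W ^+ m.-1.
  by rewrite mulr_ge0 ?prodr_ge0// exprn_ge0// ltW.
rewrite -(ler_pM2l W0) mulrCA.
apply: (@le_trans _ _ (g * (m.-1%:R * g^-1 * (4 * (1 + w)) ^+ m))).
  apply: ler_wpM2l; first exact: ltW.
  by apply: le_trans h2 _; apply: ler_wpM2l => //; rewrite mulr_ge0// invr_ge0 ltW.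
rewrite [leLHS](_ : _ = m.-1%:R * (4 * (1 + w)) ^+ m); last by field; rewrite gt_eqF.
rewrite [leRHS](_ : _ = (1 + w) * (m%:R * (4 * (1 + w)) ^+ m)); last by rewrite /W; field; rewrite gt_eqF.
rewrite -[leLHS]mul1r; apply: ler_pM => //; [by rewrite mulr_ge0|by lra|].
by rewrite ler_wpM2r// ler_nat leq_pred.
Qed.

End LagrangeBounds.

(** * Analytic regularity of the solution *)

Section DividedDifferenceIntegrals.
Context d (T : measurableType d) (R : realType) (m : {measure set T -> \bar R}).
Implicit Types (g : R -> T -> R) (a : nat -> R) (k : nat) (e : R).

Definition adm (er0 : R) a k e := [/\ injective a, off a k e, `|e| <= er0 & forall j, (j < k)%N -> `|a j| <= er0].

Lemma admS er0 a k e : adm er0 a k.+1 e -> adm er0 a k e /\ adm er0 a k (a k).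
Proof.
move=> [ia /offS[oe _] he ha]; split; split => //.
- by move=> j jk; apply: ha; exact: ltnW.
- exact: off_nodes.
- exact: ha.
- by move=> j jk; apply: ha; exact: ltnW.
Qed.

Lemma adm_node er0 a k e i : adm er0 a k e -> (i < k)%N -> adm er0 a i (a i).
Proof.
move=> [ia oe he ha] ik; split => //; [exact: off_nodes|exact: ha|].
by move=> j ji; apply: ha; exact: ltn_trans ik.
Qed.

Lemma adm_shift er0 a k e i : adm er0 a k e -> (i < k)%N -> adm er0 (shn i a) (k - i) e.
Proof.
move=> [ia oe he ha] ik; split => //.
- by move=> j l /ia /addnI.
- by move=> j jk; apply: oe; rewrite -ltn_subRL.
- by move=> j jk; apply: ha; rewrite -ltn_subRL.
Qed.

Lemma dd_sqi er0 g a k e : adm er0 a k e -> (forall t, `|t| <= er0 -> sqi m (g t)) ->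
  sqi m (fun x => dd (fun t => g t x) a k e).
Proof.
move=> + hg; elim: k e => [|k IH] e h /=; first by case: h => _ _ he _; exact: hg.
have [h1 h2] := admS h.
have := sqiZ (e - a k)^-1 (sqiB (IH _ h1) (IH _ h2)).
by congr sqi; apply/funext => x; rewrite mulrC.
Qed.

Lemma dd_ip er0 g (v : T -> R) a k e : adm er0 a k e -> (forall t, `|t| <= er0 -> sqi m (g t)) ->
  sqi m v -> dd (fun t => ip m (g t) v) a k e = ip m (fun x => dd (fun t => g t x) a k e) v.
Proof.
move=> + hg sv; elim: k e => [//|k IH] e h /=; have [h1 h2] := admS h.
have s1 := dd_sqi h1 hg; have s2 := dd_sqi h2 hg.
rewrite IH// IH// -ipBl// mulrC -ipZl//; last exact: sqiB.
by congr (ip m _ v); apply/funext => x; rewrite mulrC.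
Qed.

Lemma ip_suml (I : Type) (r : seq I) (F : I -> T -> R) w : (forall i, sqi m (F i)) -> sqi m w ->
  ip m (fun x => \sum_(i <- r) F i x) w = \sum_(i <- r) ip m (F i) w.
Proof.
move=> hF sg; elim: r => [|i r IH].
  rewrite [RHS]big_nil -[RHS](mul0r (ip m w w)) -ipZl//.
  by congr (ip m _ w); apply/funext => x; rewrite big_nil mul0r.
rewrite big_cons -IH -ipDl//; last exact: sqi_sum.
by congr (ip m _ w); apply/funext => x; rewrite big_cons.
Qed.

End DividedDifferenceIntegrals.

Section AffineFactor.
Variable R : realType.
Implicit Types (h : R -> R) (a : nat -> R) (b c M K : R).

(** An affine factor leaves two terms in the product rule, bounded by 2 and 1 times [M * K ^ k]; the
    second is of lower order and is raised to [K ^ k] by [1 <= K]. *)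
Lemma dd_affine_bound h b c er0 M K : 0 <= M -> 1 <= K -> `|c| <= 1 ->
  (forall t, `|t| <= er0 -> `|b + c * t| <= 2) ->
  (forall a k e, adm er0 a k e -> `|dd h a k e| <= M * K ^+ k) ->
  forall a k e, adm er0 a k e -> `|dd (fun t => (b + c * t) * h t) a k e| <= 3 * M * K ^+ k.
Proof.
move=> M0 K1 c1 hb hh a k e.
have K0 : 0 <= K by lra.
case: k => [|k] h1.
  have [_ _ he _] := h1; rewrite /= normrM.
  have := hh a 0%N e h1; rewrite /= expr0 !mulr1 => h2.
  apply: le_trans (ler_pM _ _ (hb _ he) h2) _ => //; lra.
have [ia oe he ha] := h1; have [h2 h3] := admS h1.
rewrite ddM_affine//; apply: le_trans (ler_normD _ _) _.
rewrite (normrM (b + c * e)) (normrM c).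
have q0 : 0 <= M * K ^+ k by rewrite mulr_ge0// exprn_ge0.
have q1 : M * K ^+ k <= M * K ^+ k.+1.
  by rewrite ler_wpM2l// exprS ler_peMl// exprn_ge0.
apply: (@le_trans _ _ (2 * (M * K ^+ k.+1) + 1 * (M * K ^+ k))); last by rewrite -mulrA; lra.
by apply: lerD; apply: ler_pM => //; [exact: hb|exact: hh|exact: hh].
Qed.

End AffineFactor.

Lemma le_of_ninth (R : realFieldType) (a b : R) : 1 / 9 * a <= b -> a <= 9 * b.
Proof. lra. Qed.

(** * Divided differences of the transported weak form *)

Section Regularity.
Variable R : realType.
Variable s : R.
Hypothesis s01 : 0 < s < 1.
Notation X3 := (R * R * R)%type.
Notation X6 := (X3 * X3)%type.
Implicit Types (u v w : X3 -> R) (p : X6) (x z : X3) (a : nat -> R) (k : nat) (e t : R).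
Variable i : axis.

Variable er : R.
Hypothesis er24 : er <= 1 / 24.

Let er4 t : `|t| <= er -> `|t| <= 1 / 4. Proof. by move=> h; apply: le_trans h _; have := er24; lra. Qed.
Let er1 t : `|t| <= er -> `|t| < 1. Proof. by move=> h; apply: le_lt_trans h _; have := er24; lra. Qed.

(** Slope of [chi]. The Jacobian is therefore affine in the deformation parameter, the situation of
    [dd_affine_bound]. *)
Definition jsg (t : R) : R := if t <= 0 then 0 else if t <= 1 / 2 then 1 else if t <= 1 then - 1 else 0.

Lemma JPhiE e x : JPhi i e x = 1 + jsg (co i x) * e.
Proof. by rewrite /JPhi /jphi /jsg; do ![case: ifP => _]; ring. Qed.

Let qexp : R := (3 + 2 * s) / 2.

(** The deformed squared distance is the polynomial [d ^ 2 + 2 * a * b * e + b ^ 2 * e ^ 2] with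
    [|b| <= |a| <= d], so [qcoef] applies with [q0 = d ^ 2]. The coefficient bound is relative to
    the undeformed kernel and hence uniform up to the diagonal. *)
Lemma kern_Phi_cvg p e : `|e| <= 1 / 12 -> 0 < edist p.1 p.2 ->
  exists c : nat -> R, (forall n, `|c n| <= kern s p * 6 ^+ n) /\
  forall e, `|e| <= 1 / 12 -> \sum_(n < N) c n * e ^+ n @[N --> \oo] --> kern s (Phi2 i e p).
Proof.
move=> _ d0; set d := edist p.1 p.2 in d0 *.
pose a := co i p.1 - co i p.2; pose b := chi (co i p.1) - chi (co i p.2).
have ad : `|a| <= d by exact: co_edist.
have ba : `|b| <= `|a| by exact: chi_lip.
have q0 : 0 < d ^+ 2 by rewrite exprn_gt0.
have q1 : `|2 * a * b| <= 2 * d ^+ 2.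
  rewrite -mulrA normrM ger0_norm// ler_wpM2l// normrM expr2 ler_pM//.
  exact: le_trans ad.
have q2 : `|b ^+ 2| <= d ^+ 2.
  by rewrite normrX lerXn2r ?nnegrE// ?(ltW d0)//; exact: le_trans ad.
have hp : 0 <= qexp <= 5 / 2 by rewrite /qexp; have := s01; lra.
have powd (y : R) : 0 <= y -> (y ^+ 2) `^ (- qexp) = (y `^ (3 + 2 * s))^-1.
  move=> y0; rewrite -powR_mulrn// -powRrM -powRN; congr (_ `^ _).
  by rewrite /qexp mulrN mulrC divfK.
exists (qcoef (d ^+ 2) (2 * a * b) (b ^+ 2) qexp); split=> [n|t ht].
  have := qcoef_bound q0 q1 q2 hp n; rewrite powd ?(ltW d0)//.
have := qsum_cvg q0 q1 q2 hp ht.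
have -> // : (d ^+ 2 + 2 * a * b * t + b ^+ 2 * t ^+ 2) `^ (- qexp) = kern s (Phi2 i t p).
have -> : d ^+ 2 + 2 * a * b * t + b ^+ 2 * t ^+ 2 = edist (Phi i t p.1) (Phi i t p.2) ^+ 2.
  rewrite /d !edist_sqr /a /b; case: p {d d0 a b ad ba q0 q1 q2} => [[[x1 x2] x3] [[z1 z2] z3]].
  by case: (i); rewrite /Phi /phi /=; ring.
by rewrite powd ?edist_ge0.
Qed.

Definition kap e p := kern s (Phi2 i e p) * JPhi2 i e p.
(** Density of the transported kernel, Jacobians included, with respect to the original one. On the
    diagonal it is a quotient by zero, that is zero, which is harmless because [dv] vanishes
    there. *)
Definition mult e p := kap e p / kern s p.

Lemma kern_gt0 p : 0 < edist p.1 p.2 -> 0 < kern s p.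
Proof. by move=> h; rewrite invr_gt0 powR_gt0. Qed.

Lemma kern0 p : edist p.1 p.2 = 0 -> kern s p = 0.
Proof. by move=> h; rewrite /kern h powR0 ?invr0//; have := s01; lra. Qed.

Lemma kern_dd a k e p : adm er a k e -> 0 < edist p.1 p.2 ->
  `|dd (fun t => kern s (Phi2 i t p)) a k e| <= (2 * kern s p) * 12 ^+ k.
Proof.
move=> [ia oe he ha] d0.
have z12 : `|0 : R| <= 1 / 12 by rewrite normr0 divr_ge0.
have [c [c1 c2]] := kern_Phi_cvg z12 d0.
have er12 t : `|t| <= er -> `|t| <= 1 / 12 by move=> h; apply: le_trans h _; have := er24; lra.
have := @dd_powlim R (fun _ n => c n) 0 1 er (kern s p) 6 (fun t => kern s (Phi2 i t p)) a k e.
rewrite normr1 mulr1 (_ : 2 * 6 = 12); last by ring.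
apply => //.
- by rewrite invr_ge0 powR_ge0.
- exact: le_trans he.
- by have := er24; lra.
- by rewrite add0r mul1r.
- by move=> j jk; rewrite add0r mul1r; exact: ha.
- by rewrite add0r mul1r; apply: c2; exact: er12.
- by move=> j jk; rewrite add0r mul1r; apply: c2; apply: er12; exact: ha.
Qed.

Let jsg1 t : `|jsg t| <= 1.
Proof. by rewrite /jsg; do ![case: ifP => _]; rewrite ?normr0 ?normrN ?normr1. Qed.

(** 18 is 2, from the kernel series, times a factor 3 for each of the two Jacobians. *)
Lemma mult_dd a k e p : adm er a k e ->
  `|dd (fun t => mult t p) a k e| <= 18 * 12 ^+ k.
Proof.
move=> h.
have -> : (fun t => mult t p) = (fun t => (kern s p)^-1 * kap t p).
  by apply/funext => t; rewrite /mult mulrC.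
rewrite ddZ normrM normfV.
have [d0|d0] := eqVneq (edist p.1 p.2) 0.
  by rewrite kern0// normr0 invr0 mul0r mulr_ge0// exprn_ge0.
have {}d0 : 0 < edist p.1 p.2 by rewrite lt_neqAle eq_sym d0 edist_ge0.
have k0 := kern_gt0 d0; rewrite (gtr0_norm k0) mulrC ler_pdivrMr//.
have -> : (fun t => kap t p) = (fun t => (1 + jsg (co i p.1) * t) *
    ((1 + jsg (co i p.2) * t) * kern s (Phi2 i t p))).
  by apply/funext => t; rewrite /kap /JPhi2 !JPhiE; ring.
have jb (x t : R) : `|t| <= er -> `|1 + jsg x * t| <= 2.
  move=> ht; apply: le_trans (ler_normD _ _) _; rewrite normr1 normrM.
  have : `|jsg x| * `|t| <= 1 * er by apply: ler_pM.
  have := er24.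
  lra.
have K1 : 1 <= (12 : R) by lra.
have M1 : 0 <= 2 * kern s p by rewrite mulr_ge0// ltW.
have M2 : 0 <= 3 * (2 * kern s p) by rewrite mulr_ge0.
have D1 := dd_affine_bound M1 K1 (jsg1 (co i p.2)) (jb _) (fun a k e h => kern_dd h d0).
have D2 := dd_affine_bound M2 K1 (jsg1 (co i p.1)) (jb _) D1.
apply: le_trans (D2 _ _ _ h) _.
by rewrite (_ : 3 * (3 * (2 * kern s p)) * 12 ^+ k = 18 * 12 ^+ k * kern s p)//; ring.
Qed.

Lemma mult_bound e p : `|e| <= er -> `|mult e p| <= 18.
Proof.
move=> he; have h : adm er (fun j => j%:R : R) 0 e by split => // j l /eqP; rewrite eqr_nat => /eqP.
by have := @mult_dd _ _ _ p h; rewrite /= expr0 mulr1.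
Qed.

Lemma measurable_Phi2 e : measurable_fun setT (@Phi2 R i e).
Proof.
by apply: measurable_fun_pair; apply: measurableT_comp => //; exact: measurable_Phi.
Qed.

Lemma measurable_mult e : measurable_fun setT (mult e).
Proof.
apply: measurable_funM.
  apply: measurable_funM.
    by apply: measurableT_comp; [exact: measurable_kern|exact: measurable_Phi2].
  by apply: measurable_funM; apply: measurableT_comp => //; exact: measurable_JPhi.
rewrite (_ : (fun x : X6 => (kern s x)^-1) = (fun p : X6 => edist p.1 p.2 `^ (3 + 2 * s))).
  apply: (measurableT_comp (f := fun t : R => t `^ (3 + 2 * s))).
    exact: measurable_powR.
  exact: measurable_edist.
by apply/funext => p; rewrite /kern invrK.
Qed.

Lemma mult_lower e p : `|e| <= er -> 0 < edist p.1 p.2 -> 1 / 9 <= mult e p.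
Proof.
move=> he d0; have k0 := kern_gt0 d0; rewrite ler_pdivlMr//.
have [_ h] := kern_Phi s01 i p (er4 he).
have := JPhi_bounds i p.1 (er4 he); have := JPhi_bounds i p.2 (er4 he).
rewrite /kap /JPhi2; move: (kern s (Phi2 i e p)) h (JPhi i e p.1) (JPhi i e p.2) => q h j1 j2 h1 h2.
have : 9 / 16 <= j1 * j2 by nra.
have : 0 <= q by lra.
by move: (j1 * j2) => j q0 hj; nra.
Qed.

Lemma dv_diag v p : edist p.1 p.2 = 0 -> dv s v p = 0.
Proof. by move=> /edist_eq0 h; rewrite /dv h subrr mul0r. Qed.

Lemma multE u v e p : `|e| <= er ->
  dv s u (Phi2 i e p) * dv s v (Phi2 i e p) * JPhi2 i e p =
  mult e p * dv s (fun x => u (Phi i e x)) p * dv s (fun x => v (Phi i e x)) p.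
Proof.
move=> he; rewrite (dvM s u) -[RHS]mulrA (dvM s (fun x => u (Phi i e x))) /mult /kap /=.
have [d0|d0] := eqVneq (edist p.1 p.2) 0.
  have e1 := kern0 d0; have [h _] := kern_Phi s01 i p (er4 he); rewrite e1 in h *.
  have -> : kern s (Phi2 i e p) = 0.
    by apply/le_anti; rewrite -{1}(mulr0 5) h invr_ge0 powR_ge0.
  by rewrite !mulr0 mul0r.
have k0 : kern s p != 0 by rewrite gt_eqF// kern_gt0// lt_neqAle eq_sym d0 edist_ge0.
by field.
Qed.

Variables (u0 F : X3 -> R) (G0 Lf : R).
Hypothesis hu0 : Ho s u0.
Hypothesis sF : sqi L3 F.
Hypothesis weak : forall v, Ho s v -> A s u0 v = ip L3 F v.
Hypothesis G00 : 0 <= G0.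
Hypothesis Lf0 : 0 <= Lf.
Definition Gf e x := F (Phi i e x) * JPhi i e x.
Hypothesis ddG : forall a k e, adm er a k e ->
  ip L3 (fun x => dd (fun t => Gf t x) a k e) (fun x => dd (fun t => Gf t x) a k e) <= (G0 * Lf ^+ k) ^+ 2.

Definition Ud a k e x := dd (fun t => u0 (Phi i t x)) a k e.

Lemma Ho_Phi e v : `|e| <= 1 / 4 -> Ho s v -> Ho s (fun x => v (Phi i e x)).
Proof.
move=> he [hv v0]; split; first by have [] := Hs_Phi s01 i he hv.
move=> x hx; apply: v0; apply: contra_not hx.
have he1 : `|e| < 1 by apply: le_lt_trans he _; lra.
by move=> /Omega_Phi; exact.
Qed.

Lemma Ud_Ho a k e : adm er a k e -> Ho s (Ud a k e).
Proof.
rewrite /Ud; elim: k e => [|k IH] e h /=.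
  by have [_ _ he _] := h; apply: Ho_Phi => //; exact: er4.
have [h1 h2] := admS h.
have := HoZ (e - a k)^-1 (HoB (IH _ h1) (IH _ h2)).
by congr (Ho s _); apply/funext => x; rewrite mulrC.
Qed.

Lemma dd_dv a k e p : dd (fun t => dv s (fun x => u0 (Phi i t x)) p) a k e = dv s (Ud a k e) p.
Proof.
rewrite /dv /Ud -ddB mulrC -ddZ.
by congr (dd _ a k e); apply/funext => t; rewrite mulrC.
Qed.

Let sU e : `|e| <= er -> sqi L6 (dv s (fun x => u0 (Phi i e x))).
Proof. by move=> he; have [[_ ? _] _] := Ho_Phi (er4 he) hu0. Qed.

Let smU e (f : X6 -> R) : `|e| <= er -> sqi L6 f -> sqi L6 (fun p => mult e p * f p).
Proof.
move=> he sf.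
by have [] := cauchy_bound sf sf (measurable_mult e) (ler0n R 18) (fun p => mult_bound p he).
Qed.

Lemma sGf e : `|e| <= er -> sqi L3 (Gf e).
Proof.
move=> he; have [mP mw w0 H] := jacm_Phi i (er1 he).
have [h _] := jacm_sqi (c := 3 / 4) (jacm_Phi i (er1 he)) ltac:(lra)
  (fun x => (andP (JPhi_bounds i x (er4 he))).1) sF.
have b x : `|JPhi i e x| <= 2.
  by have := JPhi_bounds i x (er4 he) => hJ; rewrite ger0_norm; lra.
have [h2 _] := cauchy_bound h h mw (ler0n R 2) b.
by move: h2; congr sqi; apply/funext => x; rewrite mulrC.
Qed.

(** The weak form is tested with [v o PhiV] and transported by the substitution. The test function
    becomes [v], independent of [e], so differences in [e] fall on the solution, the kernel and the
    data only. *)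
Lemma pullback v e : Ho s v -> `|e| <= er ->
  ip L6 (fun p => mult e p * dv s (fun x => u0 (Phi i e x)) p) (dv s v) = ip L3 (Gf e) v.
Proof.
move=> [hv v0] he; have he1 := er1 he.
have hv' : Ho s (fun x => v (PhiV i e x)).
  split; first exact: Hs_PhiV (er4 he) hv.
  move=> x hx; apply: v0; apply: contra_not hx => h.
  by rewrite -(PhiVK i he1 x); apply/Omega_Phi.
have := weak hv'; rewrite /A /ip.
have [[mu _] [mdu _] _] := hu0.1; have [[mv' _] [mdv' _] _] := hv'.1.
rewrite -(jacm_R (jacm_Phi2 i he1)); last exact: measurable_funM.
rewrite -(jacm_R (jacm_Phi i he1)); last by apply: measurable_funM => //; case: sF.
move=> h; transitivity (Rintegral L6 setT (fun p => dv s u0 (Phi2 i e p) *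
    dv s (fun x => v (PhiV i e x)) (Phi2 i e p) * JPhi2 i e p)).
  apply: eq_Rintegral => p _; rewrite multE//.
  by congr (_ * dv s _ p); apply/funext => x; rewrite PhiK.
rewrite h; apply: eq_Rintegral => x _; rewrite PhiK// /Gf; ring.
Qed.

(** Both sides of [pullback] are differenced in [e], and [dd_leibniz] isolates the term with the
    top-order difference of the solution. *)
Lemma Ud_identity a k e v : adm er a k e -> Ho s v ->
  ip L6 (fun p => mult e p * dv s (Ud a k e) p) (dv s v) =
  ip L3 (fun x => dd (fun t => Gf t x) a k e) v -
  \sum_(l < k) ip L6 (fun p => dd (fun t => mult t p) (shn l a) (k - l) e * dv s (Ud a l (a l)) p) (dv s v).
Proof.
move=> h hv; have [ia oe he ha] := h.
have [[sv sdv _] _] := hv.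
have smd t : `|t| <= er -> sqi L6 (fun p => mult t p * dv s (fun x => u0 (Phi i t x)) p).
  by move=> ht; apply: smU => //; exact: sU.
have E1 := dd_ip h smd sdv.
have E2 := dd_ip h sGf sv.
have E3 : dd (fun t => ip L6 (fun p => mult t p * dv s (fun x => u0 (Phi i t x)) p) (dv s v)) a k e =
    dd (fun t => ip L3 (Gf t) v) a k e.
  by apply: dd_ext => [|j jk]; apply: pullback => //; exact: ha.
have sl (l : 'I_k) : sqi L6 (fun p => dd (fun t => mult t p) (shn l a) (k - l) e * dv s (Ud a l (a l)) p).
  have hs := adm_shift h (ltn_ord l); have hn := adm_node h (ltn_ord l).
  have [[_ sd _] _] := Ud_Ho hn.
  have mm : measurable_fun setT (fun p => dd (fun t => mult t p) (shn l a) (k - l) e).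
    clear -s01; elim: (k - l)%N (e) => [|j IH] t /=; first exact: measurable_mult.
    apply: measurable_funM => //; apply: measurable_funB; exact: IH.
  have M0 : 0 <= 18 * 12 ^+ (k - l) :> R by rewrite mulr_ge0// exprn_ge0.
  by have [] := cauchy_bound sd sd mm M0 (fun p => mult_dd p hs).
have sk : sqi L6 (fun p => mult e p * dv s (Ud a k e) p).
  by apply: smU => //; have [[_ ? _] _] := Ud_Ho h.
rewrite -E2 -E3 E1 -ip_suml// -ipBl//; last 2 first.
- by apply: dd_sqi h smd.
- exact: sqi_sum.
congr (ip L6 _ _); apply/funext => p; rewrite dd_leibniz//.
rewrite dd_dv; under eq_bigr do rewrite dd_dv.
by rewrite addrK.
Qed.

(** The identity is tested with [Ud a k e] itself. The lower bound [1 / 9] for [mult] off the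
    diagonal gives coercivity, hence the factor 9; 32 is the square root of the Hardy constant
    [4 ^ 5]. *)
Lemma Ud_step a k e (S : nat -> R) : adm er a k e -> (forall l, 0 <= S l) ->
  (forall l, (l < k)%N -> Num.sqrt (A s (Ud a l (a l)) (Ud a l (a l))) <= S l) ->
  Num.sqrt (A s (Ud a k e) (Ud a k e)) <=
  9 * (32 * (G0 * Lf ^+ k) + \sum_(l < k) 18 * 12 ^+ (k - l) * S l).
Proof.
move=> h S0 hS; have [ia oe he ha] := h.
have how := Ud_Ho h; set w := Ud a k e in how *.
have [[sw sdw _] w0] := how.
set Q := Num.sqrt (A s w w); have Q0 : 0 <= Q by exact: sqrtr_ge0.
have QQ : Q * Q = A s w w by rewrite -expr2 sqr_sqrtr// A_ge0.
have coer : 1 / 9 * A s w w <= ip L6 (fun p => mult e p * dv s w p) (dv s w).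
  have smw := smU he sdw.
  have c0 : 0 <= ip L6 (fun p => (mult e p - 1 / 9) * dv s w p) (dv s w).
    apply: Rintegral_ge0 => p _; rewrite -mulrA -expr2.
    have [d0|d0] := eqVneq (edist p.1 p.2) 0; first by rewrite dv_diag// expr0n /= mulr0.
    rewrite mulr_ge0 ?sqr_ge0// subr_ge0; apply: mult_lower => //.
    by rewrite lt_neqAle eq_sym d0 edist_ge0.
  rewrite -subr_ge0; move: c0.
  rewrite (_ : (fun p => (mult e p - 1 / 9) * dv s w p) = (fun p => mult e p * dv s w p - 1 / 9 * dv s w p));
    last by apply/funext => p; ring.
  by rewrite ipBl//; [rewrite ipZl|exact: sqiZ].
have id := Ud_identity h how; rewrite -/w in id.
have b1 : `|ip L3 (fun x => dd (fun t => Gf t x) a k e) w| <= G0 * Lf ^+ k * (32 * Q).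
  have sG := dd_sqi h sGf.
  apply: le_trans (cauchy sG sw) _; apply: ler_pM; rewrite ?sqrtr_ge0//.
    rewrite -[leRHS]ger0_norm ?mulr_ge0 ?exprn_ge0// -sqrtr_sqr ler_wsqrtr//; exact: ddG.
  apply: (@le_trans _ _ (Num.sqrt (32 ^+ 2 * A s w w))).
    rewrite ler_wsqrtr// (_ : 32 ^+ 2 = 4 ^+ 5 :> R); last by ring.
    exact: L2_le.
  by rewrite sqrtrM ?sqr_ge0// sqrtr_sqr ger0_norm.
have b2 (l : 'I_k) : `|ip L6 (fun p => dd (fun t => mult t p) (shn l a) (k - l) e *
    dv s (Ud a l (a l)) p) (dv s w)| <= 18 * 12 ^+ (k - l) * S l * Q.
  have hs := adm_shift h (ltn_ord l); have hn := adm_node h (ltn_ord l).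
  have [[_ sd _] _] := Ud_Ho hn.
  have mm : measurable_fun setT (fun p => dd (fun t => mult t p) (shn l a) (k - l) e).
    clear -s01; elim: (k - l)%N (e) => [|j IH] t /=; first exact: measurable_mult.
    apply: measurable_funM => //; apply: measurable_funB; exact: IH.
  have M0 : 0 <= 18 * 12 ^+ (k - l) :> R by rewrite mulr_ge0// exprn_ge0.
  have [_] := cauchy_bound sdw sd mm M0 (fun p => mult_dd p hs).
  rewrite ipC => /le_trans; apply; rewrite mulrAC; apply: ler_wpM2r; first exact: sqrtr_ge0.
  by apply: ler_wpM2l => //; exact: hS.
have key : Q * Q <= 9 * (32 * (G0 * Lf ^+ k) + \sum_(l < k) 18 * 12 ^+ (k - l) * S l) * Q.
  rewrite QQ; apply: (@le_trans _ _ (9 * ip L6 (fun p => mult e p * dv s w p) (dv s w))).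
    by exact: le_of_ninth.
  rewrite id -mulrA ler_wpM2l// mulrDl; apply: lerD.
    by apply: le_trans (ler_norm _) _; apply: le_trans b1 _; rewrite le_eqVlt; apply/orP; left; apply/eqP; ring.
  apply: le_trans (ler_norm _) _; rewrite normrN; apply: le_trans (ler_norm_sum _ _ _) _.
  by rewrite mulr_suml; apply: ler_sum => l _; exact: b2.
have [Qz|Qz] := eqVneq Q 0.
  rewrite Qz mulr_ge0// addr_ge0 ?mulr_ge0 ?exprn_ge0// sumr_ge0// => l _.
  by rewrite !mulr_ge0// exprn_ge0.
by rewrite -(ler_pM2r (_ : 0 < Q))// lt_neqAle eq_sym Qz.
Qed.

Lemma geo_conv (g : R) k : 12 <= g -> (g - 12) * \sum_(l < k) 12 ^+ (k - l) * g ^+ l <= 12 * g ^+ k.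
Proof.
move=> hg; elim: k => [|k IH]; first by rewrite big_ord0 mulr0 expr0 mulr1.
rewrite big_ord_recr /= subSnn expr1.
have -> : \sum_(l < k) 12 ^+ (k.+1 - l) * g ^+ l = 12 * \sum_(l < k) 12 ^+ (k - l) * g ^+ l.
  by rewrite mulr_sumr; apply: eq_bigr => l _; rewrite subSn 1?ltnW// exprS mulrA.
have g0 : 0 <= g ^+ k by rewrite exprn_ge0//; lra.
rewrite exprS mulrDr mulrCA; move: IH; move: (\sum_(l < k) _) (g ^+ k) g0 => X Y Y0; nra.
Qed.

(** Chosen so that each of the two terms in [Ud_step] is at most half of the claimed bound:
    [24 * 24] is [2 * 9 * 32], and [60 * 66] keeps the geometric convolution below [g ^ k] divided
    by [2 * 9 * 18]. *)
Definition Dreg := 24 * 24 * G0.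
Definition Greg := 60 * 66 + Lf.

Let regularity_gen (D g : R) a k e : 24 * 24 * G0 <= D -> 60 * 66 <= g -> Lf <= g ->
  adm er a k e -> Num.sqrt (A s (Ud a k e) (Ud a k e)) <= D * g ^+ k.
Proof.
move=> hD g12 hL.
have D0 : 0 <= D by apply: le_trans hD; rewrite !mulr_ge0.
have g0 : 0 <= g by apply: le_trans hL.
elim/ltn_ind: k e => k IH e h.
have S0 l : 0 <= D * g ^+ l by rewrite mulr_ge0// exprn_ge0.
apply: le_trans (Ud_step h S0 _) _.
  by move=> l lk; apply: IH => //; exact: adm_node h lk.
have h1 : Lf ^+ k <= g ^+ k by apply: lerXn2r; rewrite ?nnegrE.
have -> : \sum_(l < k) 18 * 12 ^+ (k - l) * (D * g ^+ l) =
    18 * D * \sum_(l < k) 12 ^+ (k - l) * g ^+ l.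
  by rewrite mulr_sumr; apply: eq_bigr => l _; ring.
have g12' : 12 <= g by lra.
have h2 := geo_conv k g12'.
have S1 : 0 <= \sum_(l < k) 12 ^+ (k - l) * g ^+ l.
  by apply: sumr_ge0 => l _; rewrite mulr_ge0// exprn_ge0.
have Y0 : 0 <= g ^+ k by exact: exprn_ge0.
move: h1 h2 S1 Y0; move: (\sum_(l < k) _) (g ^+ k) (Lf ^+ k) => X Y Z h1 h2 S1 Y0.
have h3 : 18 * 18 * X <= Y.
  have : 60 * 65 * X <= (g - 12) * X by rewrite ler_wpM2r//; lra.
  by lra.
have h4 : G0 * Z <= G0 * Y by rewrite ler_wpM2l.
have h5 : D * (18 * 18 * X) <= D * Y by rewrite ler_wpM2l.
have h6 : 24 * 24 * G0 * Y <= D * Y by rewrite ler_wpM2r.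
have -> : 18 * D * X = D * X * 18 by ring.
move: h4 h5 h6; rewrite (_ : D * (18 * 18 * X) = D * X * (18 * 18)); last by ring.
rewrite (_ : 24 * 24 * G0 * Y = G0 * Y * (24 * 24)); last by ring.
by move: (D * X) (D * Y) (G0 * Y) (G0 * Z) => a1 a2 a3 a4; lra.
Qed.

Lemma regularity a k e : adm er a k e ->
  Num.sqrt (A s (Ud a k e) (Ud a k e)) <= Dreg * Greg ^+ k.
Proof.
by apply: regularity_gen; [exact: lexx|rewrite /Greg lerDl|rewrite /Greg lerDr mulr_ge0].
Qed.

End Regularity.

(** * Analyticity of the data *)

Section AnalyticData.
Variable R : realType.
Notation X3 := (R * R * R)%type.
Implicit Types (x z : X3) (i : axis) (a : nat -> R) (k : nat) (e c : R).

Definition along (f : X3 -> R) i c x t := f (upd i (co i x + c * t) x).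

(** One integer governs both the parameter radius and the growth. A uniform bound over the closed
    cube is then a statement about large integers, the form in which compactness is applied. The
    slope [c] will be the boundary distance of a coordinate. *)
Definition dd_at (f : X3 -> R) (n : nat) x := forall i c a k e, `|c| <= 1 ->
  adm (n.+1%:R^-1) a k e -> `|dd (along f i c x) a k e| <= n.+1%:R ^+ k.+1.

Let others i (m l : nat) (y1 y2 y3 : R) : R := match i with
  | A1 => y2 ^+ m * y3 ^+ l | A2 => y1 ^+ m * y3 ^+ l | A3 => y1 ^+ m * y2 ^+ l end.

Let perm i (cf : nat -> nat -> nat -> R) (n m l : nat) : R := match i with
  | A1 => cf n m l | A2 => cf m n l | A3 => cf m l n end.

Let sum_perm i (T : nat -> nat -> nat -> R) N :
  \sum_(n < N) \sum_(m < N) \sum_(l < N) T n m l =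
  \sum_(n < N) \sum_(m < N) \sum_(l < N) perm i T n m l.
Proof.
case: i => //=; first by rewrite exchange_big.
rewrite [RHS]exchange_big; apply: eq_bigr => m _.
by rewrite [RHS]exchange_big.
Qed.

Lemma analytic_dd_local (f : pt R -> R) x0 : analytic_on_closure f -> Omega_bar x0 ->
  exists n : nat, forall x, (forall i, `|co i x - co i x0| <= n.+1%:R^-1) ->
  forall m, (n <= m)%N -> dd_at f m x.
Proof.
move=> hf hx0; have [r [r0 [cf hcf]]] := hf x0 hx0.
(* Absolute convergence at the single corner [xr] bounds all coefficients at once; the corner is
   within [2 * rh < r] of [x0]. *)
pose rh := r / 3; have rh0 : 0 < rh by rewrite divr_gt0.
pose xr : X3 := (x0.1.1 + rh, x0.1.2 + rh, x0.2 + rh).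
have [|[M hM] _] := hcf xr.
  apply: (@le_lt_trans _ _ (2 * rh)); last by rewrite /rh; lra.
  rewrite edistC; apply: edist_le_max; first exact: ltW.
  by case=> /=; rewrite distrC addrC addKr ger0_norm// ltW.
have M0 : 0 <= M by have := hM 0%N; rewrite big_ord0.
(* Coefficient of the [n]-th power of coordinate [i] when all three indices are truncated at [N] and
   the two other coordinates are frozen. *)
pose C i y N n : R := if (n < N)%N then \sum_(m < N) \sum_(l < N) perm i cf n m l *
  others i m l (co A1 y) (co A2 y) (co A3 y) else 0.
have hC i (y : X3) N n : (forall j, `|co j y| <= rh) -> `|C i y N n| <= M * rh^-1 ^+ n.
  move=> hy; rewrite /C; case: ifP => nN; last first.
    by rewrite normr0 mulr_ge0// exprn_ge0// invr_ge0 ltW.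
  rewrite exprVn ler_pdivlMr ?exprn_gt0//.
  apply: le_trans (hM N).
  have -> : \sum_(j < N) \sum_(l < N) \sum_(k < N) `|cf j l k * (c1 xr - c1 x0) ^+ j *
      (c2 xr - c2 x0) ^+ l * (c3 xr - c3 x0) ^+ k| =
      \sum_(j < N) \sum_(l < N) \sum_(k < N) `|perm i cf j l k| * rh ^+ j * rh ^+ l * rh ^+ k.
    rewrite (sum_perm i (fun j l k => `|cf j l k * (c1 xr - c1 x0) ^+ j *
      (c2 xr - c2 x0) ^+ l * (c3 xr - c3 x0) ^+ k|)).
    apply: eq_bigr => j _; apply: eq_bigr => l _; apply: eq_bigr => k _.
    rewrite /xr /c1 /c2 /c3 /= !(addrC _ rh) !addrK.
    have nn b : `|rh ^+ b| = rh ^+ b by rewrite ger0_norm// exprn_ge0// ltW.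
    by case: (i) => /=; rewrite !normrM !nn; ring.
  rewrite [leRHS](bigD1 (Ordinal nN))//= -[leLHS]addr0; apply: lerD; last first.
    by do 3!(apply: sumr_ge0 => ? _); rewrite !mulr_ge0// exprn_ge0// ltW.
  apply: (@le_trans _ _ ((\sum_(m < N) \sum_(l < N) `|perm i cf n m l| * rh ^+ m * rh ^+ l) * rh ^+ n)).
    rewrite ler_wpM2r ?exprn_ge0 ?(ltW rh0)//.
    apply: le_trans (ler_norm_sum _ _ _) _; apply: ler_sum => m _.
    apply: le_trans (ler_norm_sum _ _ _) _; apply: ler_sum => l _.
    rewrite normrM -mulrA ler_wpM2l//.
    have pw j b : `|co j y ^+ b| <= rh ^+ b.
      by rewrite normrX lerXn2r ?nnegrE ?(ltW rh0).
    by case: (i) => /=; rewrite normrM; apply: ler_pM => //; [exact: (pw A2)|exact: (pw A3)|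
      exact: (pw A1)|exact: (pw A3)|exact: (pw A1)|exact: (pw A2)].
  rewrite mulr_suml; apply: ler_sum => m _; rewrite mulr_suml; apply: ler_sum => l _.
  by rewrite le_eqVlt; apply/orP; left; apply/eqP; ring.
(* The first condition keeps arguments within [rh / 4] of the centre of the expansion, so that
   [K * B <= 1 / 4] in [dd_powlim]; the two others dominate the constant and the growth produced
   there. *)
have [n [n1 n2 n3]] : exists n : nat, [/\ 8 / rh <= n.+1%:R, 2 * M <= n.+1%:R & 2 / rh <= n.+1%:R].
  exists (Num.truncn (8 / rh + 2 * M)).
  have h := ltW (truncnS_gt (8 / rh + 2 * M)).
  have p1 : 0 <= 8 / rh by rewrite divr_ge0// ltW.
  have p2 : 2 / rh <= 8 / rh by rewrite ler_wpM2r ?invr_ge0 ?(ltW rh0)//; lra.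
  by split; apply: le_trans h; lra.
exists n => x hx m nm i c a k e c1' [ia oe he ha].
have nr : n.+1%:R^-1 <= rh / 8.
  by rewrite -[leRHS]invrK invf_div lef_pV2 ?posrE ?invr_gt0 ?divr_gt0 ?ltr0n.
have mr : m.+1%:R^-1 <= rh / 8 :> R.
  by apply: le_trans nr; rewrite lef_pV2 ?posrE ?ltr0n// ler_nat ltnS.
pose b := co i x - co i x0; pose y : X3 := upd i 0 (x.1.1 - x0.1.1, x.1.2 - x0.1.2, x.2 - x0.2).
have hb : `|b| <= rh / 8 by apply: le_trans (hx i) nr.
have hy j : `|co j y| <= rh / 8.
  have := le_trans (hx j) nr; have h0 : 0 <= rh / 8 by rewrite divr_ge0// ltW.
  by rewrite /y; case: (i); case: (j) => //=; rewrite normr0.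
have bt t : `|t| <= m.+1%:R^-1 -> `|b + c * t| <= rh / 4.
  move=> ht; apply: le_trans (ler_normD _ _) _; rewrite normrM.
  have : `|c| * `|t| <= 1 * (rh / 8) by apply: ler_pM => //; exact: le_trans ht mr.
  by move: hb; lra.
have cvg t : `|t| <= m.+1%:R^-1 -> \sum_(j < N) C i y N j * (b + c * t) ^+ j @[N --> \oo] --> along f i c x t.
  move=> ht; pose X := upd i (co i x + c * t) x.
  have [|_ h] := hcf X.
    apply: (@le_lt_trans _ _ (2 * (rh / 4))); last by rewrite /rh; lra.
    apply: edist_le_max => [|j]; first by rewrite divr_ge0// ltW.
    have hj := le_trans (hx j) nr; have := bt _ ht.
    have h8 : rh / 8 <= rh / 4 by lra.
    rewrite /X /b; case: (i); case: (j) hj => hj /=;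
      rewrite ?(addrAC _ (c * t)) // => _; exact: le_trans hj h8.
  apply: cvg_trans h; apply: near_eq_cvg; apply: nearW => N /=.
  rewrite (sum_perm i (fun j l k => cf j l k * (c1 X - c1 x0) ^+ j *
      (c2 X - c2 x0) ^+ l * (c3 X - c3 x0) ^+ k)).
  apply: eq_bigr => j _; rewrite /C ltn_ord mulr_suml.
  apply: eq_bigr => l _; rewrite mulr_suml; apply: eq_bigr => q _.
  have -> : b + c * t = co i x + c * t - co i x0 by rewrite /b; ring.
  by rewrite /X /c1 /c2 /c3 /y; case: (i) => /=; ring.
have KB : rh^-1 * (rh / 4) <= 1 / 4 by rewrite mulrA mulVf ?gt_eqF.
have hyr j : `|co j y| <= rh by apply: le_trans (hy j) _; lra.
have := @dd_powlim R (C i y) b c (rh / 4) M rh^-1 (along f i c x) a k e ia oe M0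
  ltac:(by rewrite invr_ge0 ltW) ltac:(by rewrite divr_ge0// ltW) KB (bt _ he)
  (fun j jk => bt _ (ha j jk)) (fun N n => hC i y N n hyr) (cvg _ he) (fun j jk => cvg _ (ha j jk)).
move/le_trans; apply; rewrite exprS.
have mn : n.+1%:R <= m.+1%:R :> R by rewrite ler_nat ltnS.
apply: ler_pM; rewrite ?mulr_ge0 ?exprn_ge0 ?mulr_ge0 ?invr_ge0 ?(ltW rh0)//.
  exact: le_trans mn.
apply: lerXn2r; rewrite ?nnegrE ?mulr_ge0 ?invr_ge0 ?(ltW rh0)//.
apply: le_trans mn; apply: le_trans n3.
by rewrite ler_piMr// mulr_ge0// invr_ge0 ltW.
Qed.

Lemma compact_Omega_bar : compact (@Omega_bar R : set (R * R * R)).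
Proof.
have -> : (@Omega_bar R : set (R * R * R)) = (`[0, 1] `*` `[0, 1]) `*` `[0, 1].
  apply/seteqP; split => [x [h1 h2 h3]|x [[/= h1 h2] h3]].
    by split; [split|]; rewrite /= in_itv.
  by move: h1 h2 h3; rewrite !in_itv.
by apply: compact_setX; [apply: compact_setX|]; exact: segment_compact.
Qed.

Lemma analytic_dd (f : pt R -> R) : analytic_on_closure f ->
  exists n : nat, forall x, Omega_bar x -> dd_at f n x.
Proof.
move=> hf; have /compact_near_coveringP cov := compact_Omega_bar.
have [|N _ hN] := cov nat \oo (fun n x => dd_at f n x) _ _; last by exists N => x hx; apply: (hN N) => //=.
move=> x hx; have [n hn] := analytic_dd_local hf hx.
exists ([set z : X3 | forall i, `|co i z - co i x| < n.+1%:R^-1], [set m | (n <= m)%N]).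
  split => /=; last by exists n.
  apply/nbhs_ballP; exists n.+1%:R^-1; first by rewrite /= invr_gt0.
  move=> z [[h1 h2] h3] i; rewrite distrC.
  by case: i; [exact: h1|exact: h2|exact: h3].
by move=> [z m] /= [hz hm]; apply: hn => // i; exact: ltW.
Qed.

Variables (f : X3 -> R) (n : nat).
Hypothesis hdd : forall x, Omega_bar x -> dd_at f n x.
Notation K := (n.+1%:R : R).

Let K1 : 1 <= K. Proof. by rewrite ler1n. Qed.

Let adm1 (er t : R) : 0 <= er -> t != 0 -> `|t| <= er -> adm er (fun j => j%:R : R) 1 t.
Proof.
move=> er0 t0 ht; split => //.
- by move=> j l /eqP; rewrite eqr_nat => /eqP.
- by case.
- by case => // _; rewrite normr0.
Qed.

Lemma dd_at_bounded x : Omega_bar x -> `|f x| <= K.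
Proof.
move=> hx; have h : adm K^-1 (fun j => j%:R : R) 0 0.
  by split => //; [move=> j l /eqP; rewrite eqr_nat => /eqP|rewrite normr0 invr_ge0].
have h0 : `|0 : R| <= 1 by rewrite normr0.
have := @hdd x hx A1 0 _ _ _ h0 h.
by rewrite /= /along mul0r addr0 expr1; case: x {hx} => [[? ?] ?].
Qed.

(** A short step is a first divided difference; for a step longer than [K^-1] the bound [2 * K] for
    the difference is already large enough. *)
Let coord_lip x i t : Omega_bar x -> Omega_bar (upd i (co i x + t) x) ->
  `|f (upd i (co i x + t) x) - f x| <= 2 * K ^+ 2 * `|t|.
Proof.
move=> hx hx'; have [->|t0] := eqVneq t 0.
  by rewrite addr0 normr0 mulr0; case: x {hx hx'} => [[? ?] ?]; case: i; rewrite /= subrr normr0.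
have [ht|ht] := leP `|t| K^-1.
  have h := adm1 (_ : 0 <= K^-1) t0 ht.
  have h1 : `|1 : R| <= 1 by rewrite normr1.
  have := @hdd x hx i 1 _ _ _ h1 (h ltac:(by rewrite invr_ge0)).
  rewrite /= subr0 normrM normfV ler_pdivrMr ?normr_gt0// /along !mul1r addr0.
  have -> : upd i (co i x) x = x by case: (x) => [[? ?] ?]; case: (i).
  move/le_trans; apply; rewrite -mulrA ler_peMl ?mulr_ge0 ?exprn_ge0//; lra.
apply: (@le_trans _ _ (K + K)).
  by apply: le_trans (ler_normB _ _) _; apply: lerD; exact: dd_at_bounded.
have : 1 <= K * `|t| by rewrite mulrC -ler_pdivrMr ?ltr0n// div1r ltW.
by move: K1; move: K `|t| => y z; rewrite expr2; nra.
Qed.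

Lemma dd_at_lip x z : Omega_bar x -> Omega_bar z -> `|f x - f z| <= 6 * K ^+ 2 * edist x z.
Proof.
move=> hx hz; have [x1 x2 x3] := hx; have [z1 z2 z3] := hz.
pose y1 : X3 := (z.1.1, x.1.2, x.2); pose y2 : X3 := (z.1.1, z.1.2, x.2).
have o1 : Omega_bar (y1 : pt R) by split.
have o2 : Omega_bar (y2 : pt R) by split.
have e1 : upd A1 (co A1 x + (co A1 z - co A1 x)) x = y1 by rewrite subrKC.
have e2 : upd A2 (co A2 y1 + (co A2 z - co A2 y1)) y1 = y2 by rewrite subrKC.
have e3 : upd A3 (co A3 y2 + (co A3 z - co A3 y2)) y2 = z by rewrite subrKC /y2; move: (z) => [[? ?] ?].
have h1 := @coord_lip x A1 (co A1 z - co A1 x) hx; rewrite e1 in h1.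
have h2 := @coord_lip y1 A2 (co A2 z - co A2 y1) o1; rewrite e2 in h2.
have h3 := @coord_lip y2 A3 (co A3 z - co A3 y2) o2; rewrite e3 in h3.
have K0 : 0 <= 2 * K ^+ 2 by rewrite mulr_ge0// exprn_ge0.
have g i : 2 * K ^+ 2 * `|co i z - co i x| <= 2 * K ^+ 2 * edist x z.
  by rewrite ler_wpM2l// edistC co_edist.
have := h1 o1; have := h2 o2; have := h3 hz; have := g A1; have := g A2; have := g A3.
rewrite (distrC (f x)); have := ler_distD (f y2) (f z) (f x); have := ler_distD (f y1) (f y2) (f x).
rewrite (_ : co A2 y1 = co A2 x)// (_ : co A3 y2 = co A3 x)//.
rewrite (_ : 6 * K ^+ 2 * edist x z = 3 * (2 * K ^+ 2 * edist x z)); last by ring.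
move: (2 * K ^+ 2 * edist x z) (2 * K ^+ 2 * `|co A1 z - co A1 x|) (2 * K ^+ 2 * `|co A2 z - co A2 x|)
  (2 * K ^+ 2 * `|co A3 z - co A3 x|) => k0 k1 k2 k3.
by move: (`|f z - f x|) (`|f y1 - f x|) (`|f y2 - f y1|) (`|f z - f y2|) (`|f y2 - f x|) => *; lra.
Qed.

End AnalyticData.

(** * The boundary layer *)

Section Source.
Variable R : realType.
Notation X3 := (R * R * R)%type.
Implicit Types (x z : X3) (i : axis) (v w : X3 -> R).
Variables (f : X3 -> R) (n : nat) (c : R).
Hypothesis hdd : forall x, Omega_bar x -> dd_at f n x.
Hypothesis c0 : 0 <= c.
Notation K := (n.+1%:R : R).

Definition source x := \1_(OM : set X3) x * (c * f x).

Lemma source_in x : Omega x -> source x = c * f x.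
Proof. by move=> hx; rewrite /source indicE mem_set// mul1r. Qed.

Lemma source_out x : ~ Omega x -> source x = 0.
Proof. by move=> hx; rewrite /source indicE memNset// mul0r. Qed.

Lemma Omega_sub x : Omega (x : pt R) -> Omega_bar (x : pt R).
Proof. by case=> /andP[a1 a2] /andP[b1 b2] /andP[d1 d2]; split; apply/andP; split; exact: ltW. Qed.

Let clampr (t : R) := Num.max 0 (Num.min 1 t).
Let clamp x : X3 := (clampr x.1.1, clampr x.1.2, clampr x.2).

Let clampr_in t : 0 <= clampr t <= 1.
Proof. by rewrite /clampr le_max lexx /= ge_max ler01 /= ge_min lexx. Qed.

Let clampr_id t : 0 <= t <= 1 -> clampr t = t.
Proof. by rewrite /clampr => /andP[t0 t1]; rewrite min_r// max_r. Qed.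

Let clampr_lip t u : (clampr t - clampr u) ^+ 2 <= (t - u) ^+ 2.
Proof.
rewrite -[leLHS]real_normK ?num_real// -[leRHS]real_normK ?num_real//.
apply: lerXn2r; rewrite ?nnegrE//.
exact: clamp_unit_lip.
Qed.

Lemma source_lip x z : Omega x -> Omega z -> `|source x - source z| <= 6 * c * K ^+ 2 * edist x z.
Proof.
move=> hx hz; rewrite !source_in// -mulrBr normrM ger0_norm//.
have := dd_at_lip hdd (Omega_sub hx) (Omega_sub hz) => h.
by rewrite (_ : 6 * c * K ^+ 2 * edist x z = c * (6 * K ^+ 2 * edist x z)); [rewrite ler_wpM2l|ring].
Qed.

Lemma source_bound x : `|source x| <= c * K.
Proof.
have [hx|hx] := pselect (Omega (x : pt R)); last by rewrite source_out// normr0 mulr_ge0.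
by rewrite source_in// normrM ger0_norm// ler_wpM2l//; apply: (dd_at_bounded hdd); exact: Omega_sub.
Qed.

(** Nothing is known of [f] off the closed cube. Composition with the coordinatewise projection
    [clamp] onto the cube gives a globally Lipschitz function that yields the same source. *)
Lemma measurable_source : measurable_fun setT source.
Proof.
have -> : source = fun x => \1_(OM : set X3) x * (c * f (clamp x)).
  apply/funext => x; have [hx|hx] := pselect (Omega (x : pt R)); last first.
    by rewrite source_out// indicE memNset// mul0r.
  rewrite source_in// indicE mem_set// mul1r; have [h1 h2 h3] := Omega_sub hx.
  have -> // : clamp x = x.
  by rewrite /clamp (clampr_id h1) (clampr_id h2) (clampr_id h3); case: (x) => [[? ?] ?].
have mO := @measurable_Omega R.
apply: measurable_funM; first exact: measurable_indic.
apply: measurable_funM => //.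
apply: (@measurable_lip R _ (6 * K ^+ 2)); first by rewrite mulr_ge0// exprn_ge0.
have cin x : Omega_bar (clamp x : pt R) by split; exact: clampr_in.
move=> x z; apply: le_trans (dd_at_lip hdd (cin x) (cin z)) _.
rewrite ler_wpM2l ?mulr_ge0 ?exprn_ge0// ler_wsqrtr//.
by apply: lerD; [apply: lerD|]; exact: clampr_lip.
Qed.

Lemma sqi_indic_Omega : sqi L3 (\1_(OM : set X3) : X3 -> R) /\
  ip L3 (\1_(OM : set X3) : X3 -> R) (\1_(OM : set X3)) = 1.
Proof.
have mO := @measurable_Omega R.
have mi : measurable_fun setT (\1_(OM : set X3) : X3 -> R) by exact: measurable_indic.
have h : (\int[L3]_x ((\1_(OM : set X3) x : R) ^+ 2)%:E = 1)%E.
  transitivity (\int[L3]_x (\1_(OM : set X3) x : R)%:E)%E.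
    by apply: eq_integral => x _; rewrite indicE; case: (_ \in _); rewrite ?expr1n// expr0n.
  by rewrite integral_indic// setIT; exact: L3_Omega.
have si : sqi L3 (\1_(OM : set X3) : X3 -> R) by split => //; rewrite h ltry.
by split => //; have := sqi_fin si; rewrite h => -[->].
Qed.

Lemma bounded_sqi v M : measurable_fun setT v -> 0 <= M -> (forall x, Omega x -> `|v x| <= M) ->
  (forall x, ~ Omega x -> v x = 0) -> sqi L3 v /\ ip L3 v v <= M ^+ 2.
Proof.
move=> mv M0 hv hv0; have [si i1] := sqi_indic_Omega.
have := @sqi_le _ _ R L3 v _ (M ^+ 2) mv si (sqr_ge0 _); rewrite i1 mulr1; apply => x.
have [hx|hx] := pselect (Omega (x : pt R)); last first.
  by rewrite hv0// expr0n mulr_ge0// sqr_ge0.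
rewrite indicE mem_set// expr1n mulr1 -[leLHS]real_normK ?num_real//.
by apply: lerXn2r; rewrite ?nnegrE//; exact: hv.
Qed.

Lemma source_sqi : sqi L3 source.
Proof.
have [] // := @bounded_sqi source (c * K) measurable_source.
- by rewrite mulr_ge0.
- by move=> x _; exact: source_bound.
- exact: source_out.
Qed.

(** A deformation path stays in the cube and is a segment of direction [chi (co i x)], of size at
    most one, so [dd_at] applies pointwise. The factor 3 is due to the affine Jacobian, and the cube
    has measure one. *)
Lemma source_dd i a k e (er : R) : er <= 1 / 24 -> er <= K^-1 -> adm er a k e ->
  ip L3 (fun x => dd (fun t => Gf i source t x) a k e) (fun x => dd (fun t => Gf i source t x) a k e)
  <= ((3 * c * K) * K ^+ k) ^+ 2.
Proof.
move=> e24 eK h; have K1 : 1 <= K by rewrite ler1n.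
have K0 : 0 <= K by [].
have cK0 : 0 <= c * K by rewrite mulr_ge0.
refine (proj2 (@bounded_sqi (fun x => dd (fun t => Gf i source t x) a k e) (3 * c * K * K ^+ k) _ _ _ _)).
- by have [] := dd_sqi h (sGf i e24 source_sqi).
- by rewrite !mulr_ge0// exprn_ge0.
- move=> x hx.
  have e1 t : `|t| <= er -> `|t| < 1 by move=> ht; apply: le_lt_trans ht _; lra.
  have chi1 : `|chi (co i x)| <= 1.
    by rewrite ger0_norm ?chi_ge0//; have := chi_half (co i x); lra.
  pose g t := along f i (chi (co i x)) x t.
  have hg a' k' e' : adm er a' k' e' -> `|dd (fun t => c * g t) a' k' e'| <= (c * K) * K ^+ k'.
    move=> [ia oe he ha]; rewrite ddZ normrM (ger0_norm c0) -mulrA -exprS ler_wpM2l//.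
    apply: hdd => //; first exact: Omega_sub.
    by split => //; [exact: le_trans eK|move=> j jk; exact: le_trans (ha j jk) eK].
  have jsg1 t : `|jsg t| <= 1 :> R.
    by rewrite /jsg; do ![case: ifP => _]; rewrite ?normr0 ?normrN ?normr1.
  have b2 t : `|t| <= er -> `|1 + jsg (co i x) * t| <= 2.
    move=> ht; apply: le_trans (ler_normD _ _) _; rewrite normr1 normrM.
    have : `|jsg (co i x)| * `|t| <= 1 * er by apply: ler_pM.
    lra.
  have := dd_affine_bound cK0 K1 (jsg1 _) b2 hg h.
  rewrite (_ : 3 * (c * K) * K ^+ k = 3 * c * K * K ^+ k); last by ring.
  apply: le_trans; rewrite le_eqVlt; apply/orP; left; apply/eqP; congr `|_|.
  have E t : `|t| <= er -> Gf i source t x = (1 + jsg (co i x) * t) * (c * g t).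
    move=> ht; rewrite /Gf JPhiE source_in; last by apply/Omega_Phi => //; exact: e1.
    by rewrite /g /along /Phi /phi mulrC (mulrC t).
  by have [_ _ he ha] := h; apply: dd_ext => [|j jk]; apply: E => //; exact: ha.
- move=> x hx; have [_ _ he ha] := h.
  have Z t : `|t| <= er -> Gf i source t x = (0 : R -> R) t.
    move=> ht; rewrite /Gf source_out ?mul0r// => /Omega_Phi; apply: contra_not hx; apply.
    by apply: le_lt_trans ht _; lra.
  rewrite (@dd_ext R _ (fun t => 0 * t) a k e) ?ddZ ?mul0r//.
  + by rewrite Z// mul0r.
  + by move=> j jk; rewrite Z ?mul0r//; exact: ha.
Qed.

End Source.

Section WeakForm.
Variable R : realType.
Variable s : R.
Hypothesis s01 : 0 < s < 1.
Notation X3 := (R * R * R)%type.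
Implicit Types (v w f : X3 -> R).

(** The scaling [2 / Cs s] undoes the normalisation of [aform], which is legitimate because [Cs s]
    is nonzero. *)
Lemma weak_form f w v : (sqi L3 (source f (2 / Cs s)) -> Hs s w -> Hs s v ->
  aform s w v = L2ip f v -> (forall x, ~ Omega x -> v x = 0) ->
  A s w v = ip L3 (source f (2 / Cs s)) v).
Proof.
move=> sF [_ hw _] [sv hv _] h v0; have C0 := Cs_gt0 s01.
have C20 : Cs s / 2 != 0 by rewrite mulf_neq0// gt_eqF.
apply: (mulfI C20); rewrite -(aformE hw hv) h.
transitivity (ip L3 (fun x => Cs s / 2 * source f (2 / Cs s) x) v); last exact: (ipZl _ sF sv).
rewrite /L2ip /ip.
have -> : (Rintegral L3 setT (fun x => Cs s / 2 * source f (2 / Cs s) x * v x)) =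
    Rintegral L3 setT ((fun x => f x * v x) \_ (OM : set X3)).
  apply: eq_Rintegral => x _; rewrite /patch.
  have [hx|hx] := pselect (Omega (x : pt R)); last by rewrite memNset// v0// !mulr0.
  rewrite mem_set// source_in//.
  by field; rewrite gt_eqF.
by rewrite -Rintegral_mkcond.
Qed.

End WeakForm.

Lemma dilation_dist (R : realFieldType) (lam t : R) : 0 < lam <= 1 -> 0 < t < 1 ->
  `|t - (lam * t + (1 - lam) / 2)| <= (1 - lam) / 2.
Proof. by move=> l01 t01; rewrite ler_norml; apply/andP; split; nra. Qed.

Lemma sub_cross_le (R : realFieldType) (a b c : R) : c <= a -> a - b - (b - c) <= 2 * (a - b).
Proof. lra. Qed.

(** * Comparison of the solution with its dilations *)

Section BoundaryLayer.
Variable R : realType.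
Variable s : R.
Hypothesis s01 : 0 < s < 1.
Notation X3 := (R * R * R)%type.
Notation X6 := (X3 * X3)%type.
Implicit Types (x z : X3) (p : X6) (v w : X3 -> R) (h lam : R).
Variables (u F : X3 -> R) (K : R).
Hypothesis hu : Ho s u.
Hypothesis sF : sqi L3 F.
Hypothesis K0 : 0 <= K.
Hypothesis F_bound : forall x, `|F x| <= K.
Hypothesis F_lip : forall x z, Omega x -> Omega z -> `|F x - F z| <= K * edist x z.
Hypothesis weak : forall v, Ho s v -> A s u v = ip L3 F v.

Definition dil lam x : X3 := (lam * x.1.1 + (1 - lam) / 2, lam * x.1.2 + (1 - lam) / 2, lam * x.2 + (1 - lam) / 2).

Lemma co_dil i lam x : co i (dil lam x) = lam * co i x + (1 - lam) / 2.
Proof. by case: i. Qed.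

Lemma dilK lam x : lam != 0 -> dil lam^-1 (dil lam x) = x.
Proof. by move=> l0; case: x => [[a b] c]; rewrite /dil /=; congr (_, _, _); field. Qed.

Lemma jacm_dil lam : 0 < lam -> jacm L3 (dil lam) (fun=> lam ^+ 3).
Proof.
move=> l0.
have mD : measurable_fun setT (dil lam).
  have m i : measurable_fun setT (fun x : X3 => lam * co i x + (1 - lam) / 2).
    by apply: measurable_funD => //; apply: measurable_funM => //; exact: measurable_co.
  by apply: measurable_tuple3; [exact: (m A1)|exact: (m A2)|exact: (m A3)].
split=> // [x|G mG G0]; first by rewrite exprn_ge0// ltW.
rewrite [RHS](@integral_affine3 R (lam, lam, lam) ((1 - lam) / 2, (1 - lam) / 2, (1 - lam) / 2))//; last by case.
have := @ge0_intZr _ _ R L3 (lam ^+ 3) (fun x => G (dil lam x)) (exprn_ge0 _ (ltW l0))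
  (measurableT_comp mG mD) (fun x => G0 _).
by move=> /= ->; rewrite muleC; congr (_%:E * _)%E; rewrite !exprS expr0 mulr1 mulrA.
Qed.

Lemma edist_dil lam x z : 0 <= lam -> edist (dil lam x) (dil lam z) = lam * edist x z.
Proof.
move=> l0; rewrite -[RHS]ger0_norm ?mulr_ge0 ?edist_ge0// -sqrtr_sqr; congr Num.sqrt.
by rewrite exprMn edist_sqr /c1 /c2 /c3 /=; ring.
Qed.

Lemma Omega_dil lam x : 0 < lam <= 1 -> Omega (x : pt R) -> Omega (dil lam x : pt R).
Proof.
by move=> l01 [/= h1 h2 h3]; split; rewrite /c1 /c2 /c3 /= in h1 h2 h3 *; apply/andP; split; nra.
Qed.

(* The dilation moves [u] out of the layer [rr <= (1 - lam) / 2] without increasing its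
   energy, so by the weak form the energy of [u - udil lam] is a difference of source terms. *)
Definition udil lam x := u (dil lam^-1 x).

Let lam_inv lam : 0 < lam <= 1 -> 0 < lam^-1 /\ 1 <= lam^-1.
Proof. by case/andP=> l0 l1; rewrite invr_gt0 l0 invr_ge1// unitfE gt_eqF. Qed.

Lemma udil_out lam x : 0 < lam <= 1 -> rr x <= (1 - lam) / 2 -> udil lam x = 0.
Proof.
move=> l01 hr; have [_ u0] := hu; apply: u0 => -[h1 h2 h3].
have [l0 l1] := andP l01.
have hco i : (1 - lam) / 2 < chi (co i x).
  have : 0 < co i (dil lam^-1 x) < 1 by case: i; [exact: h1|exact: h2|exact: h3].
  rewrite co_dil => /andP[k1 k2].
  have m1 : 0 < co i x - (1 - lam) / 2.
    have := mulr_gt0 l0 k1; rewrite (_ : lam * _ = co i x - (1 - lam) / 2)//.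
    by field; rewrite gt_eqF.
  have m2 : 0 < 1 - co i x - (1 - lam) / 2.
    have : 0 < lam * (1 - (lam^-1 * co i x + (1 - lam^-1) / 2)) by rewrite mulr_gt0// subr_gt0.
    by rewrite (_ : lam * _ = 1 - co i x - (1 - lam) / 2)//; field; rewrite gt_eqF.
  by rewrite /chi lt_max lt_min; apply/orP; right; apply/andP; split; lra.
by have := lt_rr hco; lra.
Qed.

(** Exact scaling would give [lam ^ (3 - 2 * s)]. The rounded kernel bound [lam ^- 5] against the
    Jacobian [lam ^ 6] leaves [lam <= 1], which is enough. *)
Lemma udil_Ho lam : 0 < lam <= 1 -> Ho s (udil lam) /\ A s (udil lam) (udil lam) <= A s u u.
Proof.
move=> l01; have [l0 l1] := andP l01; have [i0 i1] := lam_inv l01.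
have [[su sdu uo] u0] := hu.
have jd := jacm_dil i0.
have jd2 : jacm L6 (fun p : X6 => (dil lam^-1 p.1, dil lam^-1 p.2)) (fun=> lam^-1 ^+ 3 * lam^-1 ^+ 3).
  exact: (jacm_prod jd jd).
have l3 : 0 < lam^-1 ^+ 3 by rewrite exprn_gt0.
have out x : ~ Omega x -> udil lam x = 0.
  by move=> hx; apply: udil_out => //; rewrite rr_eq0// divr_ge0// subr_ge0; case/andP: l01.
have [s1 _] := jacm_sqi jd l3 (fun x => lexx _) su.
have [s2 le2] := jacm_sqi jd2 (mulr_gt0 l3 l3) (fun _ : X6 => lexx _) sdu.
have [s3 le3] : sqi L6 (dv s (udil lam)) /\ ip L6 (dv s (udil lam)) (dv s (udil lam)) <=
    lam ^- 5 * ip L6 (fun p => dv s u (dil lam^-1 p.1, dil lam^-1 p.2)) (fun p => dv s u (dil lam^-1 p.1, dil lam^-1 p.2)).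
  apply: sqi_le => //; first by apply: measurable_dv; case: s1.
    by rewrite invr_ge0 exprn_ge0// ltW.
  move=> p; rewrite !dv2 /= mulrCA ler_wpM2l ?sqr_ge0//.
  apply: kern_le => //=; rewrite edist_dil ?(ltW i0)//.
    by rewrite mulrA mulfV ?mul1r// gt_eqF.
  by move/eqP; rewrite mulf_eq0 (gt_eqF i0) => /eqP.
split; first by split => //; split => // x hx; apply: out; apply: contra_not hx; exact: Omega_sub.
apply: le_trans le3 _.
have A0 : 0 <= A s u u := A_ge0 s u.
apply: (@le_trans _ _ (lam ^- 5 * ((lam^-1 ^+ 3 * lam^-1 ^+ 3)^-1 * A s u u))).
  by rewrite ler_wpM2l// invr_ge0 exprn_ge0// ltW.
rewrite (_ : lam ^- 5 * _ = lam * A s u u); last by field; rewrite gt_eqF.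
by rewrite ler_piMl.
Qed.

(** A substitution moves the dilation from [u] to [F], for which a Lipschitz bound is available. The
    constant 4 is 1 from the displacement plus 3 from [1 - lam ^ 3 <= 3 * (1 - lam)]. *)
Lemma udil_diff lam : 0 < lam <= 1 ->
  ip L3 F (fun x => u x - udil lam x) <= 4 * K * (1 - lam) * Num.sqrt (ip L3 u u).
Proof.
move=> l01; have [l0 l1] := andP l01; have [i0 i1] := lam_inv l01.
have [[su _ _] u0] := hu; have [[[su' _ _] _] _] := udil_Ho l01.
have [si ii] := sqi_indic_Omega R.
have [mD _ _ _] := jacm_dil l0; have mF := sF.1.
pose c x := \1_(OM : set X3) x * (F x - lam ^+ 3 * F (dil lam x)).
have mc : measurable_fun setT c.
  apply: measurable_funM; first by case: si.
  by apply: measurable_funB => //; apply: measurable_funM => //; exact: measurableT_comp.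
have c_le x : `|c x| <= 4 * K * (1 - lam).
  have M0 : 0 <= 4 * K * (1 - lam) by rewrite !mulr_ge0// subr_ge0.
  rewrite /c; have [hx|hx] := pselect (Omega (x : pt R)); last first.
    by rewrite indicE memNset// mul0r normr0.
  rewrite indicE mem_set// mul1r.
  have -> : F x - lam ^+ 3 * F (dil lam x) = (F x - F (dil lam x)) + (1 - lam ^+ 3) * F (dil lam x) by ring.
  apply: le_trans (ler_normD _ _) _; rewrite normrM.
  have hd : edist x (dil lam x) <= 1 - lam.
    have -> : 1 - lam = 2 * ((1 - lam) / 2) by field.
    apply: edist_le_max => [|i]; first by rewrite divr_ge0// subr_ge0; case/andP: l01.
    rewrite co_dil.
    have [h1 h2 h3] := hx.
    have : 0 < co i x < 1 by case: i; [exact: h1|exact: h2|exact: h3].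
    exact: dilation_dist.
  have f1 : `|F x - F (dil lam x)| <= K * (1 - lam).
    by apply: le_trans (F_lip hx (Omega_dil l01 hx)) _; rewrite ler_wpM2l.
  have l3 : lam ^+ 3 <= 1 by rewrite exprn_ile1// ltW.
  have f2 : `|1 - lam ^+ 3| * `|F (dil lam x)| <= (3 * (1 - lam)) * K.
    apply: ler_pM => //; rewrite ger0_norm ?subr_ge0//.
    by rewrite (_ : 1 - lam ^+ 3 = (1 + lam + lam ^+ 2) * (1 - lam)); [rewrite ler_wpM2r ?subr_ge0// expr2; nra|ring].
  by move: f1 f2; move: (`|_|) (`|_| * `|_|) => y1 y2; lra.
have M0 : 0 <= 4 * K * (1 - lam) by rewrite !mulr_ge0// subr_ge0.
have [_ hc] := cauchy_bound si su mc M0 c_le.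
rewrite ipBr//.
have E1 : ip L3 F (udil lam) = ip L3 (fun x => lam ^+ 3 * (\1_(OM : set X3) x * F (dil lam x))) u.
  rewrite /ip -(jacm_R (jacm_dil l0)); last by apply: measurable_funM => //; case: su'.
  apply: eq_Rintegral => x _; rewrite /udil dilK ?gt_eqF//.
  have [hx|hx] := pselect (Omega (x : pt R)); last by rewrite u0// !mulr0 mul0r.
  have -> : \1_(OM : set X3) x = 1 :> R by rewrite indicE mem_set.
  by ring.
have s4 : sqi L3 (fun x => lam ^+ 3 * (\1_(OM : set X3) x * F (dil lam x))).
  have l3 : 0 < lam ^+ 3 by rewrite exprn_gt0.
  have [s5 _] := jacm_sqi (jacm_dil l0) l3 (fun x => lexx _) sF.
  have i1' (x : X3) : `|\1_(OM : set X3) x : R| <= 1.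
    by rewrite indicE; case: (_ \in _); rewrite ?normr1 ?normr0.
  by apply: sqiZ; have [] := cauchy_bound s5 s5 si.1 ler01 i1'.
rewrite E1 -ipBl//.
have -> : ip L3 (fun x => F x - lam ^+ 3 * (\1_(OM : set X3) x * F (dil lam x))) u =
    ip L3 (\1_(OM : set X3)) (fun x => c x * u x).
  apply: eq_Rintegral => x _; rewrite /c.
  have [hx|hx] := pselect (Omega (x : pt R)); last by rewrite u0// !mulr0.
  have -> : \1_(OM : set X3) x = 1 :> R by rewrite indicE mem_set.
  by ring.
by apply: le_trans (ler_norm _) _; apply: le_trans hc _; rewrite ii sqrtr1 mulr1.
Qed.

Definition shal h x := if rr x <= h then wh s x * u x else 0.

Let whu_sqi : sqi L3 (fun x => wh s x * u x).
Proof. by have [] := hardy s01 hu.1. Qed.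

Lemma shal_sqi h : sqi L3 (shal h) /\ ip L3 (shal h) (shal h) <=
  1 * ip L3 (fun x => wh s x * u x) (fun x => wh s x * u x).
Proof.
apply: sqi_le => //.
  apply: (measurable_fun_ifT (g := fun x => wh s x * u x) (h := fun=> 0)) => //; last by case: whu_sqi.
  apply: measurable_fun_ler => //; exact: measurable_rr.
by move=> x; rewrite mul1r /shal; case: ifP => _ //; rewrite expr0n sqr_ge0.
Qed.

Lemma shallow : exists2 C, 0 <= C & forall h, 0 < h -> ip L3 (shal h) (shal h) <= C * h.
Proof.
set B := ip L3 (fun x => wh s x * u x) (fun x => wh s x * u x).
have B0 : 0 <= B by exact: ip_ge0.
set Q := Num.sqrt (ip L3 u u); have Q0 : 0 <= Q by exact: sqrtr_ge0.
set C1 := 4 ^+ 5 * (2 * (4 * K * 2 * Q)).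
have C10 : 0 <= C1 by rewrite !mulr_ge0.
exists (4 * B + C1); first by rewrite addr_ge0// mulr_ge0.
move=> h h0; have [h4|h4] := leP h (1 / 4); last first.
  apply: le_trans (shal_sqi h).2 _; rewrite -/B mul1r mulrDl.
  have : 0 <= C1 * h by rewrite mulr_ge0// ltW.
  have : B * 1 <= B * (4 * h) by rewrite ler_wpM2l//; lra.
  by move: (C1 * h) => y; lra.
(* For this ratio [udil lam] vanishes on the layer of depth [h], so [u] equals [u - udil lam] there
   and the Hardy inequality applies to the difference. *)
pose lam := 1 - 2 * h; have l01 : 0 < lam <= 1 by rewrite /lam; lra.
have [hud eud] := udil_Ho l01; have hd := HoB hu hud.
have [sw lw] := hardy s01 hd.1.
have e1 : ip L3 (shal h) (shal h) <= 1 * ip L3 (fun x => wh s x * (u x - udil lam x)) (fun x => wh s x * (u x - udil lam x)).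
  apply: (sqi_le _ sw _ _).2 => //; first by case: (shal_sqi h).1.
  move=> x; rewrite mul1r /shal; case: ifP => hr; last by rewrite expr0n sqr_ge0.
  by rewrite udil_out ?subr0// (_ : (1 - lam) / 2 = h)// /lam; field.
have e2 : A s (fun x => u x - udil lam x) (fun x => u x - udil lam x) <= 2 * ip L3 F (fun x => u x - udil lam x).
  have [H1 H2] := (hu.1, hud.1).
  have H3 := HsB H1 H2.
  rewrite -weak// (ABl H1 H2 H3) (ABr H1 H2 H1) (ABr H1 H2 H2).
  by rewrite (AC s (udil lam) u); exact: sub_cross_le.
have e3 := udil_diff l01; rewrite -/Q in e3.
apply: le_trans e1 _; rewrite mul1r; apply: le_trans lw _.
rewrite mulrDl; apply: (@le_trans _ _ (C1 * h)); last by rewrite lerDr !mulr_ge0// ltW.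
rewrite /C1 -mulrA ler_wpM2l ?exprn_ge0//; apply: le_trans e2 _; rewrite -mulrA ler_wpM2l//.
by apply: le_trans e3 _; rewrite /lam le_eqVlt; apply/orP; left; apply/eqP; ring.
Qed.

End BoundaryLayer.

(** * Local interpolation *)

Section WeightedNorm.
Variable R : realType.
Variable s : R.
Hypothesis s01 : 0 < s < 1.
Notation X3 := (R * R * R)%type.
Implicit Types (x z : X3) (v w : X3 -> R) (i : axis) (e : R).

Definition wsq v := measurable_fun setT v /\ sqi L3 (fun x => wh s x * v x).
Definition nw v : R := Num.sqrt (ip L3 (fun x => wh s x * v x) (fun x => wh s x * v x)).

Lemma nw_ge0 v : 0 <= nw v. Proof. exact: sqrtr_ge0. Qed.

Lemma nw_sqr v : nw v ^+ 2 = ip L3 (fun x => wh s x * v x) (fun x => wh s x * v x).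
Proof. by rewrite sqr_sqrtr// ip_ge0. Qed.

Lemma nwD v w : wsq v -> wsq w ->
  wsq (fun x => v x + w x) /\ nw (fun x => v x + w x) <= nw v + nw w.
Proof.
move=> [mv hv] [mw hw]; rewrite /wsq /nw.
have -> : (fun x => wh s x * (v x + w x)) = fun x => wh s x * v x + wh s x * w x.
  by apply/funext => x; rewrite mulrDr.
by split; [split; [exact: measurable_funD|exact: sqiD]|exact: ip_sqrtD].
Qed.

Lemma nwZ (c : R) v : wsq v -> wsq (fun x => c * v x) /\ nw (fun x => c * v x) = `|c| * nw v.
Proof.
move=> [mv hv]; rewrite /wsq /nw.
have -> : (fun x => wh s x * (c * v x)) = fun x => c * (wh s x * v x).
  by apply/funext => x; rewrite mulrCA.
split; first by split; [exact: measurable_funM|exact: sqiZ].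
by rewrite ipZl ?ipZr//; [rewrite mulrA -expr2 sqrtrM ?sqr_ge0// sqrtr_sqr|exact: sqiZ].
Qed.

Lemma nw_sum (m : nat) (c : 'I_m -> R) (v : 'I_m -> X3 -> R) (C E : R) : 0 <= C ->
  (forall j, `|c j| <= C) -> (forall j, wsq (v j) /\ nw (v j) <= E) ->
  wsq (fun x => \sum_(j < m) c j * v j x) /\ nw (fun x => \sum_(j < m) c j * v j x) <= m%:R * C * E.
Proof.
move=> C0 hc hv; elim: m c v hc hv => [|m IH] c v hc hv.
  have -> : (fun x => \sum_(j < 0) c j * v j x) = fun=> 0 :> R by apply/funext => x; rewrite big_ord0.
  rewrite !mul0r /wsq /nw (_ : (fun x => wh s x * 0) = fun=> 0); last by apply/funext => x; rewrite mulr0.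
  have s0 := @sqi0 _ _ R L3; split; first by split.
  have [_] := @sqi_le _ _ R L3 (fun=> 0) _ 0 (measurable_cst _) s0 (lexx _) (fun x => ltac:(by rewrite expr0n mulr0)).
  by rewrite mul0r => h; rewrite ler0_sqrtr.
have -> : (fun x => \sum_(j < m.+1) c j * v j x) =
    fun x => (\sum_(j < m) c (widen_ord (leqnSn m) j) * v (widen_ord (leqnSn m) j) x) + c ord_max * v ord_max x.
  by apply/funext => x; rewrite big_ord_recr.
have [s1 n1] := IH (fun j => c (widen_ord (leqnSn m) j)) (fun j => v (widen_ord (leqnSn m) j))
  (fun j => hc _) (fun j => hv _).
have [hs hn] := hv ord_max; have [s2 n2] := nwZ (c ord_max) hs.
have [s3 n3] := nwD s1 s2; split => //; apply: le_trans n3 _.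
rewrite -natr1 !mulrDl mul1r; apply: lerD => //; rewrite n2.
by apply: ler_pM => //; exact: nw_ge0.
Qed.

(** The boundary distance changes by a factor of at most 2, hence the squared weight by at most 4;
    with the Jacobian this gives [4 * (4 / 3) <= 3 ^ 2]. *)
Lemma nw_Phi i e v : `|e| <= 1 / 4 -> wsq v ->
  wsq (fun x => v (Phi i e x)) /\ nw (fun x => v (Phi i e x)) <= 3 * nw v.
Proof.
move=> he [mv hv]; have e1 : `|e| < 1 by apply: le_lt_trans he _; lra.
have c34 : 0 < 3 / 4 :> R by lra.
have [s1 l1] := jacm_sqi (jacm_Phi i e1) c34 (fun x => (andP (JPhi_bounds i x he)).1) hv.
have mP : measurable_fun setT (fun x => v (Phi i e x)).
  by apply: measurableT_comp => //; exact: measurable_Phi.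
have mw : measurable_fun setT (fun x => wh s x * v (Phi i e x)).
  by apply: measurable_funM => //; exact: measurable_wh.
have pt x : (wh s x * v (Phi i e x)) ^+ 2 <= 4 * (wh s (Phi i e x) * v (Phi i e x)) ^+ 2.
  have w2 : wh s x <= 2 * wh s (Phi i e x).
    have [r0|r0] := ltP 0 (rr x); last first.
      rewrite wh_out ?mulr_ge0 ?wh_ge0// => /rr_gt0; lra.
    have /andP[r1 r2] := rr_Phi i x he.
    have r3 : 0 < rr (Phi i e x) by lra.
    have h2 : 2 `^ (- s) * wh s x <= wh s (Phi i e x).
      by rewrite /wh -powRM ?(ltW r0)//; apply: powRN_le => //; have := s01; lra.
    have h3 : 2^-1 <= 2 `^ (- s) :> R.
      rewrite powRN lef_pV2 ?posrE ?powR_gt0// -[leRHS]powRr1// ler_powR ?ler1n//.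
      by case/andP: s01 => _ /ltW.
    have h4 : 2^-1 * wh s x <= 2 `^ (- s) * wh s x by rewrite ler_wpM2r ?wh_ge0.
    by rewrite -(@ler_pM2l _ 2^-1)// mulKf//; exact: le_trans h4 h2.
  have gen (p q y : R) : 0 <= p -> p <= 2 * q -> (p * y) ^+ 2 <= 4 * (q * y) ^+ 2.
    move=> p0 pq; rewrite (_ : 4 * (q * y) ^+ 2 = (2 * q) ^+ 2 * y ^+ 2); last by ring.
    by rewrite exprMn; apply: ler_wpM2r; [exact: sqr_ge0|apply: lerXn2r => //; rewrite nnegrE; lra].
  by apply: gen => //; exact: wh_ge0.
have [s2 l2] := @sqi_le _ _ R L3 _ _ 4 mw s1 (ler0n R 4) pt; split; first by split.
apply: (@le_trans _ _ (Num.sqrt (3 ^+ 2 * ip L3 (fun x => wh s x * v x) (fun x => wh s x * v x)))).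
  rewrite ler_wsqrtr//; apply: le_trans l2 _.
  move: l1 (ip_ge0 L3 (fun x => wh s x * v x)); move: (ip _ _ _) (ip _ _ _) => y z; lra.
by rewrite sqrtrM ?sqr_ge0// sqrtr_sqr ger0_norm.
Qed.

Lemma nw_Ho v : Ho s v -> wsq v /\ nw v <= 32 * Num.sqrt (A s v v).
Proof.
move=> [hv _]; have [s1 l1] := hardy s01 hv; split; first by split => //; case: hv => [[]].
apply: (@le_trans _ _ (Num.sqrt (32 ^+ 2 * A s v v))).
  by rewrite ler_wsqrtr// (_ : 32 ^+ 2 = 4 ^+ 5 :> R)//; ring.
by rewrite sqrtrM ?sqr_ge0// sqrtr_sqr ger0_norm.
Qed.

Lemma nwB v w : wsq v -> wsq w -> wsq (fun x => v x - w x).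
Proof.
move=> hv hw; have [h2 _] := nwZ (-1) hw; have [h _] := nwD hv h2.
by move: h; congr wsq; apply/funext => x; rewrite mulN1r.
Qed.

End WeightedNorm.

Lemma thrice3_le (R : realFieldType) (a b c d : R) : b <= 3 * a -> c <= 3 * b -> d <= 3 * c -> d <= 27 * a.
Proof. lra. Qed.

Section Interpolation.
Variable R : realType.
Variable s : R.
Hypothesis s01 : 0 < s < 1.
Notation X3 := (R * R * R)%type.
Implicit Types (x z tau : X3) (v w : X3 -> R) (i : axis) (e t : R).
Variables (u : X3 -> R) (e0 D Gam : R) (m : nat).
Hypothesis hu : Ho s u.
Hypothesis e00 : 0 < e0.
Hypothesis e0s : e0 <= 1 / 24.
Hypothesis m0 : (0 < m)%N.
Hypothesis D0 : 0 <= D.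
Hypothesis Gam0 : 0 <= Gam.
Notation a := (enode e0 m).
Notation ell := (lag a m).
Hypothesis hreg : forall i (b : nat -> R) k e, adm e0 b k e ->
  Ho s (Ud i u b k e) /\ Num.sqrt (A s (Ud i u b k e) (Ud i u b k e)) <= D * Gam ^+ k.

(** Three factors of the Newton remainder: [(2 * e0) ^ m] bounds the node polynomial, [D * Gam ^ m]
    the divided difference in energy, and 32 passes from energy to the weighted norm. *)
Definition eta := 32 * ((2 * e0) ^+ m * (D * Gam ^+ m)).

Let eta0 : 0 <= eta.
Proof. by rewrite /eta !mulr_ge0 ?exprn_ge0 ?mulr_ge0// ltW. Qed.

Let e4 t : `|t| <= e0 -> `|t| <= 1 / 4. Proof. by move=> h; apply: le_trans h _; have := e0s; lra. Qed.

Let ell8 j t : (j < m)%N -> `|t| <= e0 -> `|ell j t| <= 8 ^+ m.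
Proof.
move=> jm ht; have := @lagp_bound R e0 m e00 m0 j 0 1 1 t jm ltr01 (lexx _).
rewrite !mulr1 mul1r subr0 => /(_ ht)[+ _]; rewrite horner_lagp subr0 divr1.
by rewrite (_ : 4 * (1 + 1) = 8)//; ring.
Qed.

Definition rem1 i t x := u (Phi i t x) - \sum_(j < m) ell j t * u (Phi i (a j) x).

Let wsq_Phi i t v : `|t| <= e0 -> wsq s v -> wsq s (fun x => v (Phi i t x)).
Proof. by move=> ht hv; case: (nw_Phi s01 i (e4 ht) hv). Qed.

Lemma nw_rem1 i t : `|t| <= e0 -> wsq s (rem1 i t) /\ nw s (rem1 i t) <= eta.
Proof.
move=> ht; have [ws _] := nw_Ho s01 hu.
have nodes j : (j < m)%N -> `|a j| <= e0 by exact: enode_bound.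
have ia : injective a by exact: enode_inj.
have wr : wsq s (rem1 i t).
  apply: nwB; first exact: wsq_Phi.
  have c0 : 0 <= 8 ^+ m :> R by rewrite exprn_ge0.
  have h1 (j : 'I_m) : `|ell j t| <= 8 ^+ m by exact: ell8.
  have h2 (j : 'I_m) : wsq s (fun x => u (Phi i (a j) x)) /\ nw s (fun x => u (Phi i (a j) x)) <= 3 * nw s u.
    by apply: nw_Phi => //; apply: e4; exact: nodes.
  by have [] := nw_sum c0 h1 h2.
split => //; have [[j ja]|hoff] := pselect (exists j : 'I_m, t = a j).
  have E : rem1 i t = fun x => 0 * u x.
    apply/funext => x; rewrite mul0r /rem1 (bigD1 j)//= ja lag_node// eqxx mul1r big1 ?addr0 ?subrr//.
    by move=> l lj; rewrite lag_node// eq_sym; move: lj; rewrite -val_eqE /= => /negbTE ->; rewrite mul0r.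
  by rewrite E (nwZ 0 ws).2 normr0 mul0r.
have oa : off a m t by move=> j jm; apply/eqP => tj; apply: hoff; exists (Ordinal jm).
have E : rem1 i t = fun x => (\prod_(j < m) (t - a j)) * Ud i u a m t x.
  by apply/funext => x; exact: dd_remainder.
have [hU bU] := hreg i (And4 ia oa ht nodes).
have [wU nU] := nw_Ho s01 hU.
rewrite E (nwZ _ wU).2 /eta mulrCA; apply: ler_pM => //; first exact: nw_ge0.
  rewrite normr_prod; apply: (@le_trans _ _ (\prod_(j < m) (2 * e0))); last by rewrite prodr_const card_ord.
  apply: ler_prod => j _; rewrite normr_ge0 /=; apply: le_trans (ler_normB _ _) _.
  by have := nodes j (ltn_ord j); lra.
by apply: le_trans nU _; rewrite ler_wpM2l.
Qed.

Definition P3 tau x : X3 := (phi tau.1.1 x.1.1, phi tau.1.2 x.1.2, phi tau.2 x.2).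

Definition node3 (j1 j2 j3 : nat) : X3 := (a j1, a j2, a j3).

(** For fixed [x] this is the tensor-product Lagrange interpolant of [tau |-> u (P3 tau x)]; the
    deformation parameters serve as local coordinates around [x]. *)
Definition interp tau x := \sum_(j3 < m) ell j3 tau.2 * \sum_(j2 < m) ell j2 tau.1.2 *
  \sum_(j1 < m) ell j1 tau.1.1 * u (P3 (node3 j1 j2 j3) x).

Lemma interp_split tau x : u (P3 tau x) - interp tau x =
  rem1 A3 tau.2 (Phi A2 tau.1.2 (Phi A1 tau.1.1 x)) +
  \sum_(j3 < m) ell j3 tau.2 * (rem1 A2 tau.1.2 (Phi A3 (a j3) (Phi A1 tau.1.1 x)) +
  \sum_(j2 < m) ell j2 tau.1.2 * rem1 A1 tau.1.1 (Phi A2 (a j2) (Phi A3 (a j3) x))).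
Proof.
have E (j3 : 'I_m) : rem1 A2 tau.1.2 (Phi A3 (a j3) (Phi A1 tau.1.1 x)) +
  \sum_(j2 < m) ell j2 tau.1.2 * rem1 A1 tau.1.1 (Phi A2 (a j2) (Phi A3 (a j3) x)) =
  u (P3 (tau.1.1, tau.1.2, a j3) x) - \sum_(j2 < m) ell j2 tau.1.2 *
  \sum_(j1 < m) ell j1 tau.1.1 * u (P3 (node3 j1 j2 j3) x).
  rewrite /rem1; under [X in _ + X]eq_bigr do rewrite mulrBr.
  by rewrite sumrB addrA subrK.
under [in RHS]eq_bigr do rewrite E mulrBr.
by rewrite sumrB /rem1 addrA subrK.
Qed.

(** Interpolating one direction at a time leaves three remainders. Each is seen through two
    deformations, which cost [3 * 3], and carries at most two Lagrange sums, each of size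
    [m * 8 ^ m]. *)
Definition theta0 := 27 * (m%:R ^+ 2 * (8 ^+ m) ^+ 2) * eta.

Lemma nw_interp tau : (forall i, `|co i tau| <= e0) ->
  wsq s (fun x => u (P3 tau x) - interp tau x) /\
  nw s (fun x => u (P3 tau x) - interp tau x) <= theta0.
Proof.
move=> ht; have c0 : 0 <= 8 ^+ m :> R by rewrite exprn_ge0.
have nodes j : (j < m)%N -> `|a j| <= e0 by exact: enode_bound.
have two i1 i2 t1 t2 v B : `|t1| <= e0 -> `|t2| <= e0 -> wsq s v -> nw s v <= B ->
    wsq s (fun x => v (Phi i2 t2 (Phi i1 t1 x))) /\ nw s (fun x => v (Phi i2 t2 (Phi i1 t1 x))) <= 9 * B.
  move=> h1 h2 hv hB; have [w1 n1] := nw_Phi s01 i2 (e4 h2) hv.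
  have [w2 n2] := nw_Phi s01 i1 (e4 h1) w1; split => //.
  by apply: le_trans n2 _; move: n1 hB; lra.
rewrite (_ : (fun x => _) = fun x => rem1 A3 tau.2 (Phi A2 tau.1.2 (Phi A1 tau.1.1 x)) +
  \sum_(j3 < m) ell j3 tau.2 * (rem1 A2 tau.1.2 (Phi A3 (a j3) (Phi A1 tau.1.1 x)) +
  \sum_(j2 < m) ell j2 tau.1.2 * rem1 A1 tau.1.1 (Phi A2 (a j2) (Phi A3 (a j3) x))));
  last by apply/funext => x; exact: interp_split.
have [r1 b1] := nw_rem1 A1 (ht A1); have [r2 b2] := nw_rem1 A2 (ht A2).
have [r3 b3] := nw_rem1 A3 (ht A3).
have [q3 n3] := two A1 A2 _ _ _ _ (ht A1) (ht A2) r3 b3.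
have inner (j3 : 'I_m) : wsq s (fun x => rem1 A2 tau.1.2 (Phi A3 (a j3) (Phi A1 tau.1.1 x)) +
    \sum_(j2 < m) ell j2 tau.1.2 * rem1 A1 tau.1.1 (Phi A2 (a j2) (Phi A3 (a j3) x))) /\
    nw s (fun x => rem1 A2 tau.1.2 (Phi A3 (a j3) (Phi A1 tau.1.1 x)) +
    \sum_(j2 < m) ell j2 tau.1.2 * rem1 A1 tau.1.1 (Phi A2 (a j2) (Phi A3 (a j3) x))) <=
    9 * eta + m%:R * 8 ^+ m * (9 * eta).
  have [q2 n2] := two A1 A3 _ _ _ _ (ht A1) (nodes _ (ltn_ord j3)) r2 b2.
  have [q1 n1] := nw_sum c0 (fun j : 'I_m => ell8 (ltn_ord j) (ht A2))
    (fun j : 'I_m => two A3 A2 _ _ _ _ (nodes _ (ltn_ord j3)) (nodes _ (ltn_ord j)) r1 b1).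
  have [q n] := nwD q2 q1; split => //; apply: le_trans n _; exact: lerD.
have [q4 n4] := nw_sum c0 (fun j : 'I_m => ell8 (ltn_ord j) (ht A3)) inner.
have [q5 n5] := nwD q3 q4; split => //; apply: le_trans n5 _; apply: le_trans (lerD n3 n4) _.
have M1 : 1 <= m%:R * 8 ^+ m :> R.
  rewrite -[leLHS]mul1r; apply: ler_pM => //; first by rewrite ler1n.
  by rewrite exprn_ege1// ler1n.
rewrite /theta0 -exprMn; move: M1; move: (m%:R * 8 ^+ m) => M M1.
have : 1 * eta <= M ^+ 2 * eta by rewrite ler_wpM2r// exprn_ege1.
have : M * eta <= M ^+ 2 * eta by rewrite ler_wpM2r// expr2 ler_peMl// (le_trans ler01).
rewrite mulrDr; have -> : M * (M * (9 * eta)) = 9 * (M ^+ 2 * eta) by ring.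
have -> : 27 * M ^+ 2 * eta = 27 * (M ^+ 2 * eta) by ring.
have -> : M * (9 * eta) = 9 * (M * eta) by ring.
by move: (M ^+ 2 * eta) (M * eta) => y z; lra.
Qed.

Lemma theta0_ge0 : 0 <= theta0.
Proof. by rewrite /theta0; apply: mulr_ge0 => //; rewrite !mulr_ge0// !exprn_ge0. Qed.

Lemma nw_sample j1 j2 j3 : (j1 < m)%N -> (j2 < m)%N -> (j3 < m)%N ->
  wsq s (fun x => u (P3 (node3 j1 j2 j3) x)) /\
  nw s (fun x => u (P3 (node3 j1 j2 j3) x)) <= 27 * nw s u.
Proof.
move=> l1 l2 l3; have nodes j : (j < m)%N -> `|a j| <= e0 by exact: enode_bound.
have [ws _] := nw_Ho s01 hu.
have [q1 n1] := nw_Phi s01 A1 (e4 (nodes _ l1)) ws.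
have [q2 n2] := nw_Phi s01 A2 (e4 (nodes _ l2)) q1.
have [q3 n3] := nw_Phi s01 A3 (e4 (nodes _ l3)) q2.
by split => //; exact: thrice3_le n1 n2 n3.
Qed.

End Interpolation.

Section MeasureTools.
Context d (T : measurableType d) (R : realType) (m : {measure set T -> \bar R}).

(** If the bound failed throughout [B], the integral over [B] alone would be at least [2 * S]. *)
Lemma pick_point (g : T -> \bar R) (S V : R) (B : set T) : measurable_fun setT g ->
  (forall x, 0 <= g x)%E -> (\int[m]_x g x <= S%:E)%E -> 0 < S ->
  measurable B -> m B = V%:E -> 0 < V -> exists2 x, B x & (g x <= (2 * S / V)%:E)%E.
Proof.
move=> mg g0 hS S0 mB hV V0; apply: contrapT => hx.
have lo x : B x -> ((2 * S / V)%:E <= g x)%E.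
  by move=> Bx; rewrite leNgt; apply/negP => /ltW h; apply: hx; exists x.
have h1 : (\int[m]_(x in B) (2 * S / V)%:E <= \int[m]_(x in B) g x)%E.
  apply: ge0_le_integral => //.
  - by move=> x _; rewrite lee_fin !mulr_ge0 ?invr_ge0// ltW.
  - exact: measurable_funTS.
have h2 : (\int[m]_(x in B) g x <= \int[m]_x g x)%E by apply: ge0_subset_integral.
have := le_trans h1 (le_trans h2 hS).
rewrite integral_cst// [X in (_ * X)%E]hV -EFinM divfK ?gt_eqF// lee_fin; lra.
Qed.

Lemma int_sum_le (n : nat) (f : 'I_n -> T -> R) (C : R) : 0 <= C ->
  (forall i, measurable_fun setT (f i)) -> (forall i x, 0 <= f i x) ->
  (forall i, (\int[m]_x (f i x)%:E <= C%:E)%E) ->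
  (\int[m]_x (\sum_(i < n) f i x)%:E <= (n%:R * C)%:E)%E.
Proof.
move=> C0; elim: n f => [|n IH] f mf f0 hf.
  rewrite (@eq_integral _ _ _ _ _ (fun=> 0%E)) => [|x _]; last by rewrite big_ord0.
  by rewrite integral0 mul0r.
have := IH (fun i => f (widen_ord (leqnSn n) i)) (fun i => mf _) (fun i => f0 _) (fun i => hf _) => h.
have m1 : measurable_fun setT (fun x => (\sum_(i < n) f (widen_ord (leqnSn n) i) x)%:E).
  by apply: measurable_EF; exact: measurable_sum.
have m2 : measurable_fun setT (fun x => (f ord_max x)%:E) by exact: measurable_EF.
have p1 x : (0 <= (\sum_(i < n) f (widen_ord (leqnSn n) i) x)%:E)%E by rewrite lee_fin sumr_ge0.
have p2 x : (0 <= (f ord_max x)%:E)%E by rewrite lee_fin.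
have E : (\int[m]_x (\sum_(i < n.+1) f i x)%:E =
    \int[m]_x ((\sum_(i < n) f (widen_ord (leqnSn n) i) x)%:E + (f ord_max x)%:E))%E.
  by apply: eq_integral => x _; rewrite big_ord_recr EFinD.
have := ge0_intD m m1 m2 p1 p2; rewrite -E => ->.
by rewrite -natr1 mulrDl mul1r EFinD; apply: leeD.
Qed.

End MeasureTools.

Lemma quarter_bounds (R : realFieldType) (e : R) : e <= 1 / 24 ->
  [/\ e / 4 <= 1 / 96, 0 < 1 - e / 4, 1 + e / 4 <= 2 & 1 / 2 <= 1 - e / 4].
Proof. by move=> h; split; lra. Qed.

Lemma double_bounds (R : realFieldType) (s : R) : 0 < s < 1 -> 0 <= 2 * s /\ 2 * s <= 2.
Proof. by move=> h; split; lra. Qed.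

(** * Base points for the local interpolants *)

Section Selection.
Variable R : realType.
Variable s : R.
Hypothesis s01 : 0 < s < 1.
Notation X3 := (R * R * R)%type.
Notation X6 := (X3 * X3)%type.
Implicit Types (x y z tau t : X3) (v w : X3 -> R) (i : axis) (e : R).
Variables (u : X3 -> R) (e0 D Gam : R) (m : nat).
Hypothesis hu : Ho s u.
Hypothesis e00 : 0 < e0.
Hypothesis e0s : e0 <= 1 / 24.
Hypothesis m0 : (0 < m)%N.
Hypothesis D0 : 0 <= D.
Hypothesis Gam0 : 0 <= Gam.
Hypothesis hreg : forall i (b : nat -> R) k e, adm e0 b k e ->
  Ho s (Ud i u b k e) /\ Num.sqrt (A s (Ud i u b k e) (Ud i u b k e)) <= D * Gam ^+ k.
Notation a := (enode e0 m).
Notation ell := (lag a m).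
Notation interp := (interp u e0 m).
Notation node3 := (node3 e0 m).
Notation h := (e0 / 4).

Lemma measurable_lag j : measurable_fun setT (ell j).
Proof.
apply: measurable_prod => i _; apply: measurable_funM => //.
by apply: measurable_funB.
Qed.

Lemma measurable_P3 d (T : measurableType d) (f g : T -> X3) : measurable_fun setT f ->
  measurable_fun setT g -> measurable_fun setT (fun p => P3 (f p) (g p)).
Proof.
move=> mf mg.
have c i : measurable_fun setT (fun p => phi (co i (f p)) (co i (g p))).
  have m1 : measurable_fun setT (fun p => co i (f p)) by apply: measurableT_comp => //; exact: measurable_co.
  have m2 : measurable_fun setT (fun p => co i (g p)) by apply: measurableT_comp => //; exact: measurable_co.
  apply: measurable_funD => //; apply: measurable_funM => //.
  by apply: (measurableT_comp (f := @chi R)) => //; exact: measurable_chi.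
by apply: measurable_tuple3; [exact: (c A1)|exact: (c A2)|exact: (c A3)].
Qed.

Lemma measurable_interp d (T : measurableType d) (f g : T -> X3) : measurable_fun setT f ->
  measurable_fun setT g -> measurable_fun setT (fun p => interp (f p) (g p)).
Proof.
move=> mf mg; have mu : measurable_fun setT u by case: hu => [[[]]].
have ml i j : measurable_fun setT (fun p => ell j (co i (f p))).
  apply: (measurableT_comp (measurable_lag j)).
  by apply: measurableT_comp => //; exact: measurable_co.
apply: measurable_sum => j3; apply: measurable_funM; first exact: (ml A3).
apply: measurable_sum => j2; apply: measurable_funM; first exact: (ml A2).
apply: measurable_sum => j1; apply: measurable_funM; first exact: (ml A1).
by apply: measurableT_comp => //; apply: measurable_P3.
Qed.

Lemma measurable_interp_error d (T : measurableType d) (f g : T -> X3) : measurable_fun setT f ->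
  measurable_fun setT g -> measurable_fun setT (fun p => u (P3 (f p) (g p)) - interp (f p) (g p)).
Proof.
move=> mf mg; have mu : measurable_fun setT u by case: hu => [[[]]].
apply: measurable_funB; last exact: measurable_interp.
by apply: measurableT_comp => //; apply: measurable_P3.
Qed.

Variables Th Sb : R.
Hypothesis hTh : theta0 e0 D Gam m ^+ 2 <= Th.
Hypothesis Th0 : 0 < Th.
Hypothesis hSb : nw s u ^+ 2 <= Sb.
Hypothesis Sb0 : 0 < Sb.

Let org : X3 := (0, 0, 0).

Let G (p : X6) := \1_(cube3 org e0) p.2 * (wh s p.1 * (u (P3 p.2 p.1) - interp p.2 p.1)) ^+ 2.

Let mG : measurable_fun setT G.
Proof.
have mc : measurable (cube3 org e0) by exact: measurable_box3.
apply: measurable_funM; first by apply: measurableT_comp => //; exact: measurable_indic.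
apply: measurable_funX; apply: measurable_funM; last exact: measurable_interp_error.
by apply: measurableT_comp => //; exact: measurable_wh.
Qed.

Let G0 p : 0 <= G p.
Proof. by rewrite /G mulr_ge0 ?sqr_ge0. Qed.

Let S1 := (2 * e0) ^+ 3 * Th.

Let intG : (\int[L3]_x \int[L3]_tau (G (x, tau))%:E <= S1%:E)%E.
Proof.
have mG' := measurable_EF mG.
have G0' p : (0 <= (G p)%:E)%E by rewrite lee_fin.
rewrite -(tonelli1 L3 L3 mG' G0') (tonelli2 L3 L3 mG' G0').
have mc : measurable (cube3 org e0) by exact: measurable_box3.
have mi : measurable_fun setT (fun tau : X3 => (\1_(cube3 org e0) tau)%:E : \bar R).
  by apply: measurable_EF; exact: measurable_indic.
apply: (@le_trans _ _ (\int[L3]_tau (Th%:E * (\1_(cube3 org e0) tau)%:E))%E); last first.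
  have := ge0_intZ L3 (ltW Th0) mi (fun x => ltac:(by rewrite lee_fin)).
  move=> /= ->; rewrite integral_indic// setIT.
  have hc := L3_cube3 org (ltW e00); rewrite [X in (_ * X)%E](_ : _ = ((2 * e0) ^+ 3)%:E)//.
  by rewrite -EFinM lee_fin /S1 mulrC.
apply: ge0_le_int => [||tau|tau].
- exact: (measurable_tonelli2 L3 mG' G0').
- exact: measurable_funeM.
- by apply: integral_ge0 => x _.
- rewrite /G /= indicE; case: (boolP (tau \in _)) => [|_]; last first.
    by rewrite mule0; under eq_integral do rewrite mul0r; rewrite integral0.
  rewrite inE => /cube3P ht; rewrite mule1.
  have [[_ sw] nwle] := nw_interp s01 hu e00 e0s m0 D0 Gam0 hreg (tau := tau)
    (fun i => ltac:(by have := ltW (ht i); rewrite (_ : co i org = 0) ?sub0r ?normrN//; case: (i))).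
  under eq_integral do rewrite mul1r.
  rewrite (sqi_fin sw) lee_fin -nw_sqr; apply: le_trans hTh.
  by apply: lerXn2r; rewrite ?nnegrE ?nw_ge0 ?theta0_ge0.
Qed.

Let Q2 x := \sum_(j3 < m) \sum_(j2 < m) \sum_(j1 < m) (wh s x * u (P3 (node3 j1 j2 j3) x)) ^+ 2.

Let S2 := m%:R ^+ 3 * (27 * 27 * Sb).

Let mQ2 : measurable_fun setT Q2.
Proof.
apply: measurable_sum => j3; apply: measurable_sum => j2; apply: measurable_sum => j1.
apply: measurable_funX.
by have [[_ []]] := nw_sample s01 hu e00 e0s m0 (ltn_ord j1) (ltn_ord j2) (ltn_ord j3).
Qed.

Let intQ2 : (\int[L3]_x (Q2 x)%:E <= S2%:E)%E.
Proof.
have C0 : 0 <= 27 * 27 * Sb by rewrite !mulr_ge0// ltW.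
have hm j1 j2 j3 : measurable_fun setT (fun x => (wh s x * u (P3 (node3 j1 j2 j3) x)) ^+ 2).
  apply: measurable_funX; apply: measurable_funM; first exact: measurable_wh.
  have mu : measurable_fun setT u by case: hu => [[[]]].
  by apply: measurableT_comp => //; apply: measurable_P3.
rewrite (_ : S2 = m%:R * (m%:R * (m%:R * (27 * 27 * Sb)))); last by rewrite /S2; ring.
apply: int_sum_le => [|j3|j3 x|j3]; first by rewrite !mulr_ge0// ltW.
  by apply: measurable_sum => j2; apply: measurable_sum => j1; exact: hm.
  by do 2!(apply: sumr_ge0 => ? _); exact: sqr_ge0.
apply: int_sum_le => [|j2|j2 x|j2]; first by rewrite !mulr_ge0// ltW.
  by apply: measurable_sum => j1; exact: hm.
  by apply: sumr_ge0 => ? _; exact: sqr_ge0.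
apply: int_sum_le => [//|j1|j1 x|j1]; first exact: hm.
  exact: sqr_ge0.
have [[_ sw] nle] := nw_sample s01 hu e00 e0s m0 (ltn_ord j1) (ltn_ord j2) (ltn_ord j3).
rewrite (sqi_fin sw) lee_fin -nw_sqr; apply: (@le_trans _ _ ((27 * nw s u) ^+ 2)).
  by apply: lerXn2r; rewrite ?nnegrE ?mulr_ge0 ?nw_ge0.
by rewrite exprMn -expr2 ler_wpM2l// exprn_ge0.
Qed.

Definition nearb t y := [&& `|y.1.1 - t.1.1| <= h * chi t.1.1, `|y.1.2 - t.1.2| <= h * chi t.1.2
  & `|y.2 - t.2| <= h * chi t.2].

Lemma nearbP t y : reflect (forall i, `|co i y - co i t| <= h * chi (co i t)) (nearb t y).
Proof.
apply: (iffP and3P) => [[h1 h2 h3] [] //|H].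
by split; [exact: (H A1)|exact: (H A2)|exact: (H A3)].
Qed.

Lemma measurable_nearb t : measurable_fun setT (nearb t).
Proof.
have c i : measurable_fun setT (fun y : X3 => `|co i y - co i t| <= h * chi (co i t)).
  apply: measurable_fun_ler => //; apply: measurableT_comp => //.
  by apply: measurable_funB => //; exact: measurable_co.
by apply: measurable_and; [exact: (c A1)|apply: measurable_and; [exact: (c A2)|exact: (c A3)]].
Qed.

Definition rel x y : X3 := ((y.1.1 - x.1.1) / chi x.1.1, (y.1.2 - x.1.2) / chi x.1.2, (y.2 - x.2) / chi x.2).

Lemma Omega_co x : Omega (x : pt R) <-> forall i, 0 < chi (co i x).
Proof.
split=> [[h1 h2 h3] i|H]; first by rewrite chi_gt0; case: i; [exact: h1|exact: h2|exact: h3].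
by split; [have := H A1|have := H A2|have := H A3]; rewrite chi_gt0.
Qed.

Lemma chi_near (t x : R) c : `|x - t| <= c * chi t -> (1 - c) * chi t <= chi x <= (1 + c) * chi t.
Proof.
by move=> hx; have := le_trans (chi_lip x t) hx; rewrite ler_norml => /andP[h1 h2]; lra.
Qed.

(* Averaging over the box around [t] yields a single base point [x] that controls both the
   interpolation error near [t] and the interpolated values. *)
Lemma select t : Omega (t : pt R) -> exists x, [/\ Omega (x : pt R),
  forall i, `|co i x - co i t| <= h * chi (co i t),
  (\int[L3]_y (if nearb t y then (u y - interp (rel x y) x) ^+ 2 else 0)%:E <=
    (8192 * Th * rr t `^ (2 * s))%:E)%E &
  \sum_(j3 < m) \sum_(j2 < m) \sum_(j1 < m) u (P3 (node3 j1 j2 j3) x) ^+ 2 <=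
    (2 * 27 * 27 * 64 / e0 ^+ 3) * m%:R ^+ 3 * Sb * rr t `^ (2 * s) /
    (chi (co A1 t) * chi (co A2 t) * chi (co A3 t))].
Proof.
move=> ht; have hco := (Omega_co t).1 ht.
set V := chi (co A1 t) * chi (co A2 t) * chi (co A3 t).
have V0 : 0 < V by rewrite !mulr_gt0.
have h0 : 0 < h by rewrite divr_gt0.
pose lo : X3 := (t.1.1 - h * chi t.1.1, t.1.2 - h * chi t.1.2, t.2 - h * chi t.2).
pose hi : X3 := (t.1.1 + h * chi t.1.1, t.1.2 + h * chi t.1.2, t.2 + h * chi t.2).
have mB := measurable_box3 lo hi.
have hB : L3 (box3 lo hi) = (8 * h ^+ 3 * V)%:E.
  have := @L3_box3 R lo hi; rewrite /lo /hi /V /= => ->; first by congr EFin; ring.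
  by move=> i; have := mulr_gt0 h0 (hco i); case: i => /= hc; lra.
have S10 : 0 < S1 by rewrite mulr_gt0// exprn_gt0// mulr_gt0.
have S20 : 0 < S2 by apply: mulr_gt0; [rewrite exprn_gt0// ltr0n|rewrite !mulr_gt0].
(* Both quantities are normalised to have integral at most one, so one use of [pick_point] controls
   them at the same point. *)
pose g x : \bar R := ((S1^-1)%:E * \int[L3]_tau (G (x, tau))%:E + (S2^-1)%:E * (Q2 x)%:E)%E.
have mG' := measurable_EF mG.
have G0' p : (0 <= (G p)%:E)%E by rewrite lee_fin.
have mI := measurable_tonelli1 L3 mG' G0'.
have I0 x : (0 <= \int[L3]_tau (G (x, tau))%:E)%E by apply: integral_ge0 => tau _.
have i1 : 0 <= S1^-1 by rewrite invr_ge0 ltW.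
have i2 : 0 <= S2^-1 by rewrite invr_ge0 ltW.
have Q20 x : 0 <= Q2 x by do 3!(apply: sumr_ge0 => ? _); exact: sqr_ge0.
have mQ := measurable_EF mQ2.
have mg1 : measurable_fun setT (fun x => ((S1^-1)%:E * \int[L3]_tau (G (x, tau))%:E)%E) by exact: measurable_funeM.
have mg2 : measurable_fun setT (fun x => ((S2^-1)%:E * (Q2 x)%:E)%E) by exact: measurable_funeM.
have g1 x : (0 <= (S1^-1)%:E * \int[L3]_tau (G (x, tau))%:E)%E by apply: mule_ge0; rewrite ?lee_fin.
have g2 x : (0 <= (S2^-1)%:E * (Q2 x)%:E)%E by rewrite -EFinM lee_fin mulr_ge0.
have mg : measurable_fun setT g by exact: emeasurable_funD.
have ig : (\int[L3]_x g x <= 2%:E)%E.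
  have := ge0_intD L3 mg1 mg2 g1 g2 => /= ->.
  have /= -> := ge0_intZ L3 i1 mI I0.
  have /= -> := ge0_intZ L3 i2 mQ (fun x => ltac:(by rewrite lee_fin)).
  apply: (@le_trans _ _ ((S1^-1)%:E * S1%:E + (S2^-1)%:E * S2%:E)%E).
    by apply: leeD; apply: lee_wpmul2l; [rewrite lee_fin|exact: intG|rewrite lee_fin|exact: intQ2].
  by rewrite -!EFinM -EFinD lee_fin !mulVf ?gt_eqF//.
have VB : 0 < 8 * h ^+ 3 * V by rewrite !mulr_gt0// exprn_gt0.
have [x /box3P Bx gx] := @pick_point _ _ R L3 g 2 _ _ mg (fun x => adde_ge0 (g1 x) (g2 x)) ig ltac:(by []) mB hB VB.
have hx i : `|co i x - co i t| < h * chi (co i t).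
  by rewrite ltr_distl; have := Bx i; case: i.
have hx' i := ltW (hx i).
have [h4 h1m h1p h1] := quarter_bounds e0s; have [ss0 ss2] := double_bounds s01.
have cx i := chi_near (hx' i).
have cx0 i : 0 < chi (co i x).
  by have /andP[k _] := cx i; apply: lt_le_trans k; apply: mulr_gt0.
have ox : Omega (x : pt R) by apply/Omega_co.
have rx : rr x <= 2 * rr t.
  have [i ->] := rr_ex t; apply: le_trans (rr_le i x) _; have /andP[_ k] := cx i.
  by apply: le_trans k _; apply: ler_wpM2r => //; exact: chi_ge0.
have rx0 := (rr_gt0 x).1 ox; have rt0 := (rr_gt0 t).1 ht.
have wpow : rr x `^ (2 * s) <= 4 * rr t `^ (2 * s).
  apply: (@le_trans _ _ ((2 * rr t) `^ (2 * s))).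
    apply: ge0_ler_powR; [exact: ss0|by rewrite nnegrE ltW|by rewrite nnegrE mulr_ge0// ltW|exact: rx].
  rewrite powRM ?(ltW rt0)// ler_wpM2r ?powR_ge0//.
  rewrite (_ : 4 = 2 `^ 2%:R); last by rewrite powR_mulrn//; ring.
  by apply: ler_powR; rewrite ?ler1n.
have wx : wh s x ^+ 2 * rr x `^ (2 * s) = 1.
  by rewrite wh2 -powRD ?addNr ?powRr0//; apply/implyP => _; rewrite gt_eqF.
have rp0 : 0 <= rr t `^ (2 * s) by exact: powR_ge0.
have rxp0 : 0 <= rr x `^ (2 * s) by exact: powR_ge0.
exists x; split => //.
- have gx1 : ((S1^-1)%:E * \int[L3]_tau (G (x, tau))%:E <= (2 * 2 / (8 * h ^+ 3 * V))%:E)%E.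
    by apply: le_trans gx; rewrite /g leeDl.
  have mF : measurable_fun setT (fun y => (if nearb t y then (u y - interp (rel x y) x) ^+ 2 else 0)%:E).
    apply: measurable_EF; apply: measurable_fun_ifT => //; first exact: measurable_nearb.
    have mu : measurable_fun setT u by case: hu => [[[]]].
    apply: measurable_funX; apply: measurable_funB => //; apply: measurable_interp => //.
    have c i : measurable_fun setT (fun y : X3 => (co i y - co i x) / chi (co i x)).
      by apply: measurable_funM => //; apply: measurable_funB => //; exact: measurable_co.
    by apply: measurable_tuple3; [exact: (c A1)|exact: (c A2)|exact: (c A3)].
  have F0 y : (0 <= (if nearb t y then (u y - interp (rel x y) x) ^+ 2 else 0)%:E)%E.
    by rewrite lee_fin; case: ifP => _ //; exact: sqr_ge0.
  (* The substitution [y = P3 tau x], affine in [tau] for fixed [x]; its Jacobian is the product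
     [Vx] of the three boundary distances. *)
  have := @integral_affine3 R (chi x.1.1, chi x.1.2, chi x.2) x _ _ mF F0 => ->; last first.
    by case; [exact: (cx0 A1)|exact: (cx0 A2)|exact: (cx0 A3)].
  set Vx := (_ * _)%R; have Vx8 : 0 <= Vx <= 8 * V.
    have c2 i : 0 <= chi (co i x) <= 2 * chi (co i t).
      rewrite chi_ge0 /=; have /andP[_ k] := cx i; apply: le_trans k _.
      by apply: ler_wpM2r => //; exact: chi_ge0.
    have := c2 A1; have := c2 A2; have := c2 A3; rewrite /Vx /V /=.
    move: (chi x.1.1) (chi x.1.2) (chi x.2) (chi t.1.1) (chi t.1.2) (chi t.2) => q1 q2 q3 p1 p2 p3.
    move=> /andP[a3 b3] /andP[a2 b2] /andP[a1 b1]; apply/andP; split; first by rewrite !mulr_ge0.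
    rewrite (_ : 8 * (p1 * p2 * p3) = (2 * p1) * (2 * p2) * (2 * p3)); last by ring.
    by apply: ler_pM => //; [exact: mulr_ge0|apply: ler_pM].
  apply: (@le_trans _ _ (Vx%:E * (rr x `^ (2 * s))%:E * \int[L3]_tau (G (x, tau))%:E)%E).
    rewrite -muleA; apply: lee_wpmul2l; first by rewrite lee_fin; case/andP: Vx8.
    have mGx : measurable_fun setT (fun tau => (G (x, tau))%:E).
      have mp : measurable_fun setT (fun z : X3 => (x, z)) by exact: measurable_fun_pair.
      exact: (measurableT_comp mG' mp).
    have /= <- := ge0_intZ L3 rxp0 mGx (fun tau => G0' _).
    have mA : measurable_fun setT (fun tau : X3 => (chi x.1.1 * co A1 tau + co A1 x,
        chi x.1.2 * co A2 tau + co A2 x, chi x.2 * co A3 tau + co A3 x) : X3).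
      have c i : measurable_fun setT (fun tau : X3 => chi (co i x) * co i tau + co i x).
        by apply: measurable_funD => //; apply: measurable_funM => //; exact: measurable_co.
      by apply: measurable_tuple3; [exact: (c A1)|exact: (c A2)|exact: (c A3)].
    apply: ge0_le_int => [||tau|tau].
    + exact: (measurableT_comp mF mA).
    + exact: measurable_funeM.
    + exact: F0.
    + rewrite -EFinM lee_fin; case: ifP => hn; last by rewrite mulr_ge0.
      move/nearbP: hn => hn.
      (* The reason for [h = e0 / 4]: both points are within [h * chi] of [t] and [chi] at [x] is at
         least half of that at [t], so the parameter is below [4 * h]. *)
      have tin : cube3 org e0 tau.
        apply/cube3P => i; rewrite (_ : co i org = 0) ?sub0r ?normrN; last by case: i.
        have k1 : `|chi (co i x) * co i tau + co i x - co i t| <= h * chi (co i t).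
          by move: (hn i); case: i.
        have k2 : `|chi (co i x) * co i tau| < 2 * h * chi (co i t).
          rewrite (_ : chi (co i x) * co i tau = (chi (co i x) * co i tau + co i x - co i t) - (co i x - co i t)); last by ring.
          by apply: le_lt_trans (ler_normB _ _) _; rewrite -mulrA mulr_natl mulr2n; exact: ler_ltD k1 (hx i).
        rewrite normrM (ger0_norm (chi_ge0 _)) in k2.
        have /andP[k3 _] := cx i; rewrite -(ltr_pM2l (cx0 i)); apply: lt_le_trans k2 _.
        have k4 : 1 / 2 * chi (co i t) <= chi (co i x).
          by apply: le_trans k3; apply: ler_wpM2r => //; exact: chi_ge0.
        apply: (@le_trans _ _ (1 / 2 * chi (co i t) * e0)); last by rewrite ler_wpM2r// ltW.
        by rewrite le_eqVlt; apply/orP; left; apply/eqP; field.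
      rewrite /G /= indicE mem_set// mul1r exprMn mulrA (mulrC (_ `^ _)) wx mul1r.
      have -> : rel x (chi x.1.1 * tau.1.1 + x.1.1, chi x.1.2 * tau.1.2 + x.1.2, chi x.2 * tau.2 + x.2) = tau.
        have n i : chi (co i x) != 0 by rewrite gt_eqF.
        have := n A1; have := n A2; have := n A3; rewrite /rel /=.
        case: (tau) => [[? ?] ?] /= n3 n2 n1; congr (_, _, _); rewrite addrK mulrC mulKf//.
      by rewrite /P3 /phi !(addrC x.1.1) !(addrC x.1.2) !(addrC x.2) !(mulrC (chi _)).
  (* The constant 8192 collects the Jacobian bound 8, the weight factor 4, the volume [(2 * e0) ^ 3]
     and the density [4 / (8 * h ^ 3 * V)]. *)
  apply: (@le_trans _ _ ((8 * V)%:E * (4 * rr t `^ (2 * s))%:E * (S1%:E * (2 * 2 / (8 * h ^+ 3 * V))%:E))%E).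
    apply: lee_pmul.
    + by rewrite -EFinM lee_fin mulr_ge0//; case/andP: Vx8.
    + exact: I0.
    + rewrite -!EFinM lee_fin; case/andP: Vx8 => v0 v8; exact: ler_pM.
    + have := lee_wpmul2l (_ : (0 <= S1%:E)%E) gx1; rewrite lee_fin (ltW S10) => /(_ isT).
      by rewrite muleA -EFinM mulfV ?gt_eqF// mul1e.
  rewrite -!EFinM lee_fin le_eqVlt; apply/orP; left; apply/eqP; rewrite /S1; field.
  by rewrite !gt_eqF.
- have gx2 : Q2 x <= S2 * (2 * 2 / (8 * h ^+ 3 * V)).
    rewrite mulrC -ler_pdivrMr// mulrC -lee_fin; apply: le_trans gx.
    by rewrite /g EFinM leeDr.
  have -> : \sum_(j3 < m) \sum_(j2 < m) \sum_(j1 < m) u (P3 (node3 j1 j2 j3) x) ^+ 2 =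
      rr x `^ (2 * s) * Q2 x.
    rewrite /Q2 mulr_sumr; apply: eq_bigr => j3 _; rewrite mulr_sumr; apply: eq_bigr => j2 _.
    rewrite mulr_sumr; apply: eq_bigr => j1 _.
    by rewrite exprMn mulrA (mulrC (_ `^ _)) wx mul1r.
  apply: (@le_trans _ _ (4 * rr t `^ (2 * s) * (S2 * (2 * 2 / (8 * h ^+ 3 * V))))).
    exact: ler_pM.
  rewrite le_eqVlt; apply/orP; left; apply/eqP; rewrite /S2; field.
  by rewrite !gt_eqF.
Qed.

End Selection.

(** * The global approximant *)

Section Block.
Variable R : realType.
Variables (sigma e0 : R) (L n m : nat).
Hypothesis s01 : 0 < sigma < 1.
Hypothesis L2 : (2 <= L)%N.
Hypothesis n0 : (0 < n)%N.
Hypothesis m0 : (0 < m)%N.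
Hypothesis e00 : 0 < e0.
Hypothesis e0s : e0 <= 1 / 24.
Notation nd := (node sigma L).
Implicit Types (t x : R) (j : nat).

(** Pairs of a cell and a Bernstein index, stored with an offset: [p.1.+1] runs from 1 to
    [2 * L - 2] and [p.2.+1] from 1 to [n]. *)
Definition grid := ('I_(2 * L).-2 * 'I_n)%type.
Implicit Types p : grid.

Definition ctr p : R := tp sigma L n p.1.+1 p.2.+1.
Definition pu p t : R := psi sigma L n p.1.+1 p.2.+1 t.
Definition th p x j t : R := pu p t * (lagp e0 m j x (chi x)).[t].
Notation h := (e0 / 4).
Notation rho p := (chi (ctr p)).

Definition tailE : R := btail n (h * sigma).
(** Growth of the Lagrange basis over a whole cell. Its points are within [4 / sigma * chi x] of the
    base point [x], which is [w = 4 / (sigma * e0)] in [lagp_bound]; the value [w = 1] near the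
    centre gives 8 instead. *)
Definition Bw : R := 4 * (1 + 4 / (sigma * e0)).
(** [Nth] bounds a block everywhere and [Fth] bounds it away from its centre; [Lth] is its Lipschitz
    constant multiplied by the boundary distance of the centre. *)
Definition Nth : R := 8 ^+ m + 4 * tailE * Bw ^+ m.
Definition Fth : R := 4 * tailE * Bw ^+ m.
Definition Lth : R := 2 * blockM sigma n h (Bw ^+ m) (2 * m%:R / e0 * Bw ^+ m) (8 ^+ m) (2 * m%:R / e0 * 8 ^+ m) / (1 - sigma).

Let sg0 : 0 < sigma. Proof. by case/andP: s01. Qed.
Let sg1 : sigma < 1. Proof. by case/andP: s01. Qed.

Let hi p : (1 <= (p.1 : nat).+1 < (2 * L).-1)%N.
Proof. by have := ltn_ord p.1; lia. Qed.

Let hk p : (1 <= (p.2 : nat).+1 <= n)%N.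
Proof. by rewrite /= ltn_ord. Qed.

Lemma sum_grid t : \sum_(p : grid) pu p t =
  \sum_(1 <= i < (2 * L).-1) \sum_(1 <= k < n.+1) psi sigma L n i k t.
Proof.
have e1 : (2 * L).-1 = (2 * L).-2.+1 by lia.
rewrite [in RHS]e1.
rewrite big_add1 /= big_mkord; under [RHS]eq_bigr do rewrite big_add1 /= big_mkord.
by rewrite pair_bigA.
Qed.

Lemma pu_ge0 p t : 0 <= pu p t. Proof. exact: psi_ge0. Qed.
Lemma pu_le1 p t : pu p t <= 1. Proof. exact: psi_le1. Qed.

Lemma sum_grid_in t : 0 <= \sum_(p : grid) pu p t <= 1.
Proof. by rewrite sum_grid; exact: psi_sum_in. Qed.

Lemma sum_grid1 t : nd 2 < chi t -> \sum_(p : grid) pu p t = 1.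
Proof.
move=> ht; rewrite sum_grid; apply: psi_sum1 => //.
have c0 : 0 < nd 2 by rewrite nodeE ?L2; [rewrite divr_gt0// exprn_gt0|lia].
have h01 : 0 < t < 1 by rewrite -chi_gt0; exact: lt_trans ht.
have [k1 k2] : chi t <= t /\ chi t <= 1 - t.
  by rewrite /chi; case/andP: h01 => t0 t1; split; rewrite ge_max ?(ltW t0) ?subr_ge0 ?(ltW t1) ge_min lexx ?orbT.
rewrite (le_trans (ltW ht) k1) /=.
have -> : nd (2 * L).-1 = 1 - sigma ^+ L.-1 / 2.
  rewrite nodeE; last by move: L2; clear; lia.
  by case: ifP => [|_]; [move: L2; clear; lia|congr (1 - _ ^+ _ / 2); move: L2; clear; lia].
have e2 : nd 2 = sigma ^+ (L - 2) / 2 by rewrite nodeE ?L2//; move: L2; clear; lia.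
have : sigma ^+ L.-1 <= sigma ^+ (L - 2).
  by apply: ler_wiXn2l; [exact: ltW|exact: ltW|move: L2; clear; lia].
by move: k2 ht; rewrite e2; move: (sigma ^+ L.-1) (sigma ^+ (L - 2)) (chi t) => *; lra.
Qed.

Lemma rho_pos p : 0 < rho p. Proof. by apply: (rho_gt0 s01 n0); [exact: hi|exact: hk]. Qed.

Lemma pu_supp p t : pu p t != 0 -> `|t - ctr p| <= rho p / sigma /\ sigma * (1 - sigma) * rho p <= chi t.
Proof.
move=> /(psi_supp s01 n0 (hi p) (hk p))[j [hj ht hc _]].
have [c0 c1 _] := cell_chi s01 hj ht; have [_ d1 d2] := cell_chi s01 hj hc.
split.
  rewrite ler_pdivlMr//; apply: le_trans d1; rewrite mulrC ler_wpM2l ?(ltW sg0)//.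
  by move: ht hc; rewrite /cln ler_norml /ctr => /andP[? ?] /andP[? ?]; apply/andP; split; lra.
by apply: le_trans c1; rewrite -mulrA ler_wpM2l ?(ltW sg0).
Qed.

Lemma pu_far p t : h * rho p < `|t - ctr p| -> pu p t <= 4 * tailE.
Proof. by apply: (psi_far s01 n0 (hi p) (hk p)); have := e00; have := e0s; lra. Qed.

Lemma Bw_ge1 : 8 <= Bw.
Proof.
have : 1 <= 4 / (sigma * e0).
  rewrite ler_pdivlMr ?mulr_gt0// mul1r; apply: (@le_trans _ _ (1 * 1)); last by lra.
  by apply: ler_pM; rewrite ?(ltW sg0) ?(ltW e00) ?(ltW sg1)//; have := e0s; lra.
by rewrite /Bw; lra.
Qed.

Section OneBlock.
Variables (p : grid) (x : R) (j : nat).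
Hypothesis hx : `|x - ctr p| <= h * rho p.
Hypothesis hj : (j < m)%N.

Let gx : rho p <= 2 * chi x /\ 0 < chi x.
Proof.
have r0 := rho_pos p; have h1 := le_trans (chi_lip x (ctr p)) hx.
have : h * rho p <= 1 / 2 * rho p by rewrite ler_wpM2r ?(ltW r0)//; have := e0s; lra.
by move: h1; rewrite ler_norml => /andP[? ?]; split; lra.
Qed.

Let pl := lagp e0 m j x (chi x).

Let near_pl t : `|t - ctr p| <= h * rho p ->
  `|pl.[t]| <= 8 ^+ m /\ rho p * `|pl^`().[t]| <= 2 * m%:R / e0 * 8 ^+ m.
Proof.
move=> ht; have [g1 g0] := gx.
have d1 : `|t - x| <= 1 * e0 * chi x.
  have -> : t - x = (t - ctr p) - (x - ctr p) by ring.
  apply: le_trans (ler_normB _ _) _.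
  have : e0 * rho p <= e0 * (2 * chi x) by rewrite ler_wpM2l// ltW.
  by move: ht hx; lra.
have := lagp_bound e00 m0 hj g0 (lexx 1) d1; rewrite (_ : 4 * (1 + 1) = 8); last by ring.
move=> [b1 b2]; split => //; apply: (@le_trans _ _ (2 * chi x * `|pl^`().[t]|)); first by rewrite ler_wpM2r.
by rewrite -mulrA -!mulrA ler_wpM2l// mulrA.
Qed.

Let cell_pl i t : (1 <= i < 2 * L)%N -> (i = p.1.+1 \/ i = p.1.+2) ->
  nd i <= ctr p <= nd i.+1 -> nd i <= t <= nd i.+1 ->
  `|pl.[t]| <= Bw ^+ m /\ rho p * `|pl^`().[t]| <= 2 * m%:R / e0 * Bw ^+ m.
Proof.
move=> hi1 _ hc ht; have [g1 g0] := gx.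
have [c0 d1 _] := cell_chi s01 hi1 hc.
have w1 : 1 <= 4 / (sigma * e0) by have := Bw_ge1; rewrite /Bw; lra.
have d2 : `|t - x| <= 4 / (sigma * e0) * e0 * chi x.
  have k1 : `|t - ctr p| <= rho p / sigma.
    rewrite ler_pdivlMr//; apply: le_trans d1; rewrite mulrC ler_wpM2l ?(ltW sg0)//.
    by move: ht hc; rewrite /cln ler_norml => /andP[? ?] /andP[? ?]; apply/andP; split; lra.
  have k2 : h * rho p <= rho p / sigma.
    rewrite mulrC ler_wpM2l ?chi_ge0//; apply: (@le_trans _ _ 1); first by have := e0s; lra.
    by rewrite invf_ge1// ltW.
  have -> : t - x = (t - ctr p) - (x - ctr p) by ring.
  apply: le_trans (ler_normB _ _) _.
  have -> : 4 / (sigma * e0) * e0 * chi x = 2 * (2 * chi x / sigma) by field; rewrite !gt_eqF.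
  have : rho p / sigma <= 2 * chi x / sigma by rewrite ler_wpM2r// invr_ge0 ltW.
  by move: k1 k2 hx; move: (rho p / sigma) (2 * chi x / sigma) (h * rho p) => *; lra.
have [b1 b2] := lagp_bound e00 m0 hj g0 w1 d2.
split => //; apply: (@le_trans _ _ (2 * chi x * `|pl^`().[t]|)); first by rewrite ler_wpM2r.
by rewrite -mulrA -!mulrA ler_wpM2l// mulrA.
Qed.

Let c0 : 0 <= m%:R / e0. Proof. by rewrite divr_ge0// ltW. Qed.
Let Bw0 : 0 <= Bw. Proof. by have := Bw_ge1; lra. Qed.
Let B00 : 0 <= Bw ^+ m. Proof. exact: exprn_ge0. Qed.
Let N00 : 0 <= 8 ^+ m :> R. Proof. exact: exprn_ge0. Qed.
Let B10 : 0 <= 2 * m%:R / e0 * Bw ^+ m. Proof. by rewrite mulr_ge0// -mulrA mulr_ge0//. Qed.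
Let N10 : 0 <= 2 * m%:R / e0 * 8 ^+ m. Proof. by rewrite mulr_ge0// -mulrA mulr_ge0//. Qed.
Let h01 : 0 <= h <= 1. Proof. by have := e00; have := e0s; lra. Qed.

Lemma th_bound t : `|th p x j t| <= Nth.
Proof. by apply: (theta_bound s01 n0 (hi p) (hk p) h01 cell_pl near_pl). Qed.

Lemma th_lip t y : `|th p x j t - th p x j y| <= Lth / rho p * `|t - y|.
Proof.
have := theta_lip s01 n0 (hi p) (hk p) h01 cell_pl near_pl B00 B10 N00 N10 t y.
by move/le_trans; apply; rewrite ler_wpM2r// /Lth invfM !mulrA.
Qed.

Lemma th_far t : h * rho p < `|t - ctr p| -> `|th p x j t| <= Fth.
Proof.
move=> ht; have E0 : 0 <= tailE by exact: expR_ge0.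
have [z|nz] := eqVneq (pu p t) 0; first by rewrite /th z mul0r normr0 !mulr_ge0.
have [i [hi1 hti hci ho]] := psi_supp s01 n0 (hi p) (hk p) nz.
have ho' : i = p.1.+1 \/ i = p.1.+2 by case: ho => [->|[_ ->]]; [left|right].
have [b _] := cell_pl hi1 ho' hci hti.
rewrite normrM (ger0_norm (pu_ge0 _ _)) /Fth; apply: ler_pM => //; first exact: pu_ge0.
exact: pu_far.
Qed.

Lemma th_out t : ~~ (0 < t < 1) -> th p x j t = 0.
Proof. by apply: (theta_out s01 n0 pl (hi p) (hk p)). Qed.

Lemma th_cell i : (i <= 2 * L)%N -> exists P : {poly R},
  (size P <= n + m)%N /\ forall t, nd i < t < nd i.+1 -> th p x j t = P.[t].
Proof.
move=> hi1; have [P [sP hP]] := theta_cell s01 n0 pl (hi p) (hk p) hi1.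
exists P; split => //; apply: leq_trans sP _; rewrite leq_add2l; exact: size_lagp.
Qed.

End OneBlock.

Lemma th_supp p x j t : th p x j t != 0 -> pu p t != 0.
Proof. by apply: contraNN => /eqP h; rewrite /th h mul0r. Qed.

Lemma tailE_ge0 : 0 <= tailE. Proof. exact: expR_ge0. Qed.
Lemma Fth_ge0 : 0 <= Fth.
Proof. by rewrite /Fth !mulr_ge0 ?tailE_ge0 ?exprn_ge0//; have := Bw_ge1; lra. Qed.
Lemma Nth_ge1 : 1 <= Nth.
Proof.
have h1 : 1 <= 8 ^+ m :> R by rewrite exprn_ege1// ler1n.
by have := Fth_ge0; rewrite /Nth -/Fth; lra.
Qed.
Lemma Lth_ge0 : 0 <= Lth.
Proof.
have B0 : 0 <= Bw by have := Bw_ge1; lra.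
have c0 : 0 <= m%:R / e0 by rewrite divr_ge0// ltW.
rewrite /Lth divr_ge0 ?subr_ge0 ?(ltW sg1)// mulr_ge0//.
apply: blockM_ge0 => //; rewrite ?exprn_ge0// mulr_ge0 ?exprn_ge0// -mulrA mulr_ge0//.
Qed.

End Block.

Section FiniteSums.
Variable R : realType.

Lemma sqr_sum_le (I : finType) (F : I -> R) :
  (\sum_(i : I) F i) ^+ 2 <= #|I|%:R * \sum_(i : I) F i ^+ 2.
Proof.
rewrite cardE -!big_enum; elim: (enum I) => [|i r IH]; first by rewrite !big_nil expr0n mul0r.
rewrite !big_cons /= -natr1; move: IH; set S := \sum_(j <- r) F j; set Q := \sum_(j <- r) F j ^+ 2.
case: r @S @Q => [|j r] S Q IH.
  by rewrite /S /Q !big_nil add0r mul1r !addr0.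
have n1 : 0 < (size (j :: r))%:R :> R by rewrite ltr0n.
move: IH n1; move: (size (j :: r))%:R S Q (F i) => n S Q a IH n1.
rewrite -(ler_pM2l n1) -subr_ge0.
rewrite (_ : _ - _ = (n * a - S) ^+ 2 + (n + 1) * (n * Q - S ^+ 2)); last by ring.
by rewrite addr_ge0 ?sqr_ge0// mulr_ge0 ?subr_ge0//; lra.
Qed.

Lemma prod3_diff (N a b c a' b' c' : R) : `|b| <= N -> `|c| <= N ->
  `|a'| <= N -> `|b'| <= N ->
  `|a * b * c - a' * b' * c'| <= N ^+ 2 * (`|a - a'| + `|b - b'| + `|c - c'|).
Proof.
move=> hb hc ha' hb'.
have -> : a * b * c - a' * b' * c' = (a - a') * (b * c) + (b - b') * (a' * c) + (c - c') * (a' * b') by ring.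
rewrite !mulrDr; do 2!(apply: le_trans (ler_normD _ _) _; apply: lerD; last first;
  [by rewrite (normrM (_ - _)) mulrC ler_wpM2r// normrM expr2 ler_pM|]).
by rewrite (normrM (_ - _)) mulrC ler_wpM2r// normrM expr2 ler_pM.
Qed.

Lemma prod3_le (a b c A B C : R) : `|a| <= A -> `|b| <= B -> `|c| <= C -> `|a * b * c| <= A * B * C.
Proof.
move=> ha hb hc; rewrite normrM normrM; apply: ler_pM => //.
by apply: ler_pM.
Qed.

Lemma prod3_in (a b c : R) : 0 <= a <= 1 -> 0 <= b <= 1 -> 0 <= c <= 1 -> 0 <= a * b * c <= 1.
Proof.
move=> /andP[a0 a1] /andP[b0 b1] /andP[c0 c1].
by rewrite !mulr_ge0//= mulr_ile1 ?mulr_ge0// mulr_ile1.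
Qed.

Lemma prod3_le1 (a b c : R) : 0 <= a <= 1 -> 0 <= b <= 1 -> 0 <= c <= 1 ->
  [/\ a * b * c <= a, a * b * c <= b & a * b * c <= c].
Proof.
move=> /andP[a0 a1] /andP[b0 b1] /andP[c0 c1]; split.
- by rewrite -mulrA ler_piMr// mulr_ile1.
- by rewrite mulrAC ler_piMl// mulr_ile1.
- by rewrite ler_piMl// mulr_ile1.
Qed.

Lemma is_Qq_sum q (I : Type) (r : seq I) (F : I -> pt R -> R) : (forall i, is_Qq q (F i)) ->
  is_Qq q (fun x => \sum_(i <- r) F i x).
Proof.
move=> hF; have /(_ _)/cid - /all_sig[c hc] := hF.
exists (fun a b e => \sum_(i <- r) c i a b e) => x.
under eq_bigr do rewrite hc.
rewrite exchange_big /=; apply: eq_bigr => a _; rewrite exchange_big /=; apply: eq_bigr => b _.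
rewrite exchange_big /=; apply: eq_bigr => e _.
by rewrite !mulr_suml.
Qed.

Lemma is_Qq_prod q (k : R) (P1 P2 P3 : {poly R}) : (size P1 <= q.+1)%N -> (size P2 <= q.+1)%N ->
  (size P3 <= q.+1)%N -> is_Qq q (fun x => k * (P1.[c1 x] * P2.[c2 x] * P3.[c3 x])).
Proof.
move=> s1 s2 s3; exists (fun a b e => k * (P1`_a * P2`_b * P3`_e)) => x.
rewrite (horner_coef_wide _ s1) (horner_coef_wide _ s2) (horner_coef_wide _ s3).
rewrite -mulrA mulr_suml mulr_sumr; apply: eq_bigr => a _.
rewrite mulr_suml !mulr_sumr; apply: eq_bigr => b _.
rewrite !mulr_sumr; apply: eq_bigr => e _; ring.
Qed.

End FiniteSums.

(** * The spline built from tensor products of blocks *)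

Section Approximant.
Variable R : realType.
Notation X3 := (R * R * R)%type.
Implicit Types (x y z : X3) (i : axis).
Variables (sigma e0 : R) (L n m : nat) (u : X3 -> R).
Hypothesis s01 : 0 < sigma < 1.
Hypothesis L2 : (2 <= L)%N.
Hypothesis n0 : (0 < n)%N.
Hypothesis m0 : (0 < m)%N.
Hypothesis e00 : 0 < e0.
Hypothesis e0s : e0 <= 1 / 24.
Notation grid := (grid L n).
Definition grid3 := (grid * grid * grid)%type.
Definition idx3 := ('I_m * ('I_m * 'I_m))%type.
Implicit Types (g : grid3) (j : idx3).
Notation h := (e0 / 4).
Notation ctr := (@ctr R sigma L n).

Definition gax i g : grid := match i with A1 => g.1.1 | A2 => g.1.2 | A3 => g.2 end.
Definition jax i j : 'I_m := match i with A1 => j.2.2 | A2 => j.2.1 | A3 => j.1 end.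
Definition ctr3 g : X3 := (ctr g.1.1, ctr g.1.2, ctr g.2).

Lemma co_ctr3 i g : co i (ctr3 g) = ctr (gax i g). Proof. by case: i. Qed.

Variable X : grid3 -> X3.
Hypothesis hX : forall g i, `|co i (X g) - co i (ctr3 g)| <= h * chi (co i (ctr3 g)).

Definition tha i g j t := th sigma e0 m (gax i g) (co i (X g)) (jax i j) t.
Definition Th3 g j y := tha A1 g j y.1.1 * tha A2 g j y.1.2 * tha A3 g j y.2.
Definition pu3 g y := pu sigma g.1.1 y.1.1 * pu sigma g.1.2 y.1.2 * pu sigma g.2 y.2.
Definition cf g j : R := u (P3 (node3 e0 m j.2.2 j.2.1 j.1) (X g)).
(** The Bernstein factors are attached to the grid centres, whereas the Lagrange factors start from
    the nearby base points [X g]; the coefficients are values of [u] at deformed base points. *)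
Definition approximant y := \sum_(g : grid3) \sum_(j : idx3) cf g j * Th3 g j y.

Notation N := (Nth sigma e0 n m).
Notation F := (Fth sigma e0 n m).
Notation La := (Lth sigma e0 n m).

Let hXg g i : `|co i (X g) - ctr (gax i g)| <= h * chi (ctr (gax i g)).
Proof. by rewrite -co_ctr3. Qed.

Lemma tha_bound i g j t : `|tha i g j t| <= N.
Proof. by apply: th_bound. Qed.

Lemma rr_ctr_gt0 g : 0 < rr (ctr3 g).
Proof. by apply: lt_rr => i; rewrite co_ctr3; exact: (rho_pos s01 L2 n0 m0 e00 e0s). Qed.

Lemma tha_lip i g j t t' : `|tha i g j t - tha i g j t'| <= La / rr (ctr3 g) * `|t - t'|.
Proof.
apply: le_trans (th_lip s01 L2 n0 m0 e00 e0s (hXg g i) (ltn_ord _) t t') _.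
rewrite ler_wpM2r// ler_wpM2l ?Lth_ge0// lef_pV2 ?posrE ?rr_ctr_gt0 ?(rho_pos s01 L2 n0 m0 e00 e0s)//.
by rewrite -co_ctr3; exact: rr_le.
Qed.

Lemma Th3_lip g j x z : `|Th3 g j x - Th3 g j z| <= 3 * N ^+ 2 * La / rr (ctr3 g) * edist x z.
Proof.
have h1 := @tha_bound; apply: le_trans (prod3_diff (N := N) _ _ _ _ _ _) _ => //.
rewrite (_ : 3 * N ^+ 2 * La / rr (ctr3 g) * edist x z =
  N ^+ 2 * (La / rr (ctr3 g) * edist x z *+ 3)); last by ring.
rewrite ler_wpM2l ?sqr_ge0// !mulrS mulr0n addr0 addrA.
have b i t t' : `|t - t'| <= edist x z -> `|tha i g j t - tha i g j t'| <= La / rr (ctr3 g) * edist x z.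
  move=> ht; apply: le_trans (tha_lip _ _ _ _ _) _.
  by rewrite ler_wpM2l// mulr_ge0 ?Lth_ge0// invr_ge0 ltW// rr_ctr_gt0.
by rewrite !lerD// b//; [exact: (co_edist A1)|exact: (co_edist A2)|exact: (co_edist A3)].
Qed.

Lemma approx_lip : exists2 K, 0 <= K & forall x z, `|approximant x - approximant z| <= K * edist x z.
Proof.
exists (\sum_(g : grid3) \sum_(j : idx3) `|cf g j| * (3 * N ^+ 2 * La / rr (ctr3 g))).
  apply: sumr_ge0 => g _; apply: sumr_ge0 => j _; apply: mulr_ge0 => //.
  apply: mulr_ge0; last by rewrite invr_ge0 ltW// rr_ctr_gt0.
  by apply: mulr_ge0; [rewrite mulr_ge0 ?sqr_ge0|exact: Lth_ge0].
move=> x z; rewrite /approximant -sumrB; apply: le_trans (ler_norm_sum _ _ _) _.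
rewrite mulr_suml; apply: ler_sum => g _; rewrite -sumrB; apply: le_trans (ler_norm_sum _ _ _) _.
rewrite mulr_suml; apply: ler_sum => j _; rewrite -mulrBr (normrM (cf g j)) -[leRHS]mulrA; apply: ler_wpM2l => //; exact: Th3_lip.
Qed.

Lemma Th3_out g j y : ~ Omega (y : pt R) -> Th3 g j y = 0.
Proof.
move=> hy; have z i : ~~ (0 < co i y < 1) -> tha i g j (co i y) = 0 by move=> hi; apply: th_out.
have [k1|/z k1] := boolP (0 < co A1 y < 1); last by rewrite /Th3 k1 !mul0r.
have [k2|/z k2] := boolP (0 < co A2 y < 1); last by rewrite /Th3 k2 mulr0 mul0r.
have [k3|/z k3] := boolP (0 < co A3 y < 1); last by rewrite /Th3 k3 mulr0.
by case: hy; split.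
Qed.

Lemma approx_out y : ~ Omega (y : pt R) -> approximant y = 0.
Proof. by move=> hy; rewrite /approximant !big1// => g _; rewrite big1// => j _; rewrite Th3_out// mulr0. Qed.

Lemma lip_continuous (v : X3 -> R) (K : R) : 0 <= K ->
  (forall x z, `|v x - v z| <= K * edist x z) -> continuous (v : pt R -> R).
Proof.
move=> K0 hv x; apply/cvgrPdist_lt => e ep.
have K1 : 0 < 3 * (K + 1) by rewrite mulr_gt0//; lra.
have d0 : 0 < e / (3 * (K + 1)) by rewrite divr_gt0.
suff : nbhs (x : pt R) [set z | `|v x - v z| < e] by [].
apply/nbhs_ballP; exists (e / (3 * (K + 1))) => //= z [[k1 k2] k3].
apply: le_lt_trans (hv x z) _.
have dist : edist x z <= 2 * (e / (3 * (K + 1))).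
  apply: edist_le_max => [|i]; first exact: ltW.
  by apply: ltW; case: i; [exact: k1|exact: k2|exact: k3].
apply: (@le_lt_trans _ _ (K * (2 * (e / (3 * (K + 1)))))); first by rewrite ler_wpM2l.
rewrite (_ : K * _ = e * (2 * K / (3 * (K + 1)))); last by rewrite !mulrA; field; lra.
by rewrite -[ltRHS]mulr1 ltr_pM2l// ltr_pdivrMr// mul1r; lra.
Qed.

(** On a cell each one-dimensional factor is a polynomial of size at most [n + m], that is of degree
    at most [n + m - 1 <= q]. *)
Lemma approx_W q : (n + m <= q.+1)%N -> W sigma L q (approximant : pt R -> R).
Proof.
move=> hq; have [K K0 hK] := approx_lip.
split; [exact: lip_continuous hK|exact: approx_out|].
move=> i1 i2 i3 l1 l2 l3.
have cell i g j (l : nat) : (l <= 2 * L)%N -> exists P : {poly R}, (size P <= q.+1)%N /\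
    forall t, node sigma L l < t < node sigma L l.+1 -> tha i g j t = P.[t].
  move=> ll; have [P [sP hP]] := th_cell s01 L2 n0 m0 e00 e0s (gax i g) (co i (X g)) (ltn_ord (jax i j)) ll.
  by exists P; split => //; exact: leq_trans sP hq.
have /(_ _)/cid - /all_sig[Q1 hQ1] := fun gj : grid3 * idx3 => cell A1 gj.1 gj.2 i1 l1.
have /(_ _)/cid - /all_sig[Q2 hQ2] := fun gj : grid3 * idx3 => cell A2 gj.1 gj.2 i2 l2.
have /(_ _)/cid - /all_sig[Q3 hQ3] := fun gj : grid3 * idx3 => cell A3 gj.1 gj.2 i3 l3.
exists (fun x => \sum_(g : grid3) \sum_(j : idx3) cf g j *
  ((Q1 (g, j)).[c1 x] * (Q2 (g, j)).[c2 x] * (Q3 (g, j)).[c3 x])); split.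
  apply: is_Qq_sum => g; apply: is_Qq_sum => j; apply: is_Qq_prod.
  - exact: (hQ1 (g, j)).1.
  - exact: (hQ2 (g, j)).1.
  - exact: (hQ3 (g, j)).1.
move=> x [b1 b2 b3]; apply: eq_bigr => g _; apply: eq_bigr => j _; rewrite /Th3.
by rewrite ((hQ1 (g, j)).2 _ b1) ((hQ2 (g, j)).2 _ b2) ((hQ3 (g, j)).2 _ b3).
Qed.

Definition tg g y := interp u e0 m (rel (X g) y) (X g).

Lemma pu3_tg g y : pu3 g y * tg g y = \sum_(j : idx3) cf g j * Th3 g j y.
Proof.
rewrite /tg /interp -(pair_bigA _ (fun (j3 : 'I_m) (j : 'I_m * 'I_m) => cf g (j3, j) * Th3 g (j3, j) y)) /=.
rewrite mulr_sumr; apply: eq_bigr => j3 _.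
rewrite -(pair_bigA _ (fun (j2 j1 : 'I_m) => cf g (j3, (j2, j1)) * Th3 g (j3, (j2, j1)) y)) /=.
rewrite !mulr_sumr; apply: eq_bigr => j2 _; rewrite !mulr_sumr; apply: eq_bigr => j1 _.
rewrite /Th3 /tha /th /pu3 /cf /= !horner_lagp; ring.
Qed.

(** The defining sum shows a Lipschitz spline. This second form, a partition of unity applied to
    local interpolants, is the one in which the error is estimated. *)
Lemma approxE y : approximant y = \sum_(g : grid3) pu3 g y * tg g y.
Proof. by apply: eq_bigr => g _; rewrite pu3_tg. Qed.

Lemma sum_pu3 y : \sum_(g : grid3) pu3 g y = (\sum_(p : grid) pu sigma p y.1.1) *
  (\sum_(p : grid) pu sigma p y.1.2) * (\sum_(p : grid) pu sigma p y.2).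
Proof.
rewrite -(pair_bigA _ (fun (g : grid * grid) (p : grid) => pu3 (g, p) y)) /=.
rewrite -(pair_bigA _ (fun (g1 g2 : grid) => \sum_(p : grid) pu3 (g1, g2, p) y)) /=.
rewrite -mulrA mulr_suml; apply: eq_bigr => g1 _; rewrite mulrCA mulr_suml; apply: eq_bigr => g2 _.
rewrite mulrCA !mulr_sumr; apply: eq_bigr => g3 _; rewrite /pu3 /=; ring.
Qed.

Lemma sum_pu3_in y : 0 <= \sum_(g : grid3) pu3 g y <= 1.
Proof.
rewrite sum_pu3; have S t := @sum_grid_in R sigma e0 L n m s01 L2 n0 m0 e00 e0s t.
have /andP[a1 b1] := S y.1.1; have /andP[a2 b2] := S y.1.2; have /andP[a3 b3] := S y.2.
by rewrite !mulr_ge0//= mulr_ile1 ?mulr_ge0// mulr_ile1.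
Qed.

Lemma sum_pu3_1 y : node sigma L 2 < rr y -> \sum_(g : grid3) pu3 g y = 1.
Proof.
move=> hy; have c i := lt_le_trans hy (rr_le i y).
by rewrite sum_pu3 (sum_grid1 s01 L2 n0 m0 e00 e0s (c A1)) (sum_grid1 s01 L2 n0 m0 e00 e0s (c A2)) (sum_grid1 s01 L2 n0 m0 e00 e0s (c A3)) !mulr1.
Qed.

Lemma pu3_in g y : 0 <= pu3 g y <= 1.
Proof.
by apply: prod3_in; rewrite pu_ge0 pu_le1.
Qed.

Lemma far_axis g y : ~~ nearb e0 (ctr3 g) y ->
  exists i, h * chi (ctr (gax i g)) < `|co i y - ctr (gax i g)|.
Proof.
rewrite /nearb !negb_and -!ltNge => /or3P[] hh; [by exists A1|by exists A2|by exists A3].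
Qed.

Lemma Th3_far g j y : ~~ nearb e0 (ctr3 g) y -> `|Th3 g j y| <= F * N ^+ 2.
Proof.
move=> /far_axis[i hi].
have F0 : 0 <= F by apply: Fth_ge0.
have fa : `|tha i g j (co i y)| <= F by apply: th_far.
have b := tha_bound; have N0 : 0 <= N by apply: le_trans (b A1 g j 0).
rewrite expr2 mulrA; case: i fa {hi} => fa.
- exact: (prod3_le fa).
- by rewrite (mulrC F); exact: (prod3_le _ fa).
- by rewrite (_ : F * N * N = N * N * F); [exact: prod3_le|ring].
Qed.

Lemma pu3_far g y : ~~ nearb e0 (ctr3 g) y -> pu3 g y <= 4 * tailE sigma e0 n.
Proof.
move=> /far_axis[i hi]; have fa : pu sigma (gax i g) (co i y) <= 4 * tailE sigma e0 n by exact: (pu_far s01 L2 n0 m0 e00 e0s hi).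
have b (p : grid) t : 0 <= pu sigma p t <= 1 by rewrite pu_ge0 pu_le1.
have [l1 l2 l3] := prod3_le1 (b g.1.1 y.1.1) (b g.1.2 y.1.2) (b g.2 y.2).
by apply: le_trans fa; case: i {hi}.
Qed.

Lemma Th3_supp g j y : Th3 g j y != 0 -> forall i,
  `|co i y - ctr (gax i g)| <= chi (ctr (gax i g)) / sigma /\
  sigma * (1 - sigma) * chi (ctr (gax i g)) <= chi (co i y).
Proof.
move=> nz i; apply: (pu_supp s01 L2 n0 m0 e00 e0s); apply: (@th_supp R sigma e0 L n m _ (co i (X g)) (jax i j)).
by apply: contraNN nz => /eqP z; rewrite /Th3; case: i z; rewrite /tha /= => ->; rewrite ?mulr0 ?mul0r.
Qed.

End Approximant.

Section SumIntegral.
Context d (T : measurableType d) (R : realType) (m : {measure set T -> \bar R}).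

Lemma int_sum_fin (I : finType) (f : I -> T -> R) (C : R) : 0 <= C ->
  (forall i, measurable_fun setT (f i)) -> (forall i x, 0 <= f i x) ->
  (forall i, (\int[m]_x (f i x)%:E <= C%:E)%E) ->
  (\int[m]_x (\sum_(i : I) f i x)%:E <= (#|I|%:R * C)%:E)%E.
Proof.
move=> C0 mf f0 hf.
have := @int_sum_le _ _ R m #|I| (fun i => f (enum_val i)) C C0 (fun i => mf _) (fun i => f0 _) (fun i => hf _).
apply: le_trans; rewrite le_eqVlt; apply/orP; left; apply/eqP.
by apply: eq_integral => x _; congr EFin; rewrite -(big_enum_val (fun i => f i x)); exact: eq_bigl.
Qed.

End SumIntegral.

Section WeightBound.
Variable R : realType.
Variable s : R.
Hypothesis s01 : 0 < s < 1.

Lemma wh_le (c r : R) y : 0 < c <= 1 -> 0 < r -> c * r <= rr y ->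
  wh s y ^+ 2 <= c ^- 2 * r `^ (- (2 * s)).
Proof.
move=> /andP[c0 c1] r0 h; rewrite wh2.
have s2 : 0 <= 2 * s by have := s01; lra.
apply: le_trans (powRN_le (mulr_gt0 c0 r0) h s2) _.
rewrite powRM ?(ltW c0) ?(ltW r0)// ler_wpM2r ?powR_ge0//.
rewrite powRV// -exprVn -powR_mulrn ?invr_ge0 ?(ltW c0)//.
by rewrite ler_powR ?invf_ge1//; have := s01; lra.
Qed.

End WeightBound.

(** * The weighted error of the approximant *)

Section ErrorEstimate.
Variable R : realType.
Variable s : R.
Hypothesis s01 : 0 < s < 1.
Notation X3 := (R * R * R)%type.
Implicit Types (x y z : X3) (i : axis).
Variables (sigma e0 : R) (L n m : nat) (u : X3 -> R).
Hypothesis sg01 : 0 < sigma < 1.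
Hypothesis L2 : (2 <= L)%N.
Hypothesis n0 : (0 < n)%N.
Hypothesis m0 : (0 < m)%N.
Hypothesis e00 : 0 < e0.
Hypothesis e0s : e0 <= 1 / 24.
Hypothesis hu : Ho s u.
Notation grid3 := (grid3 L n).
Notation idx3 := (idx3 m).
Implicit Types (g : grid3) (j : idx3).
Notation ctr3 := (@ctr3 R sigma L n).
Notation h := (e0 / 4).
Variable X : grid3 -> X3.
Hypothesis hX : forall g i, `|co i (X g) - co i (ctr3 g)| <= h * chi (co i (ctr3 g)).
Variables (Th Sb Kc Csh : R).
Hypothesis Th0 : 0 <= Th.
Hypothesis Sb0 : 0 <= Sb.
Hypothesis hSb : nw s u ^+ 2 <= Sb.
Hypothesis Kc0 : 0 <= Kc.
Hypothesis Csh0 : 0 <= Csh.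
Definition vol g : R := chi (co A1 (ctr3 g)) * chi (co A2 (ctr3 g)) * chi (co A3 (ctr3 g)).
Notation tg := (tg e0 m u X).
Notation cf := (@cf R e0 L n m u X).
Notation Th3 := (@Th3 R sigma e0 L n m X).
Notation pu3 := (@pu3 R sigma L n).
Notation w := (approximant sigma e0 m u X).
Notation N := (Nth sigma e0 n m).
Notation F := (Fth sigma e0 n m).
Notation E := (tailE sigma e0 n).
Notation M := (#|{: grid3}|%:R : R).
Notation m3 := (#|{: idx3}|%:R : R).
Definition near2 g y : R := if nearb e0 (ctr3 g) y then (u y - tg g y) ^+ 2 else 0.
Hypothesis hXn : forall g, (\int[L3]_y (near2 g y)%:E <= (8192 * Th * rr (ctr3 g) `^ (2 * s))%:E)%E.
Hypothesis hXs : forall g, \sum_(j : idx3) cf g j ^+ 2 <= Kc * rr (ctr3 g) `^ (2 * s) / vol g.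
Notation hL := (node sigma L 2).
Hypothesis hsh : ip L3 (shal s u hL) (shal s u hL) <= Csh * hL.

Let sg0 : 0 < sigma. Proof. by case/andP: sg01. Qed.
Let sg1 : sigma < 1. Proof. by case/andP: sg01. Qed.

Let chi_ctr g i : 0 < chi (co i (ctr3 g)).
Proof. by rewrite co_ctr3; exact: (rho_pos sg01 L2 n0 m0 e00 e0s). Qed.

Lemma vol_gt0 g : 0 < vol g. Proof. by rewrite !mulr_gt0. Qed.

Lemma near_rr g y : nearb e0 (ctr3 g) y -> 1 / 2 * rr (ctr3 g) <= rr y.
Proof.
move/nearbP => hy; apply: le_rr => i.
have /andP[k _] := chi_near (hy i); apply: le_trans k.
have h1 := rr_le i (ctr3 g); have c0 := chi_ge0 (co i (ctr3 g)).
apply: (@le_trans _ _ (1 / 2 * chi (co i (ctr3 g)))); first by rewrite ler_wpM2l.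
by rewrite ler_wpM2r//; have := e0s; lra.
Qed.

Definition sbox g y := [&& `|y.1.1 - (ctr3 g).1.1| <= chi (ctr3 g).1.1 / sigma,
  `|y.1.2 - (ctr3 g).1.2| <= chi (ctr3 g).1.2 / sigma & `|y.2 - (ctr3 g).2| <= chi (ctr3 g).2 / sigma].

Lemma sboxP g y : reflect (forall i, `|co i y - co i (ctr3 g)| <= chi (co i (ctr3 g)) / sigma) (sbox g y).
Proof.
apply: (iffP and3P) => [[h1 h2 h3] [] //|H].
by split; [exact: (H A1)|exact: (H A2)|exact: (H A3)].
Qed.

Lemma measurable_sbox g : measurable_fun setT (sbox g).
Proof.
have c i : measurable_fun setT (fun y : X3 => `|co i y - co i (ctr3 g)| <= chi (co i (ctr3 g)) / sigma).
  apply: measurable_fun_ler => //; apply: measurableT_comp => //.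
  by apply: measurable_funB => //; exact: measurable_co.
by apply: measurable_and; [exact: (c A1)|apply: measurable_and; [exact: (c A2)|exact: (c A3)]].
Qed.

(** The set lies in an open box with sides [4 * c * chi], whence [64 = 4 ^ 3]. *)
Lemma integral_cbox (c : R) (b : X3 -> bool) g : 0 < c -> measurable_fun setT b ->
  (forall y, b y -> forall i, `|co i y - co i (ctr3 g)| <= c * chi (co i (ctr3 g))) ->
  (\int[L3]_y (if b y then 1 else 0)%:E <= (64 * c ^+ 3 * vol g)%:E)%E.
Proof.
move=> c0 mb hb; set t := ctr3 g.
pose lo : X3 := (t.1.1 - 2 * c * chi t.1.1, t.1.2 - 2 * c * chi t.1.2, t.2 - 2 * c * chi t.2).
pose hi : X3 := (t.1.1 + 2 * c * chi t.1.1, t.1.2 + 2 * c * chi t.1.2, t.2 + 2 * c * chi t.2).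
have hB : L3 (box3 lo hi) = (64 * c ^+ 3 * vol g)%:E.
  have := @L3_box3 R lo hi; rewrite /lo /hi /vol -/t /= => ->; first by congr EFin; ring.
  by move=> i; have := mulr_gt0 c0 (chi_ctr g i); rewrite -/t; case: i => /= hc; lra.
have mB := measurable_box3 lo hi.
apply: (@le_trans _ _ (\int[L3]_y (\1_(box3 lo hi) y)%:E)%E); last first.
  by rewrite integral_indic// setIT; rewrite [leLHS](_ : _ = (64 * c ^+ 3 * vol g)%:E).
apply: ge0_le_int => [||y|y].
- by apply: measurable_EF; exact: measurable_fun_ifT.
- by apply: measurable_EF; exact: measurable_indic.
- by rewrite lee_fin; case: ifP.
- rewrite lee_fin; case: ifP => // hy; rewrite indicE mem_set//; apply/box3P => i.
  have := hb y hy i; have := mulr_gt0 c0 (chi_ctr g i); rewrite -/t.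
  by case: i => /= cp; rewrite ler_norml => /andP[k1 k2]; apply/andP; split; lra.
Qed.

(** Contribution of an interpolant far from its centre: Cauchy-Schwarz over the [m3] nodes, one far
    factor [F] and two arbitrary ones [N], and the weight on the support of the block. *)
Definition Kf g : R := 2 * (Kc / vol g) * m3 * (F * N ^+ 2) ^+ 2 * (sigma * (1 - sigma)) ^- 2.

Definition Bg g y : R := 4 * rr (ctr3 g) `^ (- (2 * s)) * near2 g y +
  32 * E ^+ 2 * (wh s y * u y) ^+ 2 + Kf g * (if sbox g y then 1 else 0).

Let F0 : 0 <= F. Proof. by apply: Fth_ge0. Qed.
Let N1 : 1 <= N. Proof. by apply: Nth_ge1. Qed.
Let E0 : 0 <= E. Proof. exact: tailE_ge0. Qed.
Let rp g : rr (ctr3 g) `^ (2 * s) * rr (ctr3 g) `^ (- (2 * s)) = 1.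
Proof.
rewrite -powRD ?subrr ?powRr0//; apply/implyP => _.
by rewrite gt_eqF// (rr_ctr_gt0 sg01 L2 n0 m0 e00 e0s).
Qed.

Lemma Kf_ge0 g : 0 <= Kf g.
Proof.
rewrite /Kf mulr_ge0//; last by rewrite invr_ge0 sqr_ge0.
rewrite mulr_ge0 ?sqr_ge0// mulr_ge0// mulr_ge0// divr_ge0// ltW//; exact: vol_gt0.
Qed.

Lemma near2_ge0 g y : 0 <= near2 g y.
Proof. by rewrite /near2; case: ifP => // _; exact: sqr_ge0. Qed.

Lemma sum_cfTh3_sqr g y (B : R) : 0 <= B -> (forall j, `|Th3 g j y| <= B) ->
  (\sum_(j : idx3) cf g j * Th3 g j y) ^+ 2 <=
  m3 * B ^+ 2 * \sum_(j : idx3) cf g j ^+ 2.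
Proof.
move=> B0 hB; apply: le_trans (sqr_sum_le _) _; rewrite -mulrA ler_wpM2l// mulr_sumr.
apply: ler_sum => j _; rewrite exprMn mulrC ler_wpM2r ?sqr_ge0//.
by rewrite -[leLHS]real_normK ?num_real// lerXn2r ?nnegrE.
Qed.

(** Near the centre the partition function is at most one and the interpolation error counts. Far
    from it [u] and the interpolant are separated: the tail of [pu3] damps the first, the smallness
    of [Th3] the second. *)
Lemma block_bound g y : (wh s y * (pu3 g y * (u y - tg g y))) ^+ 2 <= Bg g y.
Proof.
have r0 := rr_ctr_gt0 sg01 L2 n0 m0 e00 e0s g.
have t1 : 0 <= 4 * rr (ctr3 g) `^ (- (2 * s)) * near2 g y by rewrite !mulr_ge0 ?powR_ge0 ?near2_ge0.
have t2 : 0 <= 32 * E ^+ 2 * (wh s y * u y) ^+ 2 by rewrite mulr_ge0 ?sqr_ge0// mulr_ge0 ?sqr_ge0.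
have t3 : 0 <= Kf g * (if sbox g y then 1 else 0) by rewrite mulr_ge0 ?Kf_ge0//; case: ifP.
have /andP[p0 p1] := pu3_in sigma g y.
have [hn|hf] := boolP (nearb e0 (ctr3 g) y).
  apply: (@le_trans _ _ (4 * rr (ctr3 g) `^ (- (2 * s)) * near2 g y)); last first.
    by rewrite /Bg -addrA lerDl addr_ge0.
  have wl := @wh_le R s s01 (1 / 2) (rr (ctr3 g)) y ltac:(lra) r0 (near_rr hn).
  rewrite /near2 hn exprMn; apply: ler_pM; rewrite ?sqr_ge0//.
    by apply: le_trans wl _; rewrite le_eqVlt; apply/orP; left; apply/eqP; field.
  by rewrite exprMn ler_piMl ?sqr_ge0// expr_le1.
have pE := pu3_far sg01 L2 n0 m0 e00 e0s hf.
have split2 : (wh s y * (pu3 g y * (u y - tg g y))) ^+ 2 <=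
    2 * (pu3 g y ^+ 2 * (wh s y * u y) ^+ 2) + 2 * (wh s y ^+ 2 * (pu3 g y * tg g y) ^+ 2).
  rewrite -subr_ge0; move: (wh s y) (pu3 g y) (u y) (tg g y) => a b c d.
  rewrite (_ : _ - _ = (a * b * (c + d)) ^+ 2); last by ring.
  exact: sqr_ge0.
apply: le_trans split2 _.
apply: (@le_trans _ _ (32 * E ^+ 2 * (wh s y * u y) ^+ 2 + Kf g * (if sbox g y then 1 else 0)));
  last by rewrite /Bg -addrA lerDr.
apply: lerD.
  rewrite mulrA ler_wpM2r ?sqr_ge0//.
  have : pu3 g y ^+ 2 <= (4 * E) ^+ 2 by rewrite lerXn2r ?nnegrE// mulr_ge0.
  by rewrite (_ : (4 * E) ^+ 2 = 16 * E ^+ 2); [move: (pu3 g y ^+ 2) (E ^+ 2) => a b; lra|ring].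
rewrite pu3_tg.
have [[j nz]|az] := pselect (exists j : idx3, Th3 g j y != 0); last first.
  rewrite big1 ?expr0n ?mulr0// => j _.
  by apply/eqP; rewrite mulf_eq0; apply/orP; right; apply: contrapT => /negP nz; apply: az; exists j.
have sp := Th3_supp sg01 L2 n0 m0 e00 e0s nz.
have sb : sbox g y by apply/sboxP => i; rewrite co_ctr3; exact: (sp i).1.
rewrite sb mulr1.
have c01 : 0 < sigma * (1 - sigma) <= 1.
  by rewrite mulr_gt0 ?subr_gt0//= mulr_ile1 ?subr_ge0 ?(ltW sg0) ?(ltW sg1)// lerBlDr lerDl ltW.
have ry : sigma * (1 - sigma) * rr (ctr3 g) <= rr y.
  apply: le_rr => i; apply: le_trans (sp i).2; rewrite -co_ctr3 ler_wpM2l ?rr_le//.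
  by case/andP: c01 => /ltW.
have wl := wh_le s01 c01 r0 ry.
have B0 : 0 <= F * N ^+ 2 by rewrite mulr_ge0 ?sqr_ge0.
have st := sum_cfTh3_sqr B0 (fun j => Th3_far sg01 L2 n0 m0 e00 e0s hX j hf).
apply: (@le_trans _ _ (2 * ((sigma * (1 - sigma)) ^- 2 * rr (ctr3 g) `^ (- (2 * s)) *
  (m3 * (F * N ^+ 2) ^+ 2 * (Kc * rr (ctr3 g) `^ (2 * s) / vol g))))).
  rewrite ler_wpM2l//; apply: ler_pM; rewrite ?sqr_ge0//.
  by apply: le_trans st _; rewrite ler_wpM2l ?hXs// mulr_ge0 ?sqr_ge0.
rewrite le_eqVlt; apply/orP; left; apply/eqP; rewrite /Kf.
transitivity (2 * (Kc / vol g) * m3 * (F * N ^+ 2) ^+ 2 * (sigma * (1 - sigma)) ^- 2 *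
  (rr (ctr3 g) `^ (2 * s) * rr (ctr3 g) `^ (- (2 * s)))); last by rewrite rp mulr1.
by move: ((sigma * (1 - sigma)) ^- 2) (_ `^ _) (_ `^ _) => a b c; field; rewrite gt_eqF// vol_gt0.
Qed.

Definition Bnd : R := 4 * 8192 * Th + 32 * E ^+ 2 * Sb +
  128 * Kc * m3 * (F * N ^+ 2) ^+ 2 * (sigma * (1 - sigma)) ^- 2 / sigma ^+ 3.

Let mu : measurable_fun setT u. Proof. by case: hu => [[[]]]. Qed.
Let whu : sqi L3 (fun y => wh s y * u y).
Proof. by have [[_ sw] _] := nw_Ho s01 hu. Qed.

Lemma measurable_near2 g : measurable_fun setT (near2 g).
Proof.
apply: measurable_fun_ifT => //; first exact: measurable_nearb.
apply: measurable_funX; apply: measurable_funB => //.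
apply: (measurable_interp e0 m hu) => //.
have c i : measurable_fun setT (fun y : X3 => (co i y - co i (X g)) / chi (co i (X g))).
  by apply: measurable_funM => //; apply: measurable_funB => //; exact: measurable_co.
by apply: measurable_tuple3; [exact: (c A1)|exact: (c A2)|exact: (c A3)].
Qed.

Let mBg g : measurable_fun setT (Bg g).
Proof.
apply: measurable_funD; first apply: measurable_funD.
- by apply: measurable_funM => //; exact: measurable_near2.
- by apply: measurable_funM => //; apply: measurable_funX; case: whu.
- by apply: measurable_funM => //; apply: measurable_fun_ifT => //; exact: measurable_sbox.
Qed.

Let Bg0 g y : 0 <= Bg g y.
Proof. exact: le_trans (sqr_ge0 _) (block_bound g y). Qed.

(** The bound is the same for all blocks: powers of [rr] cancel between the weight and the estimates
    at the base point, and [vol] cancels between [Kf] and the support box. *)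
Lemma int_Bg g : (\int[L3]_y (Bg g y)%:E <= Bnd%:E)%E.
Proof.
have c1 : 0 <= 4 * rr (ctr3 g) `^ (- (2 * s)) by rewrite mulr_ge0 ?powR_ge0.
have c2 : 0 <= 32 * E ^+ 2 by rewrite mulr_ge0 ?sqr_ge0.
have c3 := Kf_ge0 g.
have m1 := measurable_EF (measurable_near2 g).
have m2 : measurable_fun setT (fun y => ((wh s y * u y) ^+ 2)%:E).
  by apply: measurable_EF; apply: measurable_funX; case: whu.
have m3' : measurable_fun setT (fun y => (if sbox g y then 1 else 0 : R)%:E).
  by apply: measurable_EF; apply: measurable_fun_ifT => //; exact: measurable_sbox.
have n1 y : (0 <= (near2 g y)%:E)%E by rewrite lee_fin near2_ge0.
have n2 y : (0 <= ((wh s y * u y) ^+ 2)%:E)%E by rewrite lee_fin sqr_ge0.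
have n3 y : (0 <= (if sbox g y then 1 else 0 : R)%:E)%E by rewrite lee_fin; case: ifP.
have z1 y : (0 <= (4 * rr (ctr3 g) `^ (- (2 * s)))%:E * (near2 g y)%:E)%E by rewrite mule_ge0// lee_fin.
have z2 y : (0 <= (32 * E ^+ 2)%:E * ((wh s y * u y) ^+ 2)%:E)%E by rewrite mule_ge0// lee_fin.
have z3 y : (0 <= (Kf g)%:E * (if sbox g y then 1 else 0 : R)%:E)%E by rewrite mule_ge0// lee_fin.
have q1 : measurable_fun setT (fun y => ((4 * rr (ctr3 g) `^ (- (2 * s)))%:E * (near2 g y)%:E)%E) by exact: measurable_funeM.
have q2 : measurable_fun setT (fun y => ((32 * E ^+ 2)%:E * ((wh s y * u y) ^+ 2)%:E)%E) by exact: measurable_funeM.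
have q3 : measurable_fun setT (fun y => ((Kf g)%:E * (if sbox g y then 1 else 0 : R)%:E)%E) by exact: measurable_funeM.
have q12 := emeasurable_funD q1 q2.
have z12 y := adde_ge0 (z1 y) (z2 y).
rewrite (_ : (\int[L3]_y (Bg g y)%:E = \int[L3]_y (((4 * rr (ctr3 g) `^ (- (2 * s)))%:E * (near2 g y)%:E +
  (32 * E ^+ 2)%:E * ((wh s y * u y) ^+ 2)%:E) + (Kf g)%:E * (if sbox g y then 1 else 0 : R)%:E))%E); last first.
  by apply: eq_integral => y _; rewrite -!EFinM -!EFinD.
have /= -> := ge0_intD L3 q12 q3 z12 z3.
have /= -> := ge0_intD L3 q1 q2 z1 z2.
have /= -> := ge0_intZ L3 c1 m1 n1.
have /= -> := ge0_intZ L3 c2 m2 n2.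
have /= -> := ge0_intZ L3 c3 m3' n3.
rewrite /Bnd EFinD [(_ + 32 * _ * _)%:E]EFinD; apply: leeD; first apply: leeD.
- apply: (@le_trans _ _ ((4 * rr (ctr3 g) `^ (- (2 * s)))%:E * (8192 * Th * rr (ctr3 g) `^ (2 * s))%:E)%E).
    by apply: lee_wpmul2l; [rewrite lee_fin|exact: hXn].
  rewrite -EFinM lee_fin le_eqVlt; apply/orP; left; apply/eqP.
  transitivity (4 * 8192 * Th * (rr (ctr3 g) `^ (2 * s) * rr (ctr3 g) `^ (- (2 * s)))); first by ring.
  by rewrite rp; ring.
- rewrite (sqi_fin whu) -EFinM lee_fin ler_wpM2l// -nw_sqr; exact: hSb.
- have ci : 0 < sigma^-1 by rewrite invr_gt0.
  apply: (@le_trans _ _ ((Kf g)%:E * (64 * sigma^-1 ^+ 3 * vol g)%:E)%E).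
    apply: lee_wpmul2l; first by rewrite lee_fin.
    apply: integral_cbox => //; first exact: measurable_sbox.
    by move=> y /sboxP hy i; rewrite mulrC; exact: hy.
  rewrite -EFinM lee_fin le_eqVlt; apply/orP; left; apply/eqP; rewrite /Kf.
  move: ((sigma * (1 - sigma)) ^- 2) => a; field.
  by rewrite (gt_eqF (vol_gt0 g)) (gt_eqF sg0).
Qed.

Definition err y := u y - w y.

Lemma err_pointwise y : (wh s y * err y) ^+ 2 <=
  2 * shal s u hL y ^+ 2 + 2 * M * \sum_(g : grid3) Bg g y.
Proof.
(* The partition functions can fail to sum to one only where [rr y <= hL], so the first summand
   lives in the boundary layer. *)
have dec : err y = (1 - \sum_(g : grid3) pu3 g y) * u y + \sum_(g : grid3) pu3 g y * (u y - tg g y).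
  rewrite /err approxE mulrBl mul1r mulr_suml.
  under [X in _ = _ + X]eq_bigr do rewrite mulrBr.
  by rewrite sumrB addrA subrK.
have sq2 (a b : R) : (a + b) ^+ 2 <= 2 * a ^+ 2 + 2 * b ^+ 2.
  by rewrite -subr_ge0 (_ : _ - _ = (a - b) ^+ 2) ?sqr_ge0//; ring.
rewrite dec mulrDr; apply: le_trans (sq2 _ _) _; apply: lerD.
  rewrite ler_wpM2l// /shal.
  have /andP[S0 S1] := sum_pu3_in sg01 L2 n0 m0 e00 e0s y.
  case: (leP (rr y) hL) => hr; last first.
    by rewrite (sum_pu3_1 sg01 L2 n0 m0 e00 e0s hr) subrr mul0r mulr0 expr0n.
  rewrite mulrCA exprMn ler_piMl ?sqr_ge0// expr_le1//; lra.
rewrite -mulrA ler_wpM2l// mulr_sumr; apply: le_trans (sqr_sum_le _) _.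
by rewrite ler_wpM2l//; apply: ler_sum => g _; exact: block_bound.
Qed.

Lemma err_Ho : Ho s err.
Proof.
have [K K0 hK] := approx_lip u sg01 L2 n0 m0 e00 e0s hX.
apply: HoB => //; apply: (lip_Ho s01 K0 _ hK) => y hy.
by apply: (approx_out u sg01 L2 n0 m0 e00 e0s).
Qed.

Lemma Bnd_ge0 : 0 <= Bnd.
Proof.
have s0 : 0 <= (sigma * (1 - sigma)) ^- 2 by rewrite invr_ge0 sqr_ge0.
apply: addr_ge0; first apply: addr_ge0.
- by apply: mulr_ge0; [apply: mulr_ge0; exact: ler0n|exact: Th0].
- by apply: mulr_ge0 => //; apply: mulr_ge0; [exact: ler0n|exact: sqr_ge0].
- apply: mulr_ge0; last by rewrite invr_ge0 exprn_ge0// ltW.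
  apply: mulr_ge0 => //; apply: mulr_ge0; last exact: sqr_ge0.
  by apply: mulr_ge0; [apply: mulr_ge0 => //; exact: ler0n|exact: ler0n].
Qed.

Lemma err_bound : nw s err ^+ 2 <= 2 * (Csh * hL) + 2 * M ^+ 2 * Bnd.
Proof.
have [[me se] _] := nw_Ho s01 err_Ho.
have [sS _] := shal_sqi s01 hu hL.
rewrite -lee_fin nw_sqr -(sqi_fin se).
have mS : measurable_fun setT (fun y => (shal s u hL y ^+ 2)%:E).
  by apply: measurable_EF; apply: measurable_funX; case: sS.
have mB : measurable_fun setT (fun y => (\sum_(g : grid3) Bg g y)%:E).
  by apply: measurable_EF; apply: measurable_sum => g; exact: mBg.
have nS y : (0 <= (shal s u hL y ^+ 2)%:E)%E by rewrite lee_fin sqr_ge0.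
have nB y : (0 <= (\sum_(g : grid3) Bg g y)%:E)%E by rewrite lee_fin sumr_ge0.
have M0 : 0 <= 2 * M by rewrite mulr_ge0.
apply: (@le_trans _ _ (\int[L3]_y ((2%R)%:E * (shal s u hL y ^+ 2)%:E +
   (2 * M)%:E * (\sum_(g : grid3) Bg g y)%:E))%E).
  apply: ge0_le_int => [||y|y].
  - by apply: measurable_EF; apply: measurable_funX; case: se.
  - by apply: emeasurable_funD; exact: measurable_funeM.
  - by rewrite lee_fin sqr_ge0.
  - by rewrite -!EFinM -EFinD lee_fin; exact: err_pointwise.
have q1 : measurable_fun setT (fun y => ((2%R)%:E * (shal s u hL y ^+ 2)%:E)%E) by exact: measurable_funeM.
have q2 : measurable_fun setT (fun y => ((2 * M)%:E * (\sum_(g : grid3) Bg g y)%:E)%E) by exact: measurable_funeM.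
have z1 y : (0 <= (2%R)%:E * (shal s u hL y ^+ 2)%:E)%E by rewrite mule_ge0// lee_fin.
have z2 y : (0 <= (2 * M)%:E * (\sum_(g : grid3) Bg g y)%:E)%E by rewrite mule_ge0// lee_fin.
have /= -> := ge0_intD L3 q1 q2 z1 z2.
have /= -> := ge0_intZ L3 (ler0n R 2) mS nS.
have /= -> := ge0_intZ L3 M0 mB nB.
rewrite [leRHS]EFinD; apply: leeD.
  by rewrite (sqi_fin sS) -EFinM lee_fin ler_wpM2l.
apply: (@le_trans _ _ ((2 * M)%:E * (M * Bnd)%:E)%E).
  apply: lee_wpmul2l; first by rewrite lee_fin.
  by apply: int_sum_fin => //; [exact: Bnd_ge0|exact: int_Bg].
by rewrite -EFinM lee_fin (_ : 2 * M * (M * Bnd) = 2 * M ^+ 2 * Bnd)//; ring.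
Qed.

End ErrorEstimate.

(** * Energy of the error *)

Lemma mul_le_half_sqr (R : realType) (a b : R) : a * b <= a ^+ 2 / 2 + b ^+ 2 / 2.
Proof.
have := sqr_ge0 (a - b); rewrite (_ : (a - b) ^+ 2 = a ^+ 2 - 2 * (a * b) + b ^+ 2); last by ring.
by move: (a * b) (a ^+ 2) (b ^+ 2) => *; lra.
Qed.

Lemma absorb_half (R : realFieldType) (Q Y X a b c d g k m n : R) : Q = a - b -> b = c + d - g ->
  a <= k -> - c <= m -> - d <= n -> g <= X -> m <= Y / 2 + Q / 2 -> Q <= 2 * (k + n + X) + Y.
Proof. by move=> e1 e2 h1 h2 h3 h4 h5; lra. Qed.

Section Energy.
Variable R : realType.
Variable s : R.
Hypothesis s01 : 0 < s < 1.
Notation X3 := (R * R * R)%type.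
Notation X6 := (X3 * X3)%type.
Implicit Types (x y z : X3) (i : axis) (p : X6).
Variable del : R.
Hypothesis del0 : 0 < del <= 1 / 2.

Let d0 : 0 < del. Proof. by case/andP: del0. Qed.

(** Asymmetric in the two points, but a pair violating it is at distance at least [del / 2] times
    the boundary distance of either point, as [rr] is 1-Lipschitz and [del <= 1 / 2]. *)
Definition nearp p : bool := edist p.1 p.2 < del * rr p.1.

Lemma measurable_nearp : measurable_fun setT nearp.
Proof.
apply: measurable_fun_ltr; first exact: measurable_edist.
by apply: measurable_funM => //; apply: measurableT_comp => //; exact: measurable_rr.
Qed.

Definition nearpart (f : X6 -> R) p : R := if nearp p then f p else 0.
Definition farpart (f : X6 -> R) p : R := if nearp p then 0 else f p.

Lemma near_sqi f : sqi L6 f -> sqi L6 (nearpart f).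
Proof.
move=> sf; have mf := sf.1.
have [] // := @sqi_le _ _ R L6 (nearpart f) f 1 _ sf ler01.
- by apply: measurable_fun_ifT => //; exact: measurable_nearp.
- by move=> p; rewrite mul1r /nearpart; case: ifP => // _; rewrite expr0n sqr_ge0.
Qed.

Lemma far_sqi f : sqi L6 f -> sqi L6 (farpart f).
Proof.
move=> sf; have mf := sf.1.
have [] // := @sqi_le _ _ R L6 (farpart f) f 1 _ sf ler01.
- by apply: measurable_fun_ifT => //; exact: measurable_nearp.
- by move=> p; rewrite mul1r /farpart; case: ifP => // _; rewrite expr0n sqr_ge0.
Qed.

Lemma near_far_ip f k : sqi L6 f -> sqi L6 k ->
  ip L6 f k = ip L6 (nearpart f) k + ip L6 f (farpart k).
Proof.
move=> sf sk; have E : ip L6 f (farpart k) = ip L6 (farpart f) k.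
  by apply: eq_Rintegral => p _; rewrite /farpart; case: ifP => _ //; rewrite mulr0 mul0r.
rewrite E -ipDl ?near_sqi ?far_sqi//; last exact: far_sqi; last exact: near_sqi.
by apply: eq_Rintegral => p _; rewrite /farpart /nearpart; case: ifP => _; rewrite ?addr0 ?add0r.
Qed.

Lemma far_far_ip f : ip L6 f (farpart f) = ip L6 (farpart f) (farpart f).
Proof.
by apply: eq_Rintegral => p _; rewrite /farpart; case: ifP => _ //; rewrite mulr0 mul0r.
Qed.

Definition farker e x z : R := 2 * e x ^+ 2 * (if del / 2 * rr x <= edist x z then kern s (x, z) else 0).

Lemma far_pointwise (e : X3 -> R) p : farpart (dv s e) p ^+ 2 <= farker e p.1 p.2 + farker e p.2 p.1.
Proof.
have k0 := kern_ge0 s p; have k0' := kern_ge0 s (p.2, p.1).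
have f0 x z : 0 <= farker e x z.
  apply: mulr_ge0; last by case: ifP => _; [exact: kern_ge0|exact: lexx].
  by apply: mulr_ge0; [exact: ler0n|exact: sqr_ge0].
rewrite /farpart; case: ifPn => hp; first by rewrite expr0n addr_ge0.
move: hp; rewrite /nearp -leNgt => hp.
have r1 := rr_ge0 p.1; have r2 := rr_ge0 p.2.
have q1 : del / 2 * rr p.1 <= edist p.1 p.2.
  by apply: le_trans hp; rewrite ler_wpM2r//; have := d0; lra.
have q2 : del / 2 * rr p.2 <= edist p.2 p.1.
  rewrite (edistC p.2); have [h|h] := leP (del / 2 * rr p.2) (edist p.1 p.2) => //.
  have := rr_lip p.1 p.2; rewrite ler_norml => /andP[h1 _].
  have h2 : del * (rr p.2 - edist p.1 p.2) <= del * rr p.1 by rewrite ler_wpM2l ?(ltW d0)//; lra.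
  have h3 : del * edist p.1 p.2 <= 1 / 2 * edist p.1 p.2 by rewrite ler_wpM2r ?edist_ge0//; case/andP: del0.
  have := edist_ge0 p.1 p.2; rewrite mulrBr in h2.
  move: hp h h2 h3; rewrite (mulrAC del); move: (del * rr p.2) (del * rr p.1) (del * edist p.1 p.2) (edist p.1 p.2) => *; lra.
rewrite /farker q1 q2 dv2 (_ : kern s (p.2, p.1) = kern s p); last by rewrite /kern /= edistC.
rewrite -surjective_pairing -mulrDl; apply: ler_wpM2r; first exact: k0.
rewrite -subr_ge0 (_ : _ - _ = (e p.1 + e p.2) ^+ 2) ?sqr_ge0//; ring.
Qed.

Let mfk (e : X3 -> R) : measurable_fun setT e -> measurable_fun setT (fun p => farker e p.1 p.2).
Proof.
move=> me; apply: measurable_funM.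
  by apply: measurable_funM => //; apply: measurable_funX; exact: measurableT_comp.
apply: measurable_fun_ifT => //.
  apply: measurable_fun_ler; last exact: measurable_edist.
  by apply: measurable_funM => //; apply: measurableT_comp => //; exact: measurable_rr.
rewrite (_ : (fun t : X6 => _) = kern s); first exact: measurable_kern.
by apply/funext => p; rewrite -surjective_pairing.
Qed.

Definition farC : R := 4 * (Cfar s * (del / 2) `^ (- (2 * s))).

Lemma farC_ge0 : 0 <= farC.
Proof. by apply: mulr_ge0 => //; apply: mulr_ge0; [exact: ltW (Cfar_gt0 s01)|exact: powR_ge0]. Qed.

(** Beyond distance [del / 2 * rr x] the kernel integrates to a multiple of [rr x] to the power
    [- 2 * s], which is the squared weight of [nw]. *)
Lemma far_bound (e : X3 -> R) : Ho s e -> ip L6 (farpart (dv s e)) (farpart (dv s e)) <= farC * nw s e ^+ 2.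
Proof.
move=> he; have [[[me _] sd _] e0] := he; have [[_ sw] _] := nw_Ho s01 he.
have sf := far_sqi sd.
have mk := mfk me.
have msw : measurable_fun setT (fun p : X6 => (p.2, p.1)) by exact: measurable_fun_pair.
have mk' : measurable_fun setT (fun p => farker e p.2 p.1).
  exact: (measurableT_comp mk msw).
have f0 x z : 0 <= farker e x z.
  apply: mulr_ge0; last by case: ifP => _; [exact: kern_ge0|exact: lexx].
  by apply: mulr_ge0; [exact: ler0n|exact: sqr_ge0].
have g1 p : (0 <= (farker e p.1 p.2)%:E)%E by rewrite lee_fin.
have g2 p : (0 <= (farker e p.2 p.1)%:E)%E by rewrite lee_fin.
have c0 : 0 <= 2 * (Cfar s * (del / 2) `^ (- (2 * s))).
  by apply: mulr_ge0 => //; apply: mulr_ge0; [exact: ltW (Cfar_gt0 s01)|exact: powR_ge0].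
have inner x : (\int[L3]_z (farker e x z)%:E <= (2 * (Cfar s * (del / 2) `^ (- (2 * s))))%:E * ((wh s x * e x) ^+ 2)%:E)%E.
  have [rx|rx] := ltP 0 (rr x); last first.
    have hx : ~ Omega (x : pt R) by move=> /rr_gt0; rewrite ltNge rx.
    under eq_integral do rewrite /farker e0// expr0n mulr0 mul0r.
    by rewrite integral0 e0// mulr0 expr0n mule0.
  have h2 : 0 <= 2 * e x ^+ 2 by rewrite mulr_ge0 ?sqr_ge0.
  have mp : measurable_fun setT (fun z : X3 => (x, z)) by exact: measurable_fun_pair.
  have mz : measurable_fun setT (fun z => (if del / 2 * rr x <= edist x z then kern s (x, z) else 0)%:E).
    apply: measurable_EF; apply: measurable_fun_ifT => //.
      by apply: measurable_fun_ler => //; exact: measurable_edist1.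
    exact: (measurableT_comp (@measurable_kern R s) mp).
  have -> : (\int[L3]_z (farker e x z)%:E = \int[L3]_z ((2 * e x ^+ 2)%:E *
      (if del / 2 * rr x <= edist x z then kern s (x, z) else 0)%:E))%E.
    by apply: eq_integral => z _; rewrite -EFinM.
  have /= -> := ge0_intZ L3 h2 mz (fun z => ltac:(by rewrite lee_fin; case: ifP => // _; exact: kern_ge0)).
  have d2 : 0 < del / 2 by rewrite divr_gt0.
  have kf := kern_far s01 x (mulr_gt0 d2 rx).
  apply: (@le_trans _ _ ((2 * e x ^+ 2)%:E * (Cfar s * (del / 2 * rr x) `^ (- (2 * s)))%:E)%E).
    by apply: lee_wpmul2l => //; rewrite lee_fin.
  rewrite -!EFinM lee_fin exprMn wh2 powRM ?(ltW d2) ?(ltW rx)// le_eqVlt; apply/orP; left; apply/eqP; ring.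
have mwe : measurable_fun setT (fun x => ((wh s x * e x) ^+ 2)%:E).
  by apply: measurable_EF; apply: measurable_funX; case: sw.
have tot : (\int[L3]_x ((2 * (Cfar s * (del / 2) `^ (- (2 * s))))%:E * ((wh s x * e x) ^+ 2)%:E) =
    (2 * (Cfar s * (del / 2) `^ (- (2 * s))) * nw s e ^+ 2)%:E)%E.
  have /= -> := ge0_intZ L3 c0 mwe (fun x => ltac:(by rewrite lee_fin sqr_ge0)).
  by rewrite (sqi_fin sw) nw_sqr.
have mk1 := measurable_EF mk; have mk2 := measurable_EF mk'.
rewrite -lee_fin -(sqi_fin sf).
apply: (@le_trans _ _ (\int[L6]_p ((farker e p.1 p.2)%:E + (farker e p.2 p.1)%:E))%E).
  apply: ge0_le_int => [||p|p].
  - by apply: measurable_EF; apply: measurable_funX; case: sf.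
  - exact: (emeasurable_funD mk1 mk2).
  - by rewrite lee_fin sqr_ge0.
  - by rewrite -EFinD lee_fin; exact: far_pointwise.
have /= -> := ge0_intD L6 mk1 mk2 g1 g2.
rewrite (_ : farC * nw s e ^+ 2 = 2 * (Cfar s * (del / 2) `^ (- (2 * s))) * nw s e ^+ 2 +
  2 * (Cfar s * (del / 2) `^ (- (2 * s))) * nw s e ^+ 2); last by rewrite /farC; ring.
rewrite [leRHS]EFinD -tot; apply: leeD.
  rewrite (tonelli1 L3 L3 mk1 g1); apply: ge0_le_int => [||x|x].
  - exact: (measurable_tonelli1 L3 mk1 g1).
  - exact: measurable_funeM.
  - by apply: integral_ge0.
  - exact: inner.
rewrite (tonelli2 L3 L3 mk2 g2); apply: ge0_le_int => [||x|x].
- exact: (measurable_tonelli2 L3 mk2 g2).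
- exact: measurable_funeM.
- by apply: integral_ge0.
- exact: inner.
Qed.

(* [A e e = (F, e) - A w e]: far from the diagonal the kernel is bounded by the weight of
   [nw], so no smoothness of [e] enters; near the diagonal only [w] has to be smooth. *)
Lemma energy_split (u w e F : X3 -> R) (KF : R) : Ho s u -> Ho s w -> sqi L3 F ->
  (forall v, Ho s v -> A s u v = ip L3 F v) -> Num.sqrt (ip L3 F F) <= KF ->
  e = (fun x => u x - w x) ->
  A s e e <= 2 * (KF * nw s e + Num.sqrt (A s u u) * Num.sqrt (farC * nw s e ^+ 2) + farC * nw s e ^+ 2) +
    ip L6 (nearpart (dv s w)) (nearpart (dv s w)).
Proof.
move=> hu hw sF weak hKF e_def; set Xb := farC * nw s e ^+ 2.
have he : Ho s e by rewrite e_def; exact: HoB.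
have [[su du _] _] := hu; have [[_ dw _] _] := hw; have [[se de _] e0] := he.
have [[_ swe] _] := nw_Ho s01 he.
set Y := ip L6 (nearpart (dv s w)) _; set Q := A s e e.
have Q0 : 0 <= Q by exact: A_ge0.
have Y0 : 0 <= Y by exact: ip_ge0.
have X0 : 0 <= Xb by rewrite /Xb mulr_ge0 ?farC_ge0 ?sqr_ge0.
have eq1 : Q = ip L3 F e - A s w e.
  by rewrite -weak// /Q {1}e_def; apply: ABl; [exact: hu.1|exact: hw.1|exact: he.1].
(* Off the near zone [w] is replaced by [u - e]. *)
have eq2 : A s w e = ip L6 (nearpart (dv s w)) (dv s e) + ip L6 (dv s u) (farpart (dv s e)) -
    ip L6 (farpart (dv s e)) (farpart (dv s e)).
  rewrite /A (near_far_ip dw de) -addrA; congr (_ + _).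
  rewrite -far_far_ip -ipBl//; last exact: far_sqi.
  by congr (ip L6 _ _); rewrite e_def dvB; apply/funext => p; ring.
have b1 : ip L3 F e <= KF * nw s e.
  apply: le_trans (ler_norm _) _; apply: le_trans (cauchy sF se) _.
  apply: ler_pM; rewrite ?sqrtr_ge0// /nw ler_wsqrtr//.
  have := @sqi_le _ _ R L3 e _ 1 se.1 swe ler01 (fun x => wh_dominates s01 x e0).
  by rewrite mul1r => -[].
have b2 : - ip L6 (nearpart (dv s w)) (dv s e) <= Num.sqrt Y * Num.sqrt Q.
  by apply: le_trans (ler_norm _) _; rewrite normrN; apply: cauchy => //; exact: near_sqi.
have xb := far_bound he; rewrite -/Xb in xb.
have b3 : - ip L6 (dv s u) (farpart (dv s e)) <= Num.sqrt (A s u u) * Num.sqrt Xb.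
  apply: le_trans (ler_norm _) _; rewrite normrN; apply: le_trans (cauchy du (far_sqi de)) _.
  by apply: ler_wpM2l; [exact: sqrtr_ge0|exact: ler_wsqrtr].
(* Young's inequality; [absorb_half] moves the half of [Q] to the left side. *)
have am : Num.sqrt Y * Num.sqrt Q <= Y / 2 + Q / 2.
  by have := mul_le_half_sqr (Num.sqrt Y) (Num.sqrt Q); rewrite (sqr_sqrtr Y0) (sqr_sqrtr Q0).
exact: absorb_half eq1 eq2 b1 b2 b3 xb am.
Qed.

End Energy.

(** The displacement [b] is at most [2 * q], because [q1 <= q2 + b <= 2 * q + q1 / 2]. *)
Lemma near_cell_arith (R : realType) (a b c q1 q2 q3 q : R) : a <= q -> b <= 1 / 2 * q1 ->
  `|q1 - q2| <= b -> `|q2 - q3| <= q -> q3 <= q -> c <= b + a -> c <= 3 * q.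
Proof. by rewrite !ler_norml => h1 h2 /andP[? ?] /andP[? ?] ? ?; lra. Qed.

(** * Near-diagonal energy of the approximant *)

Section NearEnergy.
Variable R : realType.
Variable s : R.
Hypothesis s01 : 0 < s < 1.
Notation X3 := (R * R * R)%type.
Notation X6 := (X3 * X3)%type.
Implicit Types (x y z : X3) (i : axis) (p : X6).
Variables (sigma e0 : R) (L n m : nat) (u : X3 -> R).
Hypothesis sg01 : 0 < sigma < 1.
Hypothesis L2 : (2 <= L)%N.
Hypothesis n0 : (0 < n)%N.
Hypothesis m0 : (0 < m)%N.
Hypothesis e00 : 0 < e0.
Hypothesis e0s : e0 <= 1 / 24.
Notation grid3 := (grid3 L n).
Notation idx3 := (idx3 m).
Implicit Types (g : grid3) (j : idx3).
Notation ctr3 := (@ctr3 R sigma L n).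
Notation h := (e0 / 4).
Variable X : grid3 -> X3.
Hypothesis hX : forall g i, `|co i (X g) - co i (ctr3 g)| <= h * chi (co i (ctr3 g)).
Variables (Kc del : R).
Hypothesis Kc0 : 0 <= Kc.
Hypothesis del0 : 0 < del <= 1 / 2.
Notation vol := (@vol R sigma L n).
Notation cf := (@cf R e0 L n m u X).
Notation Th3 := (@Th3 R sigma e0 L n m X).
Notation w := (approximant sigma e0 m u X).
Notation N := (Nth sigma e0 n m).
Notation La := (Lth sigma e0 n m).
Notation M := (#|{: grid3}|%:R : R).
Notation m3 := (#|{: idx3}|%:R : R).
Hypothesis hXs : forall g, \sum_(j : idx3) cf g j ^+ 2 <= Kc * rr (ctr3 g) `^ (2 * s) / vol g.

Let sg0 : 0 < sigma. Proof. by case/andP: sg01. Qed.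
Let sg1 : sigma < 1. Proof. by case/andP: sg01. Qed.
Let d0 : 0 < del. Proof. by case/andP: del0. Qed.
Let rc0 g : 0 < rr (ctr3 g). Proof. exact: (rr_ctr_gt0 sg01 L2 n0 m0 e00 e0s). Qed.
Let vol0 g : 0 < vol g. Proof. exact: (vol_gt0 sg01 L2 n0 m0 e00 e0s). Qed.

Definition wbox g y := [&& `|y.1.1 - (ctr3 g).1.1| <= 3 / sigma * chi (ctr3 g).1.1,
  `|y.1.2 - (ctr3 g).1.2| <= 3 / sigma * chi (ctr3 g).1.2 & `|y.2 - (ctr3 g).2| <= 3 / sigma * chi (ctr3 g).2].

Lemma wboxP g y : reflect (forall i, `|co i y - co i (ctr3 g)| <= 3 / sigma * chi (co i (ctr3 g))) (wbox g y).
Proof.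
apply: (iffP and3P) => [[h1 h2 h3] [] //|H].
by split; [exact: (H A1)|exact: (H A2)|exact: (H A3)].
Qed.

Lemma measurable_wbox g : measurable_fun setT (wbox g).
Proof.
have c i : measurable_fun setT (fun y : X3 => `|co i y - co i (ctr3 g)| <= 3 / sigma * chi (co i (ctr3 g))).
  apply: measurable_fun_ler => //; apply: measurableT_comp => //.
  by apply: measurable_funB => //; exact: measurable_co.
by apply: measurable_and; [exact: (c A1)|apply: measurable_and; [exact: (c A2)|exact: (c A3)]].
Qed.

Let s3 : 3 <= 3 / sigma.
Proof. by rewrite ler_pdivlMr// ler_piMr// ltW. Qed.

Lemma wbox_rr g y : wbox g y -> rr y <= 4 / sigma * rr (ctr3 g).
Proof.
move/wboxP => hy; have [i ->] := rr_ex (ctr3 g); apply: le_trans (rr_le i y) _.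
have := le_trans (chi_lip (co i y) (co i (ctr3 g))) (hy i); rewrite ler_norml => /andP[_ k].
have c0 := chi_ge0 (co i (ctr3 g)).
have k1 : 1 * chi (co i (ctr3 g)) <= 1 / sigma * chi (co i (ctr3 g)).
  by rewrite ler_wpM2r// div1r invf_ge1// ltW.
have -> : 4 / sigma * chi (co i (ctr3 g)) = 3 / sigma * chi (co i (ctr3 g)) + 1 / sigma * chi (co i (ctr3 g)) by ring.
by move: k k1; move: (3 / sigma * _) (1 / sigma * _) => *; lra.
Qed.

(** At least one of the two points lies in the support. A near pair moves a coordinate by at most
    half its boundary distance, so tripling the support box accommodates the first point in either
    case. *)
Lemma near_supp g j p : nearp del p -> Th3 g j p.1 != Th3 g j p.2 -> wbox g p.1.
Proof.
move=> hp nz; apply/wboxP => i; have r0 : 0 <= chi (co i (ctr3 g)) by exact: chi_ge0.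
have w1 : chi (co i (ctr3 g)) / sigma <= 3 / sigma * chi (co i (ctr3 g)).
  by rewrite mulrAC ler_wpM2r ?invr_ge0 ?(ltW sg0)//; lra.
have [z1|nz1] := eqVneq (Th3 g j p.1) 0; last first.
  have [+ _] := Th3_supp sg01 L2 n0 m0 e00 e0s nz1 i; rewrite -co_ctr3 => h1.
  exact: le_trans w1.
have nz2 : Th3 g j p.2 != 0 by rewrite eq_sym -z1.
have [+ _] := Th3_supp sg01 L2 n0 m0 e00 e0s nz2 i; rewrite -co_ctr3 => h1.
have h2 : `|co i p.1 - co i p.2| <= 1 / 2 * chi (co i p.1).
  apply: le_trans (co_edist i _ _) _; apply: le_trans (ltW hp) _.
  apply: le_trans (ler_wpM2l (ltW d0) (rr_le i p.1)) _; rewrite ler_wpM2r ?chi_ge0//.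
  by case/andP: del0.
have c1 := chi_lip (co i p.1) (co i p.2).
have c2 := le_trans (chi_lip (co i p.2) (co i (ctr3 g))) h1.
have k1 : chi (co i (ctr3 g)) <= chi (co i (ctr3 g)) / sigma.
  by rewrite ler_peMr// invf_ge1// ltW.
have e3 : 3 / sigma * chi (co i (ctr3 g)) = 3 * (chi (co i (ctr3 g)) / sigma) by ring.
have tri := ler_distD (co i p.2) (co i p.1) (co i (ctr3 g)).
rewrite e3; exact: near_cell_arith h1 h2 c1 c2 k1 tri.
Qed.

Definition lipg g : R := 3 * N ^+ 2 * La / rr (ctr3 g).
Definition ag g : R := M * m3 * (Kc * rr (ctr3 g) `^ (2 * s) / vol g) * lipg g ^+ 2.

Let ag0 g : 0 <= ag g.
Proof.
rewrite /ag; apply: mulr_ge0; last exact: sqr_ge0.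
apply: mulr_ge0; first exact: mulr_ge0.
by rewrite !mulr_ge0 ?powR_ge0 ?invr_ge0 ?(ltW (vol0 g)).
Qed.

Definition nk x z : R := if edist x z < del * rr x then edist x z ^+ 2 * kern s (x, z) else 0.

Let nk0 x z : 0 <= nk x z.
Proof. by rewrite /nk; case: ifP => // _; rewrite mulr_ge0 ?sqr_ge0 ?kern_ge0. Qed.

Lemma near_pointwise x z :
  nearpart del (dv s w) (x, z) ^+ 2 <= (\sum_(g : grid3) ag g * (if wbox g x then 1 else 0)) * nk x z.
Proof.
rewrite /nearpart; case: ifPn => hp; last first.
  rewrite expr0n; apply: mulr_ge0; last exact: nk0.
  by apply: sumr_ge0 => g _; rewrite mulr_ge0//; case: ifP.
have hk : nk x z = edist x z ^+ 2 * kern s (x, z) by rewrite /nk ifT.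
rewrite hk dv2 mulrA ler_wpM2r ?kern_ge0//=.
rewrite /approximant -sumrB; apply: le_trans (sqr_sum_le _) _.
rewrite mulr_suml mulr_sumr; apply: ler_sum => g _.
rewrite -sumrB.
have t1 : (\sum_(j : idx3) (cf g j * Th3 g j x - cf g j * Th3 g j z)) ^+ 2 <=
    m3 * ((\sum_(j : idx3) cf g j ^+ 2) * (lipg g * edist x z) ^+ 2 * (if wbox g x then 1 else 0)).
  apply: le_trans (sqr_sum_le _) _; rewrite ler_wpM2l// -mulrA mulr_suml; apply: ler_sum => j _.
  rewrite -mulrBr exprMn ler_wpM2l ?sqr_ge0//.
  have [eq|ne] := eqVneq (Th3 g j x) (Th3 g j z).
    by rewrite eq subrr expr0n mulr_ge0 ?sqr_ge0//; case: ifP.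
  rewrite (near_supp hp ne) mulr1 -[leLHS]real_normK ?num_real//.
  have l := Th3_lip sg01 L2 n0 m0 e00 e0s hX g j x z.
  by apply: lerXn2r; rewrite ?nnegrE//; exact: le_trans l.
rewrite /ag; apply: (@le_trans _ _ (M * (m3 * ((Kc * rr (ctr3 g) `^ (2 * s) / vol g) *
    (lipg g * edist x z) ^+ 2 * (if wbox g x then 1 else 0))))).
  apply: ler_wpM2l => //; apply: le_trans t1 _; apply: ler_wpM2l => //.
  apply: ler_wpM2r; first by case: ifP.
  by apply: ler_wpM2r; [exact: sqr_ge0|exact: hXs].
rewrite le_eqVlt; apply/orP; left; apply/eqP.
by move: (_ `^ _) (if _ then _ else _) (lipg g) => a b c; field; rewrite gt_eqF.
Qed.

Definition gbnd : R := 576 * Kc * m3 * N ^+ 4 * La ^+ 2 * Cnear s * del `^ (2 - 2 * s) * 27 * 16 / sigma ^+ 5.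

Let s22 : 0 < 2 - 2 * s. Proof. by have := s01; lra. Qed.

Let Cn0 : 0 <= Cnear s.
Proof.
have [h1 h2] := andP (hp_lt1 s22).
by rewrite /Cnear divr_ge0 ?ler0n// subr_ge0 ltW.
Qed.

Definition gx x : R := \sum_(g : grid3) ag g * (Cnear s * (del * (4 / sigma * rr (ctr3 g))) `^ (2 - 2 * s)) *
  (if wbox g x then 1 else 0).

Lemma near_inner x : (\int[L3]_z (nearpart del (dv s w) (x, z) ^+ 2)%:E <= (gx x)%:E)%E.
Proof.
have [K K0 hK] := approx_lip u sg01 L2 n0 m0 e00 e0s hX.
have hw := lip_Ho s01 K0 (fun y hy => approx_out u sg01 L2 n0 m0 e00 e0s X hy) hK.
have [[_ [mdw _] _] _] := hw.
have mp : measurable_fun setT (fun z : X3 => (x, z)) by exact: measurable_fun_pair.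
set S := \sum_(g : grid3) ag g * (if wbox g x then 1 else 0).
have S0 : 0 <= S by apply: sumr_ge0 => g _; rewrite mulr_ge0//; case: ifP.
have mnk : measurable_fun setT (fun z => (nk x z)%:E).
  apply: measurable_EF; apply: measurable_fun_ifT => //.
    by apply: measurable_fun_ltr => //; exact: measurable_edist1.
  apply: measurable_funM; first by apply: measurable_funX; exact: measurable_edist1.
  exact: (measurableT_comp (@measurable_kern R s) mp).
have mnear : measurable_fun setT (nearpart del (dv s w)).
  by apply: measurable_fun_ifT => //; exact: measurable_nearp.
apply: (@le_trans _ _ (\int[L3]_z (S%:E * (nk x z)%:E))%E).
  apply: ge0_le_int => [||z|z].
  - by apply: measurable_EF; apply: measurable_funX; exact: (measurableT_comp mnear mp).
  - exact: measurable_funeM.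
  - by rewrite lee_fin sqr_ge0.
  - by rewrite -EFinM lee_fin; exact: near_pointwise.
have /= -> := ge0_intZ L3 S0 mnk (fun z => ltac:(by rewrite lee_fin)).
have [rx|rx] := ltP 0 (rr x); last first.
  rewrite (@eq_integral _ _ _ _ _ (fun=> 0%E)) => [|z _]; last first.
    rewrite /nk ifF//; apply/negbTE; rewrite -leNgt; apply: le_trans (edist_ge0 x z).
    by rewrite pmulr_rle0.
  rewrite integral0 mule0 lee_fin sumr_ge0// => g _; rewrite mulr_ge0//; last by case: ifP.
  by rewrite mulr_ge0// mulr_ge0// powR_ge0.
have kn := kern_near s01 x (mulr_gt0 d0 rx).
apply: (@le_trans _ _ (S%:E * (Cnear s * (del * rr x) `^ (2 - 2 * s))%:E)%E).
  by apply: lee_wpmul2l => //; rewrite lee_fin.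
rewrite -EFinM lee_fin mulr_suml; apply: ler_sum => g _.
case: ifPn => hb; last by rewrite !mulr0 mul0r.
rewrite !mulr1 ler_wpM2l// ler_wpM2l//.
have wr := wbox_rr hb.
have c0 : 0 <= del * rr x by rewrite mulr_ge0 ?(ltW d0) ?(ltW rx).
apply: ge0_ler_powR; rewrite ?nnegrE ?(ltW s22)//; last by rewrite ler_wpM2l// ltW.
by rewrite mulr_ge0 ?(ltW d0)//; apply: le_trans wr; exact: ltW.
Qed.

(** Powers of the local scale cancel: [rr ^ (2 * s) / vol] from the coefficients, [rr ^ (- 2)] from
    the squared Lipschitz constant, [rr ^ (2 - 2 * s)] from the kernel, [vol] from the support. What
    is left is a power of [del] times quantities common to all blocks. *)
Lemma near_bound : ip L6 (nearpart del (dv s w)) (nearpart del (dv s w)) <= M ^+ 2 * gbnd.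
Proof.
have [K K0 hK] := approx_lip u sg01 L2 n0 m0 e00 e0s hX.
have hw := lip_Ho s01 K0 (fun y hy => approx_out u sg01 L2 n0 m0 e00 e0s X hy) hK.
have [[_ sdw _] _] := hw; have sn := near_sqi del sdw.
have mn : measurable_fun setT (fun p => (nearpart del (dv s w) p ^+ 2)%:E).
  by apply: measurable_EF; apply: measurable_funX; case: sn.
have nn p : (0 <= (nearpart del (dv s w) p ^+ 2)%:E)%E by rewrite lee_fin sqr_ge0.
rewrite -lee_fin -(sqi_fin sn) (tonelli1 L3 L3 mn nn).
have t0 g x : 0 <= ag g * (Cnear s * (del * (4 / sigma * rr (ctr3 g))) `^ (2 - 2 * s)) * (if wbox g x then 1 else 0).
  by rewrite mulr_ge0//; [rewrite mulr_ge0// mulr_ge0// powR_ge0|case: ifP].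
have mt g : measurable_fun setT (fun x => ag g * (Cnear s * (del * (4 / sigma * rr (ctr3 g))) `^ (2 - 2 * s)) *
    (if wbox g x then 1 else 0)).
  by apply: measurable_funM => //; apply: measurable_fun_ifT => //; exact: measurable_wbox.
apply: (@le_trans _ _ (\int[L3]_x (gx x)%:E)%E).
  apply: ge0_le_int => [||x|x].
  - exact: (measurable_tonelli1 L3 mn nn).
  - by apply: measurable_EF; exact: measurable_sum.
  - exact: integral_ge0.
  - exact: near_inner.
have gb0 : 0 <= M * gbnd.
  apply: mulr_ge0 => //; rewrite /gbnd; apply: mulr_ge0; last by rewrite invr_ge0 exprn_ge0// ltW.
  do 2!(apply: mulr_ge0; last exact: ler0n).
  apply: mulr_ge0; last exact: powR_ge0.
  apply: mulr_ge0; [apply: mulr_ge0; last exact: sqr_ge0|exact: Cn0].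
  apply: mulr_ge0; last by rewrite (_ : N ^+ 4 = (N ^+ 2) ^+ 2); [exact: sqr_ge0|ring].
  by apply: mulr_ge0; [apply: mulr_ge0; [exact: ler0n|exact: Kc0]|exact: ler0n].
rewrite (_ : M ^+ 2 * gbnd = M * (M * gbnd)); last by ring.
apply: int_sum_fin => //= g.
set c := ag g * _.
have c0 : 0 <= c by rewrite /c mulr_ge0// mulr_ge0// powR_ge0.
have mb : measurable_fun setT (fun x => (if wbox g x then 1 else 0 : R)%:E).
  by apply: measurable_EF; apply: measurable_fun_ifT => //; exact: measurable_wbox.
have -> : (\int[L3]_x (c * (if wbox g x then 1 else 0))%:E = \int[L3]_x (c%:E * (if wbox g x then 1 else 0 : R)%:E))%E.
  by apply: eq_integral => x _; rewrite -EFinM.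
have /= -> := ge0_intZ L3 c0 mb (fun x => ltac:(by rewrite lee_fin; case: ifP)).
have s30 : 0 < 3 / sigma by rewrite divr_gt0.
have ib := integral_cbox sg01 L2 n0 m0 e00 e0s s30 (measurable_wbox g) (fun y hy => elimT (wboxP g y) hy).
apply: (@le_trans _ _ (c%:E * (64 * (3 / sigma) ^+ 3 * vol g)%:E)%E).
  by apply: lee_wpmul2l => //; rewrite lee_fin.
rewrite -EFinM lee_fin /c /ag /gbnd /lipg.
have rp : rr (ctr3 g) `^ (2 * s) * rr (ctr3 g) `^ (2 - 2 * s) = rr (ctr3 g) ^+ 2.
  rewrite -powRD; last by apply/implyP => _; rewrite gt_eqF.
  by rewrite addrC subrK powR_mulrn// ltW.
have s40 : 0 < 4 / sigma by rewrite divr_gt0.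
have pw : (del * (4 / sigma * rr (ctr3 g))) `^ (2 - 2 * s) <=
    del `^ (2 - 2 * s) * ((4 / sigma) ^+ 2 * rr (ctr3 g) `^ (2 - 2 * s)).
  have sr : 0 <= 4 / sigma * rr (ctr3 g) by rewrite mulr_ge0 ?(ltW s40) ?(ltW (rc0 g)).
  rewrite (powRM _ (ltW d0) sr) (powRM _ (ltW s40) (ltW (rc0 g))).
  rewrite ler_wpM2l ?powR_ge0// ler_wpM2r ?powR_ge0// -powR_mulrn ?(ltW s40)//.
  apply: ler_powR; last by rewrite lerBlDr lerDl; have [] := double_bounds s01.
  by apply: le_trans (_ : 4 <= _); [rewrite ler1n|rewrite ler_pdivlMr// ler_piMr// ltW].
have pre : 0 <= M * m3 * (Kc * rr (ctr3 g) `^ (2 * s) / vol g) * (3 * N ^+ 2 * La / rr (ctr3 g)) ^+ 2 by exact: ag0.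
apply: (@le_trans _ _ (M * m3 * (Kc * rr (ctr3 g) `^ (2 * s) / vol g) * (3 * N ^+ 2 * La / rr (ctr3 g)) ^+ 2 *
    (Cnear s * (del `^ (2 - 2 * s) * ((4 / sigma) ^+ 2 * rr (ctr3 g) `^ (2 - 2 * s)))) *
    (64 * (3 / sigma) ^+ 3 * vol g))).
  rewrite ler_wpM2r//; last by rewrite ler_wpM2l// ler_wpM2l.
  by apply: mulr_ge0; [apply: mulr_ge0; [exact: ler0n|exact: exprn_ge0 (ltW s30)]|exact: ltW (vol0 g)].
rewrite le_eqVlt; apply/orP; left; apply/eqP.
transitivity (M * m3 * Kc / vol g * (3 * N ^+ 2 * La / rr (ctr3 g)) ^+ 2 * Cnear s * del `^ (2 - 2 * s) *
  (4 / sigma) ^+ 2 * (rr (ctr3 g) `^ (2 * s) * rr (ctr3 g) `^ (2 - 2 * s)) * (64 * (3 / sigma) ^+ 3 * vol g)).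
  by move: (_ `^ _) (_ `^ _) (_ `^ _) => a b c'; ring.
rewrite rp; move: (Cnear s) (del `^ _) => a b.
by field; rewrite (gt_eqF (vol0 g)) (gt_eqF (rc0 g)) (gt_eqF sg0).
Qed.

End NearEnergy.

(** * The exponential rate *)

Section Domination.
Variables (R : realType) (P : Type).
Implicit Types f g : P -> R.

(* The constants hidden in [dom] are uniform over the parameter type [P]. *)
Definition dom f g := exists2 C : R, 0 <= C & forall a, 0 <= f a <= C * g a.

Lemma dom_le f f' g : (forall a, 0 <= f a <= f' a) -> dom f' g -> dom f g.
Proof.
move=> h [C C0 hC]; exists C => // a; have /andP[-> h2] := h a.
by apply: le_trans h2 _; case/andP: (hC a).
Qed.

Lemma dom_ler f g g' : (forall a, g a <= g' a) -> dom f g -> dom f g'.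
Proof.
move=> h [C C0 hC]; exists C => // a; have /andP[-> h2] := hC a.
by apply: le_trans h2 _; rewrite ler_wpM2l.
Qed.

Lemma domD f f' g : dom f g -> dom f' g -> dom (fun a => f a + f' a) g.
Proof.
move=> [C C0 hC] [C' C0' hC']; exists (C + C'); first exact: addr_ge0.
move=> a; have /andP[h1 h2] := hC a; have /andP[h3 h4] := hC' a.
by rewrite addr_ge0//= mulrDl lerD.
Qed.

Lemma domM f f' g g' : dom f g -> dom f' g' -> dom (fun a => f a * f' a) (fun a => g a * g' a).
Proof.
move=> [C C0 hC] [C' C0' hC']; exists (C * C'); first exact: mulr_ge0.
move=> a; have /andP[h1 h2] := hC a; have /andP[h3 h4] := hC' a.
by rewrite mulr_ge0//= mulrACA ler_pM.
Qed.

Lemma domZ c f g : 0 <= c -> dom f g -> dom (fun a => c * f a) g.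
Proof.
move=> c0 [C C0 hC]; exists (c * C); first exact: mulr_ge0.
by move=> a; have /andP[h1 h2] := hC a; rewrite mulr_ge0//= -mulrA ler_wpM2l.
Qed.

Lemma domX f g k : dom f g -> dom (fun a => f a ^+ k) (fun a => g a ^+ k).
Proof.
move=> [C C0 hC]; exists (C ^+ k); first exact: exprn_ge0.
move=> a; have /andP[h1 h2] := hC a; rewrite exprn_ge0//= -exprMn.
by apply: lerXn2r => //; rewrite nnegrE; exact: le_trans h2.
Qed.

Lemma dom_sqrt f g : (forall a, 0 <= g a) -> dom f (fun a => g a ^+ 2) -> dom (fun a => Num.sqrt (f a)) g.
Proof.
move=> g0 [C C0 hC]; exists (Num.sqrt C); first exact: sqrtr_ge0.
move=> a; have /andP[h1 h2] := hC a; rewrite sqrtr_ge0 /=.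
by apply: le_trans (ler_wsqrtr h2) _; rewrite sqrtrM// sqrtr_sqr ger0_norm.
Qed.

End Domination.

Lemma half_pred2 L : ((2 * L).-2 <= 2 * L)%N.
Proof. lia. Qed.

Lemma node2E (R : realType) (sigma : R) L : (2 <= L)%N -> node sigma L 2 = sigma ^+ (L - 2) / 2.
Proof. by move=> h; rewrite nodeE ?h//; lia. Qed.

Lemma expr_swap (R : pzSemiRingType) (x : R) i j : (x ^+ i) ^+ j = (x ^+ j) ^+ i.
Proof. by rewrite -!exprM mulnC. Qed.

Lemma pow_sqr_mul (R : comPzRingType) (x y : R) m : ((x ^+ m) ^+ 2 * y ^+ m) = (x ^+ 2 * y) ^+ m.
Proof. by rewrite exprMn expr_swap. Qed.

(** * Choice of parameters and orders of magnitude *)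

Section Rate.
Variable R : realType.
Variable s : R.
Hypothesis s01 : 0 < s < 1.
Notation X3 := (R * R * R)%type.
Variables (sigma k1 k2 : R) (u F : X3 -> R) (K D Gam er : R).
Hypothesis sg01 : 0 < sigma < 1.
Hypothesis k10 : 0 < k1.
Hypothesis k12 : k1 <= k2.
Hypothesis hu : Ho s u.
Hypothesis sF : sqi L3 F.
Hypothesis K0 : 0 <= K.
Hypothesis F_bound : forall x, `|F x| <= K.
Hypothesis F_lip : forall x z, Omega x -> Omega z -> `|F x - F z| <= K * edist x z.
Hypothesis weak : forall v, Ho s v -> A s u v = ip L3 F v.
Hypothesis D0 : 0 < D.
Hypothesis Gam0 : 0 < Gam.
Hypothesis er0 : 0 < er.
Hypothesis er24 : er <= 1 / 24.
Hypothesis hreg : forall i (b : nat -> R) k e, adm er b k e ->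
  Ho s (Ud i u b k e) /\ Num.sqrt (A s (Ud i u b k e) (Ud i u b k e)) <= D * Gam ^+ k.

Let sg0 : 0 < sigma. Proof. by case/andP: sg01. Qed.
Let sg1 : sigma < 1. Proof. by case/andP: sg01. Qed.

(* The near-diagonal energy of the approximant carries the growth [8 ^ (6 pm)]; with
   [dlt ~ muc ^ pm] the factor [dlt `^ (2 - 2 s)] compensates it and leaves [2 ^ - pm]. *)
Definition muc : R := (1 / 2) `^ (19 / (2 - 2 * s)).

Let s22 : 0 < 2 - 2 * s. Proof. by have := s01; lra. Qed.

Lemma muc_half : 0 < muc <= 1 / 2.
Proof.
have h0 : 0 < 1 / 2 :> R by [].
rewrite powR_gt0//= -[leRHS](powRr1 (ltW h0)) /muc; apply: ger_powR; first by apply/andP; split => //; lra.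
by rewrite ler_pdivlMr// mul1r; have := s01; lra.
Qed.

Lemma muc_pow : muc `^ (2 - 2 * s) * 8 ^+ 6 = 1 / 2.
Proof.
rewrite /muc -powRrM divfK ?gt_eqF// powR_mulrn//.
have -> : (1 / 2 : R) ^+ 19 = ((1 / 2) ^+ 3) ^+ 6 * (1 / 2) by rewrite -exprM -exprSr.
have e : (1 / 2 : R) ^+ 3 * 8 = 1 by field.
by rewrite mulrAC -exprMn e expr1n mul1r.
Qed.

(** 128 is [2 * 8 ^ 2]: apart from a power of [m], the interpolation error [theta0] grows like
    [(8 ^ 2 * 2 * e0 * Gam) ^ m], which this choice keeps below [muc ^ (4 * m)]. *)
Definition e00c : R := Num.min er (muc ^+ 4 / (128 * Gam)).
Notation e0 := e00c.

Let mu0 : 0 < muc. Proof. by case/andP: muc_half. Qed.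
Let mu1 : muc <= 1 / 2. Proof. by case/andP: muc_half. Qed.

Let e0p : 0 < e0.
Proof. by rewrite /e00c lt_min er0 divr_gt0 ?exprn_gt0 ?mulr_gt0. Qed.

Let e0er : e0 <= er. Proof. by rewrite /e00c ge_min lexx. Qed.
Let e024 : e0 <= 1 / 24. Proof. exact: le_trans e0er er24. Qed.
Let e0G : 128 * e0 * Gam <= muc ^+ 4.
Proof.
have h : e0 <= muc ^+ 4 / (128 * Gam) by rewrite /e00c ge_min lexx orbT.
by move: h; rewrite ler_pdivlMr ?mulr_gt0// mulrCA mulrA.
Qed.

Notation Bw := (Bw sigma e0).
(** What the Bernstein tail has to beat for each unit of [m]: the growth [Bw] over a cell,
    [64 = 8 ^ 2] from two further factors, and a surplus [muc ^ 4]. [kap0] is the decay rate of the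
    tail in [L], given [pn >= k1 / 2 * pL]. *)
Definition Zc : R := 64 * Bw / muc ^+ 4.
Definition kap0 : R := k1 / 2 * ((e0 / 4 * sigma) ^+ 2 / 8).

Let Bw8 : 8 <= Bw. Proof. exact: Bw_ge1. Qed.

Let kap00 : 0 < kap0.
Proof. by rewrite /kap0 mulr_gt0 ?divr_gt0 ?exprn_gt0 ?mulr_gt0 ?divr_gt0. Qed.

(* [pm] is at most [L / r]: the Bernstein tail of order [q] must beat the growth [Zc ^ pm]
   of the interpolants, and the size [sigma ^ L] of the boundary layer must beat [muc ^ (8 pm)]. *)
Lemma ratio_exists : exists r : nat, [/\ (2 <= r)%N, 2 / k1 <= r%:R, Zc <= expR (kap0 * r%:R) & sigma ^+ r <= muc ^+ 8].
Proof.
have lnl : ln sigma < 0 by rewrite ln_lt0// sg0.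
have lnm : ln muc < 0 by rewrite ln_lt0// mu0; have := mu1; lra.
have Z0 : 0 <= Zc by rewrite /Zc divr_ge0 ?exprn_ge0 ?(ltW mu0)// mulr_ge0//; have := Bw8; lra.
have c0 : 0 <= 2 / k1 by rewrite divr_ge0// ltW.
have c1 : 0 <= Zc / kap0 by rewrite divr_ge0// ltW.
have c2 : 0 <= 8 * ln muc / ln sigma.
  by rewrite -mulrNN -invrN divr_ge0// oppr_ge0 ?(ltW lnl)// mulr_ge0_le0 ?(ltW lnm).
pose S := 2 + 2 / k1 + Zc / kap0 + 8 * ln muc / ln sigma.
exists (Num.truncn S).+1; have hS := ltW (truncnS_gt S); set r := (Num.truncn S).+1 in hS *.
split.
- by rewrite -(ler_nat R); apply: le_trans hS; rewrite /S; move: c0 c1 c2; move: (2 / k1) (Zc / kap0) (_ / _) => *; lra.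
- by apply: le_trans hS; rewrite /S; move: c0 c1 c2; move: (2 / k1) (Zc / kap0) (_ / _) => *; lra.
- have h : Zc / kap0 <= r%:R.
    by apply: le_trans hS; rewrite /S; move: c0 c1 c2; move: (2 / k1) (Zc / kap0) (_ / _) => *; lra.
  apply: (@le_trans _ _ (1 + kap0 * r%:R)); last exact: expR_ge1Dx.
  by move: h; rewrite ler_pdivrMr// mulrC => h; move: h; move: (kap0 * _) => y; lra.
- have h : 8 * ln muc / ln sigma <= r%:R.
    by apply: le_trans hS; rewrite /S; move: c0 c1 c2; move: (2 / k1) (Zc / kap0) (_ / _) => *; lra.
  rewrite -(@lnK _ (sigma ^+ r)) ?posrE ?exprn_gt0// -(@lnK _ (muc ^+ 8)) ?posrE ?exprn_gt0// ler_expR.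
  rewrite (lnXn _ sg0) (lnXn _ mu0) -[ln sigma *+ r]mulr_natl -[ln muc *+ 8]mulr_natl.
  by move: h; rewrite -(ler_nM2r lnl) divfK// lt_eqF.
Qed.

Variable r : nat.
Hypothesis r2 : (2 <= r)%N.
Hypothesis rk : 2 / k1 <= r%:R.
Hypothesis rZ : Zc <= expR (kap0 * r%:R).
Hypothesis rs : sigma ^+ r <= muc ^+ 8.

(** The lower bound uses [k1 / 2] and not [k1] because up to half of the degree is handed over to
    the Lagrange factors. *)
Record par := Par { pL : nat; pn : nat; pm : nat;
  par_L : (2 <= pL)%N; par_n : (0 < pn)%N; par_m : (0 < pm)%N;
  par_r : (r * pm <= pL)%N; par_n1 : k1 / 2 * pL%:R <= pn%:R; par_n2 : pn%:R <= k2 * pL%:R }.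
Implicit Types a : par.

(** A common majorant of [2 * pL], [pn] and [pm]; every polynomial factor is recorded as a power of
    it. *)
Definition Sp a : R := (2 + k2) * (pL a)%:R.
Definition xp a : R := muc ^+ pm a.
Definition yp a : R := 8 ^+ pm a.
Notation Ep a := (tailE sigma e0 (pn a)).
Notation Np a := (Nth sigma e0 (pn a) (pm a)).
Notation Fp a := (Fth sigma e0 (pn a) (pm a)).
Notation Lp a := (Lth sigma e0 (pn a) (pm a)).

Let k20 : 0 < k2. Proof. exact: lt_le_trans k12. Qed.

Let L1 a : 1 <= (pL a)%:R :> R.
Proof. by rewrite ler1n; apply: leq_trans (par_L a). Qed.

Lemma Sp_ge1 a : 1 <= Sp a.
Proof. by rewrite /Sp -[leLHS]mulr1; apply: ler_pM => //; have := k20; lra. Qed.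

Let Sp0 a : 0 <= Sp a. Proof. by apply: le_trans (Sp_ge1 a). Qed.

Lemma L_Sp a : 2 * (pL a)%:R <= Sp a.
Proof. by rewrite /Sp ler_wpM2r//; have := k20; lra. Qed.

Lemma n_Sp a : (pn a)%:R <= Sp a.
Proof. by apply: le_trans (par_n2 a) _; rewrite /Sp ler_wpM2r//; lra. Qed.

Lemma m_Sp a : (pm a)%:R <= Sp a.
Proof.
apply: le_trans (L_Sp a); apply: (@le_trans _ _ (pL a)%:R); last by rewrite ler_peMl//; lra.
by rewrite ler_nat; apply: leq_trans (par_r a); rewrite leq_pmull// (leq_trans _ r2).
Qed.

Lemma xp_in a : 0 < xp a <= 1.
Proof.
rewrite exprn_gt0//= exprn_ile1 ?(ltW mu0)//; have := mu1; lra.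
Qed.

Let xp0 a : 0 < xp a. Proof. by case/andP: (xp_in a). Qed.

Lemma yp_ge1 a : 1 <= yp a. Proof. by rewrite exprn_ege1// ler1n. Qed.

Let yp0 a : 0 <= yp a. Proof. by apply: le_trans (yp_ge1 a). Qed.

(** Since [r * pm <= pL] and [Zc <= expR (kap0 * r)], the tail is at most the inverse of [Zc ^ pm],
    and the surplus put into [Zc] remains. *)
Lemma EZ a : Ep a * (64 * Bw) ^+ pm a <= xp a ^+ 4.
Proof.
have E1 : Ep a <= expR (- (kap0 * (pL a)%:R)).
  rewrite /tailE /btail ler_expR lerN2.
  have -> : kap0 * (pL a)%:R = k1 / 2 * (pL a)%:R * ((e0 / 4 * sigma) ^+ 2 / 8) by rewrite /kap0; ring.
  rewrite -[leRHS]mulrA; apply: ler_wpM2r; last exact: par_n1.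
  by rewrite divr_ge0// sqr_ge0.
have E2 : Zc ^+ pm a <= expR (kap0 * (pL a)%:R).
  have Z0 : 0 <= Zc by rewrite /Zc divr_ge0 ?exprn_ge0 ?(ltW mu0)// mulr_ge0//; have := Bw8; lra.
  apply: (@le_trans _ _ (expR (kap0 * r%:R) ^+ pm a)).
    by apply: lerXn2r; rewrite ?nnegrE ?expR_ge0.
  rewrite -expRM_natr ler_expR -mulrA ler_wpM2l ?(ltW kap00)// -natrM ler_nat.
  exact: par_r.
have -> : (64 * Bw) ^+ pm a = Zc ^+ pm a * xp a ^+ 4.
  by rewrite /xp -exprM mulnC exprM -exprMn /Zc divfK// gt_eqF// exprn_gt0.
rewrite mulrA; apply: ler_piMl; first exact: exprn_ge0 (ltW (xp0 a)).
apply: (@le_trans _ _ (expR (- (kap0 * (pL a)%:R)) * expR (kap0 * (pL a)%:R))).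
  apply: ler_pM => //; first exact: tailE_ge0.
  by rewrite exprn_ge0// /Zc divr_ge0 ?exprn_ge0 ?(ltW mu0)// mulr_ge0//; have := Bw8; lra.
by rewrite -expRD addNr expR0.
Qed.

Let E0 a : 0 <= Ep a. Proof. exact: tailE_ge0. Qed.

Lemma EB a : Ep a * Bw ^+ pm a * 64 ^+ pm a <= xp a ^+ 4.
Proof. by have := EZ a; rewrite exprMn (mulrC (64 ^+ _)) mulrA. Qed.

Let x4 a : xp a ^+ 4 <= 1.
Proof. by case/andP: (xp_in a) => h1 h2; rewrite exprn_ile1// ltW. Qed.

Let p64 a : 1 <= 64 ^+ pm a :> R. Proof. by rewrite exprn_ege1// ler1n. Qed.

Let Bwm0 a : 0 <= Bw ^+ pm a. Proof. by rewrite exprn_ge0//; have := Bw8; lra. Qed.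

Lemma EBw1 a : 0 <= Ep a * Bw ^+ pm a <= 1.
Proof.
have h0 : 0 <= Ep a * Bw ^+ pm a by exact: mulr_ge0.
rewrite h0 /=; apply: le_trans (x4 a); apply: le_trans (EB a).
by rewrite ler_peMr.
Qed.

Lemma dom_E : dom (fun a => Ep a) (fun a => xp a ^+ 4).
Proof.
exists 1 => // a; rewrite E0 mul1r /=; apply: le_trans (EB a); rewrite -mulrA ler_peMr//.
rewrite -[leLHS]mulr1; apply: ler_pM => //; rewrite exprn_ege1//; have := Bw8; lra.
Qed.

Lemma dom_N : dom (fun a => Np a) yp.
Proof.
exists 5; first exact: ler0n.
move=> a; have N1 : 1 <= Np a by exact: Nth_ge1.
rewrite (le_trans ler01 N1) /= /Nth -/(yp a) -mulrA.
by have /andP[_ h] := EBw1 a; have := yp_ge1 a; move: h; move: (Ep a * _) (yp a) => *; lra.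
Qed.

Lemma dom_FN : dom (fun a => Fp a * Np a ^+ 2) (fun a => xp a ^+ 4).
Proof.
have [C C0 hC] := dom_N; exists (4 * C ^+ 2); first by rewrite mulr_ge0 ?exprn_ge0.
move=> a; have F0 : 0 <= Fp a by exact: Fth_ge0.
rewrite mulr_ge0 ?sqr_ge0//=; have /andP[n0 n1] := hC a.
apply: (@le_trans _ _ (Fp a * (C * yp a) ^+ 2)).
  by rewrite ler_wpM2l// lerXn2r ?nnegrE//; exact: le_trans n1.
have -> : Fp a * (C * yp a) ^+ 2 = 4 * C ^+ 2 * (Ep a * Bw ^+ pm a * 64 ^+ pm a).
  rewrite /Fth /yp (_ : 64 = 8 ^+ 2 :> R); last by rewrite expr2; ring.
  by rewrite -exprM mulnC exprM; ring.
by rewrite ler_wpM2l ?EB// mulr_ge0 ?sqr_ge0.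
Qed.

Lemma dom_L : dom (fun a => Lp a) (fun a => Sp a * yp a).
Proof.
pose q0 := 2 / e0; have q00 : 0 <= q0 by rewrite divr_ge0// ltW.
pose c := 2 * (2 + q0 / sigma + 8 + 4 * (q0 / sigma)) / (1 - sigma).
have si : 0 <= sigma^-1 by rewrite invr_ge0 ltW.
have qs : 0 <= q0 / sigma by exact: mulr_ge0.
have s1 : 0 < 1 - sigma by rewrite subr_gt0.
exists c; first by rewrite /c divr_ge0 ?(ltW s1)// mulr_ge0// !addr_ge0// mulr_ge0.
move=> a; rewrite Lth_ge0//=.
rewrite /Lth /c -/(yp a) /blockM -/(tailE sigma e0 (pn a)) -/(btail _ _) -/(tailE sigma e0 (pn a)).
rewrite (_ : 2 * (pm a)%:R / e0 = q0 * (pm a)%:R); last by rewrite /q0; ring.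
have /andP[b0 b1] := EBw1 a; have y1 := yp_ge1 a.
have hm := m_Sp a; have hn := n_Sp a.
have m0 : 0 <= (pm a)%:R :> R by []. have nn0 : 0 <= (pn a)%:R :> R by [].
rewrite [leRHS]mulrAC ler_wpM2r ?invr_ge0 ?(ltW s1)// -[leRHS]mulrA ler_wpM2l//.
set Ea := tailE _ _ _.
have -> : 2 * (pn a)%:R * yp a + q0 * (pm a)%:R * yp a / sigma +
    Ea * (8 * (pn a)%:R * Bw ^+ pm a + 4 * (q0 * (pm a)%:R * Bw ^+ pm a / sigma)) =
    2 * ((pn a)%:R * yp a) + q0 / sigma * ((pm a)%:R * yp a) + 8 * ((pn a)%:R * (Ea * Bw ^+ pm a)) +
    4 * (q0 / sigma) * ((pm a)%:R * (Ea * Bw ^+ pm a)) by ring.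
have EBy : Ea * Bw ^+ pm a <= yp a by exact: le_trans b1 y1.
have t1 : (pn a)%:R * yp a <= Sp a * yp a by rewrite ler_wpM2r.
have t2 : (pm a)%:R * yp a <= Sp a * yp a by rewrite ler_wpM2r.
have t3 : (pn a)%:R * (Ea * Bw ^+ pm a) <= Sp a * yp a by apply: ler_pM.
have t4 : (pm a)%:R * (Ea * Bw ^+ pm a) <= Sp a * yp a by apply: ler_pM.
have -> : (2 + q0 / sigma + 8 + 4 * (q0 / sigma)) * (Sp a * yp a) =
    2 * (Sp a * yp a) + q0 / sigma * (Sp a * yp a) + 8 * (Sp a * yp a) + 4 * (q0 / sigma) * (Sp a * yp a) by ring.
apply: lerD; first apply: lerD; first apply: lerD.
- by rewrite ler_wpM2l.
- by rewrite ler_wpM2l.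
- by rewrite ler_wpM2l.
- by rewrite ler_wpM2l// mulr_ge0.
Qed.

Definition Mp a : R := #|{: grid3 (pL a) (pn a)}|%:R.
Definition m3p a : R := #|{: idx3 (pm a)}|%:R.

Lemma dom_M : dom Mp (fun a => Sp a ^+ 6).
Proof.
exists 1 => // a; rewrite /Mp ler0n mul1r /= /grid3 !card_prod !card_ord natrM natrM.
have h : (((2 * pL a).-2 * pn a)%N)%:R <= Sp a * Sp a.
  rewrite natrM; apply: ler_pM => //; last exact: n_Sp.
  by apply: le_trans (L_Sp a); rewrite -natrM ler_nat half_pred2.
rewrite (_ : Sp a ^+ 6 = Sp a * Sp a * (Sp a * Sp a) * (Sp a * Sp a)); last by ring.
by apply: ler_pM => //; apply: ler_pM.
Qed.

Lemma dom_m3 : dom m3p (fun a => Sp a ^+ 3).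
Proof.
exists 1 => // a; rewrite /m3p ler0n mul1r /= /idx3 !card_prod !card_ord !natrM.
have h := m_Sp a; rewrite (_ : Sp a ^+ 3 = Sp a * (Sp a * Sp a)); last by ring.
by apply: ler_pM => //; apply: ler_pM.
Qed.

Definition Thp a : R := theta0 e0 D Gam (pm a) ^+ 2.

Lemma Thp_gt0 a : 0 < Thp a.
Proof.
have m0 : 0 < (pm a)%:R :> R by rewrite ltr0n par_m.
rewrite /Thp exprn_gt0// /theta0 /eta; apply: mulr_gt0; apply: mulr_gt0 => //.
  by apply: mulr_gt0; rewrite !exprn_gt0// exprn_gt0.
by apply: mulr_gt0; [rewrite exprn_gt0// mulr_gt0|rewrite mulr_gt0// exprn_gt0].
Qed.

Lemma dom_Th : dom Thp (fun a => Sp a ^+ 4 * xp a ^+ 8).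
Proof.
suff h : dom (fun a => theta0 e0 D Gam (pm a)) (fun a => Sp a ^+ 2 * xp a ^+ 4).
  apply: dom_ler (domX 2 h) => a; rewrite exprMn -!exprM; exact: lexx.
exists (27 * 32 * D); first by rewrite !mulr_ge0// ltW.
move=> a; have -> : theta0 e0 D Gam (pm a) = 27 * 32 * D * ((pm a)%:R ^+ 2 * (128 * e0 * Gam) ^+ pm a).
  have -> : 128 * e0 * Gam = 8 ^+ 2 * (2 * e0 * Gam) by ring.
  by rewrite /theta0 /eta -pow_sqr_mul [(2 * e0 * Gam) ^+ _]exprMn; ring.
have q0 : 0 <= 128 * e0 * Gam by rewrite !mulr_ge0// ?(ltW e0p) ?(ltW Gam0).
have c0 : 0 <= 27 * 32 * D by rewrite !mulr_ge0// ltW.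
apply/andP; split; first by rewrite mulr_ge0// mulr_ge0 ?sqr_ge0 ?exprn_ge0.
rewrite ler_wpM2l//; apply: ler_pM; rewrite ?sqr_ge0 ?exprn_ge0//.
  by rewrite lerXn2r ?nnegrE ?m_Sp.
by rewrite /xp -exprM mulnC exprM lerXn2r ?nnegrE// exprn_ge0// ltW.
Qed.

(** The summand 1 makes the bound strictly positive, as [select] divides by it. *)
Definition Sbc : R := nw s u ^+ 2 + 1.
Definition k0c : R := 2 * 27 * 27 * 64 / e0 ^+ 3.
Definition Kp a : R := k0c * (pm a)%:R ^+ 3 * Sbc.

Let Sbc0 : 0 < Sbc. Proof. by rewrite /Sbc ltr_wpDl ?sqr_ge0. Qed.
Let k0c0 : 0 <= k0c.
Proof. by rewrite /k0c mulr_ge0 ?invr_ge0 ?exprn_ge0 ?(ltW e0p)// !mulr_ge0. Qed.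

Lemma Kp_ge0 a : 0 <= Kp a.
Proof. by rewrite /Kp mulr_ge0 ?(ltW Sbc0)// mulr_ge0// exprn_ge0. Qed.

Lemma dom_K : dom Kp (fun a => Sp a ^+ 3).
Proof.
exists (k0c * Sbc); first by rewrite mulr_ge0// ltW.
move=> a; rewrite Kp_ge0 /= /Kp mulrAC; apply: ler_wpM2l; first exact: mulr_ge0 k0c0 (ltW Sbc0).
by rewrite lerXn2r ?nnegrE ?m_Sp.
Qed.

Let xle a i j : (j <= i)%N -> xp a ^+ i <= xp a ^+ j.
Proof. by move=> ij; have /andP[h1 h2] := xp_in a; rewrite ler_wiXn2l// ltW. Qed.

Let Sle a i j : (i <= j)%N -> Sp a ^+ i <= Sp a ^+ j.
Proof. by move=> ij; apply: ler_weXn2l => //; exact: Sp_ge1. Qed.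

Let SXle a i j k l : (i <= k)%N -> (l <= j)%N -> Sp a ^+ i * xp a ^+ j <= Sp a ^+ k * xp a ^+ l.
Proof.
move=> ik jl; apply: ler_pM; [exact: exprn_ge0|exact: exprn_ge0 (ltW (xp0 a))|exact: Sle|exact: xle].
Qed.

Definition Bp a : R := Bnd sigma e0 (pn a) (pm a) (Thp a) Sbc (Kp a).

Lemma dom_B : dom Bp (fun a => Sp a ^+ 6 * xp a ^+ 8).
Proof.
rewrite /Bp /Bnd; apply: domD; first apply: domD.
- apply: domZ; first by apply: mulr_ge0; exact: ler0n.
  by apply: dom_ler dom_Th => a; exact: SXle.
- apply: (@dom_le _ _ _ (fun a => 32 * Sbc * Ep a ^+ 2)).
    move=> a; rewrite -mulrAC lexx andbT mulr_ge0 ?sqr_ge0// mulr_ge0 ?ler0n// ltW//.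
  apply: domZ; first by rewrite mulr_ge0 ?ler0n// ltW.
  apply: dom_ler (domX 2 dom_E) => a; rewrite -exprM -[leLHS]mul1r -[1](expr0 (Sp a)); exact: SXle.
- apply: (@dom_le _ _ _ (fun a => 128 * (sigma * (1 - sigma)) ^- 2 / sigma ^+ 3 *
    (Kp a * m3p a * (Fp a * Np a ^+ 2) ^+ 2))).
    move=> a; have c0 : 0 <= (sigma * (1 - sigma)) ^- 2 by rewrite invr_ge0 sqr_ge0.
    have c1 : 0 <= (sigma ^+ 3)^-1 by rewrite invr_ge0 exprn_ge0 ?(ltW sg0).
    rewrite /m3p; apply/andP; split; last first.
      by rewrite le_eqVlt; apply/orP; left; apply/eqP; move: ((sigma * (1 - sigma)) ^- 2) ((sigma ^+ 3)^-1) => y z; ring.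
    apply: mulr_ge0 => //; apply: mulr_ge0 => //; apply: mulr_ge0; last exact: sqr_ge0.
    by apply: mulr_ge0 => //; apply: mulr_ge0; [exact: ler0n|exact: Kp_ge0].
  apply: domZ.
    by rewrite mulr_ge0 ?invr_ge0 ?exprn_ge0 ?(ltW sg0)// mulr_ge0 ?ler0n// invr_ge0 sqr_ge0.
  apply: dom_ler (domM (domM dom_K dom_m3) (domX 2 dom_FN)) => a.
  by rewrite -exprD -exprM lexx.
Qed.

Variable Csh : R.
Hypothesis Csh0 : 0 <= Csh.
Hypothesis hsh : forall h, 0 < h -> ip L3 (shal s u h) (shal s u h) <= Csh * h.

Definition Tp a : R := 2 * (Csh * node sigma (pL a) 2) + 2 * Mp a ^+ 2 * Bp a.

Lemma node2 a : node sigma (pL a) 2 = sigma ^+ (pL a - 2) / 2.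
Proof. exact: node2E (par_L a). Qed.

(** The layer contributes [sigma ^ L], at most a multiple of [xp ^ 8] by the choice of [r]. The
    exponent 18 is 12 from the squared number of blocks plus 6 from [dom_B]. *)
Lemma dom_T : dom Tp (fun a => Sp a ^+ 18 * xp a ^+ 8).
Proof.
rewrite /Tp; apply: domD.
  exists (2 * (Csh * (sigma ^- 2 / 2))).
    by rewrite !mulr_ge0// invr_ge0 exprn_ge0// ltW.
  move=> a; rewrite node2; apply/andP; split; first by rewrite !mulr_ge0 ?exprn_ge0 ?(ltW sg0).
  rewrite -[leRHS]mulrA; apply: ler_wpM2l => //; rewrite -[leRHS]mulrA; apply: ler_wpM2l => //.
  have h1 : sigma ^+ (pL a - 2) <= sigma ^- 2 * xp a ^+ 8.
    rewrite mulrC ler_pdivlMr ?exprn_gt0// -exprD subnK ?par_L//.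
    apply: (@le_trans _ _ (sigma ^+ (r * pm a))).
      by rewrite ler_wiXn2l ?(ltW sg0) ?(ltW sg1)// par_r.
    rewrite exprM /xp (expr_swap muc); apply: lerXn2r => //; rewrite nnegrE exprn_ge0 ?(ltW sg0) ?(ltW mu0)//.
  have -> : sigma ^- 2 / 2 * (Sp a ^+ 18 * xp a ^+ 8) = sigma ^- 2 * (Sp a ^+ 18 * xp a ^+ 8) / 2 by ring.
  apply: ler_wpM2r => //; apply: le_trans h1 _.
  rewrite ler_wpM2l ?invr_ge0 ?exprn_ge0 ?(ltW sg0)// -[leLHS]mul1r -[1](expr0 (Sp a)); exact: SXle.
have h := domZ (ler0n R 2) (domM (domX 2 dom_M) dom_B).
apply: (dom_le _ (dom_ler _ h)) => a; last by rewrite mulrA -exprM -exprD; exact: lexx.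
rewrite -mulrA lexx andbT mulr_ge0// mulr_ge0 ?sqr_ge0//.
by have [C _ /(_ a) /andP[]] := dom_B.
Qed.

Definition dlt a : R := 1 / 2 * xp a.

Lemma dlt_in a : 0 < dlt a <= 1 / 2.
Proof.
have /andP[x0 x1] := xp_in a; rewrite /dlt mulr_gt0//=; lra.
Qed.

(** The power [- 2 * s] of the width is rounded to [- 2]. This loss of [xp ^ 2] is affordable
    against the [xp ^ 8] of [dom_T]. *)
Lemma dom_far : dom (fun a => farC s (dlt a)) (fun a => xp a ^- 2).
Proof.
exists (4 * (Cfar s * 16)); first by apply: mulr_ge0 => //; apply: mulr_ge0; [exact: ltW (Cfar_gt0 s01)|exact: ler0n].
move=> a; rewrite (farC_ge0 s01) /=; have /andP[x0 x1] := xp_in a.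
rewrite /farC -[leRHS]mulrA ler_wpM2l// -[leRHS]mulrA ler_wpM2l ?(ltW (Cfar_gt0 s01))//.
have d0 : 0 < dlt a / 2 by rewrite /dlt divr_gt0// mulr_gt0.
have d1 : dlt a / 2 <= 1 by rewrite /dlt; lra.
rewrite powRV//; apply: (@le_trans _ _ ((dlt a / 2)^-1 `^ 2%:R)).
  by rewrite ler_powR ?invf_ge1//; have := s01; lra.
rewrite powR_mulrn ?invr_ge0 ?(ltW d0)// /dlt le_eqVlt; apply/orP; left; apply/eqP.
by field; rewrite gt_eqF.
Qed.

Definition Gp a : R := gbnd s sigma e0 (pn a) (pm a) (Kp a) (dlt a).

Lemma dom_delta : dom (fun a => dlt a `^ (2 - 2 * s) * yp a ^+ 6) (fun a => (1 / 2) ^+ pm a).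
Proof.
exists 1 => // a; rewrite mulr_ge0 ?powR_ge0 ?exprn_ge0//= mul1r.
have /andP[x0 x1] := xp_in a.
apply: (@le_trans _ _ (xp a `^ (2 - 2 * s) * yp a ^+ 6)).
  rewrite ler_wpM2r ?exprn_ge0//; apply: ge0_ler_powR; rewrite ?nnegrE ?(ltW s22) ?(ltW x0)//.
    by rewrite /dlt mulr_ge0// ltW.
  by rewrite /dlt; lra.
rewrite /xp powRX ?(ltW mu0)// /yp -exprM mulnC exprM -exprMn muc_pow; exact: lexx.
Qed.

(** 20 is 12 from the squared number of blocks, 3 from the coefficients, 3 from the nodes and 2 from
    the squared Lipschitz constant. The growth [yp ^ 6] of [Np ^ 4 * Lp ^ 2] is what [dom_delta]
    compensates. *)
Lemma dom_G : dom (fun a => Mp a ^+ 2 * Gp a) (fun a => Sp a ^+ 20 * (1 / 2) ^+ pm a).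
Proof.
have Cn0 : 0 <= Cnear s.
  have [h1 h2] := andP (hp_lt1 s22).
  by rewrite /Cnear divr_ge0 ?ler0n// subr_ge0 ltW.
have c0 : 0 <= 576 * Cnear s * 27 * 16 / sigma ^+ 5.
  apply: mulr_ge0; last by rewrite invr_ge0 exprn_ge0 ?(ltW sg0).
  by do 2!(apply: mulr_ge0; last exact: ler0n); apply: mulr_ge0; [exact: ler0n|].
have h1 := domM (domM (domX 2 dom_M) (domM dom_K dom_m3)) (domM (domX 4 dom_N) (domX 2 dom_L)).
have [C C0 hC] := h1.
exists (576 * Cnear s * 27 * 16 / sigma ^+ 5 * C); first exact: mulr_ge0.
move=> a; have /andP[q0 q1] := hC a.
have -> : Mp a ^+ 2 * Gp a = 576 * Cnear s * 27 * 16 / sigma ^+ 5 *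
  ((Mp a ^+ 2 * (Kp a * m3p a) * (Np a ^+ 4 * Lp a ^+ 2)) * dlt a `^ (2 - 2 * s)).
  by rewrite /Gp /gbnd -/(m3p a); move: (Cnear s) (_ `^ _) (_ ^-1) => b c d; ring.
rewrite mulr_ge0//=; last by rewrite mulr_ge0// powR_ge0.
rewrite -[leRHS]mulrA ler_wpM2l//.
have [C' C0' /(_ a)/andP[p0 p1]] := dom_delta.
apply: (@le_trans _ _ (C * (Sp a ^+ 6 ^+ 2 * (Sp a ^+ 3 * Sp a ^+ 3) * (yp a ^+ 4 * (Sp a * yp a) ^+ 2)) *
   dlt a `^ (2 - 2 * s))); first by rewrite ler_wpM2r// powR_ge0.
have -> : C * (Sp a ^+ 6 ^+ 2 * (Sp a ^+ 3 * Sp a ^+ 3) * (yp a ^+ 4 * (Sp a * yp a) ^+ 2)) *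
   dlt a `^ (2 - 2 * s) = C * (Sp a ^+ 20 * (dlt a `^ (2 - 2 * s) * yp a ^+ 6)).
  by move: (_ `^ _) => b; ring.
rewrite ler_wpM2l// ler_wpM2l ?exprn_ge0//.
have : dlt a `^ (2 - 2 * s) * yp a ^+ 6 <= (1 / 2) ^+ pm a.
  have /andP[x0 x1] := xp_in a.
  apply: (@le_trans _ _ (xp a `^ (2 - 2 * s) * yp a ^+ 6)).
    rewrite ler_wpM2r ?exprn_ge0//; apply: ge0_ler_powR; rewrite ?nnegrE ?(ltW s22) ?(ltW x0)//.
      by rewrite /dlt mulr_ge0// ltW.
    by rewrite /dlt; lra.
  rewrite /xp powRX ?(ltW mu0)// /yp -exprM mulnC exprM -exprMn muc_pow; exact: lexx.
by [].
Qed.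

Definition Rp a : R := 2 * (Num.sqrt (ip L3 F F) * Num.sqrt (Tp a) +
  Num.sqrt (A s u u) * Num.sqrt (farC s (dlt a) * Tp a) + farC s (dlt a) * Tp a) + Mp a ^+ 2 * Gp a.

Lemma dom_R : dom Rp (fun a => Sp a ^+ 20 * (1 / 2) ^+ pm a).
Proof.
have x0' a j : 0 <= xp a ^+ j by exact: exprn_ge0 (ltW (xp0 a)).
have sx0 a i j : 0 <= Sp a ^+ i * xp a ^+ j by apply: mulr_ge0; [exact: exprn_ge0|].
have xh a j : (0 < j)%N -> Sp a ^+ 18 * xp a ^+ j <= Sp a ^+ 20 * (1 / 2) ^+ pm a.
  move=> j0; apply: ler_pM; [exact: exprn_ge0|exact: x0'|exact: Sle|].
  apply: le_trans (xle a j0) _; rewrite expr1; apply: lerXn2r; rewrite ?nnegrE ?(ltW mu0)//.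
have h9 a j : (0 < j)%N -> Sp a ^+ 9 * xp a ^+ j <= Sp a ^+ 20 * (1 / 2) ^+ pm a.
  by move=> j0; apply: le_trans (xh a j j0); apply: ler_wpM2r; [exact: x0'|exact: Sle].
have hT : dom (fun a => Num.sqrt (Tp a)) (fun a => Sp a ^+ 9 * xp a ^+ 4).
  apply: dom_sqrt => //; apply: dom_ler dom_T => a; rewrite le_eqVlt; apply/orP; left; apply/eqP; ring.
have hX : dom (fun a => farC s (dlt a) * Tp a) (fun a => Sp a ^+ 18 * xp a ^+ 6).
  apply: dom_ler (domM dom_far dom_T) => a; rewrite le_eqVlt; apply/orP; left; apply/eqP.
  by field; rewrite gt_eqF.
have hX' : dom (fun a => Num.sqrt (farC s (dlt a) * Tp a)) (fun a => Sp a ^+ 9 * xp a ^+ 3).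
  apply: dom_sqrt => //; apply: dom_ler hX => a; rewrite le_eqVlt; apply/orP; left; apply/eqP; ring.
apply: domD; last exact: dom_G.
apply: domZ => //; apply: domD; first apply: domD.
- by apply: domZ; [exact: sqrtr_ge0|apply: dom_ler hT => a; exact: h9].
- by apply: domZ; [exact: sqrtr_ge0|apply: dom_ler hX' => a; exact: h9].
- by apply: dom_ler hX => a; exact: xh.
Qed.

Lemma par_approx a (q : nat) : (pn a + pm a <= q.+1)%N ->
  exists2 w : X3 -> R, W sigma (pL a) q (w : pt R -> R) &
    A s (fun x => u x - w x) (fun x => u x - w x) <= Rp a.
Proof.
move=> hq; have hL := par_L a; have hn := par_n a; have hm := par_m a.
have hreg' i b k e : adm e0 b k e ->
    Ho s (Ud i u b k e) /\ Num.sqrt (A s (Ud i u b k e) (Ud i u b k e)) <= D * Gam ^+ k.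
  move=> [ia oe he ha]; apply: hreg; split => //; first exact: le_trans e0er.
  by move=> j jk; exact: le_trans (ha j jk) e0er.
have hSb : nw s u ^+ 2 <= Sbc by rewrite /Sbc lerDl.
pose ct (g : grid3 (pL a) (pn a)) : X3 := ctr3 sigma g.
have oc g : Omega (ct g : pt R).
  by apply/Omega_co => i; rewrite co_ctr3; exact: (rho_pos sg01 hL hn hm e0p e024).
have sel g := select s01 hu e0p e024 hm (ltW D0) (ltW Gam0) hreg' (lexx (Thp a)) (Thp_gt0 a) hSb Sbc0 (oc g).
have [X hX] := choice sel.
have hX1 g i : `|co i (X g) - co i (ctr3 sigma g)| <= e0 / 4 * chi (co i (ctr3 sigma g)).
  by have [_ h _ _] := hX g; exact: h.
have hXn g : (\int[L3]_y (near2 sigma e0 (pm a) u X g y)%:E <= (8192 * Thp a * rr (ctr3 sigma g) `^ (2 * s))%:E)%E.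
  by have [_ _ h _] := hX g; exact: h.
have hXs g : \sum_(j : idx3 (pm a)) cf e0 u X g j ^+ 2 <= Kp a * rr (ctr3 sigma g) `^ (2 * s) / vol sigma g.
  have [_ _ _ h] := hX g.
  rewrite -(pair_bigA _ (fun (j3 : 'I_(pm a)) (j : 'I_(pm a) * 'I_(pm a)) => cf e0 u X g (j3, j) ^+ 2)) /=.
  under eq_bigr => j3 _ do rewrite -(pair_bigA _ (fun (j2 j1 : 'I_(pm a)) => cf e0 u X g (j3, (j2, j1)) ^+ 2)) /=.
  by rewrite /Kp /k0c /cf /vol /=; exact: h.
have h2 : 0 < node sigma (pL a) 2 by rewrite node2 divr_gt0// exprn_gt0.
exists (approximant sigma e0 (pm a) u X); first exact: approx_W.
have eb := err_bound s01 sg01 hL hn hm e0p e024 hu hX1 (ltW (Thp_gt0 a)) (ltW Sbc0) hSb (Kp_ge0 a) hXn hXs (hsh h2).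
have heH := err_Ho s01 sg01 hL hn hm e0p e024 hu hX1.
have [K' K0' hK'] := approx_lip u sg01 hL hn hm e0p e024 hX1.
have hw := lip_Ho s01 K0' (fun y hy => approx_out u sg01 hL hn hm e0p e024 X hy) hK'.
have es := energy_split s01 (dlt_in a) hu hw sF weak (lexx _) (erefl (fun x => u x - approximant sigma e0 (pm a) u X x)).
have nb := near_bound s01 sg01 hL hn hm e0p e024 hX1 (Kp_ge0 a) (dlt_in a) hXs.
apply: le_trans es _; rewrite /Rp; apply: lerD; last exact: nb.
have nT : nw s (fun x => u x - approximant sigma e0 (pm a) u X x) ^+ 2 <= Tp a by exact: eb.
set nn := nw s _ in nT *; have n0 : 0 <= nn by exact: nw_ge0.
have fc := farC_ge0 s01 (dlt a).
have hF : farC s (dlt a) * nn ^+ 2 <= farC s (dlt a) * Tp a by rewrite ler_wpM2l.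
rewrite ler_wpM2l//; apply: lerD => //; apply: lerD.
  by rewrite ler_wpM2l ?sqrtr_ge0// -[leLHS](ger0_norm n0) -sqrtr_sqr; exact: ler_wsqrtr.
by rewrite ler_wpM2l ?sqrtr_ge0//; exact: ler_wsqrtr.
Qed.

End Rate.

(** * The exponential rate in [L] *)

Section ExponentialRate.
Variable R : realType.
Notation X3 := (R * R * R)%type.

Lemma poly_le_expR (k : nat) (c : R) : 0 < c ->
  exists2 C : R, 0 <= C & forall x, 0 <= x -> x ^+ k <= C * expR (c * x).
Proof.
move=> c0; pose d := c / k.+1%:R; have d0 : 0 < d by rewrite divr_gt0// ltr0n.
exists (d^-1 ^+ k); first by rewrite exprn_ge0// invr_ge0 ltW.
move=> x x0; have dx : 0 <= d * x by rewrite mulr_ge0// ltW.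
have -> : x ^+ k = d^-1 ^+ k * (d * x) ^+ k by rewrite -exprMn mulKf// gt_eqF.
apply: ler_wpM2l; first by rewrite exprn_ge0// invr_ge0 ltW.
apply: (@le_trans _ _ (expR (d * x) ^+ k)).
  apply: lerXn2r; rewrite ?nnegrE ?expR_ge0//.
  by apply: le_trans (expR_ge1Dx _); rewrite lerDr.
rewrite -expRM_natr ler_expR.
have -> : c * x = d * x * k.+1%:R by rewrite /d; field; rewrite gt_eqF// ltr0n.
by rewrite ler_wpM2l// ler_nat.
Qed.

(** From [1 / 2 <= expR (- (1 / 2))]; the factor 2 pays for rounding the quotient down. *)
Lemma half_pow_divn (r L : nat) : (0 < r)%N ->
  (1 / 2) ^+ (L %/ r) <= 2 * expR (- (L%:R / (2 * r%:R))) :> R.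
Proof.
move=> r0; have rR : 0 < r%:R :> R by rewrite ltr0n.
have -> : (1 / 2) ^+ (L %/ r) = 2 * (1 / 2) ^+ (L %/ r).+1 :> R by rewrite exprS; field.
apply: ler_wpM2l => //; apply: (@le_trans _ _ (expR (- (1 / 2)) ^+ (L %/ r).+1)).
  apply: lerXn2r; rewrite ?nnegrE ?expR_ge0//.
  by apply: le_trans (expR_ge1Dx _); lra.
rewrite -expRM_natr ler_expR mulNr lerN2 ler_pdivrMr ?mulr_gt0//.
have -> : 1 / 2 * (L %/ r).+1%:R * (2 * r%:R) = ((L %/ r).+1 * r)%:R :> R by rewrite natrM; field.
by rewrite ler_nat; apply: ltnW; exact: ltn_ceil.
Qed.

Variables (s sigma k1 k2 : R) (u F : X3 -> R) (K D Gam er : R).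
Hypothesis s01 : 0 < s < 1.
Hypothesis sg01 : 0 < sigma < 1.
Hypothesis k10 : 0 < k1.
Hypothesis k12 : k1 <= k2.
Hypothesis hu : Ho s u.
Hypothesis sF : sqi L3 F.
Hypothesis K0 : 0 <= K.
Hypothesis F_bound : forall x, `|F x| <= K.
Hypothesis F_lip : forall x z, Omega x -> Omega z -> `|F x - F z| <= K * edist x z.
Hypothesis weak : forall v, Ho s v -> A s u v = ip L3 F v.
Hypothesis D0 : 0 < D.
Hypothesis Gam0 : 0 < Gam.
Hypothesis er0 : 0 < er.
Hypothesis er24 : er <= 1 / 24.
Hypothesis hreg : forall i (b : nat -> R) k e, adm er b k e ->
  Ho s (Ud i u b k e) /\ Num.sqrt (A s (Ud i u b k e) (Ud i u b k e)) <= D * Gam ^+ k.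

Lemma par_exists (r L q : nat) : (2 <= r)%N -> 2 / k1 <= r%:R -> (r <= L)%N ->
  k1 * L%:R <= q%:R -> q%:R <= k2 * L%:R ->
  exists a : par k1 k2 r, [/\ pL a = L, pm a = (L %/ r)%N & (pn a + pm a = q)%N].
Proof.
move=> r2 rk rL q1 q2; have L0 : (0 < L)%N by apply: leq_trans rL; apply: leq_trans r2.
have LR : 0 < L%:R :> R by rewrite ltr0n.
have r0 : (0 < r)%N by exact: leq_trans r2.
have m0 : (0 < L %/ r)%N by rewrite divn_gt0.
have hm : (L %/ r)%:R <= k1 / 2 * L%:R :> R.
  have h1 : (L %/ r)%:R * r%:R <= L%:R :> R by rewrite -natrM ler_nat leq_trunc_div.
  have h2 : (L %/ r)%:R * (2 / k1) <= L%:R by apply: le_trans h1; rewrite ler_wpM2l.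
  have -> : (L %/ r)%:R = k1 / 2 * ((L %/ r)%:R * (2 / k1)) :> R by field; rewrite gt_eqF.
  by rewrite ler_wpM2l// divr_ge0// ltW.
have hL : k1 / 2 * L%:R + k1 / 2 * L%:R = k1 * L%:R by field.
have kL : 0 < k1 / 2 * L%:R by rewrite mulr_gt0// divr_gt0.
have mq : (L %/ r <= q)%N by rewrite -(ler_nat R); move: kL hL hm q1; move: (k1 / 2 * L%:R) (k1 * L%:R) => *; lra.
have n1 : k1 / 2 * L%:R <= (q - L %/ r)%:R.
  by rewrite natrB//; move: kL hL hm q1; move: (k1 / 2 * L%:R) (k1 * L%:R) => *; lra.
have n2 : (q - L %/ r)%:R <= k2 * L%:R by apply: le_trans q2; rewrite ler_nat leq_subr.
have n0 : (0 < q - L %/ r)%N by rewrite -(ltr_nat R); exact: lt_le_trans n1.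
have rm : (r * (L %/ r) <= L)%N by rewrite mulnC leq_trunc_div.
by exists (Par (leq_trans r2 rL) n0 m0 rm n1 n2); split => //=; rewrite subnK.
Qed.

Lemma energy_rate : exists C b : R, exists L0 : nat, [/\ 0 <= C, 0 < b &
  forall L q, (L0 <= L)%N -> k1 * L%:R <= q%:R -> q%:R <= k2 * L%:R ->
  exists2 w : X3 -> R, W sigma L q (w : pt R -> R) &
    A s (fun x => u x - w x) (fun x => u x - w x) <= C * expR (- (b * L%:R))].
Proof.
have [r [r2 rk rZ rs]] := ratio_exists s01 sg01 k10 Gam0 er0 er24.
have [Csh Csh0 hsh] := shallow s01 hu sF K0 F_bound F_lip weak.
have [C1 C10 hC1] := dom_R s01 u F sg01 k10 k12 D0 Gam0 er0 er24 r2 rZ rs Csh0.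
have r0 : (0 < r)%N by exact: leq_trans r2.
have rR : 0 < r%:R :> R by rewrite ltr0n.
have b0 : 0 < (4 * r%:R)^-1 :> R by rewrite invr_gt0 mulr_gt0.
have [C2 C20 hC2] := poly_le_expR 20 b0.
have k20 : 0 <= 2 + k2 by have := lt_le_trans k10 k12; lra.
(* Half of the exponent [L / (2 * r)] from [half_pow_divn] is spent on the factor [L ^ 20]. From
   [L >= r] on, the interpolation degree [L %/ r] is positive. *)
exists (C1 * ((2 + k2) ^+ 20 * (C2 * 2))), (4 * r%:R)^-1, r; split => //.
  by apply: mulr_ge0 => //; apply: mulr_ge0; [exact: exprn_ge0|exact: mulr_ge0].
move=> L q rL q1 q2; have [a [aL am aq]] := par_exists r2 rk rL q1 q2.
have hq : (pn a + pm a <= q.+1)%N by rewrite aq.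
have [w Ww hw] := par_approx s01 sg01 hu sF weak D0 Gam0 er0 er24 hreg hsh hq.
rewrite aL in Ww; exists w => //; apply: le_trans hw _.
have /andP[_ h] := hC1 a; apply: le_trans h _; rewrite -[leRHS]mulrA; apply: ler_wpM2l => //.
rewrite /Sp aL am (exprMn _ (2 + k2)) -[leLHS]mulrA -[leRHS]mulrA.
have := exprn_ge0 20 k20; move: ((2 + k2) ^+ 20) => X X0; apply: ler_wpM2l => //; rewrite -mulrA.
have -> : C2 * (2 * expR (- ((4 * r%:R)^-1 * L%:R))) =
    C2 * expR ((4 * r%:R)^-1 * L%:R) * (2 * expR (- (L%:R / (2 * r%:R)))).
  rewrite [RHS]mulrACA -expRD -[RHS]mulrA; congr (_ * (_ * expR _)).
  by field; rewrite gt_eqF.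
apply: ler_pM; [exact: exprn_ge0|exact: exprn_ge0|exact: hC2|exact: half_pow_divn].
Qed.

End ExponentialRate.

(** * From the rate in [L] to the Galerkin error in terms of [N] *)

Lemma Ht_norm_sq_eq (R : realType) (s : R) (v w : pt R -> R) :
  (forall x, Omega x -> v x = w x) -> Ht_norm_sq s v = Ht_norm_sq s w.
Proof.
move=> h; have e1 : L2sq (OM : set (pt R)) v = L2sq (OM : set (pt R)) w.
  by apply: eq_integral => x /set_mem hx; rewrite h.
have e2 : Hsemi_sq s (OM : set (pt R)) v = Hsemi_sq s (OM : set (pt R)) w.
  by apply: eq_integral => x /set_mem hx; apply: eq_integral => z /set_mem hz; rewrite !h.
rewrite /Ht_norm_sq e1 e2; congr (_ + _)%E.
by apply: eq_integral => x /set_mem hx; rewrite h.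
Qed.

(** The sixth root is taken of [(2 * L + 1) ^ 3 * (q + 1) ^ 3], with [2 * L + 1 <= 3 * L] and
    [q + 1 <= (k2 + 1) * L]. *)
Lemma root6_dim_le (R : realType) (k2 : R) (L q N : nat) : 0 <= k2 -> (1 <= L)%N -> q%:R <= k2 * L%:R ->
  (N <= (2 * L).+1 ^ 3 * q.+1 ^ 3)%N -> N%:R `^ (1 / 6) <= 3 * (k2 + 1) * L%:R.
Proof.
move=> k20 L1 hq hN; have LR : 1 <= L%:R :> R by rewrite ler1n.
have kap0 : 0 <= 3 * (k2 + 1) * L%:R by apply: mulr_ge0 => //; apply: mulr_ge0 => //; lra.
have h : N%:R <= (3 * (k2 + 1) * L%:R) ^+ 6.
  apply: (@le_trans _ _ ((3 * L%:R) ^+ 3 * ((k2 + 1) * L%:R) ^+ 3)).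
    apply: (@le_trans _ _ (((2 * L).+1 ^ 3 * q.+1 ^ 3)%:R)); first by rewrite ler_nat.
    rewrite natrM !natrX; apply: ler_pM; rewrite ?exprn_ge0//; apply: lerXn2r; rewrite ?nnegrE//.
    - by rewrite -natr1 natrM; move: LR; move: (L%:R) => y; lra.
    - by apply: mulr_ge0 => //; lra.
    - by rewrite -natr1 mulrDl mul1r lerD.
  have -> : (3 * L%:R) ^+ 3 * ((k2 + 1) * L%:R) ^+ 3 = (3 * (k2 + 1) * L%:R ^+ 2) ^+ 3 by ring.
  have -> : (3 * (k2 + 1) * L%:R) ^+ 6 = ((3 * (k2 + 1)) * (3 * (k2 + 1) * L%:R ^+ 2)) ^+ 3 by ring.
  have p0 : 0 <= 3 * (k2 + 1) * L%:R ^+ 2 by apply: mulr_ge0; [lra|exact: sqr_ge0].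
  apply: lerXn2r; rewrite ?nnegrE//; first by apply: mulr_ge0 => //; lra.
  by apply: ler_peMl => //; lra.
apply: (@le_trans _ _ (((3 * (k2 + 1) * L%:R) ^+ 6) `^ (1 / 6))).
  by apply: ge0_ler_powR; rewrite ?nnegrE ?exprn_ge0//.
rewrite -powR_mulrn// -powRrM (_ : 6%:R * (1 / 6) = 1); last by field.
by rewrite powRr1.
Qed.

Theorem theorem1p1 (R : realType) (s sigma : R) (f u : pt R -> R) (k1 k2 : R) :
  0 < s < 1 -> 0 < sigma < 1 ->
  analytic_on_closure f ->
  in_Ht s u -> (forall v, in_Ht s v -> aform s u v = L2ip f v) ->
  0 < k1 -> k1 <= k2 ->
  exists b C : R, 0 < b /\ 0 < C /\
    forall (L q N : nat) (uN : pt R -> R),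
      (1 <= L)%N ->
      k1 * L%:R <= q%:R -> q%:R <= k2 * L%:R ->
      has_dim (W sigma L q) N ->
      W sigma L q uN -> (forall v, W sigma L q v -> aform s uN v = L2ip f v) ->
      (Ht_norm_sq s (fun x => (u x - uN x)%R)
         <= ((C * expR (- b * N%:R `^ (1 / 6))) ^+ 2)%R%:E)%E.
Proof.
move=> s01 sg01 hf hu hweak k10 k12.
have [n hdd] := analytic_dd hf.
have k20 : 0 <= k2 by rewrite ltW// (lt_le_trans k10).
have Cs0 := Cs_gt0 s01; pose c := 2 / Cs s; have c0 : 0 < c by rewrite divr_gt0.
pose Kn : R := n.+1%:R; have Kn1 : 1 <= Kn by rewrite ler1n.
have Kn0 : 0 < Kn by rewrite ltr0n.
pose F := source f c; have sF : sqi L3 F := source_sqi hdd (ltW c0).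
pose K := c * Kn + 6 * c * Kn ^+ 2.
have cK0 : 0 <= c * Kn by rewrite mulr_ge0// ltW.
have cK2 : 0 <= 6 * c * Kn ^+ 2 by rewrite mulr_ge0 ?sqr_ge0// mulr_ge0// ltW.
have K0 : 0 <= K by exact: addr_ge0.
have Fb x : `|F x| <= K by apply: le_trans (source_bound hdd (ltW c0) x) _; rewrite lerDl.
have Fl x z : Omega x -> Omega z -> `|F x - F z| <= K * edist x z.
  move=> hx hz; apply: le_trans (source_lip hdd (ltW c0) hx hz) _.
  by apply: ler_wpM2r; [exact: sqrtr_ge0|rewrite lerDr].
have hsu : Hs s u by apply/HsP.
(* [u] may be nonzero on the faces. Neither the form nor the norm over the open cube distinguishes
   it from [u0]. *)
have [hu0 Acut] := cutP hsu; set u0 := cut u in hu0 Acut.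
have Hin v : Ho s v -> in_Ht s v by move=> [hv _]; apply/HsP.
have weak v : Ho s v -> A s u0 v = ip L3 F v.
  move=> hv; have [hv1 hv0] := hv; rewrite Acut//.
  by apply: weak_form => //; apply: hweak; exact: Hin.
(* Small enough both for the deformations and for the radius on which the data are controlled. *)
pose er : R := Kn^-1 / 24.
have iK : Kn^-1 <= 1 by rewrite invf_le1.
have iK0 : 0 < Kn^-1 by rewrite invr_gt0.
have er0 : 0 < er by rewrite divr_gt0.
have er24 : er <= 1 / 24 by rewrite /er ler_wpM2r.
have erK : er <= Kn^-1 by rewrite /er ler_piMr ?(ltW iK0)// invf_le1// ler1n.
pose G0 := 3 * c * Kn; have G00 : 0 < G0 by rewrite mulr_gt0// mulr_gt0.
have D0 : 0 < Dreg G0 by rewrite /Dreg mulr_gt0// mulr_gt0.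
have Gam0 : 0 < Greg Kn by rewrite /Greg ltr_wpDl// mulr_ge0.
have hreg i (b : nat -> R) k e : adm er b k e -> Ho s (Ud i u0 b k e) /\
    Num.sqrt (A s (Ud i u0 b k e) (Ud i u0 b k e)) <= Dreg G0 * Greg Kn ^+ k.
  move=> hb; split; first exact: (Ud_Ho s01 i er24 hu0 hb).
  apply: (regularity s01 er24 hu0 sF weak (ltW G00) (ltW Kn0) _ hb) => a' k' e' ha'.
  exact: (source_dd hdd (ltW c0) i er24 erK ha').
have [C0 [b0 [L0 [C00 b00 hrate]]]] :=
  energy_rate s01 sg01 k10 k12 hu0 sF K0 Fb Fl weak D0 Gam0 er0 er24 hreg.
(* The second summand covers the levels below [L0], where the Galerkin error is compared with the
   zero spline, obtained as [uN - uN]. *)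
pose C1 := C0 + A s u0 u0 * expR (b0 * L0%:R).
have A0 : 0 <= A s u0 u0 by exact: A_ge0.
have C10 : 0 <= C1 by rewrite addr_ge0// mulr_ge0 ?expR_ge0.
pose kap := 3 * (k2 + 1); have kap0 : 0 < kap by rewrite mulr_gt0// ltr_wpDl.
pose M : R := 2 * 4 ^+ 5 + 1.
have M0 : 0 <= M by rewrite /M addr_ge0// mulr_ge0// exprn_ge0.
(* The energy is quadratic in the error, hence the 2 and the square root; [kap] converts [L] into
   the sixth root of [N], and the summand 1 makes the constant positive. *)
exists (b0 / (2 * kap)), (Num.sqrt (M * C1) + 1); split; first by rewrite divr_gt0// mulr_gt0.
split; first by rewrite ltr_wpDl// sqrtr_ge0.
move=> L q N uN L1 q1 q2 hdim hW hgal.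
have WHo v : W sigma L q v -> Ho s v.
  move=> hv; have [Kv Kv0 hKv] := W_lip sg01 hv; have [_ hv0 _] := hv.
  exact: (lip_Ho s01 Kv0 hv0 hKv).
have huN := WHo _ hW; pose e x := u0 x - uN x; have he : Ho s e by exact: HoB.
have orth v : W sigma L q v -> A s e v = 0.
  move=> hv; have hvo := WHo _ hv; have [hv1 hv0] := hvo.
  have [hu1 _] := hu0; have [hN1 _] := huN.
  rewrite /e (ABl hu1 hN1 hv1) weak// (weak_form s01 sF hN1 hv1)//; first exact: subrr.
  exact: hgal.
have cea w : W sigma L q w -> A s e e <= A s (fun x => u0 x - w x) (fun x => u0 x - w x).
  move=> hw; have hd := W_sub hw hW.
  have := A_sub_le he (WHo _ hd) (orth _ hd); rewrite /e.
  rewrite (_ : (fun x => u0 x - uN x - (w x - uN x)) = (fun x => u0 x - w x))//.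
  by apply/funext => x; ring.
have hA : A s e e <= C1 * expR (- (b0 * L%:R)).
  have [hL|hL] := leqP L0 L.
    have [w Ww hw] := hrate L q hL q1 q2; apply: le_trans (cea w Ww) _; apply: le_trans hw _.
    by apply: ler_wpM2r; [exact: expR_ge0|rewrite lerDl mulr_ge0 ?expR_ge0].
  apply: le_trans (cea _ (W_sub hW hW)) _.
  rewrite (_ : (fun x => u0 x - (uN x - uN x)) = u0); last by apply/funext => x; rewrite subrr subr0.
  rewrite /C1 mulrDl -[leLHS]add0r lerD ?mulr_ge0 ?expR_ge0// -mulrA -expRD ler_peMr// (le_trans _ (expR_ge1Dx _))// lerDl subr_ge0.
  by rewrite ler_wpM2l ?(ltW b00)// ler_nat ltnW.
rewrite (@Ht_norm_sq_eq _ s _ e); last first.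
  by move=> x hx; rewrite /e /u0 /cut indicE mem_set// mul1r.
apply: le_trans (Ht_norm_le s01 he) _; rewrite lee_fin -/M.
have hroot := root6_dim_le k20 L1 q2 (W_dim sg01 L1 hdim).
apply: (@le_trans _ _ (M * C1 * expR (- (b0 * L%:R)))); first by rewrite -mulrA; apply: ler_wpM2l.
rewrite exprMn; apply: ler_pM; [exact: mulr_ge0|exact: expR_ge0| |].
  rewrite -[leLHS]sqr_sqrtr ?mulr_ge0//; apply: lerXn2r; rewrite ?nnegrE ?sqrtr_ge0 ?addr_ge0 ?sqrtr_ge0//.
  by rewrite lerDl.
rewrite -expRM_natr ler_expR mulNr mulNr lerN2.
have -> : b0 * L%:R = b0 / (2 * kap) * (kap * L%:R) * 2 by field; rewrite gt_eqF.
apply: ler_wpM2r => //; apply: ler_wpM2l; last exact: hroot.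
by rewrite divr_ge0 ?(ltW b00)// mulr_ge0// ltW.
Qed.
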